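(* Let $h_n>0$ and $T=nh_n$. Assume that each of the drifts $B_1,\dots,B_4$ is globally Lipschitz and of class $C^4$ with all partial derivatives of order $0$ to $4$ of polynomial growth, that $\sup_{t}\mathbb{E}[|Y_t|^{\ell}]<\infty$ for all $\ell\ge 0$ and each $Y\in\{\xi_0,\delta_0,\varepsilon_0,\zeta_0\}$, and that each such $Y$ is ergodic with an invariant measure $\pi_Y$: for every $\pi_Y$-integrable $g$, $\frac1T\int_0^Tg(Y_t)dt\to\int g\,d\pi_Y$ in probability as $T\to\infty$. Assume $H_0$: there is $\theta_0\in\operatorname{Int}\Theta$ with $\mathbf{\Sigma}_0=\mathbf{\Sigma}(\theta_0)$. Suppose that $\mathbf{\Sigma}(\theta_1)=\mathbf{\Sigma}(\theta_2)$ implies $\theta_1=\theta_2$ for $\theta_1,\theta_2\in\Theta$, and that $\operatorname{rank}\Delta=q$, where $\Delta=\partial_\theta\operatorname{vech}\mathbf{\Sigma}(\theta)|_{\theta=\theta_0}\in\mathbb{R}^{\bar p\times q}$. Let $\mathcal{F}_1=\{j:\theta_0^{(j)}\ne0\}$ and assume $0<\delta<\min_{j\in\mathcal{F}_1}|\theta_0^{(j)}|$. Then, as $h_n\to0$, $nh_n\to\infty$, $nh_n^2\to0$, $\sqrt n\lambda_{1,n}\to0$ and $\sqrt n\lambda_{2,n}\to\infty$, the statistic $\check{\mathbb{T}}_n=n\mathbb{F}_n(\check\theta_n)$ converges in distribution to $\chi^2_{\bar p-|\mathcal{F}_1|}$.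
   Context: Notation: $\operatorname{vech}$ is half-vectorization; $v^{(j)}$ is the $j$-th coordinate of $v$; $|S|$ is the cardinality of a set $S$; $\chi^2_r$ is the chi-squared distribution with $r$ degrees of freedom (degrees of freedom are understood to be positive). True model and data: $p_1,p_2,k_1,k_2,r_1,\dots,r_4\ge 1$ are fixed integers with $k_1\le p_1$, $k_2\le p_2$; $p=p_1+p_2$, $\bar p=p(p+1)/2$. $W_1,\dots,W_4$ are independent standard Wiener processes of dimensions $r_1,\dots,r_4$. The latent processes $\xi_0,\delta_0,\varepsilon_0,\zeta_0$, with values in $\mathbb{R}^{k_1},\mathbb{R}^{p_1},\mathbb{R}^{p_2},\mathbb{R}^{k_2}$, solve for $t\ge0$: $d\xi_{0,t}=B_1(\xi_{0,t})dt+\mathbf{S}_{1,0}dW_{1,t}$, $d\delta_{0,t}=B_2(\delta_{0,t})dt+\mathbf{S}_{2,0}dW_{2,t}$, $d\varepsilon_{0,t}=B_3(\varepsilon_{0,t})dt+\mathbf{S}_{3,0}dW_{3,t}$, $d\zeta_{0,t}=B_4(\zeta_{0,t})dt+\mathbf{S}_{4,0}dW_{4,t}$, with deterministic initial values $c_1,\dots,c_4$ and constant matrices $\mathbf{S}_{i,0}$. Put $\mathbf{\Sigma}_{\xi\xi,0}=\mathbf{S}_{1,0}\mathbf{S}_{1,0}^\top$, $\mathbf{\Sigma}_{\delta\delta,0}=\mathbf{S}_{2,0}\mathbf{S}_{2,0}^\top$, $\mathbf{\Sigma}_{\varepsilon\varepsilon,0}=\mathbf{S}_{3,0}\mathbf{S}_{3,0}^\top$,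 $\mathbf{\Sigma}_{\zeta\zeta,0}=\mathbf{S}_{4,0}\mathbf{S}_{4,0}^\top$; $\mathbf{\Sigma}_{\delta\delta,0}$ and $\mathbf{\Sigma}_{\varepsilon\varepsilon,0}$ are positive definite. Constant matrices: $\mathbf{\Lambda}_{x_1,0}\in\mathbb{R}^{p_1\times k_1}$ of full column rank, $\mathbf{\Lambda}_{x_2,0}\in\mathbb{R}^{p_2\times k_2}$, $\mathbf{\Gamma}_0\in\mathbb{R}^{k_2\times k_1}$, $\mathbf{B}_0\in\mathbb{R}^{k_2\times k_2}$ with zero diagonal, $\mathbf{\Psi}_0=\mathbb{I}_{k_2}-\mathbf{B}_0$ non-singular. The observed process is $\mathbb{X}_t=(\mathbb{X}_{1,t}^\top,\mathbb{X}_{2,t}^\top)^\top$ with $\mathbb{X}_{1,t}=\mathbf{\Lambda}_{x_1,0}\xi_{0,t}+\delta_{0,t}$, $\mathbb{X}_{2,t}=\mathbf{\Lambda}_{x_2,0}\eta_{0,t}+\varepsilon_{0,t}$, $\eta_{0,t}=\mathbf{B}_0\eta_{0,t}+\mathbf{\Gamma}_0\xi_{0,t}+\zeta_{0,t}$. With $t_i^n=ih_n$, $T=nh_n$, $\mathbb{Q}_{\mathbb{XX}}=\frac1T\sum_{i=1}^n(\mathbb{X}_{t_i^n}-\mathbb{X}_{t_{i-1}^n})(\mathbb{X}_{t_i^n}-\mathbb{X}_{t_{i-1}^n})^\top$. Parametric model: $\Theta\subset\mathbb{R}^q$ is convex and compact. For $\theta\in\Theta$ there are matrices $\mathbf{\Lambda}_{x_1},\mathbf{\Lambda}_{x_2},\mathbf{\Gamma},\mathbf{\Psi}=\mathbb{I}_{k_2}-\mathbf{B}$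 ($\mathbf{B}$ with zero diagonal), $\mathbf{\Sigma}_{\xi\xi},\mathbf{\Sigma}_{\delta\delta},\mathbf{\Sigma}_{\varepsilon\varepsilon},\mathbf{\Sigma}_{\zeta\zeta}$ of respective sizes $p_1\times k_1$, $p_2\times k_2$, $k_2\times k_1$, $k_2\times k_2$, $k_1\times k_1$, $p_1\times p_1$, $p_2\times p_2$, $k_2\times k_2$, each entry being either a known constant or a coordinate of $\theta$ ($\theta$ collects the unknown, non-duplicated entries); $\mathbf{\Lambda}_{x_1}$ has full column rank, $\mathbf{\Psi}$ is non-singular, $\mathbf{\Sigma}_{\xi\xi},\mathbf{\Sigma}_{\zeta\zeta}$ are positive semidefinite, $\mathbf{\Sigma}_{\delta\delta},\mathbf{\Sigma}_{\varepsilon\varepsilon}$ positive definite. $\mathbf{\Sigma}(\theta)$ is the symmetric $p\times p$ matrix with blocks $\mathbf{\Sigma}^{11}=\mathbf{\Lambda}_{x_1}\mathbf{\Sigma}_{\xi\xi}\mathbf{\Lambda}_{x_1}^\top+\mathbf{\Sigma}_{\delta\delta}$, $\mathbf{\Sigma}^{12}=\mathbf{\Lambda}_{x_1}\mathbf{\Sigma}_{\xi\xi}\mathbf{\Gamma}^\top\mathbf{\Psi}^{-1\top}\mathbf{\Lambda}_{x_2}^\top$, $\mathbf{\Sigma}^{22}=\mathbf{\Lambda}_{x_2}\mathbf{\Psi}^{-1}(\mathbf{\Gamma}\mathbf{\Sigma}_{\xi\xi}\mathbf{\Gamma}^\top+\mathbf{\Sigma}_{\zeta\zeta})\mathbf{\Psi}^{-1\top}\mathbf{\Lambda}_{x_2}^\top+\mathbf{\Sigma}_{\varepsilon\varepsilon}$;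 $\mathbf{\Sigma}_0$ is the same expression evaluated at the true matrices (subscript $0$). Contrast and estimator: $\mathrm{F}(Q,\mathbf{\Sigma})=\log\det\mathbf{\Sigma}-\log\det Q+\operatorname{tr}(\mathbf{\Sigma}^{-1}Q)-p$ for $Q,\mathbf{\Sigma}$ positive definite. $\mathbb{F}_n(\theta)=\mathrm{F}(\mathbb{Q}_{\mathbb{XX}},\mathbf{\Sigma}(\theta))$ if $\mathbb{Q}_{\mathbb{XX}}$ is non-singular and $\mathbb{F}_n(\theta)=|\operatorname{vech}\mathbb{Q}_{\mathbb{XX}}-\operatorname{vech}\mathbf{\Sigma}(\theta)|^2$ otherwise. $\hat\theta_n\in\Theta$ satisfies $\mathbb{F}_n(\hat\theta_n)=\inf_{\theta\in\Theta}\mathbb{F}_n(\theta)$. Sparse estimation: $\lambda_{1,n},\lambda_{2,n},\gamma,\delta>0$ are deterministic tuning constants (the scalar $\delta$ is unrelated to the process $\delta_0$). $\kappa_n^{(j)}=\lambda_{1,n}|\hat\theta_n^{(j)}|^{-\gamma}1_{\{|\hat\theta_n^{(j)}|\ge\delta\}}+\lambda_{2,n}1_{\{|\hat\theta_n^{(j)}|<\delta\}}$, $j=1,\dots,q$. $\tilde\theta_{\mathbb{I},n}\in\Theta$ minimizes $\mathbb{Q}_{\mathbb{I},n}(\theta)=\sum_{j=1}^q(\theta^{(j)}-\hat\theta_n^{(j)})^2+\sum_{j=1}^q\kappa_n^{(j)}|\theta^{(j)}|$ over $\Theta$. $\tilde\Theta_n=\{\theta\in\Theta:\theta^{(j)}=0\text{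 for all }j\text{ with }\tilde\theta^{(j)}_{\mathbb{I},n}=0\}$, and the P-O estimator $\check\theta_n\in\tilde\Theta_n$ satisfies $\mathbb{F}_n(\check\theta_n)=\inf_{\theta\in\tilde\Theta_n}\mathbb{F}_n(\theta)$. *)

(* Defs.v *)
From HB Require Import structures.
From mathcomp Require Import all_boot all_order all_algebra.
From mathcomp Require Import all_classical all_reals all_analysis.
From mathcomp Require Import measurable_realfun.

Set Implicit Arguments.
Unset Strict Implicit.
Unset Printing Implicit Defensive.

Import Order.TTheory GRing.Theory Num.Theory.
Import numFieldNormedType.Exports.

Local Open Scope classical_set_scope.
Local Open Scope ring_scope.

Section Vectors.
Context {R : realType}.

(* Euclidean norm; the library norm [`|x|] of a matrix is the sup norm. *)
Definition enorm m n (x : 'M[R]_(m, n)) : R :=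
  Num.sqrt (\sum_i \sum_j x i j ^+ 2).

Definition psd n (A : 'M[R]_n) : Prop :=
  A^T = A /\ forall x : 'cV[R]_n, 0 <= (x^T *m A *m x) 0 0.

Definition posdef n (A : 'M[R]_n) : Prop :=
  A^T = A /\ forall x : 'cV[R]_n, x != 0 -> 0 < (x^T *m A *m x) 0 0.

Definition vech_dim (p : nat) : nat := ((p * p.+1)./2)%N.

(* The lower triangle, column by column. *)
Definition vech_seq p (A : 'M[R]_p) : seq R :=
  flatten [seq [seq A i j | i : 'I_p <- enum 'I_p & (j <= i)%N]
          | j : 'I_p <- enum 'I_p].

Definition vech p (A : 'M[R]_p) : 'rV[R]_(vech_dim p) :=
  \row_k nth 0 (vech_seq A) k.

Lemma size_vech_seq p (A : 'M[R]_p) : size (vech_seq A) = vech_dim p.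
Proof.
rewrite size_flatten /shape -map_comp.
under eq_map => j do rewrite /= size_map size_filter.
rewrite sumnE big_map big_enum /=.
transitivity (\sum_(j < p) (p - j))%N.
  apply: eq_bigr => j _; rewrite -(count_map val (fun x => (j <= x)%N)).
  rewrite val_enum_ord; case: j => j /= ltjp.
  rewrite -{1}(subnKC (ltnW ltjp)) iotaD add0n count_cat.
  rewrite (eq_in_count (a2 := pred0)) ?count_pred0 ?add0n; last first.
    by move=> x; rewrite mem_iota /= => h; rewrite leqNgt h.
  rewrite (eq_in_count (a2 := predT)) ?count_predT ?size_iota//.
  by move=> x; rewrite mem_iota => /andP[].
rewrite -(big_mkord xpredT (fun j => p - j)%N) /vech_dim.
have -> : (\sum_(0 <= j < p) (p - j) = \sum_(0 <= j < p.+1) j)%N.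
  rewrite big_nat_rev /= add0n big_nat_recl//= add0n.
  by apply: eq_big_nat => i /andP[_ ip]; rewrite subKn.
by rewrite bin2_sum bin2 mulnC.
Qed.

(* R^{m x n} with its Borel sigma-algebra. *)
Definition borel m n := g_sigma_algebraType (@open 'M[R]_(m, n)).

End Vectors.
Arguments borel : clear implicits.

Section Drift.
Context {R : realType}.

Definition glob_lipschitz d (B : 'cV[R]_d -> 'cV[R]_d) : Prop :=
  exists L : R, forall x y, enorm (B x - B y) <= L * enorm (x - y).

Definition poly_growth d (f : 'cV[R]_d -> R) : Prop :=
  exists (C : R) (m : nat), forall x, `|f x| <= C * (1 + enorm x) ^+ m.

Definition pderiv d (s : seq 'I_d) (f : 'cV[R]_d -> R) : 'cV[R]_d -> R :=
  foldr (fun j g x => 'D_(delta_mx j 0) g x) f s.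

Definition Ck_poly_growth d (k : nat) (f : 'cV[R]_d -> R) : Prop :=
  (forall (s : seq 'I_d) j x, (size s < k)%N ->
     derivable (pderiv s f) x (delta_mx j 0)) /\
  (forall s : seq 'I_d, (size s <= k)%N ->
     continuous (pderiv s f) /\ poly_growth (pderiv s f)).

Definition regular_drift d (B : 'cV[R]_d -> 'cV[R]_d) : Prop :=
  glob_lipschitz B /\ forall i, Ck_poly_growth 4 (fun x => B x i 0).

End Drift.

Section Probability.
Context {R : realType} {disp : measure_display} {Om : measurableType disp}.
Variable P : probability Om R.
Implicit Types t s : R.

(* Product rule for a finite family; taking some [B i := setT] gives it for
   every subfamily. *)
Definition indep_rvs (I : finType) (X : I -> Om -> R) : Prop :=
  forall B : I -> set R, (forall i, measurable (B i)) ->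
    P (\bigcap_i (X i @^-1` B i)) = (\big[*%E/1]_i P (X i @^-1` B i))%E.

Definition indep_sigma (I : finType) (G : I -> set (set Om)) : Prop :=
  forall A : I -> set Om, (forall i, G i (A i)) ->
    P (\bigcap_i A i) = (\big[*%E/1]_i P (A i))%E.

Definition proc_sigma d (Y : R -> Om -> 'cV[R]_d) : set (set Om) :=
  <<s [set A | exists t (B : set (borel R d 1)),
         [/\ 0 <= t, measurable B & A = Y t @^-1` B]] >>.

Definition measurable_process d (Y : R -> Om -> 'cV[R]_d) : Prop :=
  forall t, 0 <= t -> measurable_fun setT (Y t : Om -> borel R d 1).

Definition continuous_process d (Y : R -> Om -> 'cV[R]_d) : Prop :=
  {ae P, forall w, {within `[0, +oo[, continuous (fun t => Y t w)}}.

(* Time runs over the half-line [0 <= t]; values at negative times are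
   irrelevant. The second parameter of [normal_prob] is a standard deviation. *)
Definition wiener r (W : R -> Om -> 'cV[R]_r) : Prop :=
  [/\ measurable_process W,
      continuous_process W,
      {ae P, forall w, W 0 w = 0},
      forall s t (i : 'I_r) (A : set R), 0 <= s -> s < t -> measurable A ->
        P [set w | A ((W t w - W s w) i 0)]
        = normal_prob 0 (Num.sqrt (t - s)) A &
      forall (m : nat) (u : nat -> R), 0 <= u 0%N ->
        (forall k, u k < u k.+1) ->
        indep_rvs (fun ki : 'I_m * 'I_r => fun w =>
          (W (u ki.1.+1) w - W (u ki.1) w) ki.2 0)].

(* dY_t = B(Y_t) dt + S dW_t, Y_0 = c: as S is constant, the stochastic
   integral is S W_t and the remaining one is a pathwise Lebesgue integral. *)
Definition sde_solution d r (B : 'cV[R]_d -> 'cV[R]_d) (S : 'M[R]_(d, r))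
    (W : R -> Om -> 'cV[R]_r) (c : 'cV[R]_d) (Y : R -> Om -> 'cV[R]_d) : Prop :=
  [/\ measurable_process Y,
      continuous_process Y &
      {ae P, forall w, forall t, 0 <= t -> forall i,
         Y t w i 0 = c i 0
           + \int[@lebesgue_measure R]_(s in `[0, t]) (B (Y s w) i 0)
           + (S *m W t w) i 0}].

Definition bounded_moments d (Y : R -> Om -> 'cV[R]_d) : Prop :=
  forall l : R, 0 <= l -> exists C : R, forall t, 0 <= t ->
    (\int[P]_w (enorm (Y t w) `^ l)%:E <= C%:E)%E.

(* [g] ranges over the pi-integrable functions whose time integrals exist
   almost surely: as Y starts from a fixed point, a pi-integrable [g] that is
   singular there may have infinite time integrals. Convergence in probability is expressed with the outer
   measure [P^*], which is [P] on measurable sets. *)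
Definition ergodic d (Y : R -> Om -> 'cV[R]_d) : Prop :=
  exists piY : probability (borel R d 1) R,
  forall g : borel R d 1 -> R,
    piY.-integrable setT (EFin \o g) ->
    {ae P, forall w, forall T : R, 0 < T ->
       (@lebesgue_measure R).-integrable `[0, T]
         (fun t => (g (Y t w))%:E)} ->
    forall eps : R, 0 < eps ->
      (P^* [set w | (eps <=
             `|T^-1 * \int[@lebesgue_measure R]_(t in `[0%R, T]) g (Y t w)
               - \int[piY]_x g x|)%R])%mu @[T --> +oo%R] --> 0%E.

Definition latent_process d r (B : 'cV[R]_d -> 'cV[R]_d) (S : 'M[R]_(d, r))
    (W : R -> Om -> 'cV[R]_r) (c : 'cV[R]_d) (Y : R -> Om -> 'cV[R]_d) : Prop :=
  [/\ sde_solution B S W c Y, regular_drift B, bounded_moments Y & ergodic Y].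

Definition cvg_in_distribution (X : nat -> Om -> R)
    (mu : probability (measurableTypeR R) R) : Prop :=
  (forall n, measurable_fun setT (X n)) /\
  forall f : R -> R, continuous f -> (exists M, forall x, `|f x| <= M) ->
    (\int[P]_w (f (X n w))%:E)%E @[n --> \oo] --> (\int[mu]_x (f x)%:E)%E.

End Probability.

Section ChiSquared.
Context {R : realType}.

(* [normal_prob] is a probability on [measurableTypeR R], i.e. R itself with
   its Borel sets. *)
Definition add_sqr (z : measurableTypeR R * measurableTypeR R) :
    measurableTypeR R :=
  (z.1 : R) ^+ 2 + (z.2 : R).

Let measurable_add_sqr : measurable_fun setT add_sqr.
Proof.
apply: measurable_funD; last exact: measurable_snd.
by apply: measurable_funX; exact: measurable_fst.
Qed.

HB.instance Definition _ := isMeasurableFun.Build _ _ _ _ add_sqr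
  measurable_add_sqr.

(* Law of Z_1^2 + ... + Z_r^2 with Z_1, ..., Z_r independent N(0,1). *)
Fixpoint chi2 (r : nat) : probability (measurableTypeR R) R :=
  if r is r'.+1 then
    distribution (normal_prob 0 1 \x chi2 r')%E add_sqr
  else \d_(0 : measurableTypeR R).

End ChiSquared.

Section StructuralModel.

(* [E] is R for actual matrices and R + 'I_q for parametrized ones. The
   coefficient matrix B is not a field: Psi = I - B. *)
Record sem (E : Type) (p1 p2 k1 k2 : nat) := Sem {
  Lx1 : 'M[E]_(p1, k1);
  Lx2 : 'M[E]_(p2, k2);
  Gam : 'M[E]_(k2, k1);
  Psi : 'M[E]_k2;
  Sxi : 'M[E]_k1;
  Sdelta : 'M[E]_p1;
  Seps : 'M[E]_p2;
  Szeta : 'M[E]_k2 }.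

Context {R : realType} {p1 p2 k1 k2 : nat}.

Definition Sigma (M : sem R p1 p2 k1 k2) : 'M[R]_(p1 + p2) :=
  let S12 := Lx1 M *m Sxi M *m (Gam M)^T *m (invmx (Psi M))^T *m (Lx2 M)^T in
  block_mx
    (Lx1 M *m Sxi M *m (Lx1 M)^T + Sdelta M) S12
    S12^T
    (Lx2 M *m invmx (Psi M) *m (Gam M *m Sxi M *m (Gam M)^T + Szeta M)
       *m (invmx (Psi M))^T *m (Lx2 M)^T + Seps M).

(* [1%:M - Psi M] is the matrix B. *)
Definition admissible (M : sem R p1 p2 k1 k2) : Prop :=
  [/\ \rank (Lx1 M) = k1,
      Psi M \in unitmx,
      forall i, (1%:M - Psi M) i i = 0,
      psd (Sxi M) /\ psd (Szeta M) &
      posdef (Sdelta M) /\ posdef (Seps M)].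

(* A parametrization: each entry is a known constant [inl c] or the [j]-th
   coordinate [inr j] of the parameter. *)
Definition param_sem (q : nat) := sem (R + 'I_q) p1 p2 k1 k2.

Definition entry q (theta : 'rV[R]_q) (e : R + 'I_q) : R :=
  match e with inl c => c | inr j => theta 0 j end.

Definition sem_at q (M : param_sem q) (theta : 'rV[R]_q) : sem R p1 p2 k1 k2 :=
  let ev m n (A : 'M[R + 'I_q]_(m, n)) := map_mx (entry theta) A in
  Sem (ev _ _ (Lx1 M)) (ev _ _ (Lx2 M)) (ev _ _ (Gam M)) (ev _ _ (Psi M))
      (ev _ _ (Sxi M)) (ev _ _ (Sdelta M)) (ev _ _ (Seps M))
      (ev _ _ (Szeta M)).

Definition uses_coordinate q (M : param_sem q) (j : 'I_q) : Prop :=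
  let occ m n (A : 'M[R + 'I_q]_(m, n)) := exists i k, A i k = inr j in
  (occ _ _ (Lx1 M) \/ occ _ _ (Lx2 M) \/ occ _ _ (Gam M) \/ occ _ _ (Psi M)) \/
  (occ _ _ (Sxi M) \/ occ _ _ (Sdelta M) \/ occ _ _ (Seps M) \/
   occ _ _ (Szeta M)).

End StructuralModel.

Section Estimation.
Context {R : realType}.

Definition realized_cov p (X : R -> 'cV[R]_p) (h : R) (n : nat) : 'M[R]_p :=
  (n%:R * h)^-1 *: \sum_(1 <= i < n.+1)
    (X (i%:R * h) - X (i.-1%:R * h)) *m (X (i%:R * h) - X (i.-1%:R * h))^T.

Definition F_disc p (Q S : 'M[R]_p) : R :=
  ln (\det S) - ln (\det Q) + \tr (invmx S *m Q) - p%:R.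

Definition contrast p (Q S : 'M[R]_p) : R :=
  if Q \in unitmx then F_disc Q S else enorm (vech Q - vech S) ^+ 2.

Definition attains_inf (T : Type) (A : set T) (f : T -> R) (x : T) : Prop :=
  A x /\ f x = inf [set f y | y in A].

Definition minimizes (T : Type) (A : set T) (f : T -> R) (x : T) : Prop :=
  A x /\ forall y, A y -> f x <= f y.

Definition penalty_weight (l1 l2 gamma delta a : R) : R :=
  l1 * `|a| `^ (- gamma) * (delta <= `|a|)%R%:R + l2 * (`|a| < delta)%R%:R.

Definition penalized q (l1 l2 gamma delta : R) (that theta : 'rV[R]_q) : R :=
  \sum_j (theta 0 j - that 0 j) ^+ 2
  + \sum_j penalty_weight l1 l2 gamma delta (that 0 j) * `|theta 0 j|.

Definition restricted q (Theta : set 'rV[R]_q) (ttilde : 'rV[R]_q) :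
    set 'rV[R]_q :=
  [set theta | Theta theta /\ forall j, ttilde 0 j = 0 -> theta 0 j = 0].

Definition active q (theta : 'rV[R]_q) : {set 'I_q} :=
  [set j | theta 0 j != 0]%SET.

End Estimation.

(* Main.v *)
(** On the event that sqrt n (Q_n - Sigma_0) is bounded, the first estimator is
    within O(n^-1/2) of theta_0, the penalized estimator vanishes exactly off
    F_1 for large n, and F(Q, Sigma) is half the squared norm of Q - Sigma for
    the form tr(Sigma_0^-1 D Sigma_0^-1 D), up to a higher-order term. Minimizing
    over the coordinates in F_1 leaves the squared norm of the projection of
    sqrt n (Q_n - Sigma_0) onto the orthogonal complement of |F_1| tangent
    directions, a space of dimension pbar - |F_1|.

    The four latent equations form one equation with Lipschitz drift, of which
    the observation is a linear image. Its drift changes sqrt n (Q_n - Sigma_0)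
    by O(sqrt h_n + sqrt (n h_n^2)) in L^1: only the cross terms of drift and
    noise are delicate, and they are orthogonal because the solution is a limit
    of Euler schemes, which are functions of past increments. What remains is a
    normalized sum of i.i.d. centred quadratic forms in Gaussian vectors.

    For such a sum U_n in dimension r, E exp(- k |U_n|^2) tends to
    (1 + 2 k)^(- r / 2) by replacing the summands one at a time, using the
    functions s^(- r / 2) exp(- k |u|^2 / s), which Gaussian convolution permutes.
    Convergence of Laplace transforms at the natural numbers gives convergence in
    distribution by polynomial approximation in the variable exp(- x). *)
Require Import Defs.
From HB Require Import structures.
From mathcomp Require Import all_boot all_order all_algebra.
From mathcomp Require Import all_classical all_reals all_analysis.
From mathcomp Require Import measurable_realfun spectral ring lra.
From mathcomp Require complex.

Set Implicit Arguments.
Unset Strict Implicit.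
Unset Printing Implicit Defensive.

Import Order.TTheory GRing.Theory Num.Theory.
Import numFieldNormedType.Exports.

Local Open Scope classical_set_scope.
Local Open Scope ring_scope.

(** * The contrast of positive definite matrices *)

Section SquareNorm.
Context {R : realType}.

(** The estimators enter only through deterministic statements: there is a radius [r] such that
    every [Q] near [S0], with any minimizers built from it, satisfies an expansion with error
    [e * enorm (Q - S0) ^+ 2]. Rates, selection and the choice among several minimizers thus involve
    no probability, and multiplication by [n] is harmless because the error is relative. Probability
    is left with one random matrix, whose tail is removed by a first-moment bound. The limit is
    exactly chi-squared because two quadratic forms match. The contrast is locally half of [wtr],
    while Isserlis' formula gives the traces of the limiting noise against [B] and [B'] the
    covariance [2 * \tr (B *m S0 *m (B' *m S0))]; coordinates that are orthonormal for the first
    form are uncorrelated with unit variance for the second. Laplace transforms suit this limit: the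
    statistic is nonnegative, and [expR (- (k * ssq u))] is itself a Gaussian profile, so replacing
    a summand by a Gaussian one only compares explicit functions. *)

Definition sqn m n (A : 'M[R]_(m, n)) : R := \sum_i \sum_j A i j ^+ 2.

Lemma sqn_ge0 m n (A : 'M[R]_(m, n)) : 0 <= sqn A.
Proof. by apply: sumr_ge0 => i _; apply: sumr_ge0 => j _; exact: sqr_ge0. Qed.

Lemma sqn_tr m n (A : 'M[R]_(m, n)) : sqn A = \tr (A *m A^T).
Proof.
apply: eq_bigr => i _; rewrite mxE; apply: eq_bigr => j _.
by rewrite mxE expr2.
Qed.

Lemma sqn_trmx m n (A : 'M[R]_(m, n)) : sqn A^T = sqn A.
Proof.
rewrite /sqn exchange_big /=; apply: eq_bigr => i _; apply: eq_bigr => j _.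
by rewrite mxE.
Qed.

Lemma sqn_entry m n (A : 'M[R]_(m, n)) i j : A i j ^+ 2 <= sqn A.
Proof.
rewrite /sqn (bigD1 i) //= (bigD1 j) //= -addrA lerDl addr_ge0 //.
  by apply: sumr_ge0 => k _; exact: sqr_ge0.
by apply: sumr_ge0 => k _; apply: sumr_ge0 => l _; exact: sqr_ge0.
Qed.

Lemma sqn_eq0 m n (A : 'M[R]_(m, n)) : (sqn A == 0) = (A == 0).
Proof.
apply/eqP/eqP => [A0|->]; last first.
  by rewrite /sqn big1 // => i _; rewrite big1 // => j _; rewrite mxE expr0n.
apply/matrixP => i j; rewrite mxE; apply/eqP; rewrite -sqrf_eq0 eq_le sqr_ge0.
by rewrite andbT -A0 sqn_entry.
Qed.

Lemma sqn0 m n : sqn (0 : 'M[R]_(m, n)) = 0.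
Proof. by apply/eqP; rewrite sqn_eq0. Qed.

Lemma sqnN m n (A : 'M[R]_(m, n)) : sqn (- A) = sqn A.
Proof.
by apply: eq_bigr => i _; apply: eq_bigr => j _; rewrite mxE sqrrN.
Qed.

Lemma sqnZ m n (a : R) (A : 'M[R]_(m, n)) : sqn (a *: A) = a ^+ 2 * sqn A.
Proof.
rewrite /sqn mulr_sumr; apply: eq_bigr => i _; rewrite mulr_sumr.
by apply: eq_bigr => j _; rewrite mxE exprMn.
Qed.

Lemma sqnD m n (A B : 'M[R]_(m, n)) : sqn (A + B) <= 2 * sqn A + 2 * sqn B.
Proof.
rewrite /sqn !mulr_sumr -big_split; apply: ler_sum => i _ /=.
rewrite !mulr_sumr -big_split; apply: ler_sum => j _ /=; rewrite mxE.
have := sqr_ge0 (A i j - B i j); lra.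
Qed.

Lemma sum_sqr_CS (I : finType) (a b : I -> R) :
  (\sum_i a i * b i) ^+ 2 <= (\sum_i a i ^+ 2) * (\sum_i b i ^+ 2).
Proof.
set x := \sum_i a i ^+ 2; set y := \sum_i b i ^+ 2; set z := \sum_i a i * b i.
have x0 : 0 <= x by apply: sumr_ge0 => i _; exact: sqr_ge0.
have key s t : 0 <= s ^+ 2 * x + t ^+ 2 * y - 2 * s * t * z.
  have -> : s ^+ 2 * x + t ^+ 2 * y - 2 * s * t * z
      = \sum_i (s * a i - t * b i) ^+ 2.
    rewrite /x /y /z !mulr_sumr -big_split -sumrB /=.
    by apply: eq_bigr => i _; ring.
  by apply: sumr_ge0 => i _; exact: sqr_ge0.
have [x_eq0|x_neq0] := eqVneq x 0.
  have z0 : z = 0.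
    rewrite /z big1 // => i _; suff -> : a i = 0 by rewrite mul0r.
    apply/eqP; rewrite -sqrf_eq0 eq_le sqr_ge0 andbT -x_eq0 /x.
    rewrite (bigD1 i) //= lerDl; apply: sumr_ge0 => j _; exact: sqr_ge0.
  by rewrite z0 x_eq0 expr0n mul0r.
have xp : 0 < x by rewrite lt_def x_neq0.
(* At [s = z], [t = x] the form equals [x * (x * y - z ^+ 2)]. *)
have := key z x => h; rewrite -subr_ge0 -(pmulr_rge0 _ xp).
by move: h; congr (0 <= _); ring.
Qed.

Lemma sqnM m n p (A : 'M[R]_(m, n)) (B : 'M[R]_(n, p)) :
  sqn (A *m B) <= sqn A * sqn B.
Proof.
rewrite -(sqn_trmx B) /sqn mulr_suml; apply: ler_sum => i _.
rewrite mulr_sumr; apply: ler_sum => j _; rewrite mxE.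
apply: le_trans (sum_sqr_CS _ _) _; rewrite le_eqVlt; apply/orP; left.
by apply/eqP; congr (_ * _); apply: eq_bigr => k _; rewrite mxE.
Qed.

Lemma sqr_trM_le m n (A : 'M[R]_(m, n)) (B : 'M[R]_(n, m)) :
  \tr (A *m B) ^+ 2 <= sqn A * sqn B.
Proof.
rewrite -(sqn_trmx B) /mxtrace.
under eq_bigr do rewrite mxE.
rewrite pair_big /= /sqn !pair_big /=.
apply: le_trans (sum_sqr_CS _ _) _; rewrite le_eqVlt; apply/orP; left.
by apply/eqP; congr (_ * _); apply: eq_bigr => k _; rewrite mxE.
Qed.

Lemma mx_normrP m n (A : 'M[R]_(m, n)) (c : R) : 0 <= c ->
  (`|A| <= c) <-> (forall i j, `|A i j| <= c).
Proof.
move=> c0; rewrite /Num.norm /= mx_normrE; split.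
  by move=> h i j; apply: le_trans h; apply: (le_bigmax _ _ (i, j)).
by move=> h; apply: bigmax_le => // -[i j] _; exact: h.
Qed.

Lemma mx_entry_norm m n (A : 'M[R]_(m, n)) i j : `|A i j| <= `|A|.
Proof. by have /mx_normrP := lexx `|A|; apply. Qed.

Lemma sqn_le_norm m n (A : 'M[R]_(m, n)) : sqn A <= (m * n)%:R * `|A| ^+ 2.
Proof.
have h i j : A i j ^+ 2 <= `|A| ^+ 2.
  rewrite -[X in X <= _]real_normK ?num_real // lerXn2r ?nnegrE //.
  exact: mx_entry_norm.
have -> : (m * n)%:R * `|A| ^+ 2 = \sum_(i < m) \sum_(j < n) `|A| ^+ 2.
  by rewrite !sumr_const !card_ord -mulrnA mulnC mulr_natl.
by apply: ler_sum => i _; apply: ler_sum => j _.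
Qed.

Lemma enorm_ge0 m n (A : 'M[R]_(m, n)) : 0 <= enorm A.
Proof. exact: sqrtr_ge0. Qed.

Lemma enorm_sqr m n (A : 'M[R]_(m, n)) : enorm A ^+ 2 = sqn A.
Proof. by rewrite sqr_sqrtr // sqn_ge0. Qed.

Lemma enorm_entry m n (A : 'M[R]_(m, n)) i j : `|A i j| <= enorm A.
Proof. by rewrite -sqrtr_sqr ler_wsqrtr // sqn_entry. Qed.

Lemma norm_le_enorm m n (A : 'M[R]_(m, n)) : `|A| <= enorm A.
Proof. by apply/mx_normrP; [exact: enorm_ge0|exact: enorm_entry]. Qed.

Lemma enorm_le_norm m n (A : 'M[R]_(m, n)) :
  enorm A <= Num.sqrt (m * n)%:R * `|A|.
Proof.
rewrite -[X in _ * X]ger0_norm // -sqrtr_sqr -sqrtrM ?ler0n //.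
by rewrite ler_wsqrtr // sqn_le_norm.
Qed.

Lemma enorm0 m n : enorm (0 : 'M[R]_(m, n)) = 0.
Proof. by rewrite /enorm -/(sqn _) sqn0 sqrtr0. Qed.

Lemma enorm_eq0 m n (A : 'M[R]_(m, n)) : (enorm A == 0) = (A == 0).
Proof. by rewrite -sqn_eq0 -enorm_sqr sqrf_eq0. Qed.

Lemma enormN m n (A : 'M[R]_(m, n)) : enorm (- A) = enorm A.
Proof. by rewrite /enorm -!/(sqn _) sqnN. Qed.

Lemma enormZ m n (a : R) (A : 'M[R]_(m, n)) : enorm (a *: A) = `|a| * enorm A.
Proof. by rewrite /enorm -!/(sqn _) sqnZ sqrtrM ?sqr_ge0 // sqrtr_sqr. Qed.

Lemma enormB m n (A B : 'M[R]_(m, n)) : enorm (A - B) = enorm (B - A).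
Proof. by rewrite -enormN opprB. Qed.

Lemma enormM m n p (A : 'M[R]_(m, n)) (B : 'M[R]_(n, p)) :
  enorm (A *m B) <= enorm A * enorm B.
Proof.
by rewrite /enorm -!/(sqn _) -sqrtrM ?sqn_ge0 // ler_wsqrtr // sqnM.
Qed.

Lemma enorm_trmx m n (A : 'M[R]_(m, n)) : enorm A^T = enorm A.
Proof. by rewrite /enorm -!/(sqn _) sqn_trmx. Qed.

Lemma trM_le m n (A : 'M[R]_(m, n)) (B : 'M[R]_(n, m)) :
  `|\tr (A *m B)| <= enorm A * enorm B.
Proof.
rewrite -sqrtr_sqr /enorm -!/(sqn _) -sqrtrM ?sqn_ge0 // ler_wsqrtr //.
exact: sqr_trM_le.
Qed.

Lemma sqn_addE m n (A B : 'M[R]_(m, n)) :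
  sqn (A + B) = sqn A + 2 * \tr (A *m B^T) + sqn B.
Proof.
rewrite !sqn_tr linearD /= mulmxDl !mulmxDr !mxtraceD.
rewrite -[\tr (B *m A^T)]mxtrace_tr trmx_mul trmxK; ring.
Qed.

Lemma ler_enormD m n (A B : 'M[R]_(m, n)) : enorm (A + B) <= enorm A + enorm B.
Proof.
rewrite -(ler_pXn2r (n := 2)) ?nnegrE ?addr_ge0 ?enorm_ge0 //.
rewrite sqrrD !enorm_sqr sqn_addE lerD2r lerD2l mulr2n.
have := le_trans (ler_norm _) (trM_le A B^T); rewrite enorm_trmx; lra.
Qed.

End SquareNorm.

(** * Cholesky factors and stability of positive definiteness *)

Section PositiveDefinite.
Context {R : realType}.

Lemma invmx_mul n (A B : 'M[R]_n) : A \in unitmx -> B \in unitmx ->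
  invmx (A *m B) = invmx B *m invmx A.
Proof.
move=> uA uB; have uAB : A *m B \in unitmx by rewrite unitmx_mul uA.
rewrite -[RHS]mulmx1 -(mulmxV uAB) !mulmxA -(mulmxA _ _ A) mulVmx // mulmx1.
by rewrite mulVmx // mul1mx.
Qed.

Lemma sqn_col n (x : 'cV[R]_n) : (x^T *m x) 0 0 = sqn x.
Proof.
rewrite -sqn_trmx sqn_tr trmxK /mxtrace big_ord1; by [].
Qed.

Lemma posdef_mulmx n (C : 'M[R]_n) : C \in unitmx -> posdef (C *m C^T).
Proof.
move=> uC; split=> [|x x0]; first by rewrite trmx_mul trmxK.
rewrite mulmxA -mulmxA -{1}(trmxK C) -trmx_mul sqn_col lt_def sqn_ge0 andbT.
rewrite sqn_eq0; apply: contra x0 => /eqP h.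
have uC' : C^T \in unitmx by rewrite unitmx_tr.
by rewrite -(mulKmx uC' x) h mulmx0.
Qed.

(** Eliminating the first coordinate leaves the Schur complement [D - a^-1 *: (b *m b^T)], again
    positive definite. This triangular factor plays the part of a square root below: changing
    variables by [C] turns the form of [A] into the Euclidean one. *)
Lemma posdef_cholesky n (A : 'M[R]_n) : posdef A ->
  exists2 C : 'M[R]_n, C \in unitmx & A = C *m C^T.
Proof.
elim: n A => [|n IHn] A.
  by move=> _; exists 1%:M; [exact: unitmx1|rewrite flatmx0 [RHS]flatmx0].
rewrite -[n.+1]/(1 + n)%N in A *; move=> [tA hA].
set a := A 0 0; set b := dlsubmx A; set D := drsubmx A.
have ulA : ulsubmx A = a%:M.
  apply/matrixP => i j; rewrite !ord1 !mxE eqxx mulr1n /a.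
  by congr (A _ _); apply/val_inj.
have urA : ursubmx A = b^T by rewrite /b trmx_dlsub tA.
have eA : A = block_mx a%:M b^T b D by rewrite -ulA -urA submxK.
have tD : D^T = D by rewrite /D trmx_drsub tA.
have quad (s : R) (y : 'cV[R]_n) :
    ((col_mx s%:M y)^T *m A *m col_mx s%:M y) 0 0 =
    a * s ^+ 2 + 2 * s * (b^T *m y) 0 0 + (y^T *m D *m y) 0 0.
  have eb : (y^T *m b) 0 0 = (b^T *m y) 0 0.
    by rewrite -[y^T *m b]trmxK trmx_mul trmxK mxE.
  rewrite eA tr_col_mx mul_row_block mul_row_col !mulmxDl tr_scalar_mx.
  rewrite -!scalar_mxM !mul_mx_scalar -!mulmxA !mul_scalar_mx.
  have eb' : \sum_j b^T 0 j * y j 0 = \sum_j y^T 0 j * b j 0.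
    by apply: eq_bigr => j _; rewrite !mxE mulrC.
  by rewrite -eb !mxE eqxx !mulr1n eb'; ring.
have a0 : 0 < a.
  have := hA (col_mx 1%:M 0); rewrite quad !mulmx0 !mxE expr1n !mulr1 !mulr0.
  rewrite !addr0; apply.
  apply/eqP => /matrixP/(_ 0 0); rewrite mxE; case: splitP => // i _.
  by rewrite !mxE ord1 eqxx => /eqP; rewrite oner_eq0.
pose S := D - a^-1 *: (b *m b^T).
have pS : posdef S.
  split; first by rewrite /S linearB linearZ /= trmx_mul trmxK tD.
  move=> y y0; set t := (b^T *m y) 0 0.
  (* The first coordinate [- a^-1 * t] minimizes the form of [A] over vectors with lower part [y],
     and the minimum is the form of [S] at [y]. *)
  have := hA (col_mx (- a^-1 * t)%:M y); rewrite quad -/t.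
  have -> : (y^T *m S *m y) 0 0 = (y^T *m D *m y) 0 0 - a^-1 * t ^+ 2.
    rewrite /S mulmxBr mulmxBl -scalemxAr -scalemxAl mulmxA.
    rewrite -[y^T *m b *m b^T *m y]mulmxA -[y^T *m b]trmxK trmx_mul trmxK.
    rewrite [b^T *m y]mx11_scalar -/t tr_scalar_mx -scalar_mxM.
    by rewrite !mxE eqxx mulr1n expr2.
  have -> : a * (- a^-1 * t) ^+ 2 + 2 * (- a^-1 * t) * t = - (a^-1 * t ^+ 2).
    by field; rewrite gt_eqF.
  rewrite addrC; apply; apply: contra y0 => /eqP h; apply/eqP.
  by rewrite -(col_mxKd (- a^-1 * t)%:M y) h linear0.
have [C uC eS] := IHn _ pS.
exists (block_mx (Num.sqrt a)%:M 0 ((Num.sqrt a)^-1 *: b) C).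
  rewrite unitmxE det_lblock det_scalar1 unitrM -unitmxE uC andbT.
  by rewrite unitfE sqrtr_eq0 -ltNge.
have sa0 : Num.sqrt a != 0 by rewrite sqrtr_eq0 -ltNge.
rewrite tr_block_mx mulmx_block !trmx0 !tr_scalar_mx !mulmx0 !mul0mx !addr0.
rewrite -scalar_mxM -expr2 sqr_sqrtr ?ltW // -eS linearZ /=.
rewrite mul_scalar_mx mul_mx_scalar !scalerA mulfV // !scale1r.
rewrite -scalemxAl -scalemxAr scalerA -invfM -expr2 sqr_sqrtr ?ltW //.
by rewrite /S addrC subrK eA.
Qed.

Lemma posdef_unit n (A : 'M[R]_n) : posdef A -> A \in unitmx.
Proof. by case/posdef_cholesky => C uC ->; rewrite unitmx_mul unitmx_tr uC. Qed.

Lemma posdef_det_gt0 n (A : 'M[R]_n) : posdef A -> 0 < \det A.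
Proof.
case/posdef_cholesky => C uC ->; rewrite det_mulmx det_tr -expr2.
by rewrite lt_def sqr_ge0 sqrf_eq0 andbT -unitfE -unitmxE.
Qed.

(** The form of [S] is at least [c^-1 * sqn x]; a symmetric perturbation of Euclidean norm at most
    [(2 * c)^-1] takes away at most half of it. *)
Lemma posdef_nbhs n (S : 'M[R]_n) : posdef S ->
  exists2 r, 0 < r & forall Q : 'M[R]_n, Q^T = Q -> enorm (Q - S) <= r -> posdef Q.
Proof.
move=> pS; have [C uC eS] := posdef_cholesky pS.
pose c := 1 + sqn (invmx C)^T; have c0 : 0 < c by rewrite ltr_pwDl ?sqn_ge0.
exists (2 * c)^-1; first by rewrite invr_gt0 mulr_gt0.
move=> Q tQ hQ; split=> // x x0.
have sx : 0 < sqn x by rewrite lt_def sqn_ge0 sqn_eq0 x0.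
have xC : x = (invmx C)^T *m (C^T *m x) by rewrite mulmxA -trmx_mul mulmxV // trmx1 mul1mx.
have h1 : sqn x <= c * sqn (C^T *m x).
  rewrite {1}xC; apply: le_trans (sqnM _ _) _.
  by rewrite ler_wpM2r ?sqn_ge0 // lerDr.
have e1 : (x^T *m S *m x) 0 0 = sqn (C^T *m x).
  by rewrite -sqn_col trmx_mul trmxK eS !mulmxA.
have h2 : - (enorm (Q - S) * sqn x) <= (x^T *m (Q - S) *m x) 0 0.
  rewrite lerNl; apply: le_trans (ler_norm _) _; rewrite normrN.
  apply: le_trans (enorm_entry _ _ _) _; apply: le_trans (enormM _ _) _.
  rewrite -(enorm_sqr x) expr2 mulrA ler_wpM2r ?enorm_ge0 //.
  by apply: le_trans (enormM _ _) _; rewrite enorm_trmx mulrC.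
have -> : x^T *m Q *m x = x^T *m S *m x + x^T *m (Q - S) *m x.
  by rewrite mulmxBr mulmxBl addrC subrK.
rewrite mxE e1.
have h3 : enorm (Q - S) * sqn x <= (2 * c)^-1 * sqn x by rewrite ler_wpM2r ?sqn_ge0.
have h4 : c^-1 * sqn x <= sqn (C^T *m x) by rewrite ler_pdivrMl.
have h5 : (2 * c)^-1 * sqn x = c^-1 * sqn x / 2 by rewrite invfM; ring.
have h6 : 0 < c^-1 * sqn x by rewrite mulr_gt0 ?invr_gt0.
lra.
Qed.

(** If the form vanished at [x], moving from [x] by [t] along [A *m x] would change it to first
    order by [2 * t * sqn (A *m x)], so a small negative [t] would make it negative. *)
Lemma psd_unit_posdef n (A : 'M[R]_n) : psd A -> A \in unitmx -> posdef A.
Proof.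
move=> [tA hA] uA; split=> // x x0; rewrite lt_def hA andbT.
apply/eqP => q0.
pose v := A *m x.
have v0 : sqn v != 0.
  by rewrite sqn_eq0; apply: contra x0 => /eqP h; rewrite -(mulKmx uA x) -/v h mulmx0.
have evv : (v^T *m A *m x) 0 0 = sqn v by rewrite -mulmxA sqn_col.
have exv : (x^T *m A *m v) 0 0 = sqn v.
  have -> : x^T *m A *m v = (v^T *m A *m x)^T.
    by rewrite trmx_mul trmx_mul trmxK tA mulmxA.
  by rewrite mxE.
have key t : 0 <= 2 * t * sqn v + t ^+ 2 * (v^T *m A *m v) 0 0.
  have := hA (x + t *: v); congr (0 <= _).
  have -> : (x + t *: v)^T = x^T + t *: v^T by rewrite linearD linearZ.
  rewrite !mulmxDl !mulmxDr.
  rewrite -!scalemxAl -!scalemxAr.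
  move: exv evv q0; rewrite !mxE => -> -> ->.
  by set c := \sum_i _; ring.
have vp : 0 < sqn v by rewrite lt_def v0 sqn_ge0.
have c0 := hA v; set c := (_ *m _) 0 0 in key c0.
(* A nearly optimal [t]; the [+ 1] covers the case [c = 0]. *)
have := key (- (sqn v / (c + 1))).
have -> : 2 * - (sqn v / (c + 1)) * sqn v + (- (sqn v / (c + 1))) ^+ 2 * c
    = - ((sqn v / (c + 1)) ^+ 2 * (c + 2)).
  by field; apply: lt0r_neq0; rewrite ltr_wpDl.
rewrite oppr_ge0 leNgt mulr_gt0 ?ltr_wpDl //.
by rewrite exprn_gt0 // divr_gt0 // ltr_wpDl.
Qed.

End PositiveDefinite.

(** * Spectral theorem for real symmetric matrices *)

Section Spectrum.
Import complex.
Context {R : realType}.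

(** Eigenvalues are recorded through the characteristic determinant, the trace and the trace of the
    square, which is all that the contrast sees of them. They come from the spectral theorem for
    normal matrices over the complex numbers, where a real symmetric matrix is Hermitian, so that
    the diagonal form is real. *)
Lemma symmetric_spectrum n (E : 'M[R]_n) : E^T = E ->
  exists d : 'I_n -> R,
    [/\ forall x, \det (x%:M + E) = \prod_i (x + d i),
        \tr E = \sum_i d i & \tr (E *m E) = \sum_i d i ^+ 2].
Proof.
move=> tE; pose C : numClosedFieldType := R[i].
pose f : {rmorphism R -> C} := real_complex R.
pose Ec : 'M[C]_n := map_mx f E.
have hS : Ec \is symmetricmx.
  by apply/is_hermitianmxP; rewrite expr0 scale1r map_mx_id // map_trmx tE.
have hR : Ec \is a mxOver Num.real.
  by apply/mxOverP => i j; rewrite mxE; apply/complex_realP; exists (E i j).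
have hE : Ec \is normalmx by exact: symmetric_normalmx.
have hD := hermitian_spectral_diag_real (realsym_hermsym hS hR).
have /orthomx_spectralP := hE.
have uU := spectral_unit Ec.
set U := spectralmx Ec in uU *; set D := spectral_diag Ec in hD * => eE.
pose d i := Re (D 0 i).
have eD i : D 0 i = f (d i).
  by apply/esym/RRe_real; exact: (mxOverP hD).
have fI : injective f by exact: complexI.
have eD' : D = map_mx f (\row_i d i).
  by apply/matrixP => i j; rewrite ord1 eD !mxE.
exists d; split.
- move=> x; apply: fI; rewrite -det_map_mx rmorphD rmorph_prod /=.
  rewrite map_scalar_mx -/Ec eE.
  have -> : (f x)%:M + invmx U *m diag_mx D *m U
      = invmx U *m ((f x)%:M + diag_mx D) *m U.
    by rewrite mulmxDr mulmxDl mul_mx_scalar -scalemxAl mulVmx // scalemx1.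
  rewrite !det_mulmx mulrAC -det_mulmx mulVmx // det1 mul1r.
  have -> : (f x)%:M + diag_mx D = diag_mx (\row_i (f x + D 0 i)).
    by apply/matrixP => i j; rewrite !mxE -mulrnDl.
  by rewrite det_diag; apply: eq_bigr => i _; rewrite mxE eD rmorphD.
- apply: fI; rewrite -trace_map_mx -/Ec eE mxtrace_mulC mulmxA mulmxV // mul1mx.
  by rewrite mxtrace_diag rmorph_sum; apply: eq_bigr => i _; rewrite eD.
- apply: fI; rewrite -trace_map_mx map_mxM -/Ec eE.
  rewrite -!mulmxA (mulmxA U (invmx U)) mulmxV // mul1mx mxtrace_mulC.
  rewrite -!mulmxA mulmxV // mulmx1 mulmx_diag mxtrace_diag rmorph_sum.
  by apply: eq_bigr => i _; rewrite mxE eD rmorphXn expr2.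
Qed.

End Spectrum.

(** * Bounds for x - ln (1 + x) *)

Section ScalarBounds.
Context {R : realType}.
Implicit Types x : R.

Lemma is_derive_ext (f g : R -> R) x df dg :
  is_derive x 1 g dg -> f =1 g -> df = dg -> is_derive x 1 f df.
Proof. by move=> h /funext -> ->. Qed.

Lemma is_derive_ln1p x : -1 < x ->
  is_derive x 1 (fun y : R => ln (1 + y)) (1 + x)^-1.
Proof.
move=> x1; have x0 : 0 < 1 + x by lra.
have h1 : is_derive (1 + x) 1 (@ln R) (1 + x)^-1 by exact: is_derive1_ln.
have h2 : is_derive x 1 (fun y : R => 1 + y) 1.
  apply: is_derive_eq (is_deriveD (is_derive_cst _ _ _) (is_derive_id _ _)) _.
  by rewrite add0r.
have := @is_derive1_comp _ (@ln R) (fun y : R => 1 + y) x _ _ h1 h2.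
by rewrite mulr1.
Qed.

(** Mean value theorem for [g], which vanishes at 0 and has derivative [- (y ^+ 2 / (1 + y))]. The
    intermediate point is kept in the statement because it yields both a sign for negative [x] and a
    cubic bound for small [x]. *)
Lemma ln1p_remainder x : -1 < x ->
  exists2 c, (0 <= c <= x) || (x <= c <= 0) &
    x - ln (1 + x) - x ^+ 2 / 2 = - (c ^+ 2 / (1 + c)) * x.
Proof.
move=> x1; pose g (y : R) := y - ln (1 + y) - y ^+ 2 / 2.
have dg (y : R) : -1 < y -> is_derive y 1 g (- (y ^+ 2 / (1 + y))).
  move=> y1; have := is_derive_ln1p y1 => h.
  have h2 : is_derive y 1 (fun z : R => z ^+ 2 / 2) y.
    apply: is_derive_ext (is_deriveZ 2^-1 (is_deriveX 2 (is_derive_id y 1))) _ _.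
      by move=> z; rewrite /= /GRing.scale /= mulrC.
    by rewrite /GRing.scale /=; field.
  apply: is_derive_ext (is_deriveB (is_deriveB (is_derive_id y 1) h) h2) _ _.
    by [].
  field; lra.
have g0 : g 0 = 0 by rewrite /g addr0 ln1 expr0n /= mul0r !subr0.
have cg y : -1 < y -> {for y, continuous g}.
  move=> y1; apply: differentiable_continuous; apply/derivable1_diffP.
  by have [] := dg _ y1.
have [x0|x0|->] := ltgtP x 0; last first.
- by exists 0; rewrite ?lexx // -/(g 0) g0 mulr0.
- have [||c] := @MVT R g (fun y => - (y ^+ 2 / (1 + y))) 0 x x0.
  + by move=> y; rewrite in_itv /= => /andP[y0 _]; apply: dg; lra.
  + apply: continuous_in_subspaceT => y; rewrite inE /= in_itv /= => /andP[y0 _].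
    by apply: cg; lra.
  + rewrite in_itv /= => /andP[c0 cx]; rewrite g0 !subr0 => e; exists c => //; apply/orP; left.
    by rewrite !ltW.
- have [||c] := @MVT R g (fun y => - (y ^+ 2 / (1 + y))) x 0 x0.
  + by move=> y; rewrite in_itv /= => /andP[y0 _]; apply: dg; lra.
  + apply: continuous_in_subspaceT => y; rewrite inE /= in_itv /= => /andP[y0 _].
    by apply: cg; lra.
  + rewrite in_itv /= => /andP[c0 cx]; rewrite g0 !sub0r => e; exists c; first by apply/orP; right; rewrite !ltW.
    by rewrite -/(g x) -[LHS]opprK e mulrN opprK.
Qed.

(** Valid on the whole domain of the logarithm: quadratic near 0, linear for large [x]. A small
    contrast can therefore bound eigenvalues that are not known beforehand to be small. *)
Lemma ln1p_le_sub_sqr x : -1 < x -> x ^+ 2 / (2 * (1 + `|x|)) <= x - ln (1 + x).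
Proof.
move=> x1; have [x0|x0] := leP 0 x; last first.
  have [c hc e] := ln1p_remainder x1.
  have : 0 <= x - ln (1 + x) - x ^+ 2 / 2.
    rewrite e mulNr -mulrN mulr_ge0 ?divr_ge0 ?sqr_ge0 //; last by lra.
    by case/orP: hc => /andP[]; lra.
  suff : x ^+ 2 / (2 * (1 + `|x|)) <= x ^+ 2 / 2 by lra.
  rewrite ler_wpM2l ?sqr_ge0 // lef_pV2 ?posrE //; have := normr_ge0 x; lra.
rewrite ger0_norm //.
(* For [x >= 0]: the difference vanishes at 0 and has derivative [y ^+ 2 / (2 * (1 + y) ^+ 2)]. *)
pose g (y : R) := y - ln (1 + y) - y ^+ 2 / (2 * (1 + y)).
have dg (y : R) : -1 < y -> is_derive y 1 g (y ^+ 2 / (2 * (1 + y) ^+ 2)).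
  move=> y1; have := is_derive_ln1p y1 => h.
  have h0 : is_derive y 1 (fun z : R => 2 * (1 + z)) 2.
    have h1 : is_derive y 1 (fun z : R => 1 + z) 1.
      apply: is_derive_eq (is_deriveD (is_derive_cst _ _ _) (is_derive_id _ _)) _.
      by rewrite add0r.
    apply: is_derive_ext (is_deriveZ 2 h1) _ _; first by [].
    by rewrite /GRing.scale /= mulr1.
  have y2 : 2 * (1 + y) != 0 by lra.
  have h2 : is_derive y 1 (fun z : R => z ^+ 2 / (2 * (1 + z)))
      ((2 * y + y ^+ 2) / (2 * (1 + y) ^+ 2)).
    have h3 : is_derive y 1 (fun z : R => (2 * (1 + z))^-1)
        (- (2 * (1 + y)) ^- 2 *: 2).
      apply: DeriveDef; first by apply: derivableV => //; case: h0.
      by rewrite deriveV ?derive_val //; case: h0.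
    apply: is_derive_ext (is_deriveM (is_deriveX 2 (is_derive_id y 1)) h3) _ _.
      by [].
    rewrite -[(id ^+ 2) y]/(y ^+ 2) /GRing.scale /=; field; lra.
  apply: is_derive_ext (is_deriveB (is_deriveB (is_derive_id y 1) h) h2) _ _.
    by [].
  field; lra.
have [->|xn0] := eqVneq x 0; first by rewrite expr0n /= mul0r addr0 ln1 subrr.
have xp : 0 < x by rewrite lt_def xn0.
have [||c] := @MVT R g (fun y => y ^+ 2 / (2 * (1 + y) ^+ 2)) 0 x xp.
- by move=> y; rewrite in_itv /= => /andP[y0 _]; apply: dg; lra.
- apply: continuous_in_subspaceT => y; rewrite inE /= in_itv /= => /andP[y0 _].
  apply: differentiable_continuous; apply/derivable1_diffP.
  by have [] := dg y; first lra.
rewrite in_itv /= => /andP[c0 cx].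
rewrite /g addr0 ln1 expr0n /= mul0r !subr0 => e.
have : 0 <= c ^+ 2 / (2 * (1 + c) ^+ 2) * x.
  by rewrite mulr_ge0 // divr_ge0 ?sqr_ge0 // mulr_ge0 // sqr_ge0.
by rewrite -e subr_ge0.
Qed.

Lemma ln1p_taylor2 x : `|x| <= 1 / 2 ->
  `|x - ln (1 + x) - x ^+ 2 / 2| <= 2 * `|x| ^+ 3.
Proof.
rewrite ler_norml => /andP[h1 h2].
have [|c hc ->] := @ln1p_remainder x; first lra.
have c1 : `|c| <= `|x|.
  case/orP: hc => /andP[a b]; first by rewrite !ger0_norm //; lra.
  by rewrite !ler0_norm //; lra.
have c2 : - (1 / 2) <= c by case/orP: hc => /andP[]; lra.
rewrite normrM normrN normrM normrX [`|x| ^+ 3]exprSr mulrA ler_wpM2r //.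
rewrite mulrC ler_pM //; last by rewrite lerXn2r ?nnegrE.
rewrite normfV ger0_norm; last lra.
by rewrite -[leRHS]invrK lef_pV2 ?posrE; lra.
Qed.
End ScalarBounds.

(** * The contrast in terms of relative eigenvalues *)

Section Contrast.
Context {R : realType}.

(** [F_disc Q S] is twice the Kullback-Leibler divergence between the centred Gaussian laws with
    covariances [Q] and [S]; [wtr S (Q - S) / 2] is its second-order part. *)
Definition wtr p (S D : 'M[R]_p) : R := \tr (invmx S *m D *m (invmx S *m D)).

(** With [S = C *m C^T], the symmetric matrix [invmx C *m Q *m (invmx C)^T - 1%:M] carries all
    invariants of the pair: its eigenvalues [d i] turn the ratio of determinants into a product and
    both traces into power sums. *)
Lemma F_disc_spectrum p (Q S : 'M[R]_p) : posdef Q -> posdef S ->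
  exists d : 'I_p -> R,
    [/\ forall i, -1 < d i, F_disc Q S = \sum_i (d i - ln (1 + d i)) &
        wtr S (Q - S) = \sum_i d i ^+ 2].
Proof.
move=> pQ pS; have [C uC eS] := posdef_cholesky pS.
have uCT : C^T \in unitmx by rewrite unitmx_tr.
pose E := invmx C *m Q *m (invmx C)^T - 1%:M.
have tQ : Q^T = Q by case: pQ.
have tE : E^T = E by rewrite /E linearB /= trmx1 !trmx_mul trmxK tQ mulmxA.
have eQ : C *m (1%:M + E) *m C^T = Q.
  rewrite /E addrC subrK !mulmxA mulmxV // mul1mx -mulmxA -trmx_mul mulmxV //.
  by rewrite trmx1 mulmx1.
have [d [dd dt dq]] := symmetric_spectrum tE.
have p1E : posdef (1%:M + E).
  have [_ hQ] := pQ.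
  split=> [|x x0]; first by rewrite linearD /= trmx1 tE.
  have := hQ ((invmx C)^T *m x); rewrite /E addrC subrK trmx_mul trmxK !mulmxA.
  apply; apply: contra x0 => /eqP h.
  have uCi : (invmx C)^T \in unitmx by rewrite unitmx_tr unitmx_inv.
  by rewrite -(mulKmx uCi x) h mulmx0.
(* If [d i <= -1], then [(- d i)%:M + E] is the positive definite [1%:M + E] plus a nonnegative
   multiple of the identity, yet its determinant has a zero factor. *)
have dpos i : -1 < d i.
  rewrite ltNge; apply/negP => di.
  have : \det ((- d i)%:M + E) = 0.
    by rewrite dd (bigD1 i) //= addNr mul0r.
  apply/eqP; rewrite gt_eqF //; apply: posdef_det_gt0.
  have -> : (- d i)%:M + E = (- d i - 1)%:M + (1%:M + E).
    apply/matrixP => j k; rewrite !mxE; case: (j == k); ring.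
  have [t1 h1] := p1E; split=> [|x x0].
    by rewrite linearD /= tr_scalar_mx t1.
  rewrite mulmxDr mulmxDl mxE ltr_wpDl ?h1 //.
  rewrite mul_mx_scalar -scalemxAl mxE sqn_col mulr_ge0 ?sqn_ge0 //; lra.
have eSi : invmx S = (invmx C)^T *m invmx C.
  by rewrite eS invmx_mul // trmx_inv.
exists d; split => //.
- have detS : \det S = \det C ^+ 2 by rewrite eS det_mulmx det_tr expr2.
  have detQ : \det Q = \det S * \prod_i (1 + d i).
    by rewrite -eQ !det_mulmx det_tr dd detS; ring.
  have lnQ : ln (\det Q) = ln (\det S) + \sum_i ln (1 + d i).
    rewrite detQ lnM ?posrE ?posdef_det_gt0 //; last first.
      by apply: prodr_gt0 => i _; have := dpos i; lra.
    congr (_ + _).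
    (* Positivity of the partial product is carried along with its logarithm, since [lnM] asks for
       it. *)
    pose K (x y : R) := 0 < x /\ ln x = y.
    suff [] : K (\prod_i (1 + d i)) (\sum_i ln (1 + d i)) by [].
    apply: big_rec2 => [|i y x _ [h1 h2]]; first by split; rewrite ?ln1.
    have di : 0 < 1 + d i by have := dpos i; lra.
    by split; rewrite ?mulr_gt0 // lnM ?posrE // h2.
  have tr1 : \tr (invmx S *m Q) = p%:R + \sum_i d i.
    rewrite eSi -mulmxA mxtrace_mulC -mulmxA -dt -(mxtrace1 R p) -raddfD /=.
    by rewrite /E addrC subrK mulmxA.
  rewrite /F_disc tr1 lnQ sumrB; ring.
- rewrite /wtr -dq.
  have -> : Q - S = C *m E *m C^T.
    by rewrite -eQ mulmxDr mulmx1 mulmxDl -eS addrC addKr.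
  rewrite eSi -!mulmxA (mulmxA (invmx C) C) mulVmx // mul1mx.
  rewrite (mulmxA C^T (invmx C)^T) -trmx_mul mulVmx // trmx1 mul1mx.
  rewrite (mulmxA (invmx C) C) mulVmx // mul1mx.
  by rewrite mxtrace_mulC -!mulmxA -trmx_mul mulVmx // trmx1 mulmx1.
Qed.

Lemma F_disc_ge0 p (Q S : 'M[R]_p) : posdef Q -> posdef S -> 0 <= F_disc Q S.
Proof.
move=> pQ pS; have [d [d1 -> _]] := F_disc_spectrum pQ pS.
apply: sumr_ge0 => i _; apply: le_trans (ln1p_le_sub_sqr (d1 i)).
by rewrite divr_ge0 ?sqr_ge0 // mulr_ge0 // addr_ge0.
Qed.

Lemma wtr_ge0 p (Q S : 'M[R]_p) : posdef Q -> posdef S -> 0 <= wtr S (Q - S).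
Proof.
move=> pQ pS; have [d [_ _ ->]] := F_disc_spectrum pQ pS.
by apply: sumr_ge0 => i _; exact: sqr_ge0.
Qed.

Lemma normr_le_sqrt_sum (I : finType) (d : I -> R) i :
  `|d i| <= Num.sqrt (\sum_i d i ^+ 2).
Proof.
rewrite -sqrtr_sqr ler_wsqrtr // (bigD1 i) //= lerDl.
by apply: sumr_ge0 => j _; exact: sqr_ge0.
Qed.

(** No smallness of [Q - S] is assumed. Each eigenvalue is at most the root of the sum of squares in
    absolute value, so the same denominator of the scalar bound serves for all of them. *)
Lemma F_disc_lower p (Q S : 'M[R]_p) : posdef Q -> posdef S ->
  wtr S (Q - S) <= F_disc Q S * (2 * (1 + Num.sqrt (wtr S (Q - S)))).
Proof.
move=> pQ pS; have [d [d1 -> ->]] := F_disc_spectrum pQ pS.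
set s := Num.sqrt _; have s0 : 0 <= s by exact: sqrtr_ge0.
rewrite -ler_pdivrMr; last by rewrite mulr_gt0 // ltr_pwDl.
rewrite mulr_suml; apply: ler_sum => i _.
apply: le_trans (ln1p_le_sub_sqr (d1 i)).
rewrite ler_wpM2l ?sqr_ge0 // lef_pV2 ?posrE ?mulr_gt0 ?ltr_pwDl //.
by rewrite ler_pM2l // lerD2l normr_le_sqrt_sum.
Qed.

(** The threshold [1 / 4] keeps every eigenvalue within [1 / 2], the range of the scalar Taylor
    bound; in the sum of cubes one factor is estimated by the root of [wtr]. *)
Lemma F_disc_taylor2 p (Q S : 'M[R]_p) : posdef Q -> posdef S ->
  wtr S (Q - S) <= 1 / 4 ->
  `|F_disc Q S - wtr S (Q - S) / 2|
    <= 2 * wtr S (Q - S) * Num.sqrt (wtr S (Q - S)).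
Proof.
move=> pQ pS; have [d [d1 -> e]] := F_disc_spectrum pQ pS.
rewrite e => s14.
have s12 : Num.sqrt (\sum_i d i ^+ 2) <= 1 / 2.
  rewrite -(ler_pXn2r (n := 2)) ?nnegrE ?sqrtr_ge0 ?sqr_sqrtr //.
    by apply: le_trans s14 _; rewrite expr_div_n expr1n -natrX.
  by rewrite -e wtr_ge0.
set s := Num.sqrt _ in s12 *.
rewrite mulr_suml -sumrB (le_trans (ler_norm_sum _ _ _)) //.
rewrite mulr_sumr mulr_suml; apply: ler_sum => i _.
have dis : `|d i| <= s by exact: normr_le_sqrt_sum.
apply: le_trans (ln1p_taylor2 _) _; first exact: le_trans dis s12.
rewrite -mulrA ler_pM2l // exprSr -[X in X * _]normrX ger0_norm ?sqr_ge0 //.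
by rewrite ler_wpM2l ?sqr_ge0.
Qed.

(** [D = C *m E *m C^T] with [sqn E = wtr S D], and [sqn C = \tr S]. The constant involves [S] and
    not its inverse, so a bound on the trace over the parameter set makes it uniform. *)
Lemma sqn_le_wtr p (S D : 'M[R]_p) : D^T = D -> posdef S ->
  sqn D <= \tr S ^+ 2 * wtr S D.
Proof.
move=> tD pS; have [C uC eS] := posdef_cholesky pS.
pose E := invmx C *m D *m (invmx C)^T.
have tE : E^T = E by rewrite /E !trmx_mul trmxK tD mulmxA.
have eD : C *m E *m C^T = D.
  rewrite /E !mulmxA mulmxV // mul1mx -mulmxA -trmx_mul mulmxV //.
  by rewrite trmx1 mulmx1.
have -> : wtr S D = sqn E.
  have eSi : invmx S = (invmx C)^T *m invmx C.
    by rewrite eS invmx_mul ?unitmx_tr // trmx_inv.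
  rewrite sqn_tr tE /wtr eSi /E -!(mulmxA (invmx C)^T).
  by rewrite mxtrace_mulC !mulmxA.
have -> : \tr S = sqn C by rewrite sqn_tr -eS.
rewrite -eD; apply: le_trans (sqnM _ _) _; rewrite sqn_trmx.
rewrite expr2 mulrAC ler_wpM2r ?sqn_ge0 //; exact: sqnM.
Qed.

Lemma wtr_le_sqn p (S D : 'M[R]_p) : wtr S D <= sqn (invmx S) * sqn D.
Proof.
apply: le_trans (ler_norm _) _; apply: le_trans (trM_le _ _) _.
rewrite -expr2 enorm_sqr; exact: sqnM.
Qed.

Lemma wtr_sub p (S S0 D : 'M[R]_p) :
  `|wtr S D - wtr S0 D| <=
    enorm (invmx S - invmx S0) * (enorm (invmx S) + enorm (invmx S0)) * sqn D.
Proof.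
have -> : wtr S D - wtr S0 D =
    \tr ((invmx S - invmx S0) *m D *m (invmx S *m D))
    + \tr (invmx S0 *m D *m ((invmx S - invmx S0) *m D)).
  rewrite /wtr !mulmxBl !mulmxBr !raddfB /=; ring.
apply: le_trans (ler_normD _ _) _.
rewrite mulrDr mulrDl lerD //.
  apply: le_trans (trM_le _ _) _.
  rewrite -enorm_sqr expr2 mulrACA ler_pM ?enorm_ge0 //; exact: enormM.
apply: le_trans (trM_le _ _) _.
rewrite -enorm_sqr expr2 mulrACA mulrC ler_pM ?enorm_ge0 //; exact: enormM.
Qed.

End Contrast.

(** * Half-vectorization and reduction of the quadratic form *)

Section OrthogonalComplement.
Context {R : realType}.

Lemma row_free_gram_posdef m n (A : 'M[R]_(m, n)) :
  row_free A -> posdef (A *m A^T).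
Proof.
move=> fA; split=> [|x x0]; first by rewrite trmx_mul trmxK.
rewrite mulmxA -mulmxA -{1}(trmxK A) -trmx_mul sqn_col lt_def sqn_ge0 andbT.
rewrite sqn_eq0; apply: contra x0 => /eqP h.
have : x^T *m A = 0 by rewrite -[LHS]trmxK trmx_mul trmxK h trmx0.
by move/eqP; rewrite mulmx_free_eq0 // => /eqP /(congr1 trmx); rewrite trmxK trmx0 => ->.
Qed.

(** A basis of the kernel is orthonormalized by the inverse Cholesky factor of its Gram matrix,
    which does the work of Gram-Schmidt. *)
Lemma orthonormal_complement s n r (G : 'M[R]_(s, n)) :
  row_free G -> (r + s = n)%N ->
  exists O : 'M[R]_(r, n),
    [/\ O *m O^T = 1%:M, G *m O^T = 0 &
      forall v : 'rV[R]_n, G *m v^T = 0 -> sqn v = sqn (v *m O^T)].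
Proof.
move=> fG ern.
have rG : \rank G = s by exact/eqP.
pose K0 := kermx G^T.
have rK : \rank K0 = r by rewrite mxrank_ker mxrank_tr rG -ern addnK.
pose K : 'M[R]_(r, n) := castmx (rK, erefl) (row_base K0).
have eK : (K :=: K0)%MS.
  rewrite /K; apply: eqmx_trans (eq_row_base _); exact: eqmx_cast.
have fK : row_free K by rewrite /row_free eK rK.
have [C uC eC] := posdef_cholesky (row_free_gram_posdef fK).
have KG : K *m G^T = 0.
  by apply/sub_kermxP; rewrite eK.
pose O := invmx C *m K.
have OO : O *m O^T = 1%:M.
  rewrite /O trmx_mul mulmxA -(mulmxA _ K) eC mulmxA mulVmx // mul1mx.
  by rewrite -trmx_mul mulVmx // trmx1.
exists O; split=> //.
  by rewrite -[LHS]trmxK trmx_mul trmxK /O -mulmxA KG mulmx0 trmx0.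
move=> v Gv.
have : (v <= K0)%MS.
  by apply/sub_kermxP; rewrite -[LHS]trmxK trmx_mul trmxK Gv trmx0.
rewrite -eK => /submxP[w ew].
have -> : v = (w *m C) *m O by rewrite /O mulmxA mulmxK.
by rewrite -(mulmxA _ O) OO mulmx1 !sqn_tr trmx_mul mulmxA -(mulmxA _ O) OO mulmx1.
Qed.

Lemma bessel r n (O : 'M[R]_(r, n)) (v : 'rV[R]_n) :
  O *m O^T = 1%:M -> sqn (v *m O^T) <= sqn v.
Proof.
move=> OO; rewrite -subr_ge0.
have -> : sqn v - sqn (v *m O^T) = sqn (v - v *m O^T *m O); last exact: sqn_ge0.
rewrite !sqn_tr linearB /= !trmx_mul trmxK mulmxBl !mulmxBr !raddfB /=.
rewrite !mulmxA.
have -> : v *m O^T *m O *m O^T = v *m O^T by rewrite -mulmxA OO mulmx1.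
ring.
Qed.

End OrthogonalComplement.

Section HalfVectorization.
Context {R : realType}.

(** The positions read by [vech_seq], separated from the matrix so that a coordinate of [vech] can
    be traced back to one entry. *)
Definition vech_pairs p : seq ('I_p * 'I_p) :=
  flatten [seq [seq (i, j) | i : 'I_p <- enum 'I_p & (j <= i)%N]
          | j : 'I_p <- enum 'I_p].

Lemma vech_seqE p (A : 'M[R]_p) :
  vech_seq A = [seq A ij.1 ij.2 | ij <- vech_pairs p].
Proof.
rewrite /vech_seq /vech_pairs map_flatten -map_comp; congr flatten.
by apply: eq_map => j /=; rewrite -map_comp.
Qed.

Lemma size_vech_pairs p : size (vech_pairs p) = vech_dim p.
Proof. by rewrite -(size_vech_seq (0 : 'M[R]_p)) vech_seqE size_map. Qed.

Lemma mem_vech_pairs p i j : ((i, j) \in vech_pairs p) = (j <= i)%N.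
Proof.
apply/flatten_mapP/idP => [[k _ /mapP[l]]|ij].
  by rewrite mem_filter => /andP[kl _] [-> ->].
exists j; rewrite ?mem_enum //; apply/mapP; exists i => //.
by rewrite mem_filter ij mem_enum.
Qed.

Lemma uniq_vech_pairs p : uniq (vech_pairs p).
Proof.
rewrite /vech_pairs.
have : uniq (enum 'I_p) by exact: enum_uniq.
set L := (X in flatten (map X _)).
elim: (enum 'I_p) => //= j s IHs /andP[js us].
rewrite cat_uniq IHs // andbT map_inj_uniq ?filter_uniq ?enum_uniq //=.
  apply/hasPn => -[a b] /flatten_mapP[k ks /mapP[l _ [-> ->]]].
  apply/negP => /mapP[l' _ [_ ekj]]; by rewrite -ekj ks in js.
  by move: (enum_uniq 'I_p); rewrite enumT.
by move=> a b [].
Qed.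

Definition vech_pair p (k : 'I_(vech_dim p)) : 'I_p * 'I_p :=
  tnth (in_tuple (vech_pairs p)) (cast_ord (esym (size_vech_pairs p)) k).

Lemma vechE p (A : 'M[R]_p) k :
  vech A 0 k = A (vech_pair k).1 (vech_pair k).2.
Proof.
rewrite mxE vech_seqE /vech_pair; set x := tnth _ _.
rewrite (nth_map x) ?size_vech_pairs //.
by have -> : nth x (vech_pairs p) k = x by rewrite {2}/x (tnth_nth x).
Qed.

Lemma vech_pair_inj p : injective (@vech_pair p).
Proof.
have /tuple_uniqP h : uniq (in_tuple (vech_pairs p)) by exact: uniq_vech_pairs.
by move=> k l /h /cast_ord_inj.
Qed.

Lemma vech_pair_surj p (i j : 'I_p) : (j <= i)%N ->
  exists k, vech_pair k = (i, j).
Proof.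
rewrite -mem_vech_pairs => /(tnthP (in_tuple _))[k ->].
exists (cast_ord (size_vech_pairs p) k).
by rewrite /vech_pair; congr tnth; apply/val_inj.
Qed.

Lemma vech_is_linear p : linear (@vech R p).
Proof. by move=> a A B; apply/rowP => k; rewrite vechE !mxE -!vechE !mxE. Qed.

HB.instance Definition _ p := GRing.isLinear.Build R 'M[R]_p 'rV[R]_(vech_dim p)
  *:%R (@vech R p) (@vech_is_linear p).

Lemma vech_sym_inj p (A B : 'M[R]_p) : A^T = A -> B^T = B ->
  vech A = vech B -> A = B.
Proof.
move=> tA tB /rowP h.
have {}h (i j : 'I_p) : (j <= i)%N -> A i j = B i j.
  by case/vech_pair_surj => k e; have := h k; rewrite !vechE e.
apply/matrixP => i j; have [/h //|/ltnW/h] := leqP j i.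
by rewrite -{2}tA -{2}tB !mxE.
Qed.

Lemma vech_sym_surj p (v : 'rV[R]_(vech_dim p)) :
  exists2 A : 'M[R]_p, A^T = A & vech A = v.
Proof.
pose f (i j : 'I_p) : R := \sum_k (vech_pair k == (i, j))%:R * v 0 k.
pose A := \matrix_(i, j) (if (j <= i)%N then f i j else f j i).
exists A.
  apply/matrixP => i j; rewrite !mxE; case: ltngtP => // ij.
  by congr f; apply/val_inj.
apply/rowP => k; rewrite vechE mxE.
have := mem_vech_pairs (vech_pair k).1 (vech_pair k).2.
rewrite -surjective_pairing {1}/vech_pair mem_tnth => <-.
rewrite /f -surjective_pairing (bigD1 k) //= eqxx mul1r big1 ?addr0 // => l lk.
by rewrite (inj_eq (@vech_pair_inj p)) (negPf lk) mul0r.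
Qed.

End HalfVectorization.

(** * Orthonormal coordinates for the local quadratic form *)

Section Reduction.
Context {R : realType}.
Variables (p q : nat) (S0 : 'M[R]_p) (J : 'M[R]_(q, vech_dim p)).
Variable (Act : {set 'I_q}).
Hypotheses (pS0 : posdef S0) (fJ : row_free J).

Definition unvech (v : 'rV[R]_(vech_dim p)) : 'M[R]_p :=
  projT1 (cid2 (vech_sym_surj v)).

Lemma unvech_sym v : (unvech v)^T = unvech v.
Proof. by rewrite /unvech; case: cid2. Qed.

Lemma unvechK v : vech (unvech v) = v.
Proof. by rewrite /unvech; case: cid2. Qed.

Lemma vechK (D : 'M[R]_p) : D^T = D -> unvech (vech D) = D.
Proof.
by move=> tD; apply: vech_sym_inj => //; rewrite ?unvech_sym ?unvechK.
Qed.

Lemma unvech_is_linear : linear unvech.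
Proof.
move=> a u v; apply: vech_sym_inj; first exact: unvech_sym.
  by rewrite linearD linearZ /= !unvech_sym.
by rewrite linearD linearZ /= !unvechK.
Qed.

HB.instance Definition _ := GRing.isLinear.Build R 'rV[R]_(vech_dim p) 'M[R]_p
  *:%R unvech unvech_is_linear.

(* The polarization of [wtr S0 / 2]. *)
Definition bwtr (D E : 'M[R]_p) : R :=
  2^-1 * \tr (invmx S0 *m D *m (invmx S0 *m E)).

Let H : 'M[R]_(vech_dim p) :=
  \matrix_(i, j) bwtr (unvech (delta_mx 0 i)) (unvech (delta_mx 0 j)).

Lemma bwtrC D E : bwtr D E = bwtr E D.
Proof. by rewrite /bwtr mxtrace_mulC. Qed.

Lemma bwtrDl a D D' E : bwtr (a *: D + D') E = a * bwtr D E + bwtr D' E.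
Proof.
rewrite /bwtr mulmxDr mulmxDl -scalemxAr -scalemxAl raddfD /= mxtraceZ; ring.
Qed.

Lemma bwtr_suml (I : finType) (c : I -> R) (D : I -> 'M[R]_p) E :
  bwtr (\sum_i c i *: D i) E = \sum_i c i * bwtr (D i) E.
Proof.
elim/big_rec2: _ => [|i y x _ <-]; last exact: bwtrDl.
by rewrite /bwtr mulmx0 mul0mx mxtrace0 mulr0.
Qed.

Lemma bwtr_unvech u v : bwtr (unvech u) (unvech v) = (u *m H *m v^T) 0 0.
Proof.
have e (w : 'rV[R]_(vech_dim p)) : unvech w = \sum_i w 0 i *: unvech (delta_mx 0 i).
  rewrite {1}(row_sum_delta w) linear_sum; apply: eq_bigr => i _.
  by rewrite linearZ.
rewrite (e u) bwtr_suml mxE.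
under [RHS]eq_bigr do rewrite mxE mulr_suml.
rewrite exchange_big /=; apply: eq_bigr => i _.
rewrite bwtrC (e v) bwtr_suml mulr_sumr; apply: eq_bigr => j _.
by rewrite !mxE bwtrC; ring.
Qed.

Lemma bwtr_gt0 D : D^T = D -> D != 0 -> 0 < bwtr D D.
Proof.
move=> tD D0; rewrite /bwtr mulr_gt0 ?invr_gt0 //.
have [C uC eC] := posdef_cholesky pS0.
have eSi : invmx S0 = (invmx C)^T *m invmx C.
  by rewrite eC invmx_mul ?unitmx_tr // trmx_inv.
pose E := invmx C *m D *m (invmx C)^T.
have tE : E^T = E by rewrite /E !trmx_mul trmxK tD mulmxA.
have -> : \tr (invmx S0 *m D *m (invmx S0 *m D)) = sqn E.
  rewrite sqn_tr tE eSi /E -!(mulmxA (invmx C)^T).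
  by rewrite mxtrace_mulC !mulmxA.
rewrite lt_def sqn_ge0 sqn_eq0 andbT; apply: contra D0 => /eqP E0.
have -> : D = C *m E *m C^T; last by rewrite E0 mulmx0 mul0mx.
rewrite /E !mulmxA mulmxV // mul1mx -mulmxA -trmx_mul mulmxV //.
by rewrite trmx1 mulmx1.
Qed.

Let posdefH : posdef H.
Proof.
split=> [|x x0]; first by apply/matrixP => i j; rewrite !mxE bwtrC.
rewrite -{2}(trmxK x) -bwtr_unvech bwtr_gt0 ?unvech_sym //.
apply: contra x0 => /eqP h; apply/eqP.
by rewrite -[x]trmxK -[x^T]unvechK h linear0 trmx0.
Qed.

(** In the coordinates [vech D *m C], with [C] the Cholesky factor of the Gram matrix [H], the form
    [wtr S0 / 2] is Euclidean. The active tangent directions become the rows of [G]; the columns of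
    [K] read coordinates along an orthonormal basis of their complement, and [U] is the
    least-squares fit along [G]. The matrices [B a] express the same coordinates as traces,
    normalized so that they have unit variance and no correlation under the limiting noise. *)
Lemma quadratic_reduction :
  exists (K : 'M[R]_(vech_dim p, vech_dim p - #|Act|))
         (B : 'I_(vech_dim p - #|Act|) -> 'M[R]_p)
         (U : 'M[R]_(vech_dim p, q)),
  [/\ forall a, (B a)^T = B a,
      forall D, D^T = D -> forall a, (vech D *m K) 0 a = \tr (B a *m D),
      forall a b, 2 * \tr (B a *m S0 *m (B b *m S0)) = (a == b)%:R,
      (forall D (u : 'rV[R]_q), D^T = D -> (forall j, j \notin Act -> u 0 j = 0) ->
        sqn (vech D *m K) <= wtr S0 (D - unvech (u *m J)) / 2) &
      (forall D j, j \notin Act -> (vech D *m U) 0 j = 0) /\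
      (forall D, D^T = D ->
        wtr S0 (D - unvech (vech D *m U *m J)) / 2 = sqn (vech D *m K))].
Proof.
have [C uC eH] := posdef_cholesky posdefH.
(* Extends a vector of active coordinates by zeros. *)
have [E Eij] : exists E : 'M[R]_(#|Act|, q),
    forall i j, E i j = (enum_val i == j)%:R.
  by exists (\matrix_(i, j) (enum_val i == j)%:R) => i j; rewrite mxE.
have EE : E *m E^T = 1%:M.
  apply/matrixP => i k; rewrite !mxE (bigD1 (enum_val i)) //= mxE !Eij eqxx.
  rewrite mul1r big1 => [|j ji]; last by rewrite Eij eq_sym (negPf ji) mul0r.
  by rewrite addr0 (inj_eq enum_val_inj) eq_sym.
have [J' JJ] := row_freeP fJ.
pose G := E *m J *m C.
have fG : row_free G.
  apply/row_freeP; exists (invmx C *m (J' *m E^T)).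
  rewrite /G !mulmxA -(mulmxA _ C) mulmxV // mulmx1 -(mulmxA _ J) JJ mulmx1.
  exact: EE.
(* Makes the truncated subtraction in the number of columns of [K] a true one. *)
have cA : (#|Act| <= vech_dim p)%N.
  by rewrite -(eqP fG) rank_leq_col.
have [N [NN GN hN]] := orthonormal_complement fG (subnK cA).
have wtrE D : D^T = D -> wtr S0 D / 2 = sqn (vech D *m C).
  move=> tD; rewrite -{1}(vechK tD) mulrC -/(bwtr _ _) bwtr_unvech eH.
  by rewrite sqn_tr trmx_mul !mulmxA /mxtrace big_ord1.
have uGG : G *m G^T \in unitmx by exact/posdef_unit/row_free_gram_posdef.
have uS0 := posdef_unit pS0.
have [tS0 _] := pS0.
pose Da a := unvech (row a (N *m invmx C)).
have tU v : (unvech v)^T = unvech v := unvech_sym v.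
(* [B a] is dual to [Da a]: the trace of [B a *m D] is [bwtr (Da a) D]. *)
exists (C *m N^T), (fun a => 2^-1 *: (invmx S0 *m Da a *m invmx S0)).
exists (C *m G^T *m invmx (G *m G^T) *m E); split.
- by move=> a; rewrite linearZ /= !trmx_mul trmx_inv tS0 tU mulmxA.
- move=> D tD a; rewrite -scalemxAl mxtraceZ.
  transitivity (bwtr (Da a) D); last by rewrite /bwtr -!mulmxA.
  rewrite -{2}(vechK tD) bwtr_unvech eH -!row_mul -!mulmxA mulKmx //.
  have -> : vech D *m (C *m N^T) = (N *m (C^T *m (vech D)^T))^T.
    by rewrite !trmx_mul !trmxK mulmxA.
  by rewrite mxE [RHS]mxE.
- move=> a b; rewrite -!scalemxAl -scalemxAr !mxtraceZ.
  transitivity (bwtr (Da a) (Da b)).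
    by rewrite -!mulmxA mulVmx // mulmx1 (mulmxA (invmx S0) S0) mulVmx //
      mul1mx /bwtr !mulmxA; field.
  rewrite bwtr_unvech eH !row_mul trmx_mul trmx_inv !mulmxA mulmxKV //.
  rewrite mulmxK ?unitmx_tr //.
  have -> : (a == b)%:R = (N *m N^T) a b by rewrite NN mxE.
  by rewrite !mxE; apply: eq_bigr => j _; rewrite !mxE.
- move=> D u tD hu.
  (* A vector supported on the active set factors through [E], so its tangent image lies in the span
     of the rows of [G] and is invisible to [N]. *)
  have -> : u = (\row_i u 0 (@enum_val _ (mem Act) i)) *m E.
    apply/rowP => j; rewrite mxE.
    under eq_bigr do rewrite mxE Eij.
    rewrite -(big_enum_val (fun k => u 0 k * (k == j)%:R)) /=.
    have [jA|jA] := boolP (j \in Act).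
      rewrite (bigD1 j) //= eqxx mulr1 big1 ?addr0 // => k /andP[_ kj].
      by rewrite (negPf kj) mulr0.
    rewrite hu // big1 // => k kA; have [e|_] := eqVneq k j.
      by rewrite -e kA in jA.
    by rewrite mulr0.
  rewrite wtrE; last by rewrite linearB /= tD tU.
  rewrite linearB /= unvechK mulmxBl.
  apply: le_trans (bessel _ NN); rewrite mulmxBl -!mulmxA.
  have -> : E *m (J *m (C *m N^T)) = 0 by rewrite !mulmxA; exact: GN.
  by rewrite mulmx0 subr0.
- split=> [D j jA|D tD].
    rewrite !mulmxA mxE big1 // => i _; rewrite Eij.
    case: eqP => [e|_]; last by rewrite mulr0.
    by rewrite -e (enum_valP i) in jA.
  rewrite wtrE; last by rewrite linearB /= tD tU.
  rewrite linearB /= unvechK mulmxBl.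
  set v := vech D *m C; rewrite !mulmxA -/v -(mulmxA _ E J) -(mulmxA _ (E *m J)).
  (* Normal equations: the least-squares residual is orthogonal to the rows of [G], so [N] preserves
     its norm. *)
  rewrite -/G hN; last first.
    have gen s (F : 'M[R]_(s, vech_dim p)) (x : 'rV[R]_(vech_dim p)) :
        (x *m F^T *m invmx (F *m F^T) *m F)^T
        = F^T *m (invmx (F *m F^T) *m (F *m x^T)).
      by rewrite 3!trmx_mul trmx_inv trmx_mul !trmxK.
    by rewrite linearB /= gen mulmxBr mulmxA mulKVmx // subrr.
  by rewrite mulmxBl -(mulmxA _ G) GN mulmx0 subr0.
Qed.

End Reduction.

(** * The covariance model and contrast minimizers *)

Section DifferentiableMatrices.
Context {R : realType} {V : normedModType R}.
Implicit Types (x : V).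

Definition diffmx m n (f : V -> 'M[R]_(m, n)) x :=
  forall i j, differentiable (fun y => f y i j) x.

Lemma differentiable_sumI (I : finType) (P : pred I) (f : I -> V -> R) x :
  (forall i, P i -> differentiable (f i) x) ->
  differentiable (fun y => \sum_(i | P i) f i y) x.
Proof.
move=> h.
have -> : (fun y => \sum_(i | P i) f i y) = \sum_(i | P i) f i.
  by apply/funext => y; rewrite fct_sumE.
elim/big_rec: _ => [|i g Pi dg]; first exact: differentiable_cst.
by apply: differentiableD => //; exact: h.
Qed.

Lemma differentiable_prodI (I : finType) (f : I -> V -> R) x :
  (forall i, differentiable (f i) x) ->
  differentiable (fun y => \prod_i f i y) x.
Proof.
move=> h.
suff : forall s : seq I, differentiable (fun y => \prod_(i <- s) f i y) x by exact.
elim=> [|i s IH].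
  under eq_fun do rewrite big_nil; exact: differentiable_cst.
under eq_fun do rewrite big_cons.
by apply: differentiableM.
Qed.

Lemma diffmx_cst m n (A : 'M[R]_(m, n)) x : diffmx (fun=> A) x.
Proof. by move=> i j; exact: differentiable_cst. Qed.

Lemma diffmxD m n (f g : V -> 'M[R]_(m, n)) x :
  diffmx f x -> diffmx g x -> diffmx (fun y => f y + g y) x.
Proof.
move=> df dg i j; under eq_fun do rewrite mxE; exact: differentiableD.
Qed.

Lemma diffmx_tr m n (f : V -> 'M[R]_(m, n)) x :
  diffmx f x -> diffmx (fun y => (f y)^T) x.
Proof. by move=> df i j; under eq_fun do rewrite mxE; exact: df. Qed.

Lemma diffmxM m n p (f : V -> 'M[R]_(m, n)) (g : V -> 'M[R]_(n, p)) x :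
  diffmx f x -> diffmx g x -> diffmx (fun y => f y *m g y) x.
Proof.
move=> df dg i j; under eq_fun do rewrite mxE.
by apply: differentiable_sumI => k _; apply: differentiableM.
Qed.

Lemma differentiable_det n (f : V -> 'M[R]_n) x :
  diffmx f x -> differentiable (fun y => \det (f y)) x.
Proof.
move=> df; apply: differentiable_sumI => s _.
apply: differentiableM; first exact: differentiable_cst.
exact: differentiable_prodI.
Qed.

Lemma diffmx_adj n (f : V -> 'M[R]_n) x :
  diffmx f x -> diffmx (fun y => \adj (f y)) x.
Proof.
move=> df i j; under eq_fun do rewrite mxE.
apply: differentiableM; first exact: differentiable_cst.
apply: differentiable_det => k l; under eq_fun do rewrite !mxE; exact: df.
Qed.

(** [invmx] agrees with the adjugate formula only at invertible matrices, so differentiability has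
    to be transferred along an equality that holds near the point. *)
Lemma differentiable_near_eq (f g : V -> R) x :
  (\forall y \near x, f y = g y) -> differentiable g x -> differentiable f x.
Proof.
move=> fg dg.
have fgx : f x = g x by exact: (nbhs_singleton fg).
have dgc : continuous ('d g x) by exact: diff_continuous.
have E : f \o shift x = cst (f x) + 'd g x +o_ 0 id.
  apply/eqaddoP => eps eps0.
  have /eqaddoP/(_ _ eps0) := diff_locally dg.
  rewrite (near_shift 0) subr0 in fg.
  near_simpl => h.
  near=> y.
  have -> : (f \o shift x - (cst (f x) + 'd g x)) y
      = (g \o shift x - (cst (g x) + 'd g x)) y.
    rewrite !fctE /= fgx; congr (_ - _); near: y; exact: fg.
  by near: y.
have E' := diff_unique dgc E.
by apply/diff_locallyP; rewrite E'.
Unshelve. all: by end_near. Qed.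

Lemma diffmx_inv n (f : V -> 'M[R]_n) x :
  diffmx f x -> f x \in unitmx -> diffmx (fun y => invmx (f y)) x.
Proof.
move=> df ux i j.
have dd := differentiable_det df.
apply: (@differentiable_near_eq _ (fun y => (\det (f y))^-1 * (\adj (f y)) i j)).
  near=> y; rewrite /invmx ifT ?mxE // unitmxE unitfE; near: y.
  have : \det (f x) != 0 by rewrite -unitfE -unitmxE.
  exact: (cvgr_neq0 _ (differentiable_continuous dd)).
apply: differentiableM; last exact: diffmx_adj.
by apply: differentiableV => //; rewrite -unitfE -unitmxE.
Unshelve. all: by end_near. Qed.

Lemma diffmx_differentiable m n (f : V -> 'M[R]_(m, n)) x :
  diffmx f x -> differentiable f x.
Proof.
move=> df.
have -> : f = (fun y => \sum_i \sum_j f y i j *: delta_mx i j).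
  by apply/funext => y; rewrite {1}(matrix_sum_delta (f y)).
have -> : (fun y => \sum_i \sum_j f y i j *: delta_mx i j)
    = \sum_(i < m) \sum_(j < n) (fun y => f y i j *: (delta_mx i j : 'M[R]_(m, n))).
  apply/funext => y; rewrite fct_sumE; apply: eq_bigr => i _.
  by rewrite fct_sumE.
apply: differentiable_sum => i; apply: differentiable_sum => j.
exact: differentiableZl.
Qed.

End DifferentiableMatrices.

Lemma continuous_enorm (R : realType) (V : normedModType R) m n
    (f : V -> 'M[R]_(m, n)) x :
  diffmx f x -> {for x, continuous (fun y => enorm (f y))}.
Proof.
move=> df; apply: (@continuous_comp _ _ _ (fun y => sqn (f y)) Num.sqrt).
  apply: differentiable_continuous; apply: differentiable_sumI => i _.
  apply: differentiable_sumI => j _; under eq_fun do rewrite expr2.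
  exact: differentiableM.
exact: sqrt_continuous.
Qed.

(** Half of the sup-norm radius turns an open sup-norm ball into a closed Euclidean ball inside
    it. *)
Lemma nbhs_enormP (R : realType) m n (x : 'M[R]_(m, n)) (P : set 'M[R]_(m, n)) :
  nbhs x P -> exists2 r, 0 < r & forall y, enorm (y - x) <= r -> P y.
Proof.
move=> /nbhs_normP[r /= r0 h]; exists (r / 2); first by rewrite divr_gt0.
move=> y yx; apply: h; rewrite /ball_ /= -normrN opprB.
apply: le_lt_trans (norm_le_enorm _) _; apply: le_lt_trans yx _.
by rewrite ltr_pdivrMr // ltr_pMr // ltr1n.
Qed.

Lemma differentiable_enorm (R : realType) m n (f : 'rV[R]_m -> 'rV[R]_n) x :
  differentiable f x -> forall e, 0 < e -> exists2 r, 0 < r &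
    forall y, enorm (y - x) <= r ->
      enorm (f y - f x - (y - x) *m 'J f x) <= e * enorm (y - x).
Proof.
move=> df e e0.
have := diff_locally df => /eqaddoP h.
have [c c0 hc] : exists2 c, 0 < c & forall v : 'rV[R]_n, enorm v <= c * `|v|.
  exists (1 + Num.sqrt (1 * n)%:R); first by rewrite ltr_pwDl ?sqrtr_ge0.
  move=> v; apply: le_trans (enorm_le_norm _) _.
  by rewrite ler_wpM2r // lerDr.
have /nbhs_enormP[r r0 hr] := h _ (divr_gt0 e0 c0).
exists r => // y yx; have := hr (y - x).
rewrite subr0 => /(_ yx) /=.
rewrite !fctE /= subrK => hy.
rewrite mul_rV_lin1 /=.
apply: le_trans (hc _) _.
rewrite -ler_pdivlMl // mulrA [c^-1 * e]mulrC.
rewrite opprD addrA in hy.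
by apply: le_trans hy _; rewrite ler_wpM2l ?norm_le_enorm // divr_ge0 // ltW.
Qed.

(** * Positivity and smoothness of the model covariance *)

Section ModelCovariance.
Context {R : realType} {p1 p2 k1 k2 : nat}.

(** Grouping by the source of the noise writes the covariance as congruences of positive
    semidefinite matrices plus a positive definite block, a structure that the blockwise definition
    hides. *)
Lemma SigmaE (M : sem R p1 p2 k1 k2) : (Sxi M)^T = Sxi M ->
  let X := col_mx (Lx1 M) (Lx2 M *m invmx (Psi M) *m Gam M) in
  let Y := col_mx 0 (Lx2 M *m invmx (Psi M)) in
  Sigma M = X *m Sxi M *m X^T + Y *m Szeta M *m Y^T
            + block_mx (Sdelta M) 0 0 (Seps M).
Proof.
move=> tS X Y; rewrite /Sigma /X /Y !tr_col_mx.
rewrite (mul_col_mx _ _ (Sxi M)) (mul_col_mx _ _ (Szeta M)) !mul_col_row.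
rewrite !add_block_mx !mul0mx !trmx0 !mulmx0 !addr0.
congr block_mx.
- by rewrite !trmx_mul !mulmxA.
- by rewrite !trmx_mul !trmxK !mulmxA tS.
- by rewrite mulmxDr !mulmxDl !trmx_mul !mulmxA.
Qed.

Lemma psd_congr m n (A : 'M[R]_(m, n)) (S : 'M[R]_n) :
  psd S -> psd (A *m S *m A^T).
Proof.
move=> [tS hS]; split=> [|x]; first by rewrite !trmx_mul trmxK tS mulmxA.
by have := hS (A^T *m x); rewrite trmx_mul trmxK !mulmxA.
Qed.

Lemma psdD n (A B : 'M[R]_n) : psd A -> psd B -> psd (A + B).
Proof.
move=> [tA hA] [tB hB]; split=> [|x]; first by rewrite linearD /= tA tB.
by rewrite mulmxDr mulmxDl mxE addr_ge0.
Qed.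

Lemma posdefDl n (A B : 'M[R]_n) : psd A -> posdef B -> posdef (A + B).
Proof.
move=> [tA hA] [tB hB]; split=> [|x x0]; first by rewrite linearD /= tA tB.
by rewrite mulmxDr mulmxDl mxE ltr_wpDl ?hB.
Qed.

Lemma posdef_block m n (A : 'M[R]_m) (B : 'M[R]_n) :
  posdef A -> posdef B -> posdef (block_mx A 0 0 B).
Proof.
move=> pA pB; have [C uC ->] := posdef_cholesky pA.
have [D uD ->] := posdef_cholesky pB.
have -> : block_mx (C *m C^T) 0 0 (D *m D^T)
    = block_mx C 0 0 D *m (block_mx C 0 0 D)^T.
  by rewrite tr_block_mx mulmx_block !trmx0 !mulmx0 !mul0mx !addr0 !add0r.
by apply: posdef_mulmx; rewrite unitmxE det_lblock unitrM -!unitmxE uC.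
Qed.

Lemma Sigma_posdef (M : sem R p1 p2 k1 k2) : admissible M -> posdef (Sigma M).
Proof.
move=> [_ _ _ [psx psz] [pd pe]].
rewrite SigmaE; last by case: psx.
apply: posdefDl; last exact: posdef_block.
by apply: psdD; apply: psd_congr.
Qed.

Lemma diffmx_map_entry q m n (A : 'M[R + 'I_q]_(m, n)) (theta : 'rV[R]_q) :
  diffmx (fun th => map_mx (entry th) A) theta.
Proof.
move=> i j; under eq_fun do rewrite mxE.
case: (A i j) => [c|k] /=; first exact: differentiable_cst.
exact: differentiable_coord.
Qed.

Lemma diffmx_block (V : normedModType R) m1 m2 n1 n2
    (f1 : V -> 'M[R]_(m1, n1)) (f2 : V -> 'M[R]_(m1, n2))
    (f3 : V -> 'M[R]_(m2, n1)) (f4 : V -> 'M[R]_(m2, n2)) x :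
  diffmx f1 x -> diffmx f2 x -> diffmx f3 x -> diffmx f4 x ->
  diffmx (fun y => block_mx (f1 y) (f2 y) (f3 y) (f4 y)) x.
Proof.
move=> d1 d2 d3 d4 i j; under eq_fun do rewrite !mxE.
by case: splitP => k _; under eq_fun do rewrite !mxE; case: splitP => l _.
Qed.

Lemma diffmx_Sigma q (M : @param_sem R p1 p2 k1 k2 q) (theta : 'rV[R]_q) :
  Psi (sem_at M theta) \in unitmx ->
  diffmx (fun th => Sigma (sem_at M th)) theta.
Proof.
move=> uPsi.
have dL1 := diffmx_map_entry (Lx1 M) theta.
have dL2 := diffmx_map_entry (Lx2 M) theta.
have dG := diffmx_map_entry (Gam M) theta.
have dP := diffmx_inv (diffmx_map_entry (Psi M) theta) uPsi.
have dx := diffmx_map_entry (Sxi M) theta.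
have dd := diffmx_map_entry (Sdelta M) theta.
have de := diffmx_map_entry (Seps M) theta.
have dz := diffmx_map_entry (Szeta M) theta.
by apply: diffmx_block;
  repeat (apply: diffmxD || apply: diffmxM || apply: diffmx_tr).
Qed.

End ModelCovariance.

(** * Rates of minimizers and local expansion of the contrast *)

Section EstimatorExpansion.
Context {R : realType}.
Variables (p q : nat) (Theta : set 'rV[R]_q) (S : 'rV[R]_q -> 'M[R]_p).
Variables (theta0 : 'rV[R]_q) (Act : {set 'I_q}).
Hypotheses (cTheta : compact Theta) (iTheta : interior Theta theta0).
Hypotheses (pS : forall th, Theta th -> posdef (S th)).
Hypotheses (dS : forall th, Theta th -> diffmx S th).
Hypotheses (idS : forall th, Theta th -> S th = S theta0 -> th = theta0).
Let S0 := S theta0.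
Let J := 'J (fun th => vech (S th)) theta0.
Hypothesis fJ : row_free J.

Let Theta0 : Theta theta0. Proof. exact: interior_subset. Qed.

Lemma diffmx_vech th : Theta th -> diffmx (fun th => vech (S th)) th.
Proof.
by move=> h i j; rewrite ord1; under eq_fun do rewrite vechE; exact: dS.
Qed.

Lemma continuous_within (f : 'rV[R]_q -> R) :
  (forall th, Theta th -> {for th, continuous f}) ->
  forall A, A `<=` Theta -> {within A, continuous f}.
Proof.
move=> cf A AT; apply: continuous_in_subspaceT => th /set_mem /AT; exact: cf.
Qed.

Lemma trace_bound : exists2 K, 0 < K & forall th, Theta th -> \tr (S th) <= K.
Proof.
have [||c _ hc] := @EVT_max_rV R q (fun th => \tr (S th)) Theta _ cTheta.
- by exists theta0.
- apply: continuous_within (fun _ h => h) => th hth.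
  apply: differentiable_continuous; apply: differentiable_sumI => i _.
  exact: dS.
exists (1 + `|\tr (S c)|); first by rewrite ltr_pwDl.
move=> th hth; apply: le_trans (hc th (mem_set hth)) _.
by rewrite ler_wpDl // ler_norm.
Qed.

Lemma vech_le (D : 'M[R]_p) : enorm (vech D) <= enorm D.
Proof.
rewrite /enorm ler_wsqrtr // big_ord1.
under eq_bigr do rewrite vechE.
rewrite (pair_big xpredT xpredT (fun i j => D i j ^+ 2)) /=.
rewrite (eq_bigl (mem predT)) // -(big_imset (h := @vech_pair R p)
  (fun ij => D ij.1 ij.2 ^+ 2)).
  rewrite big_mkcond /=; apply: ler_sum => ij _.
  by case: ifP => // _; exact: sqr_ge0.
by move=> x y _ _; exact: vech_pair_inj.
Qed.

(** By symmetry every entry of [unvech v] equals one in the lower triangle, which is a coordinate of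
    [v]. *)
Lemma unvech_le : exists2 c, 0 < c &
  forall v : 'rV[R]_(vech_dim p), enorm (unvech v) <= c * enorm v.
Proof.
exists (1 + Num.sqrt (p * p)%:R); first by rewrite ltr_pwDl ?sqrtr_ge0.
move=> v; apply: le_trans (enorm_le_norm _) _.
apply: ler_pM; rewrite ?sqrtr_ge0 ?lerDr //.
apply/mx_normrP => [|i j]; first exact: enorm_ge0.
have h (k l : 'I_p) : (l <= k)%N -> `|unvech v k l| <= enorm v.
  move=> /(vech_pair_surj (R := R))[m e]; have := enorm_entry v 0 m.
  by rewrite -{1}(unvechK v) vechE e.
have [/h //|/ltnW/h] := leqP j i.
by rewrite -{1}(unvech_sym v) mxE.
Qed.

(** A right inverse of the Jacobian bounds [u] by [k] times [u *m J]. The linearization error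
    [(2 * k)^-1 * enorm u] then costs half of [enorm u] and is absorbed. *)
Lemma local_separation : exists2 r, 0 < r & exists2 C, 0 < C &
  forall th, enorm (th - theta0) <= r ->
    enorm (th - theta0) <= C * enorm (S th - S0).
Proof.
have [J' JJ] := row_freeP fJ.
pose k := 1 + enorm J'; have k0 : 0 < k by rewrite ltr_pwDl ?enorm_ge0.
have [] := @differentiable_enorm R q _ (fun th => vech (S th)) theta0 _
  (2 * k)^-1 _.
- by apply: diffmx_differentiable; exact: diffmx_vech.
- by rewrite invr_gt0 mulr_gt0.
move=> r r0 hr; exists r => //; exists (2 * k); first by rewrite mulr_gt0.
move=> th hth; have := hr _ hth; rewrite -/J.
set u := th - theta0; set x := _ - vech _ => h.
have h1 : enorm u <= k * enorm (u *m J).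
  rewrite -{1}(mulmx1 u) -JJ mulmxA mulrC.
  apply: le_trans (enormM _ _) _; rewrite ler_wpM2l ?enorm_ge0 //.
  by rewrite /k lerDr.
have h2 : enorm (u *m J) <= enorm x + (2 * k)^-1 * enorm u.
  have -> : u *m J = x - (x - u *m J) by rewrite subKr.
  by apply: le_trans (ler_enormD _ _) _; rewrite enormN lerD2l.
have h3 : enorm x <= enorm (S th - S0) by rewrite /x -linearB vech_le.
have h4 : k * ((2 * k)^-1 * enorm u) = enorm u / 2 by field; rewrite gt_eqF.
have := le_trans h1 (ler_wpM2l (ltW k0) h2).
rewrite mulrDr h4 -mulrA.
have := ler_wpM2l (ltW k0) h3; lra.
Qed.

(** Away from [theta0], compactness and identifiability keep [enorm (S th - S0)] above a positive
    minimum [m], while the distance to [theta0] is bounded by its maximum; [B] is the quotient. *)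
Lemma global_separation : exists2 C, 0 < C &
  forall th, Theta th -> enorm (th - theta0) <= C * enorm (S th - S0).
Proof.
have [r r0 [C C0 hC]] := local_separation.
pose A := Theta `&` [set th | r <= enorm (th - theta0)].
have cE : continuous (fun th : 'rV[R]_q => enorm (th - theta0)).
  move=> th; apply: (@continuous_enorm R _ _ _ (fun y : 'rV[R]_q => y - theta0)).
  apply: diffmxD; last exact: diffmx_cst.
  by move=> i j; exact: differentiable_coord.
have cA : compact A.
  apply: compact_closedI => //; apply: (closed_comp (D := [set y | r <= y])).
    by move=> th _; exact: cE.
  exact: closed_ge.
have [A0|/set0P A0] := eqVneq A set0.
  exists C => // th hth; apply: hC; rewrite leNgt; apply/negP => /ltW h.
  by have : A th; [split|rewrite A0].
have [|c /set_mem cA' hc] := @EVT_min_rV R q (fun th => enorm (S th - S0)) A A0 cA.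
  apply: continuous_within => [th hth|th []//]; apply: continuous_enorm.
  by apply: diffmxD; [exact: dS|exact: diffmx_cst].
have [b _ hb] := @EVT_max_rV R q (fun th => enorm (th - theta0)) A A0 cA
  (continuous_subspaceT cE).
pose m := enorm (S c - S0).
have m0 : 0 < m.
  rewrite lt_def enorm_ge0 enorm_eq0 subr_eq0 andbT.
  case: cA' => hc1 hc2; apply/eqP => /(idS hc1) e.
  by move: hc2; rewrite /= e subrr enorm0 leNgt r0.
pose B := enorm (b - theta0) / m.
have B0 : 0 <= B by rewrite divr_ge0 ?enorm_ge0.
exists (C + B); first by rewrite ltr_wpDr.
move=> th hth; rewrite mulrDl.
have [h|h] := leP (enorm (th - theta0)) r.
  by rewrite (le_trans (hC _ h)) // lerDl mulr_ge0 ?enorm_ge0.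
have Ath : A th by split=> //; exact: ltW.
apply: (@le_trans _ _ (B * enorm (S th - S0))); last first.
  by rewrite lerDr mulr_ge0 ?enorm_ge0 // ltW.
apply: le_trans (hb th (mem_set Ath)) _.
rewrite /B mulrAC -mulrA ler_peMr ?enorm_ge0 //.
by rewrite ler_pdivlMr // mul1r; exact: hc (mem_set Ath).
Qed.

(** Consistency and rate in one deterministic step, applicable to every minimizer. The contrast at
    [theta0] is of order [d ^+ 2]; [F_disc_lower] turns a contrast no larger into closeness of
    [S th] to [Q], and separation turns that into closeness of the parameters. *)
Lemma contrast_rate : exists C, exists2 r, 0 < r & 0 < C /\
  forall Q, posdef Q -> enorm (Q - S0) <= r -> forall th, Theta th ->
    F_disc Q (S th) <= F_disc Q S0 ->
    enorm (th - theta0) <= C * enorm (Q - S0).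
Proof.
have [K K0 hK] := trace_bound.
have [C C0 hC] := global_separation.
pose M := 1 + sqn (invmx S0); have M0 : 0 < M by rewrite ltr_pwDl ?sqn_ge0.
(* From the chain [sqn (Q - S th) <= K ^+ 2 * s], [s <= 4 * F] and [F <= 2 * (M * d ^+ 2)]. *)
pose A := Num.sqrt (8 * K ^+ 2 * M).
exists (C * (1 + A)), (4 * M + 4)^-1.
  by rewrite invr_gt0 addr_gt0 // mulr_gt0.
split; first by rewrite mulr_gt0 // ltr_pwDl // sqrtr_ge0.
move=> Q pQ; set d := enorm (Q - S0) => dr th hth hF.
have d0 : 0 <= d by exact: enorm_ge0.
have dM : d * (4 * M + 4) <= 1.
  by rewrite -ler_pdivlMr ?mul1r // addr_gt0 // mulr_gt0.
have pS0 := pS Theta0; have pSt := pS hth.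
set w0 := wtr S0 (Q - S0).
have w00 : 0 <= w0 by exact: wtr_ge0.
have w0d : w0 <= M * d ^+ 2.
  apply: le_trans (wtr_le_sqn _ _) _; rewrite -/d /d enorm_sqr.
  by rewrite ler_wpM2r ?sqn_ge0 // lerDr.
have Md2 : 16 * (M * d ^+ 2) <= 1.
  have Md : 0 <= M * d by rewrite mulr_ge0 // ltW.
  by rewrite expr2 mulrA; nra.
have sw0 : Num.sqrt w0 <= 1 / 2.
  rewrite -(ler_pXn2r (n := 2)) ?nnegrE ?sqrtr_ge0 // sqr_sqrtr //.
  by rewrite expr_div_n expr1n -natrX; lra.
have F0 : F_disc Q S0 <= 2 * (M * d ^+ 2).
  have := F_disc_taylor2 pQ pS0; rewrite -/w0 => /(_ _)/ler_normlP[|_]; first lra.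
  have := ler_wpM2l w00 sw0; lra.
set s := wtr (S th) (Q - S th).
have s0 : 0 <= s by exact: wtr_ge0.
have hs := F_disc_lower pQ pSt; rewrite -/s in hs.
set F := F_disc Q (S th) in hs hF.
have F00 : 0 <= F by exact: F_disc_ge0.
have ss : Num.sqrt s ^+ 2 = s by rewrite sqr_sqrtr.
have ss0 : 0 <= Num.sqrt s by exact: sqrtr_ge0.
(* A priori bound: were [Num.sqrt s] above 1, the lower bound would give [Num.sqrt s <= 4 * F], and
   [4 * F] is at most [1 / 2]. *)
have ss1 : Num.sqrt s <= 1.
  rewrite leNgt; apply/negP => s1.
  have : Num.sqrt s * Num.sqrt s <= F * (4 * Num.sqrt s).
    rewrite -expr2 ss; apply: le_trans hs _; rewrite ler_wpM2l //; lra.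
  rewrite mulrA ler_pM2r; lra.
have sF : s <= 4 * F by nra.
have hD : enorm (Q - S th) <= A * d.
  rewrite -(ler_pXn2r (n := 2)) ?nnegrE ?mulr_ge0 ?enorm_ge0 ?sqrtr_ge0 //.
  rewrite enorm_sqr exprMn /A sqr_sqrtr; last first.
    by rewrite mulr_ge0 // ?ltW // mulr_gt0 // exprn_gt0.
  have tD : (Q - S th)^T = Q - S th by rewrite linearB /= pQ.1 pSt.1.
  apply: le_trans (sqn_le_wtr tD pSt) _; rewrite -/s.
  have tK : \tr (S th) ^+ 2 <= K ^+ 2.
    rewrite lerXn2r ?nnegrE ?hK ?(ltW K0) //.
    have [E uE ->] := posdef_cholesky pSt.
    by rewrite -sqn_tr; exact: sqn_ge0.
  have : s <= 8 * (M * d ^+ 2) by lra.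
  have K20 := sqr_ge0 K.
  move=> s8; apply: le_trans (ler_wpM2r s0 tK) _.
  by apply: le_trans (ler_wpM2l K20 s8) _; rewrite le_eqVlt; apply/orP; left;
    apply/eqP; ring.
apply: le_trans (hC _ hth) _; rewrite -mulrA ler_pM2l // mulrDl mul1r.
have -> : S th - S0 = (Q - S0) - (Q - S th).
  by apply/matrixP => i j; rewrite !mxE; ring.
by apply: le_trans (ler_enormD _ _) _; rewrite enormN lerD2l.
Qed.

Lemma exists_small (k e : R) : 0 <= k -> 0 < e ->
  exists2 x, 0 < x <= 1 & k * x <= e.
Proof.
move=> k0 e0; exists (e / (e + k)).
  by rewrite divr_gt0 ?ltr_wpDr //= ler_pdivrMr ?ltr_wpDr // mul1r lerDl.
rewrite mulrCA ler_piMr ?(ltW e0) // ler_pdivrMr ?ltr_wpDr // mul1r lerDr.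
exact: ltW.
Qed.

Lemma wtr_subr (S1 D D' : 'M[R]_p) :
  `|wtr S1 D - wtr S1 D'|
    <= sqn (invmx S1) * (enorm (D - D') * (enorm D + enorm D')).
Proof.
have -> : wtr S1 D - wtr S1 D' =
    \tr (invmx S1 *m (D - D') *m (invmx S1 *m D))
    + \tr (invmx S1 *m D' *m (invmx S1 *m (D - D'))).
  rewrite /wtr !(mulmxBr, mulmxBl) !raddfB /=; ring.
apply: le_trans (ler_normD _ _) _.
rewrite 2!mulrDr lerD //.
  apply: le_trans (trM_le _ _) _.
  rewrite -enorm_sqr expr2 mulrACA ler_pM ?enorm_ge0 //; exact: enormM.
apply: le_trans (trM_le _ _) _.
rewrite -enorm_sqr expr2 mulrACA mulrC ler_pM ?enorm_ge0 //; exact: enormM.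
Qed.

(** Three errors, each given a third of [e]: the cubic remainder of the contrast, the change of
    weight from [S th] to [S0], and the linearization of [S]. All are uniform over points at
    distance at most [C * enorm (Q - S0)], the rate just obtained for minimizers. *)
Lemma contrast_expansion C : 0 < C -> forall e, 0 < e ->
  exists2 r, 0 < r & forall Q, posdef Q -> enorm (Q - S0) <= r ->
    forall th, Theta th -> enorm (th - theta0) <= C * enorm (Q - S0) ->
    `|F_disc Q (S th) - wtr S0 (Q - S0 - unvech ((th - theta0) *m J)) / 2|
      <= e * enorm (Q - S0) ^+ 2.
Proof.
move=> C0 e e0; have pS0 := pS Theta0.
have [c c0 hc] := unvech_le.
(* [N * d] bounds [Q - S th] and also the same difference with [S] linearized; [B * d] bounds the
   root of [wtr (S th) (Q - S th)]. *)
pose N := 1 + c * (enorm J + 1) * C + c * C.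
have N0 : 0 < N.
  rewrite /N -addrA ltr_pwDl // addr_ge0 // !mulr_ge0 ?ltW //.
  by rewrite ltr_wpDl ?enorm_ge0.
pose I0 := enorm (invmx S0); have I00 : 0 <= I0 by exact: enorm_ge0.
pose B := (I0 + 1) * N; have B0 : 0 < B by rewrite mulr_gt0 // ltr_wpDl.
have c0' := ltW c0; have C0' := ltW C0; have N0' := ltW N0; have B0' := ltW B0.
have e3 : 0 < e / 3 by rewrite divr_gt0.
have [|e1 /andP[e10 e11] he1] := @exists_small (I0 ^+ 2 * (c * C * N)) (e / 3) _ e3.
  by rewrite !mulr_ge0 // exprn_ge0.
have [|e2 /andP[e20 e21] he2] := @exists_small ((2 * I0 + 1) * N ^+ 2) (e / 3) _ e3.
  by rewrite mulr_ge0 ?exprn_ge0 // addr_ge0 // mulr_ge0.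
have [|d1 /andP[d10 d11] hd1] := @exists_small (2 * B ^+ 3) (e / 3) _ e3.
  by rewrite mulr_ge0 // exprn_ge0 // ltW.
have [|d2 /andP[d20 d21] hd2] := @exists_small B (1 / 2) _ (divr_gt0 ltr01 (ltr0Sn _ _)).
  exact: ltW.
have [|r1 r10 hr1] := @differentiable_enorm R q _ (fun th => vech (S th)) theta0 _
  e1 e10.
  by apply: diffmx_differentiable; exact: diffmx_vech.
have [r2 r20 hr2] : exists2 r, 0 < r & forall th, enorm (th - theta0) <= r ->
    enorm (invmx (S th) - invmx S0) <= e2.
  apply: nbhs_enormP.
  have : {for theta0, continuous (fun th => enorm (invmx (S th) - invmx S0))}.
    apply: continuous_enorm; apply: diffmxD; last exact: diffmx_cst.
    by apply: diffmx_inv; [exact: dS|exact: posdef_unit].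
  move=> /cvgr_le; rewrite subrr enorm0; apply; exact: e20.
exists (Num.min (Num.min d1 d2) (Num.min (r1 / C) (r2 / C))).
  by rewrite !lt_min d10 d20 !divr_gt0.
move=> Q pQ; set d := enorm (Q - S0).
rewrite !le_min !ler_pdivlMr // => /andP[/andP[dd1 dd2] /andP[dr1 dr2]].
move=> th hth hu; set u := th - theta0 in hu *.
have d0 : 0 <= d by exact: enorm_ge0.
have u1 : enorm u <= r1 by rewrite (le_trans hu) // mulrC.
have u2 : enorm u <= r2 by rewrite (le_trans hu) // mulrC.
have := hr1 _ u1; rewrite -/J -/u -linearB /=; set rho := vech _ - _ => hrho.
pose D := Q - S th; pose D' := Q - S0 - unvech (u *m J).
have tS th' : Theta th' -> (S th')^T = S th' by move=> /pS[].
have eS : S th - S0 = unvech (u *m J) + unvech rho.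
  have erho : rho + u *m J = vech (S th - S0) by rewrite /rho subrK.
  rewrite -[LHS]vechK; last by rewrite linearB /= !tS.
  by rewrite -erho linearD addrC.
have eDD : D - D' = - unvech rho.
  rewrite /D /D' -[S th](subrK S0) eS; apply/matrixP => i j; rewrite !mxE; ring.
have hrho' : enorm (unvech rho) <= c * C * e1 * d.
  apply: le_trans (hc _) _; rewrite -!mulrA ler_pM2l //.
  by apply: le_trans hrho _; rewrite mulrCA ler_pM2l.
have hrho1 : enorm (unvech rho) <= c * C * d.
  apply: le_trans hrho' _; rewrite -!mulrA !ler_pM2l //.
  by rewrite ler_piMl.
have hDS : enorm (S th - S0) <= c * (enorm J + 1) * C * d.
  rewrite eS; apply: le_trans (ler_enormD _ _) _.
  have : enorm (unvech (u *m J)) <= c * (enorm J * (C * d)).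
    apply: le_trans (hc _) _; rewrite ler_pM2l //.
    apply: le_trans (enormM _ _) _; rewrite [leLHS]mulrC.
    by rewrite ler_wpM2l ?enorm_ge0.
  move: hrho1; lra.
have hD : enorm D <= N * d.
  have -> : D = (Q - S0) - (S th - S0).
    by apply/matrixP => i j; rewrite !mxE; ring.
  apply: le_trans (ler_enormD _ _) _; rewrite enormN -/d.
  have : 0 <= c * C * d by rewrite !mulr_ge0 // ltW.
  move: hDS; rewrite /N; lra.
have hD' : enorm D' <= N * d.
  have -> : D' = (Q - S0) - unvech (u *m J) by [].
  apply: le_trans (ler_enormD _ _) _; rewrite enormN -/d.
  have : enorm (unvech (u *m J)) <= c * (enorm J * (C * d)).
    apply: le_trans (hc _) _; rewrite ler_pM2l //.
    apply: le_trans (enormM _ _) _; rewrite [leLHS]mulrC.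
    by rewrite ler_wpM2l ?enorm_ge0.
  have : 0 <= c * C * d by rewrite !mulr_ge0 // ltW.
  rewrite /N; lra.
have hI : enorm (invmx (S th)) <= I0 + 1.
  rewrite -[invmx (S th)](subrK (invmx S0)) addrC.
  apply: le_trans (ler_enormD _ _) _; rewrite lerD2l.
  exact: le_trans (hr2 _ u2) e21.
have I1 := enorm_ge0 (invmx (S th)).
have D0 := enorm_ge0 D.
pose w := wtr (S th) D.
have w0 : 0 <= w by apply: wtr_ge0 => //; exact: pS.
have Bd0 : 0 <= B * d by exact: mulr_ge0.
have sw : Num.sqrt w <= B * d.
  rewrite -(ler_pXn2r (n := 2)) ?nnegrE ?sqrtr_ge0 //.
  rewrite sqr_sqrtr //; apply: le_trans (wtr_le_sqn _ _) _.
  rewrite -!enorm_sqr -exprMn lerXn2r ?nnegrE //; first exact: mulr_ge0.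
  by rewrite /B -mulrA ler_pM.
have sw2 : Num.sqrt w ^+ 2 = w by rewrite sqr_sqrtr.
have sw0 : 0 <= Num.sqrt w := sqrtr_ge0 _.
have Bd : B * d <= 1 / 2 by apply: le_trans hd2; rewrite ler_pM2l.
have w14 : w <= 1 / 4 by rewrite -sw2 expr2; nra.
have t1 : `|F_disc Q (S th) - w / 2| <= e / 3 * d ^+ 2.
  apply: le_trans (F_disc_taylor2 pQ (pS hth) w14) _; rewrite -/w.
  rewrite -{1}sw2 -mulrA -exprSr.
  apply: (@le_trans _ _ (2 * (B * d) ^+ 3)).
    by rewrite ler_pM2l // lerXn2r ?nnegrE // mulr_ge0 // ltW.
  have -> : 2 * (B * d) ^+ 3 = 2 * B ^+ 3 * d * d ^+ 2 by ring.
  rewrite ler_wpM2r ?sqr_ge0 //; apply: le_trans hd1.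
  by rewrite ler_wpM2l // mulr_ge0 // exprn_ge0.
have sqD : sqn D <= N ^+ 2 * d ^+ 2.
  by rewrite -enorm_sqr -exprMn lerXn2r ?nnegrE ?mulr_ge0 // ltW.
have t2 : `|w - wtr S0 D| <= e / 3 * d ^+ 2.
  apply: le_trans (wtr_sub _ _ _) _; rewrite -/I0.
  apply: (@le_trans _ _ (e2 * (2 * I0 + 1) * (N ^+ 2 * d ^+ 2))).
    rewrite ler_pM ?sqn_ge0 ?mulr_ge0 ?addr_ge0 ?enorm_ge0 //.
    rewrite ler_pM ?addr_ge0 ?enorm_ge0 ?hr2 //; lra.
  have -> : e2 * (2 * I0 + 1) * (N ^+ 2 * d ^+ 2)
      = (2 * I0 + 1) * N ^+ 2 * e2 * d ^+ 2 by ring.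
  by rewrite ler_wpM2r ?sqr_ge0.
have t3 : `|wtr S0 D - wtr S0 D'| / 2 <= e / 3 * d ^+ 2.
  have := wtr_subr S0 D D'; rewrite eDD enormN -enorm_sqr -/I0 => h.
  have : I0 ^+ 2 * (enorm (unvech rho) * (enorm D + enorm D'))
      <= I0 ^+ 2 * ((c * C * e1 * d) * (N * d + N * d)).
    by rewrite ler_wpM2l ?sqr_ge0 // ler_pM ?addr_ge0 ?enorm_ge0 // lerD.
  have : I0 ^+ 2 * (c * C * N) * e1 * d ^+ 2 <= e / 3 * d ^+ 2.
    by rewrite ler_wpM2r ?sqr_ge0.
  move: h; lra.
rewrite -/D'.
have -> : F_disc Q (S th) - wtr S0 D' / 2 = (F_disc Q (S th) - w / 2)
    + ((w - wtr S0 D) / 2 + (wtr S0 D - wtr S0 D') / 2) by lra.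
apply: le_trans (ler_normD _ _) _.
have := ler_normD ((w - wtr S0 D) / 2) ((wtr S0 D - wtr S0 D') / 2).
rewrite !normrM (ger0_norm (_ : 0 <= 2^-1)) ?invr_ge0 //.
have := normr_ge0 (w - wtr S0 D); lra.
Qed.

(** From below, the form at the minimizer is at least its minimum over active displacements. From
    above, the minimizer is compared with the explicit point at which the form attains this
    minimum. *)
Lemma restricted_minimum (Kx : 'M[R]_(vech_dim p, vech_dim p - #|Act|))
    (U : 'M[R]_(vech_dim p, q)) :
  (forall j, j \notin Act -> theta0 0 j = 0) ->
  (forall D (u : 'rV[R]_q), D^T = D -> (forall j, j \notin Act -> u 0 j = 0) ->
     sqn (vech D *m Kx) <= wtr S0 (D - unvech (u *m J)) / 2) ->
  (forall D j, j \notin Act -> (vech D *m U) 0 j = 0) ->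
  (forall D, D^T = D ->
     wtr S0 (D - unvech (vech D *m U *m J)) / 2 = sqn (vech D *m Kx)) ->
  forall e, 0 < e -> exists2 r, 0 < r & forall Q, posdef Q ->
    enorm (Q - S0) <= r -> forall th, Theta th ->
    (forall j, j \notin Act -> th 0 j = 0) ->
    (forall th', Theta th' -> (forall j, j \notin Act -> th' 0 j = 0) ->
       F_disc Q (S th) <= F_disc Q (S th')) ->
    `|F_disc Q (S th) - sqn (vech (Q - S0) *m Kx)| <= e * enorm (Q - S0) ^+ 2.
Proof.
move=> th0A lowN UA eqN e e0.
have [C [r1 r10 [C0 hC]]] := contrast_rate.
pose C' := C + enorm U.
have C'0 : 0 < C' by rewrite ltr_wpDr ?enorm_ge0.
have [r2 r20 hr2] := contrast_expansion C'0 e0.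
have [r3 r30 hr3] := nbhs_enormP iTheta.
exists (Num.min (Num.min r1 r2) (r3 / C')); first by rewrite !lt_min r10 r20 divr_gt0.
move=> Q pQ; rewrite !le_min ler_pdivlMr // => /andP[/andP[d1 d2] d3].
move=> th hth thA hmin; have pS0 := pS Theta0.
have d0 := enorm_ge0 (Q - S0).
have tD : (Q - S0)^T = Q - S0.
  by case: pQ pS0 => [tQ _] [tS _]; rewrite linearB /= tQ tS.
have hth1 : enorm (th - theta0) <= C' * enorm (Q - S0).
  apply: le_trans (hC _ pQ d1 _ hth (hmin _ Theta0 th0A)) _.
  by rewrite ler_wpM2r // lerDl enorm_ge0.
(* The competitor satisfies the zero constraints by [UA] and lies in [Theta] because [theta0] is
   interior. *)
pose us := vech (Q - S0) *m U; pose ths := theta0 + us.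
have hus : enorm us <= C' * enorm (Q - S0).
  apply: le_trans (enormM _ _) _; rewrite mulrC.
  by rewrite ler_pM ?enorm_ge0 ?vech_le // lerDr ltW.
have eus : ths - theta0 = us by rewrite /ths addrC addKr.
have hths : Theta ths.
  by apply: hr3; rewrite eus (le_trans hus) // mulrC.
have thsA j : j \notin Act -> ths 0 j = 0.
  by move=> jA; rewrite mxE th0A // add0r UA.
have h1 := hr2 _ pQ d2 _ hth hth1.
have h2 := hr2 _ pQ d2 _ hths; rewrite eus in h2; have {}h2 := h2 hus.
rewrite eqN // in h2.
have h3 := hmin _ hths thsA.
have h4 : sqn (vech (Q - S0) *m Kx)
    <= wtr S0 (Q - S0 - unvech ((th - theta0) *m J)) / 2.
  by apply: lowN => // j jA; rewrite !mxE thA // th0A // subrr.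
move: h1 h2; rewrite !ler_norml => /andP[h1 h1'] /andP[h2 h2'].
by apply/andP; split; lra.
Qed.

End EstimatorExpansion.

(** * Selection consistency *)

Section ModelSelection.
Context {R : realType}.

(** The minimizer shrinks [a] towards 0 by [k / 2] and sticks at 0. The extra term [(x - s) ^+ 2]
    expresses strong convexity, from which uniqueness follows. *)
Lemma soft_threshold (k a : R) : 0 <= k -> exists s,
  [/\ forall x, (s - a) ^+ 2 + k * `|s| + (x - s) ^+ 2 <= (x - a) ^+ 2 + k * `|x|,
      (s = 0) <-> (`|a| <= k / 2) & `|s - a| <= k / 2].
Proof.
move=> k0; have [h|h] := leP `|a| (k / 2).
  exists 0; split=> [x||]; [|by []|by rewrite sub0r normrN].
  rewrite normr0 mulr0 addr0 sub0r subr0 sqrrN.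
  have : x * a <= k / 2 * `|x|.
    by apply: le_trans (ler_norm _) _; rewrite normrM mulrC ler_wpM2r.
  lra.
have [a0|a0] := leP 0 a.
  rewrite ger0_norm // in h; exists (a - k / 2); split=> [x||].
  - rewrite (ger0_norm (_ : 0 <= a - k / 2)); last lra.
    have := ler_wpM2l k0 (ler_norm x); rewrite !expr2; lra.
  - split=> // e.
    by suff : False by []; lra.
  - by rewrite addrC addKr normrN ger0_norm // divr_ge0.
rewrite ltr0_norm // in h; exists (a + k / 2); split=> [x||].
- rewrite (ler0_norm (_ : a + k / 2 <= 0)); last lra.
  have := ler_wpM2l k0 (ler_norm (- x)); rewrite normrN !expr2; lra.
- split=> // e.
  by suff : False by []; lra.
- by rewrite addrC addKr ger0_norm // divr_ge0.
Qed.

(** Free of the constraint, the criterion separates over the coordinates. If the coordinatewise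
    optimum lies in [Theta], strong convexity leaves no other constrained minimizer. *)
Lemma penalized_minimizer q (Theta : set 'rV[R]_q) (l1 l2 gamma delta : R)
    (a t s : 'rV[R]_q) :
  let k j := penalty_weight l1 l2 gamma delta (a 0 j) in
  (forall j x, (s 0 j - a 0 j) ^+ 2 + k j * `|s 0 j| + (x - s 0 j) ^+ 2
     <= (x - a 0 j) ^+ 2 + k j * `|x|) ->
  Theta s -> minimizes Theta (penalized l1 l2 gamma delta a) t -> t = s.
Proof.
move=> k hs Ts [_ /(_ _ Ts)]; rewrite /penalized -!big_split /= => h.
have : sqn (t - s) <= 0.
  rewrite /sqn big_ord1.
  have : \sum_j ((s 0 j - a 0 j) ^+ 2 + k j * `|s 0 j| + (t - s) 0 j ^+ 2)
      <= \sum_j ((t 0 j - a 0 j) ^+ 2 + k j * `|t 0 j|).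
    by apply: ler_sum => j _; rewrite !mxE; exact: hs.
  rewrite big_split /= => h'; have := le_trans h' h.
  by rewrite gerDl.
by rewrite le_eqVlt ltNge sqn_ge0 orbF sqn_eq0 subr_eq0 => /eqP.
Qed.

Lemma penalty_weight_ge0 (l1 l2 gamma delta a : R) : 0 < l1 -> 0 < l2 ->
  0 <= penalty_weight l1 l2 gamma delta a.
Proof.
by move=> l10 l20; rewrite addr_ge0 // !mulr_ge0 ?powR_ge0 // ltW.
Qed.

(** An inactive coordinate of [a] is below [delta], has weight [l2] and size at most [l2 / 2], hence
    is thresholded to 0. An active one exceeds [delta], and its weight, at most [l1 * D], is too
    small to cancel it. *)
Lemma selection_consistency q (Theta : set 'rV[R]_q) (theta0 : 'rV[R]_q)
    (gamma delta : R) :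
  interior Theta theta0 -> 0 < gamma -> 0 < delta ->
  (forall j, j \in active theta0 -> delta < `|theta0 0 j|) ->
  exists2 r, 0 < r & forall (l1 l2 : R) (a t : 'rV[R]_q),
    0 < l1 -> 0 < l2 -> l1 <= r -> enorm (a - theta0) <= r ->
    enorm (a - theta0) <= l2 / 2 ->
    minimizes Theta (penalized l1 l2 gamma delta a) t ->
    forall j, (t 0 j = 0) <-> (j \notin active theta0).
Proof.
move=> iT g0 d0 hd.
have [rT rT0 hT] := nbhs_enormP iT.
have [r1 r10 hr1] : exists2 r, 0 < r &
    forall j, j \in active theta0 -> delta + r <= `|theta0 0 j|.
  exists (\big[Num.min/1]_(j in active theta0) (`|theta0 0 j| - delta)).
    by apply: lt_bigmin => // j jA; rewrite subr_gt0 hd.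
  by move=> j jA; rewrite addrC -lerBrDr; apply: bigmin_le_cond.
pose D := delta `^ (- gamma); have D0 : 0 < D by exact: powR_gt0.
(* Passes from a bound on each coordinate to the Euclidean norm. *)
pose c : R := 1 + Num.sqrt (1 * q)%:R.
have c0 : 0 < c by rewrite ltr_pwDl ?sqrtr_ge0.
have [e [e0 [ed eT]]] : exists e : R, 0 < e /\ e <= delta /\ e <= rT / (2 * c).
  exists (Num.min delta (rT / (2 * c))).
  by rewrite lt_min d0 !ge_min !lexx orbT divr_gt0 // mulr_gt0.
pose r := Num.min (Num.min (delta / 2) r1) (Num.min (e / D) e).
have r0 : 0 < r by rewrite 3!lt_min r10 e0 !divr_gt0.
exists r => //.
move=> l1 l2 a t l10 l20.
rewrite !le_min => /andP[/andP[_ _] /andP[lD _]].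
move=> /andP[/andP[ad ar1] /andP[_ ae]] al2 hmin.
have aj j : `|a 0 j - theta0 0 j| <= enorm (a - theta0).
  by have := enorm_entry (a - theta0) 0 j; rewrite !mxE.
pose k j := penalty_weight l1 l2 gamma delta (a 0 j).
have k0 j : 0 <= k j by exact: penalty_weight_ge0.
have [s hs] : exists s : 'rV[R]_q, forall j,
    [/\ forall x, (s 0 j - a 0 j) ^+ 2 + k j * `|s 0 j| + (x - s 0 j) ^+ 2
     <= (x - a 0 j) ^+ 2 + k j * `|x|, (s 0 j = 0) <-> (`|a 0 j| <= k j / 2) &
     `|s 0 j - a 0 j| <= k j / 2].
  exists (\row_j projT1 (cid (soft_threshold (a 0 j) (k0 j)))) => j.
  by rewrite mxE; case: cid.
have kA j : j \in active theta0 -> k j <= e /\ delta <= `|a 0 j|.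
  move=> jA; have h1 := hr1 _ jA.
  have h2 : delta <= `|a 0 j|.
    have := ler_normD (theta0 0 j - a 0 j) (a 0 j).
    rewrite subrK distrC => h3; have := aj j; lra.
  split=> //; rewrite /k /penalty_weight h2 ltNge h2 /= mulr1 mulr0 addr0.
  apply: (@le_trans _ _ (l1 * D)); last by rewrite -ler_pdivlMr.
  rewrite ler_pM2l // /D !powRN lef_pV2 ?posrE ?powR_gt0 //.
    by apply: ge0_ler_powR; rewrite ?nnegrE ?(ltW g0) ?(ltW d0).
  exact: lt_le_trans h2.
have kN j : j \notin active theta0 -> s 0 j = 0 /\ theta0 0 j = 0.
  rewrite inE negbK => /eqP t0.
  have h1 : `|a 0 j| <= enorm (a - theta0) by have := aj j; rewrite t0 subr0.
  split=> //; have [_ [_ h2] _] := hs j; apply: h2.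
  have h3 : `|a 0 j| < delta by rewrite (le_lt_trans h1) //; lra.
  rewrite /k /penalty_weight (leNgt delta) h3 /= mulr0 add0r mulr1.
  exact: le_trans h1 al2.
have sA j : j \in active theta0 -> s 0 j <> 0.
  move=> jA; have [h1 h2] := kA j jA; have [_ [h3 _] _] := hs j.
  move=> /h3 h4; lra.
(* Each coordinate of [s] is within [2 * e] of that of [theta0], so [s] lies in [Theta]. *)
have hts : t = s.
  apply: penalized_minimizer hmin; first by move=> j; have [] := hs j.
  apply: hT; apply: le_trans (enorm_le_norm _) _.
  apply: (@le_trans _ _ (c * (2 * e))).
    apply: ler_pM; rewrite ?sqrtr_ge0 ?lerDr //.
    apply/mx_normrP => [|i j]; first by rewrite mulr_ge0 // ltW.
    rewrite ord1 !mxE.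
    have [jA|/kN[-> ->]] := boolP (j \in active theta0); last first.
      by rewrite subrr normr0 mulr_ge0 // ltW.
    have [h1 _] := kA j jA; have [_ _ h2] := hs j.
    have := ler_normD (s 0 j - a 0 j) (a 0 j - theta0 0 j).
    rewrite subrKA; have := aj j; lra.
  move: eT; by rewrite ler_pdivlMr ?mulr_gt0 //; lra.
move=> j; rewrite hts; split=> [h|]; last by case/kN.
by apply/negP => /sA.
Qed.

End ModelSelection.

(** * Expectation and independence *)

Section Expectation.
Context {R : realType} {disp : measure_display} {Om : measurableType disp}.
Variable P : probability Om R.
Implicit Types f g : Om -> R.

Definition L1 f := P.-integrable setT (EFin \o f).
Definition Ex f : R := \int[P]_w f w.

Lemma L1_measurable f : L1 f -> measurable_fun setT f.
Proof. by move=> /measurable_int/measurable_EFinP. Qed.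

Lemma ExE f : L1 f -> (\int[P]_w (f w)%:E)%E = (Ex f)%:E.
Proof. by move=> h; rewrite /Ex /Rintegral fineK //; exact: integrable_fin_num. Qed.

Lemma L1_cst (c : R) : L1 (fun=> c).
Proof. exact: finite_measure_integrable_cst. Qed.

Lemma Ex_cst (c : R) : Ex (fun=> c) = c.
Proof. by rewrite /Ex /Rintegral integral_cst //= probability_setT mule1. Qed.

Lemma L1D f g : L1 f -> L1 g -> L1 (fun w => f w + g w).
Proof. by move=> hf hg; exact: (integrableD measurableT hf hg). Qed.

Lemma L1B f g : L1 f -> L1 g -> L1 (fun w => f w - g w).
Proof. by move=> hf hg; exact: (integrableB measurableT hf hg). Qed.

Lemma L1Z (k : R) f : L1 f -> L1 (fun w => k * f w).
Proof. by move=> hf; exact: (integrableZl measurableT k hf). Qed.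

Lemma L1_norm f : L1 f -> L1 (fun w => `|f w|).
Proof. by move=> /integrable_norm. Qed.

Lemma L1_sum (I : Type) (r : seq I) (Q : pred I) (F : I -> Om -> R) :
  (forall i, Q i -> L1 (F i)) -> L1 (fun w => \sum_(i <- r | Q i) F i w).
Proof.
move=> h; elim: r => [|i r IH].
  under eq_fun do rewrite big_nil; exact: L1_cst.
have [Qi|Qi] := boolP (Q i); last by under eq_fun do rewrite big_cons (negPf Qi).
by under eq_fun do rewrite big_cons Qi; apply: L1D => //; exact: h.
Qed.

Lemma L1_le f g : measurable_fun setT f -> (forall w, `|f w| <= g w) ->
  L1 g -> L1 f.
Proof.
move=> mf fg; apply: le_integrable => //; first exact/measurable_EFinP.
by move=> w _ /=; rewrite lee_fin (le_trans (fg w)) // ler_norm.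
Qed.

Lemma L1_bounded f (M : R) : measurable_fun setT f -> (forall w, `|f w| <= M) ->
  L1 f.
Proof. by move=> mf fM; apply: (L1_le mf fM); exact: L1_cst. Qed.

Lemma ExD f g : L1 f -> L1 g -> Ex (fun w => f w + g w) = Ex f + Ex g.
Proof. by move=> hf hg; exact: RintegralD. Qed.

Lemma ExB f g : L1 f -> L1 g -> Ex (fun w => f w - g w) = Ex f - Ex g.
Proof. by move=> hf hg; exact: RintegralB. Qed.

Lemma ExZ (k : R) f : L1 f -> Ex (fun w => k * f w) = k * Ex f.
Proof. by move=> hf; exact: RintegralZl. Qed.

Lemma Ex_sum (I : Type) (r : seq I) (Q : pred I) (F : I -> Om -> R) :
  (forall i, Q i -> L1 (F i)) ->
  Ex (fun w => \sum_(i <- r | Q i) F i w) = \sum_(i <- r | Q i) Ex (F i).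
Proof.
move=> h; elim: r => [|i r IH].
  by under eq_fun do rewrite big_nil; rewrite Ex_cst big_nil.
rewrite big_cons -IH; have [Qi|Qi] := boolP (Q i); last first.
  by under eq_fun do rewrite big_cons (negPf Qi).
under eq_fun do rewrite big_cons Qi.
by rewrite ExD //; [exact: h|exact: L1_sum].
Qed.

Lemma Ex_le f g : L1 f -> L1 g -> (forall w, f w <= g w) -> Ex f <= Ex g.
Proof. by move=> hf hg fg; apply: le_Rintegral. Qed.

Lemma Ex_ge0 f : (forall w, 0 <= f w) -> 0 <= Ex f.
Proof. by move=> h; apply: Rintegral_ge0. Qed.

Lemma Ex_norm f : L1 f -> `|Ex f| <= Ex (fun w => `|f w|).
Proof. by move=> hf; apply: le_normr_Rintegral. Qed.

Lemma Ex_ae_eq f g : measurable_fun setT f -> measurable_fun setT g ->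
  {ae P, forall w, f w = g w} -> Ex f = Ex g.
Proof.
move=> mf mg fg; rewrite /Ex /Rintegral; congr fine.
apply: ae_eq_integral => //; [exact/measurable_EFinP|exact/measurable_EFinP|].
by apply: filterS fg => w -> _.
Qed.

Lemma dominated_cvg_Ex (F : nat -> Om -> R) f g :
  (forall n, measurable_fun setT (F n)) -> measurable_fun setT f ->
  {ae P, forall w, F n w @[n --> \oo] --> f w} ->
  (forall n w, `|F n w| <= g w) -> L1 g ->
  Ex (F n) @[n --> \oo] --> Ex f.
Proof.
move=> mF mf Ff Fg hg.
have hF n : L1 (F n) by apply: L1_le (Fg n) hg; exact: mF.
have [||||h1 _] := @dominated_convergence _ _ _ P setT measurableT
  (fun n => EFin \o F n) (EFin \o f) (EFin \o g) _ _ _ hg.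
- by move=> n; exact/measurable_EFinP.
- exact/measurable_EFinP.
- apply: filterS Ff => w h _; apply: cvg_EFin; last exact: h.
  exact: nearW.
- by apply: aeW => w n _; rewrite /= lee_fin.
rewrite /= (ExE h1); under eq_fun do rewrite ExE //.
by move/fine_cvg; rewrite /= => h; exact: h.
Qed.

Lemma Ex_CS f g : measurable_fun setT f -> measurable_fun setT g ->
  L1 (fun w => f w ^+ 2) -> L1 (fun w => g w ^+ 2) ->
  L1 (fun w => f w * g w) /\
  Ex (fun w => f w * g w) ^+ 2
    <= Ex (fun w => f w ^+ 2) * Ex (fun w => g w ^+ 2).
Proof.
move=> mf mg hf hg.
have hfg : L1 (fun w => f w * g w).
  apply: L1_le (L1D hf hg); first exact: measurable_funM.
  move=> w; rewrite ler_norml !expr2; apply/andP; split; nra.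
split=> //; set x := Ex (fun w => f w ^+ 2); set y := Ex (fun w => g w ^+ 2).
set z := Ex _.
have key s t : 0 <= s ^+ 2 * x + t ^+ 2 * y - 2 * s * t * z.
  have -> : s ^+ 2 * x + t ^+ 2 * y - 2 * s * t * z
      = Ex (fun w => s ^+ 2 * f w ^+ 2 + t ^+ 2 * g w ^+ 2
                     - 2 * s * t * (f w * g w)).
    rewrite ExB ?ExD ?ExZ //; try exact: L1Z.
    by apply: L1D; exact: L1Z.
  apply: Ex_ge0 => w.
  have -> : s ^+ 2 * f w ^+ 2 + t ^+ 2 * g w ^+ 2 - 2 * s * t * (f w * g w)
    = (s * f w - t * g w) ^+ 2 by ring.
  exact: sqr_ge0.
have x0 : 0 <= x by apply: Ex_ge0 => w; exact: sqr_ge0.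
have y0 : 0 <= y by apply: Ex_ge0 => w; exact: sqr_ge0.
have [x_eq0|x_neq0] := eqVneq x 0; last first.
  have xp : 0 < x by rewrite lt_def x_neq0.
  rewrite -subr_ge0 -(pmulr_rge0 _ xp).
  by have := key z x; congr (0 <= _); ring.
have [z_eq0|z_neq0] := eqVneq z 0; first by rewrite z_eq0 expr0n mulr_ge0.
have zp : 0 < z ^+ 2 by rewrite lt_def sqr_ge0 sqrf_eq0 z_neq0.
(* With [x = 0] the form at these arguments is [y - 2 * (y + 1)], which is negative. *)
have := key ((y + 1) / z) 1; rewrite x_eq0 mulr0 add0r expr1n mul1r mulr1.
by rewrite -mulrA divfK //; lra.
Qed.

Lemma Ex_sqr_norm f : measurable_fun setT f -> L1 (fun w => f w ^+ 2) ->
  L1 f /\ Ex (fun w => `|f w|) <= Num.sqrt (Ex (fun w => f w ^+ 2)).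
Proof.
move=> mf hf.
have mnf : measurable_fun setT (fun w => `|f w|) by exact: measurableT_comp.
have hf' : L1 (fun w => `|f w| ^+ 2).
  by under eq_fun do rewrite real_normK ?num_real //.
have h1 : L1 (fun w => (cst 1 w : R) ^+ 2).
  by under eq_fun do rewrite expr1n; exact: L1_cst.
have [] := Ex_CS mnf (measurable_cst (1 : R)) hf' h1.
under eq_fun do rewrite mulr1; move=> hn.
have -> : Ex (fun w => cst 1 w ^+ 2) = 1 by rewrite -[RHS]Ex_cst /cst expr1n.
rewrite mulr1; under [in X in _ <= X]eq_fun do rewrite real_normK ?num_real //.
move=> h2; split; first by apply: L1_le hn.
rewrite -[leLHS]ger0_norm ?Ex_ge0 // -sqrtr_sqr; exact: ler_wsqrtr.
Qed.

End Expectation.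

Section Independence.
Context {R : realType} {disp : measure_display} {Om : measurableType disp}.
Variable P : probability Om R.

Lemma law_exists d' (T' : measurableType d') (Z : Om -> T') :
  measurable_fun setT Z -> exists mu : probability T' R,
  [/\ forall A, mu A = P (Z @^-1` A),
      forall h : T' -> \bar R, measurable_fun setT h -> (forall y, 0 <= h y)%E ->
        (\int[mu]_y h y = \int[P]_w h (Z w))%E &
      forall h : T' -> \bar R, measurable_fun setT h ->
        P.-integrable setT (fun w => h (Z w)) ->
        (\int[mu]_y h y = \int[P]_w h (Z w))%E].
Proof.
move=> mZ.
pose X : {mfun Om >-> T'} :=
  HB.pack_for {mfun Om >-> T'} Z (isMeasurableFun.Build _ _ _ _ Z mZ).
exists (distribution P X); split=> // h mh h0.
- exact: ge0_integral_distribution.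
- exact: integral_distribution.
Qed.

(** Independence identifies the joint law with the product of the marginal laws; Tonelli applied to
    the absolute value gives integrability, Fubini the value. *)
Lemma indep_product (f g : Om -> R) : L1 P f -> L1 P g ->
  (forall A B, measurable A -> measurable B ->
     P (f @^-1` A `&` g @^-1` B) = P (f @^-1` A) * P (g @^-1` B))%E ->
  L1 P (fun w => f w * g w) /\ Ex P (fun w => f w * g w) = Ex P f * Ex P g.
Proof.
move=> hf hg fg.
have mf := L1_measurable hf; have mg := L1_measurable hg.
have [mX [eX geX iX]] := law_exists mf.
have [mY [eY geY iY]] := law_exists mg.
have [mu [eZ geZ iZ]] := law_exists (measurable_fun_pair mf mg).
have muE A : measurable A -> (mX \x mY)%E A = mu A.
  apply: (@product_measure_unique _ _ _ _ _ mX mY mu) => C D mC mD.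
  transitivity (P (f @^-1` C `&` g @^-1` D)); first exact: eZ.
  by rewrite fg //; congr (_ * _)%E; apply/esym; [exact: eX|exact: eY].
pose h (z : R * R) : \bar R := (z.1 * z.2)%:E.
have mh : measurable_fun setT h.
  by apply/measurable_EFinP; apply: measurable_funM; [exact: measurable_fst|exact: measurable_snd].
have mab : measurable_fun setT (fun x : R => `|x%:E|%E).
  by apply: measurableT_comp => //.
have fub : (\int[P]_w `|(f w * g w)%:E| = (\int[P]_w `|(f w)%:E|) * (\int[P]_w `|(g w)%:E|))%E.
  transitivity (\int[mu]_z `|h z|)%E.
    by rewrite geZ //; exact: measurableT_comp.
  transitivity (\int[mX \x mY]_z `|h z|)%E.
    by apply: eq_measure_integral => A mA _; exact/esym/muE.
  rewrite fubini_tonelli1 //; last exact: measurableT_comp.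
  transitivity (\int[mX]_x (`|x%:E| * \int[mY]_y `|y%:E|))%E.
    apply: eq_integral => x _; rewrite /fubini_F /h /=.
    rewrite -ge0_integralZl //.
    by apply: eq_integral => y _; rewrite normrM EFinM.
  rewrite ge0_integralZr //; last exact: integral_ge0.
  by rewrite geX // geY.
have fin F : L1 P F -> (\int[P]_w `|(F w)%:E|)%E = (Ex P (fun w => `|F w|))%:E.
  by move=> /L1_norm/ExE <-.
have hfg : L1 P (fun w => f w * g w).
  apply/integrableP; split; first by apply/measurable_EFinP; exact: measurable_funM.
  by rewrite fub !fin // -EFinM ltry.
split=> //; apply: EFin_inj; rewrite -ExE //.
have ih : (mX \x mY)%E.-integrable setT h.
  apply/integrableP; split=> //.
  rewrite -(@eq_measure_integral _ _ _ setT _ mu) => [|A mA _]; last first.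
    exact/esym/muE.
  by rewrite geZ ?fub ?fin -?EFinM ?ltry //; exact: measurableT_comp.
transitivity (\int[mu]_z h z)%E; first by rewrite iZ.
transitivity (\int[mX \x mY]_z h z)%E.
  by apply: eq_measure_integral => A mA _; exact/esym/muE.
rewrite -integral12_prod_meas1 //.
have iY' : (\int[mY]_y y%:E)%E = (Ex P g)%:E by rewrite -ExE // iY.
have iX' : (\int[mX]_x x%:E)%E = (Ex P f)%:E by rewrite -ExE // iX.
have hY : mY.-integrable setT (EFin : R -> \bar R).
  apply/integrableP; split; first exact/measurable_EFinP.
  by rewrite geY ?fin ?ltry.
have hX : mX.-integrable setT (EFin : R -> \bar R).
  apply/integrableP; split; first exact/measurable_EFinP.
  by rewrite geX ?fin ?ltry.
transitivity (\int[mX]_x (x%:E * (Ex P g)%:E))%E.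
  apply: eq_integral => x _; rewrite /fubini_F /h /=.
  by under eq_integral do rewrite EFinM; rewrite integralZl // iY'.
by rewrite integralZr // iX' EFinM.
Qed.

End Independence.

(** * Independence of generated sigma-algebras *)

Section GeneratedIndependence.
Context {R : realType} {disp : measure_display} {Om : measurableType disp}.
Variable P : probability Om R.

Definition measG (G : set (set Om)) (f : Om -> R) :=
  measurable_fun [set: g_sigma_algebraType G] (f : g_sigma_algebraType G -> R).

(** Uniqueness of finite measures on a pi-system, used twice: for a fixed second event, the
    restriction of [P] to it and the multiple of [P] by its probability agree on the generators;
    then the roles are exchanged. *)
Lemma indep_generated (G1 G2 : set (set Om)) :
  G1 `<=` measurable -> G2 `<=` measurable ->
  setI_closed G1 -> setI_closed G2 -> G1 setT -> G2 setT ->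
  (forall A B, G1 A -> G2 B -> P (A `&` B) = P A * P B)%E ->
  forall A B, <<s G1 >> A -> <<s G2 >> B -> (P (A `&` B) = P A * P B)%E.
Proof.
move=> m1 m2 I1 I2 T1 T2 h.
have fP B : measurable B -> P B = (fine (P B))%:E.
  by move=> mB; rewrite fineK // fin_num_measure.
have gen (G : set (set Om)) B : G `<=` measurable -> setI_closed G -> G setT ->
    measurable B -> (forall A, G A -> P (A `&` B) = P A * P B)%E ->
    forall A, <<s G >> A -> (P (A `&` B) = P A * P B)%E.
  move=> mG IG TG mB hB A sA.
  have b0 : 0 <= fine (P B) by rewrite fine_ge0.
  pose r := NngNum b0.
  have := @g_sigma_algebra_measure_unique _ R _ G mG (fun=> setT) (fun=> TG)
    _ (mrestr P mB) (mscale r P) IG.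
  have -> : (P A * P B = mscale r P A)%E by rewrite /mscale /= muleC [in LHS](fP B).
  rewrite -[P (A `&` B)]/(mrestr P mB A); apply => //.
  - by rewrite bigcup_const //; exists 0%N.
  - move=> C GC; transitivity (P (C `&` B)); first by [].
    by rewrite hB // muleC /mscale /= [in LHS](fP B).
  - by move=> _; rewrite /mrestr /= (le_lt_trans (probability_le1 _ _)) ?ltry //
      setTI.
have sm (G : set (set Om)) : G `<=` measurable -> <<s G >> `<=` measurable.
  by move=> mG; apply: smallest_sub => //; exact: sigma_algebra_measurable.
move=> A B sA sB.
apply: (gen G1) => //; first exact: sm sB.
move=> C GC; rewrite setIC muleC.
apply: (gen G2) => //; first exact: m1.
by move=> D GD; rewrite setIC muleC; exact: h.
Qed.

Lemma indep_Ex (G1 G2 : set (set Om)) (f g : Om -> R) :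
  (forall A B, <<s G1 >> A -> <<s G2 >> B -> P (A `&` B) = P A * P B)%E ->
  measG G1 f -> measG G2 g -> L1 P f -> L1 P g ->
  L1 P (fun w => f w * g w) /\ Ex P (fun w => f w * g w) = Ex P f * Ex P g.
Proof.
move=> h mf mg hf hg; apply: indep_product => // A B mA mB; apply: h.
- by have := mf measurableT A mA; rewrite setTI.
- by have := mg measurableT B mB; rewrite setTI.
Qed.

Variables (K : finType) (z : K -> Om -> R).
Hypothesis mz : forall k, measurable_fun setT (z k).

(** Cylinder events constraining only the coordinates in [S]: a pi-system that generates their
    sigma-algebra. Indexing by all of [K], with [setT] off [S], matches the form of [indep_rvs]. *)
Definition boxes (S : pred K) : set (set Om) :=
  [set A | exists B : K -> set R, [/\ forall k, measurable (B k),
     forall k, ~~ S k -> B k = setT & A = \bigcap_k (z k @^-1` B k)]].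

Lemma boxes_measurable S : boxes S `<=` measurable.
Proof.
move=> A [B [mB _ ->]].
rewrite -[X in measurable X]setCK setC_bigcap; apply: measurableC.
apply: fin_bigcup_measurable => // k _.
by apply: measurableC; rewrite -[X in measurable X]setTI; exact: mz.
Qed.

Lemma boxesT S : boxes S setT.
Proof. by exists (fun=> setT); split=> //; apply/seteqP; split=> // w _ k _. Qed.

Lemma boxesI S : setI_closed (boxes S).
Proof.
move=> _ _ [B [mB TB ->]] [C [mC TC ->]].
exists (fun k => B k `&` C k); split=> [k|k Sk|].
- exact: measurableI.
- by rewrite TB // TC // setTI.
- by rewrite -bigcapI; apply: eq_bigcapr => k _; rewrite preimage_setI.
Qed.

Lemma boxes_meas (S : pred K) k : S k -> measG (boxes S) (z k).
Proof.
move=> Sk _ B mB; rewrite setTI; apply: sub_gen_smallest.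
exists (fun l => if l == k then B else setT); split.
- by move=> l; case: ifP.
- by move=> l Sl; case: eqP => // e; rewrite e Sk in Sl.
- apply/seteqP; split=> w /=; last by move=> /(_ k I); rewrite eqxx.
  by move=> h l _; case: eqP => // ->.
Qed.

Lemma boxes_indep (S1 S2 : pred K) : indep_rvs P z -> (forall k, S1 k -> ~~ S2 k) ->
  forall A B, <<s boxes S1 >> A -> <<s boxes S2 >> B ->
    (P (A `&` B) = P A * P B)%E.
Proof.
move=> iz dS; apply: indep_generated; do ?exact: boxes_measurable;
  do ?exact: boxesI; do ?exact: boxesT.
move=> _ _ [B [mB TB ->]] [C [mC TC ->]].
have -> : \bigcap_k (z k @^-1` B k) `&` \bigcap_k (z k @^-1` C k)
    = \bigcap_k (z k @^-1` (B k `&` C k)).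
  by rewrite -bigcapI; apply: eq_bigcapr => k _; rewrite preimage_setI.
rewrite (iz (fun k => B k `&` C k)); last by move=> k; exact: measurableI.
rewrite !iz // -big_split /=; apply: eq_bigr => k _.
have [S1k|S1k] := boolP (S1 k).
  have -> : C k = setT.
    by apply: TC; exact: dS.
  by rewrite setIT preimage_setT probability_setT mule1.
by rewrite TB // setTI preimage_setT probability_setT mul1e.
Qed.

Lemma boxes_Ex (S1 S2 : pred K) f g : indep_rvs P z -> (forall k, S1 k -> ~~ S2 k) ->
  measG (boxes S1) f -> measG (boxes S2) g -> L1 P f -> L1 P g ->
  L1 P (fun w => f w * g w) /\ Ex P (fun w => f w * g w) = Ex P f * Ex P g.
Proof. by move=> iz dS; apply: indep_Ex; exact: boxes_indep. Qed.

End GeneratedIndependence.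

(** * Gaussian moments *)

Section Density.
Context {R : realType} {d : measure_display} {T : measurableType d}.
Local Open Scope ereal_scope.
Import HBNNSimple.

(** Both sides are limits along one increasing sequence of simple functions; on a level set the
    identity is the hypothesis on [nu]. *)
Lemma integral_density (mu nu : {measure set T -> \bar R}) (g : T -> R)
    (f : T -> \bar R) :
  measurable_fun setT g -> (forall x, (0 <= g x)%R) ->
  (forall A, measurable A -> nu A = \int[mu]_(x in A) (g x)%:E) ->
  measurable_fun setT f -> (forall x, 0 <= f x) ->
  \int[nu]_x f x = \int[mu]_x (f x * (g x)%:E).
Proof.
move=> mg g0 nuE mf f0.
have mgE : measurable_fun setT (EFin \o g) by exact/measurable_EFinP.
pose h : nat -> {nnsfun T >-> R} := nnsfun_approx measurableT mf.
have -> : \int[nu]_x f x = lim (\int[nu]_x (h n x)%:E @[n --> \oo]).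
  have fE x : f x = lim ((h n x)%:E @[n --> \oo]).
    by apply/esym/cvg_lim => //; exact: cvg_nnsfun_approx.
  under eq_integral => x _ do rewrite fE.
  apply: monotone_convergence => //.
  - by move=> n; exact/measurable_EFinP.
  - by move=> n x _ //=; rewrite lee_fin.
  - by move=> x _ a b ab; rewrite lee_fin; exact/lefP/nd_nnsfun_approx.
have -> : \int[mu]_x (f x * (g x)%:E) =
    lim (\int[mu]_x ((h n x)%:E * (g x)%:E) @[n --> \oo]).
  have fg x : f x * (g x)%:E = lim ((h n x)%:E * (g x)%:E @[n --> \oo]).
    by apply/esym/cvg_lim => //; apply: cvgeZr => //; exact: cvg_nnsfun_approx.
  under eq_integral => x _ do rewrite fg.
  apply: monotone_convergence => //.
  - by move=> n; apply: emeasurable_funM => //; exact/measurable_EFinP.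
  - by move=> n x _; rewrite mule_ge0 ?lee_fin.
  - move=> x _ a b ab; rewrite lee_wpmul2r ?lee_fin //.
    exact/lefP/nd_nnsfun_approx.
suff suf n : \int[mu]_x ((h n x)%:E * (g x)%:E) = \int[nu]_x (h n x)%:E.
  by under [in RHS]eq_fun do rewrite suf.
transitivity (\int[nu]_x
   (\sum_(y \in range (h n)) (y * \1_(h n @^-1` [set y]) x)%:E)); last first.
  by apply: eq_integral => t tE; rewrite /= fimfunE -fsumEFin.
have indich m r : measurable_fun setT (fun x => (r * \1_(h m @^-1` [set r]) x)%:E).
  by apply/measurable_EFinP; exact: measurable_funM.
rewrite ge0_integral_fsum//; last by move=> m y Ey; exact: nnfun_muleindic_ge0.
transitivity (\int[mu]_x (\sum_(y \in range (h n))
    (y * \1_(h n @^-1` [set y]) x)%:E * (g x)%:E)).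
  under [RHS]eq_integral => x xE.
    rewrite -ge0_mule_fsuml => [|y]; last exact: nnfun_muleindic_ge0.
    rewrite fsumEFin // -(fimfunE _ x); over.
  by [].
rewrite ge0_integral_fsum//; last 2 first.
  - by move=> y; apply: emeasurable_funM.
  - move=> m y Ey; apply: mule_ge0; rewrite ?lee_fin //.
  by rewrite -lee_fin EFinM; exact: nnfun_muleindic_ge0.
apply: eq_fsbigr => r rhn.
under [RHS]eq_integral do rewrite EFinM.
rewrite integralZl_indic_nnsfun => //.
rewrite integral_indic // setIT nuE //.
have r0 : (0 <= r)%R.
  by move: rhn; rewrite inE => -[x _ <-].
under eq_integral do rewrite EFinM -muleA.
rewrite ge0_integralZl //; last 2 first.
  - by apply: emeasurable_funM => //; exact/measurable_EFinP.
  - by move=> x _; rewrite mule_ge0 ?lee_fin.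
congr (_ * _); rewrite [RHS]integral_mkcond; apply: eq_integral => x _.
by rewrite patchE indicE; case: ifP => _; rewrite ?mul1e ?mul0e.
Qed.

End Density.

Section GaussianMoments.
Context {R : realType} {disp : measure_display} {Om : measurableType disp}.
Variable P : probability Om R.

Definition gaussian (s : R) (X : Om -> R) :=
  measurable_fun setT X /\
  forall A, measurable A -> P [set w | A (X w)] = normal_prob 0 s A.

Variables (s : R) (X : Om -> R).
Hypotheses (s0 : 0 < s) (gX : gaussian s X).

Lemma gaussian_integral (h : R -> R) :
  measurable_fun setT h -> (forall x, 0 <= h x) ->
  (\int[P]_w (h (X w))%:E = \int[lebesgue_measure]_x (h x * normal_pdf 0 s x)%:E)%E.
Proof.
move=> mh h0; have [mX eX] := gX.
have [nu [eN geN _]] := @law_exists _ _ _ P _ (measurableTypeR R) X mX.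
rewrite -(geN (EFin \o h)) //; last exact/measurable_EFinP.
rewrite (@integral_density _ _ _ (@lebesgue_measure R) nu (normal_pdf 0 s)) //.
- exact: measurable_normal_pdf.
- exact: normal_pdf_ge0.
- by move=> A mA; rewrite -/(normal_prob 0 s A) -eX //; exact: eN.
- exact/measurable_EFinP.
Qed.

(** Completing the square turns the integrand into a constant times the density with mean
    [t * s ^+ 2]. *)
Lemma gaussian_mgf (t : R) :
  L1 P (fun w => expR (t * X w)) /\
  Ex P (fun w => expR (t * X w)) = expR (t ^+ 2 * s ^+ 2 / 2).
Proof.
have mE : measurable_fun setT (fun x : R => expR (t * x)).
  by apply: measurableT_comp => //; exact: measurable_funM.
have key : (\int[P]_w (expR (t * X w))%:E = (expR (t ^+ 2 * s ^+ 2 / 2))%:E)%E.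
  rewrite (@gaussian_integral (fun x => expR (t * x))) //.
  transitivity (\int[lebesgue_measure]_x ((expR (t ^+ 2 * s ^+ 2 / 2))%:E
      * (normal_pdf (t * s ^+ 2) s x)%:E))%E.
    apply: eq_integral => x _; rewrite -EFinM; congr EFin.
    rewrite !normal_pdfE ?gt_eqF // mulrCA [RHS]mulrCA; congr (_ * _).
    rewrite /normal_fun -!expRD; congr expR; field; rewrite gt_eqF //.
  rewrite ge0_integralZl //.
  - by rewrite integral_normal_pdf mule1.
  - by apply: measurableT_comp => //; exact: measurable_normal_pdf.
  - by move=> x _; rewrite lee_fin normal_pdf_ge0.
have mEX : measurable_fun setT (fun w => expR (t * X w)).
  by apply: (measurableT_comp mE); case: gX.
have h : L1 P (fun w => expR (t * X w)).
  apply/integrableP; split; first exact/measurable_EFinP.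
  under eq_integral do rewrite gee0_abs ?lee_fin ?expR_ge0 //.
  by rewrite key ltry.
by split=> //; apply: EFin_inj; rewrite -ExE.
Qed.

Lemma expR_norm_le (x : R) : expR `|x| <= expR x + expR (- x).
Proof.
have := expR_ge0 x; have := expR_ge0 (- x).
by case: (ger0P x) => _; lra.
Qed.

(** The inequality [y <= expR y] at the absolute value of [x] divided by [m], raised to the power
    [m]. *)
Lemma pow_le_expR (x : R) m : `|x| ^+ m <= m%:R ^+ m * (expR x + expR (- x)).
Proof.
case: m => [|m].
  rewrite !expr0 mul1r; apply: le_trans (expR_norm_le x).
  by rewrite -expR0 ler_expR.
apply: le_trans (ler_wpM2l _ (expR_norm_le x)); last by rewrite exprn_ge0.
set y := `|x| / m.+1%:R.
have e : `|x| = m.+1%:R * y by rewrite mulrC divfK // pnatr_eq0.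
have y0 : 0 <= y by rewrite divr_ge0.
rewrite {1}e exprMn ler_wpM2l ?exprn_ge0 // e expRM_natl.
rewrite lerXn2r ?nnegrE ?expR_ge0 //.
by have := expR_ge1Dx y; lra.
Qed.

Lemma gaussian_expnorm (t : R) : L1 P (fun w => expR (t * X w) + expR (- (t * X w))).
Proof.
apply: L1D; first by case: (gaussian_mgf t).
by under eq_fun do rewrite -mulNr; case: (gaussian_mgf (- t)).
Qed.

Lemma gaussian_pow m : L1 P (fun w => X w ^+ m).
Proof.
have mX : measurable_fun setT X by case: gX.
apply: (@L1_le _ _ _ _ _ (fun w => m%:R ^+ m * (expR (1 * X w) + expR (- (1 * X w))))).
- exact: measurable_funX.
- by move=> w; rewrite mul1r normrX; exact: pow_le_expR.
- by apply: L1Z; exact: gaussian_expnorm.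
Qed.

Lemma expR_sub1_le (x : R) : `|expR x - 1| <= `|x| * expR `|x|.
Proof.
have h (y : R) : 0 <= y -> expR y - 1 <= y * expR y.
  move=> y0; have := expR_ge1Dx (- y); rewrite expRN => h.
  have := ler_wpM2r (expR_ge0 y) h; rewrite mulVf ?gt_eqF ?expR_gt0 //; lra.
case: (ger0P x) => x0.
  by rewrite ger0_norm ?h // subr_ge0 -expR0 ler_expR.
rewrite ler0_norm ?subr_le0 -?expR0 ?ler_expR ?(ltW x0) // expR0.
have := expR_ge1Dx x; have : 1 <= expR (- x) by rewrite -expR0 ler_expR oppr_ge0 ltW.
by move=> h1 h2; apply: le_trans (_ : - x <= _); [lra|rewrite ler_peMr //; lra].
Qed.

(** This is sinh (t x) / t, which tends to [x] as [t] tends to 0. Its powers expand into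
    exponentials, so a moment is the limit of finite combinations of values of the generating
    function, with no differentiation under the integral. *)
Definition sinc (t x : R) := (expR (t * x) - expR (- (t * x))) / (2 * t).

Lemma sinc_norm_le (t x : R) : 0 < t -> t <= 1 -> `|sinc t x| <= expR (2 * `|x|).
Proof.
move=> t0 t1; rewrite /sinc.
have -> : expR (t * x) - expR (- (t * x)) = (expR (t * x) - 1) - (expR (- (t * x)) - 1).
  by ring.
have h : `|(expR (t * x) - 1) - (expR (- (t * x)) - 1)|
    <= 2 * t * (`|x| * expR `|x|).
  apply: le_trans (ler_normB _ _) _.
  have hx : `|t * x| * expR `|t * x| <= t * (`|x| * expR `|x|).
    rewrite normrM (gtr0_norm t0) -mulrA ler_pM2l //.
    by rewrite ler_wpM2l // ler_expR ler_piMl.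
  have := expR_sub1_le (t * x); have := expR_sub1_le (- (t * x)); rewrite normrN.
  by lra.
have t2 : 0 < 2 * t by lra.
rewrite normrM normfV (gtr0_norm t2).
rewrite ler_pdivrMr // [leRHS]mulrC; apply: le_trans h _.
rewrite ler_pM2l // (_ : 2 * `|x| = `|x| + `|x|); last by ring.
rewrite expRD ler_wpM2r ?expR_ge0 //.
by have := expR_ge1Dx `|x|; lra.
Qed.

Lemma expR_taylor1 (x : R) : `|expR x - 1 - x| <= x ^+ 2 * expR `|x|.
Proof.
have h1 := expR_ge1Dx x; rewrite ger0_norm; last by lra.
have h2 : expR x - 1 <= x * expR x.
  have := ler_wpM2r (expR_ge0 x) (expR_ge1Dx (- x)).
  by rewrite expRN mulVf ?gt_eqF ?expR_gt0 //; lra.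
have h3 : expR x - 1 - x <= x * (expR x - 1) by lra.
apply: le_trans h3 _; apply: le_trans (ler_norm _) _.
by rewrite normrM -(real_normK (num_real x)) expr2 -mulrA ler_wpM2l // expR_sub1_le.
Qed.

Lemma expR_quotient (c t : R) : 0 < t -> t <= 1 ->
  `|(expR (c * t) - 1) / t - c| <= c ^+ 2 * expR `|c| * t.
Proof.
move=> t0 t1; have -> : (expR (c * t) - 1) / t - c = (expR (c * t) - 1 - c * t) / t.
  by field; rewrite gt_eqF.
rewrite normrM normfV (gtr0_norm t0) ler_pdivrMr //.
apply: le_trans (expR_taylor1 _) _.
have -> : c ^+ 2 * expR `|c| * t * t = (c * t) ^+ 2 * expR `|c| by ring.
by rewrite ler_wpM2l ?sqr_ge0 // ler_expR normrM (gtr0_norm t0) ler_piMr.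
Qed.

Let t n : R := n.+1%:R^-1.
Let t_gt0 n : 0 < t n. Proof. by rewrite invr_gt0. Qed.
Let t_le1 n : t n <= 1. Proof. by rewrite invf_le1 // ler1n. Qed.
Let t_cvg : t n @[n --> \oo] --> (0 : R).
Proof. exact: cvg_harmonic. Qed.

Lemma cvg_expR_quotient (c : R) (u : nat -> R) : (forall n, 0 < u n <= 1) ->
  u n @[n --> \oo] --> 0 -> (expR (c * u n) - 1) / u n @[n --> \oo] --> c.
Proof.
move=> u01 u0; apply/cvgrPdist_le => e e0.
have : c ^+ 2 * expR `|c| * u n @[n --> \oo] --> c ^+ 2 * expR `|c| * 0.
  by apply: cvgM => //; exact: cvg_cst.
rewrite mulr0 => /cvgr0Pnorm_le/(_ e e0); apply: filterS => n h.
have /andP[un0 un1] := u01 n.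
rewrite distrC; apply: le_trans (expR_quotient _ _ _) _ => //.
by apply: le_trans h; exact: ler_norm.
Qed.

Lemma cvg_sinc (x : R) : sinc (t n) x @[n --> \oo] --> x.
Proof.
have -> : (fun n => sinc (t n) x) =
  (fun n => ((expR (x * t n) - 1) / t n - (expR (- x * t n) - 1) / t n) / 2).
  apply/funext => n; rewrite /sinc mulNr (mulrC x); field.
  by rewrite gt_eqF.
have e : x = (x - (- x)) / 2 by field.
rewrite {3}e.
by apply: cvgM; [apply: cvgB; apply: cvg_expR_quotient => // n; rewrite t_gt0 t_le1|exact: cvg_cst].
Qed.

Lemma cvg_sinc_moment m :
  Ex P (fun w => sinc (t n) (X w) ^+ m) @[n --> \oo] --> Ex P (fun w => X w ^+ m).
Proof.
have mX : measurable_fun setT X by case: gX.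
apply: (@dominated_cvg_Ex _ _ _ _ _ _
  (fun w => expR (2 * m%:R * X w) + expR (- (2 * m%:R * X w)))).
- move=> n; apply: measurable_funX; apply: measurable_funM => //.
  apply: measurable_funB; (apply: measurableT_comp => //).
    exact: measurable_funM.
  by apply: measurable_funN => //; exact: measurable_funM.
- exact: measurable_funX.
- by apply/aeW => w; apply: (@cvg_comp _ _ _ (fun n => sinc (t n) (X w)) (fun x => x ^+ m) _ (nbhs (X w))); [exact: cvg_sinc|exact: exprn_continuous].
- move=> n w; rewrite normrX.
  have h := sinc_norm_le (X w) (t_gt0 n) (t_le1 n).
  apply: le_trans (_ : expR (2 * `|X w|) ^+ m <= _).
    by apply: lerXn2r => //; rewrite nnegrE ?expR_ge0.
  rewrite -expRM_natl; apply: le_trans (expR_norm_le _).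
  rewrite ler_expR !normrM (@ger0_norm _ 2) // (@ger0_norm _ m%:R) //.
  by rewrite mulrA (mulrC m%:R).
- exact: gaussian_expnorm.
Qed.

Lemma ExpR_X (c : R) : Ex P (fun w => expR (c * X w)) = expR (c ^+ 2 * s ^+ 2 / 2).
Proof. by case: (gaussian_mgf c). Qed.

Lemma L1_expRX (c : R) : L1 P (fun w => expR (c * X w)).
Proof. by case: (gaussian_mgf c). Qed.

Lemma sinc_moment m n : Ex P (fun w => sinc (t n) (X w) ^+ m) =
  (2 * t n) ^- m * \sum_(i < m.+1) (-1) ^+ i * expR (((m%:R - i%:R * 2) * t n) ^+ 2 * s ^+ 2 / 2) *+ 'C(m, i).
Proof.
under eq_fun => w.
  rewrite /sinc exprMn mulrC exprVn exprBn big_distrr /=.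
  under eq_bigr => i _.
    rewrite -!expRM_natl (_ : _ * _ * expR _ = (-1) ^+ i * expR (((m%:R - i%:R * 2) * t n) * X w)); last first.
      rewrite -mulrA -expRD natrB; last by rewrite -ltnS.
      by congr (_ * expR _); ring.
    rewrite -mulrnAl mulrA.
    over.
  over.
rewrite Ex_sum; last by move=> i _; apply: L1Z; exact: L1_expRX.
rewrite big_distrr /=; apply: eq_bigr => i _.
rewrite ExZ; last exact: L1_expRX.
by rewrite ExpR_X -[in RHS]mulrnAl [in RHS]mulrA.
Qed.

Let q n : R := (expR (2 * s ^+ 2 * t n ^+ 2) - 1) / t n ^+ 2.

Let q_cvg : q n @[n --> \oo] --> 2 * s ^+ 2.
Proof.
apply: cvg_expR_quotient => [n|].
  by rewrite exprn_gt0 //= exprn_ile1 ?t_le1 // ltW.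
rewrite -[X in _ --> X](expr0n R 2).
exact: (@cvg_comp _ _ _ t (fun x => x ^+ 2) _ (nbhs (0:R)) _ t_cvg (@exprn_continuous _ 2 0)).
Qed.

Let y_cvg : expR (2 * s ^+ 2 * t n ^+ 2) @[n --> \oo] --> (1 : R).
Proof.
have -> : (fun n => expR (2 * s ^+ 2 * t n ^+ 2)) = (fun n => 1 + t n * (t n * q n)).
  apply/funext => n; rewrite /q; field; rewrite gt_eqF //.
rewrite -[X in _ --> X]addr0 -(mul0r (0 * (2 * s ^+ 2))).
by apply: cvgD; [exact: cvg_cst|do 2 apply: cvgM => //].
Qed.

Let moment_lim m (L : R) (f : nat -> R) :
  (forall n, Ex P (fun w => sinc (t n) (X w) ^+ m) = f n) ->
  f n @[n --> \oo] --> L -> Ex P (fun w => X w ^+ m) = L.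
Proof.
move=> h fL; have := cvg_sinc_moment (m := m).
have -> : (fun n => Ex P (fun w => sinc (t n) (X w) ^+ m)) = f by exact/funext.
by move=> h2; exact: (cvg_unique _ h2 fL).
Qed.

Let E n (c : R) := expR ((c * t n) ^+ 2 * s ^+ 2 / 2).

Let EN n c : E n (- c) = E n c. Proof. by rewrite /E mulNr sqrrN. Qed.

(** For even moments all exponentials in the binomial sum are powers of
    [expR (2 * s ^+ 2 * t n ^+ 2)], so the sum is a polynomial in one quantity [y] tending to 1, and
    [q] is the limit-bearing quotient of [y - 1] by [t n ^+ 2]. *)
Let E2 n (c : R) j : c ^+ 2 = 4 * j%:R -> E n c = expR (2 * s ^+ 2 * t n ^+ 2) ^+ j.
Proof. by move=> cj; rewrite /E -expRM_natl exprMn cj; congr expR; field. Qed.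

Lemma gaussian_mean : Ex P X = 0.
Proof.
have -> : X = (fun w => X w ^+ 1) by [].
apply: (@moment_lim _ _ (fun=> 0)); last exact: cvg_cst.
move=> n; rewrite sinc_moment !big_ord_recl big_ord0 /= /bump /= bin0 bin1 -!/(E _ _).
have -> : (1 - (1 + 0)%N%:R * 2 : R) = - (1 - 0 * 2) by ring.
by rewrite EN; ring.
Qed.

Lemma gaussian_moment2 : Ex P (fun w => X w ^+ 2) = s ^+ 2.
Proof.
apply: (@moment_lim _ _ (fun n => q n / 2)).
  move=> n; rewrite sinc_moment !big_ord_recl big_ord0 /= /bump /=.
  rewrite !(addn0, add1n) -!/(E _ _) (@E2 _ (2 - 0 * 2) 1) ?(@E2 _ (2 - 1 * 2) 0)
    ?(@E2 _ (2 - 2 * 2) 1); try ring.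
  rewrite bin0 binn bin1 /q.
  by field; rewrite gt_eqF.
rewrite [X in _ --> X](_ : _ = (2 * s ^+ 2) / 2); last by field.
by apply: cvgM => //; exact: cvg_cst.
Qed.

Lemma gaussian_moment4 : Ex P (fun w => X w ^+ 4) = 3 * s ^+ 4.
Proof.
pose y n := expR (2 * s ^+ 2 * t n ^+ 2).
(* The binomial sum is [(y ^+ 4 - 4 * y + 3) / (8 * t ^+ 4)], whose numerator factors as
   [(y - 1) ^+ 2 * (y ^+ 2 + 2 * y + 3)]. *)
apply: (@moment_lim _ _ (fun n => q n ^+ 2 * (y n ^+ 2 + 2 * y n + 3) / 8)).
  move=> n; rewrite sinc_moment !big_ord_recl big_ord0 /= /bump /= -!/(E _ _).
  rewrite !(addn0, add1n) (@E2 _ (4 - 0 * 2) 4) ?(@E2 _ (4 - 1 * 2) 1)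
    ?(@E2 _ (4 - 2 * 2) 0) ?(@E2 _ (4 - 3 * 2) 1) ?(@E2 _ (4 - 4 * 2) 4); try ring.
  rewrite bin0 binn bin1 (_ : 'C(4, 2) = 6%N) // (_ : 'C(4, 3) = 4%N) // -/(y n) /q -/(y n).
  by field; rewrite gt_eqF.
rewrite [X in _ --> X](_ : _ = (2 * s ^+ 2) ^+ 2 * (1 ^+ 2 + 2 * 1 + 3) / 8); last by field.
apply: cvgM; last exact: cvg_cst.
apply: cvgM; rewrite ?expr2.
  by under eq_fun do rewrite expr2; exact: cvgM.
under eq_fun do rewrite expr2.
apply: cvgD; last exact: cvg_cst.
by apply: cvgD; apply: cvgM => //; exact: cvg_cst.
Qed.

End GaussianMoments.

(** * Central limit theorem for Laplace transforms *)

Section ExponentialBounds.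
Context {R : realType}.
Implicit Types x : R.

(** The bound uses [expR x] rather than the exponential of the absolute value: multiplied by a
    Gaussian profile at one point it becomes the profile at another point, and so stays bounded. *)
Lemma expR_sub1_bound x : `|expR x - 1| <= `|x| * (1 + expR x).
Proof.
have h1 := expR_ge1Dx x; have e0 := expR_gt0 x.
have h2 : expR x - 1 <= x * expR x.
  have := ler_wpM2r (expR_ge0 x) (expR_ge1Dx (- x)).
  by rewrite expRN mulVf ?gt_eqF //; lra.
case: (ger0P x) => x0.
  rewrite ger0_norm; last by rewrite subr_ge0 -expR0 ler_expR.
  by apply: le_trans h2 _; rewrite ler_wpM2l //; lra.
rewrite ler0_norm; last by rewrite subr_le0 -expR0 ler_expR ltW.
have : 0 <= - x * expR x by rewrite mulr_ge0 ?ltW // oppr_gt0.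
lra.
Qed.

Lemma expR_sub1x_bound x : `|expR x - 1 - x| <= x ^+ 2 * (1 + expR x).
Proof.
have h1 := expR_ge1Dx x; rewrite ger0_norm; last by lra.
have h2 : expR x - 1 <= x * expR x.
  have := ler_wpM2r (expR_ge0 x) (expR_ge1Dx (- x)).
  by rewrite expRN mulVf ?gt_eqF ?expR_gt0 //; lra.
have h3 : expR x - 1 - x <= x * (expR x - 1) by lra.
apply: le_trans h3 _; apply: le_trans (ler_norm _) _.
by rewrite normrM -(real_normK (num_real x)) expr2 -mulrA ler_wpM2l // expR_sub1_bound.
Qed.

Lemma expR_taylor2 x : `|expR x - 1 - x - x ^+ 2 / 2| <= `|x| ^+ 3 * (2 + expR x).
Proof.
pose g (y : R) := expR y - 1 - y - y ^+ 2 / 2.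
have dg (y : R) : is_derive y 1 g (expR y - 1 - y).
  have h2 : is_derive y 1 (fun z : R => z ^+ 2 / 2) y.
    apply: is_derive_ext (is_deriveZ 2^-1 (is_deriveX 2 (is_derive_id y 1))) _ _.
      by move=> z; rewrite /= /GRing.scale /= mulrC.
    by rewrite /GRing.scale /=; field.
  apply: is_derive_ext (is_deriveB (is_deriveB (is_deriveB (is_derive_expR y)
    (is_derive_cst (1 : R) y 1)) (is_derive_id y 1)) h2) _ _; first by [].
  by rewrite subr0.
have cg : continuous g.
  by move=> y; apply: differentiable_continuous; apply/derivable1_diffP; have [] := dg y.
have g0 : g 0 = 0 by rewrite /g expR0 expr0n /= mul0r !subr0 subrr.
have bnd c : `|c| <= `|x| -> expR c <= 1 + expR x ->
    `|(expR c - 1 - c) * x| <= `|x| ^+ 3 * (2 + expR x).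
  move=> cx ex; rewrite normrM exprSr [leRHS]mulrAC ler_wpM2r //.
  apply: le_trans (expR_sub1x_bound c) _; rewrite -(real_normK (num_real c)).
  have ec := expR_ge0 c.
  by apply: ler_pM; [rewrite exprn_ge0|lra|rewrite lerXn2r ?nnegrE|lra].
rewrite -/(g x); have e0 := expR_ge0 x.
have [x0|x0|->] := ltgtP x 0; last by rewrite g0 normr0 expr0n mul0r.
- have [|c] := @MVT R g (fun y => expR y - 1 - y) x 0 x0 (fun y _ => dg y) _.
    by apply: continuous_subspaceT.
  rewrite in_itv /= => /andP[c0 cx]; rewrite g0 !sub0r => e.
  have -> : g x = (expR c - 1 - c) * x by rewrite -[LHS]opprK e; ring.
  apply: bnd; first by rewrite !ltr0_norm // lerN2 ltW.
  have : expR c <= 1 by rewrite -expR0 ler_expR ltW.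
  by lra.
- have [|c] := @MVT R g (fun y => expR y - 1 - y) 0 x x0 (fun y _ => dg y) _.
    by apply: continuous_subspaceT.
  rewrite in_itv /= => /andP[c0 cx]; rewrite g0 !subr0 => ->.
  apply: bnd; first by rewrite !gtr0_norm // ltW.
  have : expR c <= expR x by rewrite ler_expR ltW.
  by lra.
Qed.

Lemma poly_exp_bound (k : R) m : 0 < k -> exists2 C : R, 0 <= C &
  forall q : R, 0 <= q -> (1 + q) ^+ m * expR (- (k * q)) <= C.
Proof.
move=> k0; exists (expR k * (m%:R / k) ^+ m); first by rewrite mulr_ge0 ?expR_ge0 ?exprn_ge0 ?divr_ge0 // ltW.
move=> q q0.
have h : (1 + q) ^+ m <= (m%:R / k) ^+ m * expR (k * (1 + q)).
  case: m => [|m].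
    by rewrite !expr0 mul1r -[leLHS]expR0 ler_expR mulr_ge0 ?(ltW k0) //; lra.
  pose y := k * (1 + q) / m.+1%:R.
  have y0 : 0 <= y by rewrite divr_ge0 // mulr_ge0 ?ltW //; lra.
  have -> : 1 + q = m.+1%:R / k * y.
    have m0 : m.+1%:R != 0 :> R by rewrite pnatr_eq0.
    by rewrite /y; field; rewrite (gt_eqF k0) nat1r m0.
  have -> : k * (m.+1%:R / k * y) = m.+1%:R * y by field; rewrite gt_eqF.
  rewrite exprMn ler_wpM2l ?exprn_ge0 ?divr_ge0 ?(ltW k0) // expRM_natl.
  rewrite lerXn2r ?nnegrE ?expR_ge0 //.
  by have := expR_ge1Dx y; lra.
apply: le_trans (ler_wpM2r (expR_ge0 _) h) _.
rewrite -mulrA -expRD mulrC le_eqVlt; apply/orP; left; apply/eqP.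
by congr (expR _ * _); ring.
Qed.

End ExponentialBounds.

(** * Expansion of Gaussian profiles under a small step *)

Section HeatStep.
Context {R : realType} (r : nat).
Implicit Types u y : 'I_r -> R.

Definition ssq u : R := \sum_a u a ^+ 2.
Definition dotp u y : R := \sum_a u a * y a.
Definition n1 u : R := \sum_a `|u a|.

Lemma ssq_ge0 u : 0 <= ssq u.
Proof. by apply: sumr_ge0 => a _; rewrite sqr_ge0. Qed.

Lemma n1_ge0 u : 0 <= n1 u.
Proof. by apply: sumr_ge0. Qed.

Lemma dotp_le u y : `|dotp u y| <= (1 + ssq u) * n1 y.
Proof.
apply: le_trans (ler_norm_sum _ _ _) _; rewrite /n1 mulr_sumr; apply: ler_sum => a _.
rewrite normrM ler_wpM2r //; apply: le_trans (_ : 1 + u a ^+ 2 <= _).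
  by rewrite -(real_normK (num_real (u a))); have := sqr_ge0 (`|u a| - 1); have := normr_ge0 (u a); nra.
by rewrite lerD2l /ssq (bigD1 a) //= lerDl sumr_ge0 // => b _; rewrite sqr_ge0.
Qed.

Lemma ssq_le u : ssq u <= n1 u ^+ 2.
Proof.
rewrite expr2 /n1 mulr_suml; apply: ler_sum => a _.
rewrite -(real_normK (num_real (u a))) expr2 ler_wpM2l //.
by rewrite (bigD1 a) //= lerDl sumr_ge0.
Qed.

Lemma ssqD u y (e : R) : ssq (fun a => u a + e * y a)
  = ssq u + 2 * e * dotp u y + e ^+ 2 * ssq y.
Proof.
rewrite /ssq /dotp !mulr_sumr -!big_split /=; apply: eq_bigr => a _; ring.
Qed.

Variables (k0 k : R).
Hypotheses (k00 : 0 < k0) (k0k : k0 <= k).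

(** The error is uniform in [u] because the Gaussian factor absorbs polynomial growth in [u]; the
    growth in [y] remains and fixes the sixth moment asked of the summands. *)
Lemma gauss_step_expand : exists2 C : R, 0 <= C & forall (e kk : R) u y,
  0 < e <= 1 -> k0 <= kk <= k ->
  `|expR (- (kk * ssq (fun a => u a + e * y a)))
    - expR (- (kk * ssq u)) * (1 - 2 * kk * e * dotp u y - kk * e ^+ 2 * ssq y
        + 2 * kk ^+ 2 * e ^+ 2 * dotp u y ^+ 2)|
  <= C * e ^+ 3 * (1 + n1 y) ^+ 6.
Proof.
have [C C0 hC] := poly_exp_bound 3 k00.
have kp : 0 < k := lt_le_trans k00 k0k.
exists (24 * k ^+ 3 * C + 3 * k ^+ 2 * C).
  by have k2 := ltW kp; rewrite addr_ge0 // !mulr_ge0 ?exprn_ge0.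
move=> e kk u y /andP[e0 e1] /andP[kk0 kk1].
set v := fun a => u a + e * y a.
have kkp : 0 <= kk := le_trans (ltW k00) kk0.
set N : R := n1 y; have N0 : 0 <= N := n1_ge0 y.
pose w := kk * (ssq v - ssq u).
have wE : w = 2 * kk * e * dotp u y + kk * e ^+ 2 * ssq y.
  by rewrite /w /v ssqD; ring.
have expC (q : R) : 0 <= q -> (1 + q) ^+ 3 * expR (- (kk * q)) <= C.
  move=> q0; apply: le_trans (hC q q0); rewrite ler_wpM2l ?exprn_ge0 //; first lra.
  by rewrite ler_expR lerN2 ler_wpM2r.
have b1 : e * N + (e * N) ^+ 2 <= e * (1 + N) ^+ 2 by nra.
(* Used at [q = ssq u] and at [q = ssq v]: the Taylor remainder contains [expR (- w)], which carries
   the profile from [u] to [v]. *)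
have wb (q : R) : 0 <= q -> `|w| <= kk * (2 * (1 + q) * (e * N) + (e * N) ^+ 2) ->
    `|w| ^+ 3 * expR (- (kk * q)) <= 8 * k ^+ 3 * C * e ^+ 3 * (1 + N) ^+ 6.
  move=> q0 hw; have eN : 0 <= e * N by rewrite mulr_ge0 // ltW.
  have h : `|w| <= 2 * k * (1 + q) * (e * (1 + N) ^+ 2).
    apply: le_trans hw _; apply: le_trans (_ : kk * (2 * (1 + q) * (e * N + (e * N) ^+ 2)) <= _).
      rewrite ler_wpM2l //.
      have h : 0 <= (e * N) ^+ 2 * q by rewrite mulr_ge0 ?sqr_ge0.
      have h' := sqr_ge0 (e * N); lra.
    apply: le_trans (_ : k * (2 * (1 + q) * (e * N + (e * N) ^+ 2)) <= _).
      rewrite ler_wpM2r // mulr_ge0 //; first lra.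
      by rewrite addr_ge0 ?sqr_ge0.
    rewrite (_ : 2 * k * (1 + q) * (e * (1 + N) ^+ 2) = k * (2 * (1 + q) * (e * (1 + N) ^+ 2))); last by ring.
    by rewrite ler_pM2l // ler_wpM2l //; lra.
  have h3 : `|w| ^+ 3 <= (2 * k * (1 + q) * (e * (1 + N) ^+ 2)) ^+ 3.
    by rewrite lerXn2r ?nnegrE //; apply: le_trans h.
  apply: le_trans (ler_wpM2r (expR_ge0 _) h3) _.
  rewrite (_ : _ ^+ 3 * _ = (8 * k ^+ 3 * e ^+ 3 * (1 + N) ^+ 6) *
      ((1 + q) ^+ 3 * expR (- (kk * q)))); last by ring.
  rewrite (_ : 8 * k ^+ 3 * C * e ^+ 3 * (1 + N) ^+ 6 = (8 * k ^+ 3 * e ^+ 3 * (1 + N) ^+ 6) * C); last by ring.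
  rewrite ler_wpM2l ?expC // !mulr_ge0 ?exprn_ge0 //; lra.
have wu : `|w| <= kk * (2 * (1 + ssq u) * (e * N) + (e * N) ^+ 2).
  rewrite wE; apply: le_trans (ler_normD _ _) _; rewrite mulrDr lerD //.
    rewrite normrM (@ger0_norm _ (2 * kk * e)); last by rewrite !mulr_ge0 //; lra.
    rewrite (_ : kk * _ = 2 * kk * e * ((1 + ssq u) * N)); last by ring.
    by rewrite ler_wpM2l ?dotp_le // !mulr_ge0 //; lra.
  rewrite ger0_norm; last by rewrite !mulr_ge0 ?ssq_ge0 ?sqr_ge0 //; lra.
  rewrite -mulrA ler_wpM2l //.
  by rewrite exprMn ler_wpM2l ?sqr_ge0 ?ssq_le.
have wv : `|w| <= kk * (2 * (1 + ssq v) * (e * N) + (e * N) ^+ 2).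
  have -> : w = 2 * kk * e * dotp v y - kk * e ^+ 2 * ssq y.
    have -> : dotp v y = dotp u y + e * ssq y.
      by rewrite /dotp /ssq mulr_sumr -big_split /=; apply: eq_bigr => a _; rewrite /v; ring.
    by rewrite wE; ring.
  apply: le_trans (ler_normB _ _) _; rewrite mulrDr lerD //.
    rewrite normrM (@ger0_norm _ (2 * kk * e)); last by rewrite !mulr_ge0 //; lra.
    rewrite (_ : kk * _ = 2 * kk * e * ((1 + ssq v) * N)); last by ring.
    by rewrite ler_wpM2l ?dotp_le // !mulr_ge0 //; lra.
  rewrite ger0_norm; last by rewrite !mulr_ge0 ?ssq_ge0 ?sqr_ge0 //; lra.
  rewrite -mulrA ler_wpM2l //.
  by rewrite exprMn ler_wpM2l ?sqr_ge0 ?ssq_le.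
have evw : expR (- (kk * ssq v)) = expR (- (kk * ssq u)) * expR (- w).
  by rewrite -expRD; congr expR; rewrite /w; ring.
pose D := expR (- w) - 1 - (- w) - (- w) ^+ 2 / 2.
(* The terms of order [e ^+ 3] and [e ^+ 4] in [w ^+ 2 / 2]. *)
pose E := 2 * kk ^+ 2 * e ^+ 3 * dotp u y * ssq y + kk ^+ 2 * e ^+ 4 * ssq y ^+ 2 / 2.
have -> : expR (- (kk * ssq v)) - expR (- (kk * ssq u)) *
   (1 - 2 * kk * e * dotp u y - kk * e ^+ 2 * ssq y + 2 * kk ^+ 2 * e ^+ 2 * dotp u y ^+ 2)
   = expR (- (kk * ssq u)) * D + expR (- (kk * ssq u)) * E.
  by rewrite evw /D /E wE; field.
apply: le_trans (ler_normD _ _) _; rewrite !normrM (ger0_norm (expR_ge0 _)).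
rewrite [leRHS](_ : _ = 24 * k ^+ 3 * C * e ^+ 3 * (1 + N) ^+ 6
  + 3 * k ^+ 2 * C * e ^+ 3 * (1 + N) ^+ 6); last by rewrite /N; ring.
apply: lerD.
  apply: le_trans (ler_wpM2l (expR_ge0 _) (expR_taylor2 (- w))) _.
  have h1 := wb _ (ssq_ge0 u) wu; have h2 := wb _ (ssq_ge0 v) wv.
  rewrite normrN (_ : _ * (_ * _) = 2 * (`|w| ^+ 3 * expR (- (kk * ssq u)))
     + `|w| ^+ 3 * expR (- (kk * ssq v))); last by rewrite evw; ring.
  by lra.
have E_le : `|E| <= 3 * k ^+ 2 * e ^+ 3 * (1 + N) ^+ 6 * (1 + ssq u) ^+ 3.
  set A : R := 1 + ssq u; set M : R := 1 + N.
  have A1 : 1 <= A by rewrite lerDl ssq_ge0.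
  have M1 : 1 <= M by rewrite lerDl.
  have A0 : 0 <= A by lra.
  have NM : N <= M by rewrite lerDr.
  have M0 : 0 <= M by lra.
  have qN : ssq y <= M ^+ 2.
    by apply: le_trans (ssq_le y) _; rewrite lerXn2r ?nnegrE.
  have dA : `|dotp u y| <= A * M.
    by apply: le_trans (dotp_le u y) _; rewrite -/A -/N; exact: ler_wpM2l.
  have kk2 : kk ^+ 2 <= k ^+ 2 by rewrite lerXn2r ?nnegrE // ltW.
  have e3 : 0 <= e ^+ 3 by rewrite exprn_ge0 // ltW.
  have e43 : e ^+ 4 <= e ^+ 3 by rewrite exprS ler_piMl.
  have q0 := ssq_ge0 y; have ke0 : 0 <= k ^+ 2 * e ^+ 3 by rewrite mulr_ge0 ?sqr_ge0.
  have AM3 : A * M ^+ 3 <= M ^+ 6 * A ^+ 3.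
    rewrite mulrC; apply: ler_pM; rewrite ?exprn_ge0 //.
      by rewrite ler_weXn2l.
    by rewrite -[leLHS]expr1 ler_weXn2l.
  have M46 : M ^+ 4 <= M ^+ 6 * A ^+ 3.
    rewrite -[leLHS]mulr1; apply: ler_pM; rewrite ?exprn_ge0 //.
      by rewrite ler_weXn2l.
    by rewrite exprn_ege1.
  apply: le_trans (ler_normD _ _) _.
  have h1 : `|2 * kk ^+ 2 * e ^+ 3 * dotp u y * ssq y| <= 2 * (k ^+ 2 * e ^+ 3) * (A * M ^+ 3).
    have p0 : 0 <= kk ^+ 2 * e ^+ 3 by rewrite mulr_ge0 ?sqr_ge0.
    have -> : 2 * kk ^+ 2 * e ^+ 3 * dotp u y * ssq y
      = 2 * (kk ^+ 2 * e ^+ 3) * (dotp u y * ssq y) by ring.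
    have p2 : 0 <= 2 * (kk ^+ 2 * e ^+ 3) by rewrite mulr_ge0.
    rewrite normrM (ger0_norm p2); apply: ler_pM => //.
      by rewrite ler_pM2l // ler_wpM2r.
    rewrite normrM (ger0_norm q0) (_ : A * M ^+ 3 = A * M * M ^+ 2); last by ring.
    exact: ler_pM.
  have h2 : `|kk ^+ 2 * e ^+ 4 * ssq y ^+ 2 / 2| <= (k ^+ 2 * e ^+ 3) * M ^+ 4 / 2.
    have p4 : 0 <= e ^+ 4 by rewrite exprn_ge0 // ltW.
    have p0 : 0 <= kk ^+ 2 * e ^+ 4 by rewrite mulr_ge0 ?sqr_ge0.
    have p1 : 0 <= kk ^+ 2 * e ^+ 4 * ssq y ^+ 2 by rewrite mulr_ge0 ?sqr_ge0.
    rewrite ger0_norm; last by rewrite divr_ge0.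
    rewrite ler_pM2r ?invr_gt0 //; apply: ler_pM; rewrite ?sqr_ge0 //.
      by apply: ler_pM; rewrite ?sqr_ge0.
    by rewrite (_ : M ^+ 4 = (M ^+ 2) ^+ 2) ?lerXn2r ?nnegrE ?sqr_ge0 // -exprM.
  have X0 : 0 <= k ^+ 2 * e ^+ 3 * (M ^+ 6 * A ^+ 3).
    by apply: mulr_ge0 => //; rewrite mulr_ge0 ?exprn_ge0.
  have := ler_wpM2l ke0 AM3; have := ler_wpM2l ke0 M46.
  by lra.
apply: le_trans (ler_wpM2l (expR_ge0 _) E_le) _.
rewrite (_ : expR _ * _ = (3 * k ^+ 2 * e ^+ 3 * (1 + N) ^+ 6) *
      ((1 + ssq u) ^+ 3 * expR (- (kk * ssq u)))); last by ring.
rewrite (_ : 3 * k ^+ 2 * C * e ^+ 3 * (1 + N) ^+ 6 = (3 * k ^+ 2 * e ^+ 3 * (1 + N) ^+ 6) * C); last by ring.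
by rewrite ler_wpM2l ?expC ?ssq_ge0 // !mulr_ge0 ?exprn_ge0 //; lra.
Qed.

(** The first exponential is the mean of the profile after a Gaussian step of covariance [e ^+ 2]
    times the identity. Its expansion is the mean of the one in [gauss_step_expand] when [y] is
    centred with identity covariance, so a summand may be exchanged for a Gaussian one at a cost of
    order [e ^+ 3]. *)
Lemma gauss_heat_expand : exists2 C : R, 0 <= C & forall (e kk : R) u,
  0 < e <= 1 -> k0 <= kk <= k ->
  `|expR (- (r%:R / 2 * ln (1 + 2 * kk * e ^+ 2)) - kk * ssq u / (1 + 2 * kk * e ^+ 2))
    - expR (- (kk * ssq u)) * (1 - kk * r%:R * e ^+ 2 + 2 * kk ^+ 2 * e ^+ 2 * ssq u)|
  <= C * e ^+ 3.
Proof.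
have kp : 0 < k := lt_le_trans k00 k0k.
(* The rate of decay that survives division by [1 + 2 * kk * e ^+ 2], which is at most
   [1 + 2 * k]. *)
have k1p : 0 < k0 / (1 + 2 * k) by rewrite divr_gt0 //; lra.
have [C C0 hC] := poly_exp_bound 2 k1p.
pose a := r%:R / 2 : R; have a0 : 0 <= a by rewrite divr_ge0.
pose c := a + k; have c0 : 0 <= c by rewrite addr_ge0 // ltW.
exists (4 * k ^+ 2 * C * (c + 2 * c ^+ 2)).
  by rewrite mulr_ge0 ?(mulr_ge0 (mulr_ge0 _ (sqr_ge0 k))) // addr_ge0 // mulr_ge0 // sqr_ge0.
move=> e kk u /andP[e0 e1] /andP[kk0 kk1].
have kkp : 0 < kk := lt_le_trans k00 kk0.
have e2 : 0 < e ^+ 2 <= 1 by rewrite exprn_gt0 // exprn_ile1 // ltW.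
move/andP: e2 => [e20 e21].
set q := ssq u; have q0 : 0 <= q := ssq_ge0 u.
pose d := 2 * kk * e ^+ 2; rewrite -/d.
have d0 : 0 < d by rewrite /d !mulr_gt0.
have dk : d <= 2 * k by rewrite /d; nra.
have i01 : 0 < 1 + d by lra.
pose x := - (a * ln (1 + d)) + kk * q * (d / (1 + d)).
pose xh := - (a * d) + kk * q * d.
have l1 : ln (1 + d) <= d by apply: le_ln1Dx; lra.
have l2 : d / (1 + d) <= ln (1 + d).
  have i1 : 0 < (1 + d)^-1 by rewrite invr_gt0.
  have : ln (1 + (- (d / (1 + d)))) <= - (d / (1 + d)).
    apply: le_ln1Dx; rewrite ltrN2 ltr_pdivrMr //; lra.
  have -> : 1 + - (d / (1 + d)) = (1 + d)^-1 by field; rewrite gt_eqF.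
  by rewrite lnV ?posrE // lerN2.
have l3 : d - d ^+ 2 <= d / (1 + d).
  rewrite ler_pdivlMr //; have : 0 <= d ^+ 3 by rewrite exprn_ge0 // ltW.
  lra.
have l4 : d / (1 + d) <= d by rewrite ler_pdivrMr //; nra.
have l5 : 0 <= d / (1 + d) by rewrite divr_ge0 // ltW.
have -> : - (r%:R / 2 * ln (1 + d)) - kk * q / (1 + d) = - (kk * q) + x.
  by rewrite /x /a; field; rewrite gt_eqF.
rewrite expRD.
have -> : 1 - kk * r%:R * e ^+ 2 + 2 * kk ^+ 2 * e ^+ 2 * q = 1 + xh.
  by rewrite /xh /a /d; field.
have -> : expR (- (kk * q)) * expR x - expR (- (kk * q)) * (1 + xh) =
  expR (- (kk * q)) * ((expR x - 1 - x) + (x - xh)) by ring.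
rewrite normrM (ger0_norm (expR_ge0 _)).
have na (z : R) : `|a * z| = a * `|z| by rewrite normrM ger0_norm.
have nk (z : R) : `|kk * q * z| = kk * q * `|z|.
  by rewrite normrM ger0_norm // mulr_ge0 // ltW.
have hxh : `|x - xh| <= c * d ^+ 2 * (1 + q) ^+ 2.
  apply: le_trans (_ : a * d ^+ 2 + k * q * d ^+ 2 <= _); last first.
    have t1 : 0 <= d ^+ 2 * (a * (2 * q + q ^+ 2)) 
      by apply: mulr_ge0 (sqr_ge0 d) (mulr_ge0 a0 (addr_ge0 (mulr_ge0 _ q0) (sqr_ge0 q))).
    have t2 : 0 <= d ^+ 2 * (k * (1 + q + q ^+ 2)).
      apply: mulr_ge0 (sqr_ge0 d) (mulr_ge0 (ltW kp) _).
      by rewrite addr_ge0 ?sqr_ge0 // addr_ge0.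
    rewrite /c; lra.
  have -> : x - xh = a * (d - ln (1 + d)) - kk * q * (d - d / (1 + d)) by rewrite /x /xh; ring.
  apply: le_trans (ler_normB _ _) _; rewrite na nk.
  apply: lerD; first by rewrite ler_wpM2l // ger0_norm; lra.
  apply: ler_pM; rewrite ?mulr_ge0 // ?ler_wpM2r //; first exact: ltW.
  by rewrite ger0_norm; lra.
have hx : `|x| <= c * d * (1 + q).
  apply: le_trans (_ : a * d + k * q * d <= _); last first.
    have t1 : 0 <= d * (a * q) by rewrite !mulr_ge0 // ltW.
    have t2 : 0 <= d * k by rewrite mulr_ge0 ?ltW.
    rewrite /c; lra.
  apply: le_trans (ler_normD _ _) _; rewrite normrN na nk.
  apply: lerD; first by rewrite ler_wpM2l // ger0_norm; lra.
  apply: ler_pM; rewrite ?mulr_ge0 // ?ler_wpM2r //; first exact: ltW.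
  by rewrite ger0_norm.
have h1 : `|expR x - 1 - x + (x - xh)| <= (c + c ^+ 2) * d ^+ 2 * (1 + q) ^+ 2 + c ^+ 2 * d ^+ 2 * (1 + q) ^+ 2 * expR x.
  apply: le_trans (ler_normD _ _) _.
  have := expR_sub1x_bound x.
  have : x ^+ 2 * (1 + expR x) <= (c * d * (1 + q)) ^+ 2 * (1 + expR x).
    rewrite ler_wpM2r ?addr_ge0 ?expR_ge0 // -(real_normK (num_real x)) lerXn2r ?nnegrE //.
    by apply: le_trans hx.
  by lra.
apply: le_trans (ler_wpM2l (expR_ge0 _) h1) _.
have g1 : (1 + q) ^+ 2 * expR (- (kk * q)) <= C.
  apply: le_trans (hC q q0); rewrite ler_wpM2l ?sqr_ge0 // ler_expR lerN2 ler_wpM2r //.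
  by rewrite ler_pdivrMr; nra.
have g2 : (1 + q) ^+ 2 * (expR (- (kk * q)) * expR x) <= C.
  apply: le_trans (hC q q0); rewrite ler_wpM2l ?sqr_ge0 // -expRD ler_expR.
  have : 0 <= a * ln (1 + d) by rewrite mulr_ge0 // ln_ge0 //; lra.
  have : k0 / (1 + 2 * k) * q <= kk * q * (1 - d / (1 + d)).
    have -> : 1 - d / (1 + d) = (1 + d)^-1 by field; rewrite gt_eqF.
    rewrite [leRHS]mulrAC ler_wpM2r // ler_pM //; [exact: ltW| | ].
      by rewrite invr_ge0; lra.
    by rewrite lef_pV2 ?posrE; lra.
  by rewrite /x; lra.
have d2 : d ^+ 2 <= 4 * k ^+ 2 * e ^+ 3.
  rewrite /d (_ : _ ^+ 2 = 4 * (kk ^+ 2 * e ^+ 4)); last by ring.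
  rewrite -mulrA ler_pM2l // ler_pM ?sqr_ge0 ?exprn_ge0 ?(ltW e0) //.
    by rewrite lerXn2r ?nnegrE // ltW.
  by rewrite exprS ler_piMl // exprn_ge0 // ltW.
have c20 : 0 <= c ^+ 2 := sqr_ge0 c.
apply: le_trans (_ : d ^+ 2 * (C * (c + 2 * c ^+ 2)) <= _).
  have := ler_wpM2l (addr_ge0 c0 c20) g1; have := ler_wpM2l c20 g2 => A B.
  have := ler_wpM2l (sqr_ge0 d) (lerD A B); lra.
have cc : 0 <= C * (c + 2 * c ^+ 2) by rewrite mulr_ge0 // addr_ge0 // mulr_ge0.
have := ler_wpM2r cc d2; lra.
Qed.

End HeatStep.

Section MeasurableBumps.
Context {R : realType} (r : nat) {d : measure_display} {T : measurableType d}.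
Variable U : 'I_r -> T -> R.
Hypothesis mU : forall a, measurable_fun setT (U a).

Lemma measurable_ssq : measurable_fun setT (fun w => ssq (U^~ w)).
Proof. by apply: measurable_sum => a; apply: measurable_funX. Qed.

Lemma measurable_bump (kk : R) : measurable_fun setT (fun w => expR (- (kk * ssq (U^~ w)))).
Proof.
apply: measurableT_comp => //; apply: measurable_funN => //.
by apply: measurable_funM => //; exact: measurable_ssq.
Qed.

End MeasurableBumps.

(** * Replacement of the summands one at a time *)

Section CLT.
Context {R : realType} {disp : measure_display} {Om : measurableType disp}.
Variable P : probability Om R.
Variables (r : nat) (k Mom : R).
Hypotheses (k_gt0 : 0 < k) (Mom0 : 0 <= Mom).

Definition partial_sum (e : R) (y : nat -> 'I_r -> Om -> R) (j : nat) (a : 'I_r) (w : Om) : R :=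
  e * \sum_(i < j) y i a w.

Variables (n : nat) (y : nat -> 'I_r -> Om -> R) (G1 G2 : nat -> set (set Om)).

(** [G1 i] stands for the past of row [i] and [G2 i] for the row itself. Their independence is
    stated as the product rule for expectations, the form in which it is applied. *)
Definition centered_array :=
  [/\ forall i a, (i < n)%N -> measurable_fun setT (y i a),
      forall i j a, (i < n)%N -> (j < i)%N -> measG (G1 i) (y j a),
      forall i a, (i < n)%N -> measG (G2 i) (y i a),
      forall i f g, (i < n)%N -> measG (G1 i) f -> measG (G2 i) g -> L1 P f -> L1 P g ->
        L1 P (fun w => f w * g w) /\ Ex P (fun w => f w * g w) = Ex P f * Ex P g &
      forall i, (i < n)%N ->
        [/\ L1 P (fun w => (1 + n1 (y i ^~ w)) ^+ 6),
            Ex P (fun w => (1 + n1 (y i ^~ w)) ^+ 6) <= Mom,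
            forall a, Ex P (y i a) = 0 &
            forall a b, Ex P (fun w => y i a w * y i b w) = (a == b)%:R]].

Hypothesis hy : centered_array.

Lemma array_L1 i : (i < n)%N -> (forall a, L1 P (y i a)) /\
  (forall a b, L1 P (fun w => y i a w * y i b w)).
Proof.
have [my _ _ _ hm] := hy; move=> li; have [h6 _ _ _] := hm i li.
have le_n1 a w : `|y i a w| <= n1 (y i ^~ w).
  by rewrite /n1 (bigD1 a) //= lerDl sumr_ge0.
split=> [a|a b].
- apply: (L1_le _ _ h6); first exact: my.
  move=> w; have h := le_n1 a w; have h0 := n1_ge0 (y i ^~ w).
  apply: le_trans (_ : 1 + n1 (y i ^~ w) <= _); first lra.
  by rewrite -[leLHS]expr1 ler_weXn2l //; lra.
- apply: (L1_le _ _ h6); first by apply: measurable_funM; exact: my.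
  move=> w; have h := le_n1 a w; have h' := le_n1 b w; have h0 := n1_ge0 (y i ^~ w).
  apply: le_trans (_ : (1 + n1 (y i ^~ w)) ^+ 2 <= _).
    by rewrite normrM expr2; apply: ler_pM => //; lra.
  by rewrite ler_weXn2l //; lra.
Qed.

Variables (e kk : R).
Hypotheses (kk0 : 0 < kk).

(** Polynomials in the past are bounded against the factor [A], so every product of past and present
    splits. The linear term dies with the mean of [y j], and the identity covariance produces [r]
    and [ssq]. *)
Lemma step_expectation j : (j < n)%N ->
  let U := partial_sum e y j in
  let A w := expR (- (kk * ssq (U^~ w))) in
  let F w := A w * (1 - 2 * kk * e * dotp (U^~ w) (y j ^~ w) - kk * e ^+ 2 * ssq (y j ^~ w)
        + 2 * kk ^+ 2 * e ^+ 2 * dotp (U^~ w) (y j ^~ w) ^+ 2) in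
  let H w := A w * (1 - kk * r%:R * e ^+ 2 + 2 * kk ^+ 2 * e ^+ 2 * ssq (U^~ w)) in
  [/\ L1 P F, L1 P H & Ex P F = Ex P H].
Proof.
move=> lj U A F H.
have [my mG1 mG2 ind hm] := hy; have [h6 _ m1 m2] := hm j lj.
have [Ly Lyy] := array_L1 lj.
have mU a : measurable_fun setT (U a).
  apply: measurable_funM => //; apply: measurable_sum => i.
  by apply: my; apply: ltn_trans lj.
have mGU a : measG (G1 j) (U a).
  apply: measurable_funM => //; apply: measurable_sum => i.
  by apply: mG1.
have mA : measurable_fun setT A := measurable_bump mU kk.
have mGA : measG (G1 j) A := measurable_bump mGU kk.
have [C C0 hC] := poly_exp_bound 1 kk0.
have AU2 a b w : `|A w * (U a w * U b w)| <= C.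
  rewrite normrM (ger0_norm (expR_ge0 _)) mulrC; apply: le_trans (hC _ (ssq_ge0 (U^~ w))).
  rewrite ler_wpM2r ?expR_ge0 // expr1.
  have ha : U a w ^+ 2 <= ssq (U^~ w) by rewrite /ssq (bigD1 a) //= lerDl sumr_ge0 // => ? _; rewrite sqr_ge0.
  have hb : U b w ^+ 2 <= ssq (U^~ w) by rewrite /ssq (bigD1 b) //= lerDl sumr_ge0 // => ? _; rewrite sqr_ge0.
  rewrite normrM.
  have := sqr_ge0 (`|U a w| - `|U b w|); rewrite sqrrB !real_normK ?num_real //.
  lra.
have AU1 a w : `|A w * U a w| <= C.
  rewrite normrM (ger0_norm (expR_ge0 _)) mulrC; apply: le_trans (hC _ (ssq_ge0 (U^~ w))).
  rewrite ler_wpM2r ?expR_ge0 // expr1.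
  have ha : U a w ^+ 2 <= ssq (U^~ w) by rewrite /ssq (bigD1 a) //= lerDl sumr_ge0 // => ? _; rewrite sqr_ge0.
  have := sqr_ge0 (`|U a w| - 1); rewrite sqrrB !real_normK ?num_real // expr1n mulr1.
  have := normr_ge0 (U a w).
  lra.
have A1 w : `|A w| <= 1.
  rewrite ger0_norm ?expR_ge0 // -[leRHS]expR0 ler_expR oppr_le0.
  by rewrite mulr_ge0 ?ssq_ge0 // ltW.
have LA : L1 P A by exact: (L1_bounded P mA A1).
have LAU a : L1 P (fun w => A w * U a w).
  by apply: L1_bounded (AU1 a); exact: measurable_funM.
have LAUU a b : L1 P (fun w => A w * (U a w * U b w)).
  by apply: L1_bounded (AU2 a b); apply: measurable_funM => //; exact: measurable_funM.
have i1 a : L1 P (fun w => A w * U a w * y j a w) /\ Ex P (fun w => A w * U a w * y j a w) = 0.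
  have [] := ind j _ _ lj (measurable_funM mGA (mGU a)) (mG2 j a lj) (LAU a) (Ly a).
  by move=> h ->; rewrite m1 mulr0.
have i2 a : L1 P (fun w => A w * (y j a w * y j a w)) /\
    Ex P (fun w => A w * (y j a w * y j a w)) = Ex P A.
  have [] := ind j _ _ lj mGA (measurable_funM (mG2 j a lj) (mG2 j a lj)) LA (Lyy a a).
  by move=> h ->; rewrite m2 eqxx mulr1.
have i3 a b : L1 P (fun w => A w * (U a w * U b w) * (y j a w * y j b w)) /\
    Ex P (fun w => A w * (U a w * U b w) * (y j a w * y j b w)) =
    Ex P (fun w => A w * (U a w * U b w)) * (a == b)%:R.
  have [] := ind j _ _ lj (measurable_funM mGA (measurable_funM (mGU a) (mGU b)))
    (measurable_funM (mG2 j a lj) (mG2 j b lj)) (LAUU a b) (Lyy a b).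
  by move=> h ->; rewrite m2.
have FE : F = (fun w => A w - 2 * kk * e * (\sum_a A w * U a w * y j a w)
    - kk * e ^+ 2 * (\sum_a A w * (y j a w * y j a w))
    + 2 * kk ^+ 2 * e ^+ 2 * (\sum_a \sum_b A w * (U a w * U b w) * (y j a w * y j b w))).
  apply/funext => w; rewrite /F.
  have -> : \sum_a A w * U a w * y j a w = A w * dotp (U^~ w) (y j ^~ w).
    by rewrite /dotp mulr_sumr; apply: eq_bigr => a _; rewrite mulrA.
  have -> : \sum_a A w * (y j a w * y j a w) = A w * ssq (y j ^~ w).
    by rewrite /ssq mulr_sumr; apply: eq_bigr.
  have -> : \sum_a \sum_b A w * (U a w * U b w) * (y j a w * y j b w)
      = A w * dotp (U^~ w) (y j ^~ w) ^+ 2.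
    rewrite expr2 /dotp mulr_suml mulr_sumr; apply: eq_bigr => a _.
    rewrite !mulr_sumr; apply: eq_bigr => b _; ring.
  ring.
have HE : H = (fun w => (1 - kk * r%:R * e ^+ 2) * A w
    + 2 * kk ^+ 2 * e ^+ 2 * \sum_a A w * (U a w * U a w)).
  apply/funext => w; rewrite /H.
  have -> : \sum_a A w * (U a w * U a w) = A w * ssq (U^~ w).
    by rewrite /ssq mulr_sumr; apply: eq_bigr.
  ring.
have LS1 : L1 P (fun w => \sum_a A w * U a w * y j a w) by apply: L1_sum => a _; case: (i1 a).
have LS2 : L1 P (fun w => \sum_a A w * (y j a w * y j a w)) by apply: L1_sum => a _; case: (i2 a).
have LS3 : L1 P (fun w => \sum_a \sum_b A w * (U a w * U b w) * (y j a w * y j b w)).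
  by apply: L1_sum => a _; apply: L1_sum => b _; case: (i3 a b).
have LS4 : L1 P (fun w => \sum_a A w * (U a w * U a w)) by apply: L1_sum.
rewrite FE HE; split.
- by apply: L1D; [apply: L1B; [apply: L1B|]|]; do ?exact: L1Z.
- by apply: L1D; exact: L1Z.
pose c1 := 2 * kk * e; pose c2 := kk * e ^+ 2; pose c3 := 2 * kk ^+ 2 * e ^+ 2.
have LZ1 := L1Z c1 LS1; have LZ2 := L1Z c2 LS2; have LZ3 := L1Z c3 LS3.
have LB1 := L1B LA LZ1; have LB2 := L1B LB1 LZ2.
rewrite (ExD LB2 LZ3) (ExB LB1 LZ2) (ExB LA LZ1) (ExD (L1Z _ LA) (L1Z _ LS4)) !ExZ //.
rewrite !Ex_sum //; try by move=> a _; first [case: (i1 a)|case: (i2 a)].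
  rewrite big1; last by move=> a _; case: (i1 a).
  rewrite (eq_bigr (fun=> Ex P A)); last by move=> a _; case: (i2 a).
  rewrite sumr_const card_ord.
  rewrite [X in _ + c3 * X](eq_bigr (fun a => Ex P (fun w => A w * (U a w * U a w)))).
    by rewrite -mulr_natr /c2 /c3; ring.
  move=> a _; rewrite Ex_sum => [|b _]; last by case: (i3 a b).
  rewrite (bigD1 a) //= big1 ?addr0; first by have [_ ->] := i3 a a; rewrite eqxx mulr1.
  by move=> b ba; have [_ ->] := i3 a b; rewrite eq_sym (negPf ba) mulr0.
  by move=> a _; apply: L1_sum => b _; case: (i3 a b).
by move=> a _; case: (i2 a).
Qed.

(** Up to a constant factor the centred Gaussian density of variance [s / (2 * k)] in each
    coordinate: a Gaussian step of variance [e ^+ 2] moves [s] to [s + 2 * k * e ^+ 2]. *)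
Definition heat (s : R) (u : 'I_r -> R) : R :=
  expR (- (r%:R / 2 * ln s) - k / s * ssq u).

Lemma heat_ge0 s u : 0 <= heat s u. Proof. exact: expR_ge0. Qed.

Lemma heat_le1 s u : 1 <= s -> heat s u <= 1.
Proof.
move=> s1; rewrite -[leRHS]expR0 ler_expR.
have h1 : 0 <= r%:R / 2 * ln s by rewrite mulr_ge0 ?divr_ge0 ?ln_ge0.
have s0 : 0 < s by lra.
have h2 : 0 <= k / s * ssq u by rewrite mulr_ge0 ?ssq_ge0 // divr_ge0 ?ltW.
lra.
Qed.

End CLT.

Section CLTBound.
Context {R : realType} {disp : measure_display} {Om : measurableType disp}.
Variable P : probability Om R.
Variables (r : nat) (k Mom : R).
Hypotheses (k_gt0 : 0 < k) (Mom0 : 0 <= Mom).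

(** There are [n] replacements, each at a cost of order [e ^+ 3] with [n%:R * e ^+ 2 = 1], so the
    total is of order [e]. *)
Theorem clt_laplace : exists2 C : R, 0 <= C & forall n y G1 G2, (0 < n)%N ->
  @centered_array _ _ _ P r Mom n y G1 G2 ->
  `|Ex P (fun w => expR (- (k * ssq (fun a => partial_sum (Num.sqrt n%:R)^-1 y n a w))))
    - expR (- (r%:R / 2 * ln (1 + 2 * k)))| <= C / Num.sqrt n%:R.
Proof.
have kp : 0 < k := k_gt0.
have k0p : 0 < k / (1 + 2 * k) by rewrite divr_gt0 //; lra.
have k0k : k / (1 + 2 * k) <= k by rewrite ler_pdivrMr; nra.
have [C1 C10 h1] := @gauss_step_expand R r _ _ k0p k0k.
have [C2 C20 h2] := @gauss_heat_expand R r _ _ k0p k0k.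
exists (C1 * Mom + C2) => [|n y G1 G2 n0 hy]; first by rewrite addr_ge0 // mulr_ge0.
have [my _ _ _ hm] := hy.
set e := (Num.sqrt n%:R)^-1.
have ne2 : n%:R * e ^+ 2 = 1 :> R.
  by rewrite exprVn sqr_sqrtr // divff // pnatr_eq0 -lt0n.
have e0 : 0 < e by rewrite invr_gt0 sqrtr_gt0 ltr0n.
have e1 : e <= 1.
  rewrite invf_le1 ?sqrtr_gt0 ?ltr0n // -[leLHS]sqrtr1 ler_sqrt ?ler0n // ler1n //.
have e01 : 0 < e <= 1 by rewrite e0.
pose S j := partial_sum e y j.
have mS j a : (j <= n)%N -> measurable_fun setT (S j a).
  move=> jn; apply: measurable_funM => //; apply: measurable_sum => i.
  by apply: my; apply: leq_trans jn.
have mheat s j : (j <= n)%N -> 1 <= s -> L1 P (fun w => heat k s ((S j)^~ w)).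
  move=> jn s1; apply: (@L1_bounded _ _ _ P _ 1).
    apply: measurableT_comp => //; apply: measurable_funB => //.
    apply: measurable_funM => //; apply: measurable_ssq => a; exact: mS.
  by move=> w; rewrite ger0_norm ?heat_ge0 // heat_le1.
(* At stage [j] the last [n - j] summands are Gaussian and have each added [2 * k * e ^+ 2] to the
   parameter. *)
pose s j : R := 1 + 2 * k * (n - j)%N%:R * e ^+ 2.
have s1 j : 1 <= s j by rewrite lerDl !mulr_ge0 ?(ltW k_gt0) ?(ltW e0).
have s2 j : s j <= 1 + 2 * k.
  have : (n - j)%N%:R * e ^+ 2 <= n%:R * e ^+ 2 by rewrite ler_wpM2r ?sqr_ge0 // ler_nat leq_subr.
  by rewrite ne2 /s lerD2l -mulrA => ?; rewrite ler_piMr //; lra.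
pose a j := Ex P (fun w => heat k (s j) ((S j)^~ w)).
have step j : (j < n)%N -> `|a j.+1 - a j| <= (C1 * Mom + C2) * e ^+ 3.
  move=> jn; set kk := k / s j.+1.
  have sp : 0 < s j.+1 by apply: lt_le_trans (s1 _).
  have kkp : 0 < kk by rewrite divr_gt0.
  have hkk : k / (1 + 2 * k) <= kk <= k.
    by rewrite ler_pM2l // lef_pV2 ?posrE ?s2 //=; [rewrite ler_pdivrMr // ler_peMr // ltW|lra].
  have [] := step_expectation hy e kkp jn.
  set F := fun w => _; set H := fun w => _ => LF LH FH.
  pose L := expR (- (r%:R / 2 * ln (s j.+1))).
  have L01 : 0 <= L <= 1.
    rewrite expR_ge0 /= -[leRHS]expR0 ler_expR oppr_le0 mulr_ge0 ?divr_ge0 //.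
    by rewrite ln_ge0.
  have [h6 hM _ _] := hm j jn.
  have d1 w : `|heat k (s j.+1) ((S j.+1)^~ w) - L * F w| <= C1 * e ^+ 3 * (1 + n1 (y j ^~ w)) ^+ 6.
    have -> : heat k (s j.+1) ((S j.+1)^~ w) = L * expR (- (kk * ssq (fun b => S j b w + e * y j b w))).
      rewrite /heat expRD; congr (_ * expR (- (_ * ssq _))); apply/funext => b.
      by rewrite /S /partial_sum big_ord_recr /= mulrDr.
    rewrite -mulrBr normrM (ger0_norm (andP L01).1).
    have := h1 e kk (fun b => S j b w) (fun b => y j b w) e01 hkk.
    by move=> h; apply: le_trans h; rewrite ler_piMl // (andP L01).2.
  have d2 w : `|heat k (s j) ((S j)^~ w) - L * H w| <= C2 * e ^+ 3.
    (* Seen from the rate [kk = k / s j.+1], passing from [j.+1] to [j] is one Gaussian step. *)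
    have sE : s j = s j.+1 * (1 + 2 * kk * e ^+ 2).
      by rewrite /kk mulrDr mulr1 (_ : s j.+1 * _ = 2 * k * e ^+ 2);
        [rewrite /s -(subnSK jn) -natr1; ring|field; rewrite gt_eqF].
    have f0 : 0 < 1 + 2 * kk * e ^+ 2 by rewrite addr_gt0 // mulr_gt0 ?exprn_gt0 // mulr_gt0.
    have -> : heat k (s j) ((S j)^~ w) = L * expR (- (r%:R / 2 * ln (1 + 2 * kk * e ^+ 2)) - kk * ssq ((S j)^~ w) / (1 + 2 * kk * e ^+ 2)).
      rewrite /heat /L -expRD; congr expR; rewrite sE lnM ?posrE // /kk; field.
      rewrite gt_eqF //= gt_eqF // addr_gt0 // mulr_gt0 ?exprn_gt0 // mulr_gt0 //.
    rewrite -mulrBr normrM (ger0_norm (andP L01).1).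
    have := h2 e kk (fun b => S j b w) e01 hkk.
    by move=> h; apply: le_trans h; rewrite ler_piMl // (andP L01).2.
  have hj1 := mheat _ _ jn (s1 j.+1).
  have hj := mheat _ _ (ltnW jn) (s1 j).
  have LLF := L1Z L LF; have LLH := L1Z L LH.
  have -> : a j.+1 - a j = Ex P (fun w => heat k (s j.+1) ((S j.+1)^~ w) - L * F w)
     - Ex P (fun w => heat k (s j) ((S j)^~ w) - L * H w).
    by rewrite /a (ExB hj1 LLF) (ExB hj LLH) !ExZ // FH; ring.
  apply: le_trans (ler_normB _ _) _; rewrite mulrDl; apply: lerD.
    apply: le_trans (Ex_norm (L1B hj1 LLF)) _.
    apply: le_trans (Ex_le (L1_norm (L1B hj1 LLF)) (L1Z _ h6) d1) _.
    by rewrite ExZ // mulrAC ler_wpM2r ?exprn_ge0 ?(ltW e0) // ler_wpM2l.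
  apply: le_trans (Ex_norm (L1B hj LLH)) _.
  by apply: le_trans (Ex_le (L1_norm (L1B hj LLH)) (L1_cst _ _) d2) _; rewrite Ex_cst.
have tele j : (j <= n)%N -> `|a j - a 0%N| <= j%:R * ((C1 * Mom + C2) * e ^+ 3).
  elim: j => [|j IH] jn; first by rewrite subrr normr0 mul0r.
  have -> : a j.+1 - a 0%N = (a j.+1 - a j) + (a j - a 0%N) by rewrite addrA subrK.
  rewrite -natr1 mulrDl mul1r addrC; apply: le_trans (ler_normD _ _) _.
  by apply: lerD; [exact: IH (ltnW jn)|exact: step].
have := tele n (leqnn n).
have -> : a n = Ex P (fun w => expR (- (k * ssq ((S n)^~ w)))).
  congr Ex; apply/funext => w; rewrite /heat /s subnn mulr0 mul0r addr0 ln1 mulr0 oppr0 sub0r.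
  by rewrite divr1.
have -> : a 0%N = expR (- (r%:R / 2 * ln (1 + 2 * k))).
  rewrite /a /s subn0 -mulrA ne2 mulr1 -[RHS](Ex_cst P); congr Ex; apply/funext => w.
  rewrite /heat /ssq big1 ?mulr0 ?subr0 // => b _.
  by rewrite /S /partial_sum big_ord0 mulr0 expr0n.
move=> h; apply: le_trans h _.
rewrite le_eqVlt; apply/orP; left; apply/eqP.
have aux (x z c : R) : x * z ^+ 2 = 1 -> x * (c * z ^+ 3) = c * z.
  by move=> xz; rewrite -[RHS]mul1r -xz; ring.
exact: aux.
Qed.

End CLTBound.

(** * Quadratic forms in Gaussian vectors *)

Section StandardMoments.
Context {R : realType} {disp : measure_display} {Om : measurableType disp}.
Variable P : probability Om R.

(** Bounds the twelfth moment of a standard normal variable, through [pow_le_expR] and the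
    generating function at 1 and -1. Order 12 belongs to the sixth power of a quadratic form. *)
Definition mom12 : R := 12%:R ^+ 12 * (2 * expR (2^-1)).

(* The third moment is not needed: in a product of four coordinates, a coordinate
   occurring three times leaves another one occurring once. *)
Definition std_moments (Z : Om -> R) :=
  [/\ measurable_fun setT Z, forall m, L1 P (fun w => Z w ^+ m),
      Ex P Z = 0 /\ Ex P (fun w => Z w ^+ 2) = 1,
      Ex P (fun w => Z w ^+ 4) = 3 & Ex P (fun w => Z w ^+ 12) <= mom12].

Lemma gaussian_std_moments (s : R) (X : Om -> R) : 0 < s -> gaussian P s X ->
  std_moments (fun w => s^-1 * X w).
Proof.
move=> s0 gX; have mX : measurable_fun setT X by case: gX.
have sn0 : s != 0 by rewrite gt_eqF.
have LX m := gaussian_pow s0 gX m.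
have EX m : Ex P (fun w => (s^-1 * X w) ^+ m) = s ^- m * Ex P (fun w => X w ^+ m).
  by rewrite -ExZ //; congr Ex; apply/funext => w; rewrite exprMn exprVn.
split.
- exact: measurable_funM.
- by move=> m; under eq_fun do rewrite exprMn; apply: L1Z.
- split; last by rewrite EX (gaussian_moment2 s0 gX) mulVf // expf_neq0.
  by have := EX 1%N; rewrite (gaussian_mean s0 gX) mulr0.
- rewrite EX (gaussian_moment4 s0 gX) mulrCA mulVf ?mulr1 // expf_neq0 //.
- have L1e := gaussian_expnorm s0 gX s^-1.
  apply: le_trans (_ : Ex P (fun w => 12%:R ^+ 12 * (expR (s^-1 * X w) + expR (- (s^-1 * X w)))) <= _).
    apply: Ex_le; last first.
    - move=> w; apply: le_trans (ler_norm _) _; rewrite normrX; exact: pow_le_expR.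
    - exact: L1Z.
    - by under eq_fun do rewrite exprMn; apply: L1Z.
  have [l1 e1] := gaussian_mgf s0 gX s^-1; have [l2 e2] := gaussian_mgf s0 gX (- s^-1).
  rewrite ExZ // /mom12 ler_wpM2l ?exprn_ge0 // ExD //; last by under eq_fun do rewrite -mulNr.
  rewrite e1; under [X in _ + Ex _ X]eq_fun do rewrite -mulNr.
  rewrite e2 sqrrN exprVn mulVf ?expf_neq0 // div1r; lra.
Qed.

End StandardMoments.

Section QuadraticForms.
Context {R : realType} {disp : measure_display} {Om : measurableType disp}.
Variable P : probability Om R.
Variables (n r : nat) (z : nat -> 'I_r -> Om -> R).
Let zz (k : 'I_n * 'I_r) := z k.1 k.2.
Hypothesis (sz : forall i b, (i < n)%N -> std_moments P (z i b)).
Hypothesis (iz : indep_rvs P zz).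

Let mzz k : measurable_fun setT (zz k).
Proof. by case: (sz k.2 (ltn_ord k.1)). Qed.

Section Row.
Variables (i : nat) (li : (i < n)%N).
Let k b : 'I_n * 'I_r := (Ordinal li, b).
Let mz b : measurable_fun setT (z i b). Proof. by case: (sz b li). Qed.

Lemma z_pow_L1 b m : L1 P (fun w => z i b w ^+ m).
Proof. by case: (sz b li). Qed.

Lemma z_prod2_L1 b c : L1 P (fun w => z i b w * z i c w).
Proof.
apply: (@L1_le _ _ _ _ _ (fun w => z i b w ^+ 2 + z i c w ^+ 2)).
- exact: measurable_funM.
- move=> w; rewrite normrM.
  have := sqr_ge0 (`|z i b w| - `|z i c w|); rewrite sqrrB !real_normK ?num_real //.
  have := sqr_ge0 (z i b w); have := sqr_ge0 (z i c w); lra.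
- by apply: L1D; exact: z_pow_L1.
Qed.

Lemma z_prod4_L1 b c d e : L1 P (fun w => z i b w * z i c w * (z i d w * z i e w)).
Proof.
apply: (@L1_le _ _ _ _ _ (fun w => (z i b w ^+ 4 + z i c w ^+ 4) + (z i d w ^+ 4 + z i e w ^+ 4))).
- by apply: measurable_funM; exact: measurable_funM.
- move=> w; rewrite !normrM.
  have h (x y : R) : (`|x| * `|y|) ^+ 2 <= (x ^+ 4 + y ^+ 4) / 2.
    rewrite exprMn !real_normK ?num_real //.
    have := sqr_ge0 (x ^+ 2 - y ^+ 2); lra.
  have := h (z i b w) (z i c w); have := h (z i d w) (z i e w).
  have := sqr_ge0 (`|z i b w| * `|z i c w| - `|z i d w| * `|z i e w|).
  have := sqr_ge0 (`|z i b w| * `|z i c w|).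
  have := sqr_ge0 (`|z i d w| * `|z i e w|).
  lra.
- by do 2 apply: L1D; exact: z_pow_L1.
Qed.

Lemma z_split (f g : Om -> R) b : measG (boxes zz (pred1 (k b))) f ->
  measG (boxes zz (predC1 (k b))) g -> L1 P f -> L1 P g ->
  Ex P (fun w => f w * g w) = Ex P f * Ex P g.
Proof.
move=> mf mg lf lg.
by have [|_ ->] := @boxes_Ex _ _ _ P _ zz mzz _ _ f g iz _ mf mg lf lg => // x /= ->.
Qed.

Lemma z_own b : measG (boxes zz (pred1 (k b))) (z i b).
Proof. by apply: (@boxes_meas _ _ _ _ zz _ (k b)) => /=. Qed.

Lemma z_other b c : b != c -> measG (boxes zz (predC1 (k b))) (z i c).
Proof.
move=> bc; apply: (@boxes_meas _ _ _ _ zz _ (k c)) => /=.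
by rewrite /k xpair_eqE eqxx /= eq_sym.
Qed.

Lemma z_mean b : Ex P (z i b) = 0. Proof. by case: (sz b li) => _ _ []. Qed.
Lemma z_sqr b : Ex P (fun w => z i b w ^+ 2) = 1. Proof. by case: (sz b li) => _ _ []. Qed.

Lemma z_L1 b : L1 P (z i b).
Proof. by have := z_pow_L1 b 1. Qed.

Lemma z_cov b c : Ex P (fun w => z i b w * z i c w) = (b == c)%:R.
Proof.
have [<-|bc] := eqVneq b c; first by rewrite -(z_sqr b).
by rewrite (z_split (@z_own b) (@z_other _ _ bc)) ?z_mean ?mul0r //; exact: z_L1.
Qed.

Lemma z_lone b c d e : b != c -> b != d -> b != e ->
  Ex P (fun w => z i b w * z i c w * (z i d w * z i e w)) = 0.
Proof.
move=> bc bd be; under eq_fun do rewrite -mulrA.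
rewrite (z_split (@z_own b)) ?z_mean ?mul0r //; last 2 first.
- exact: z_L1.
- apply: (L1_le _ _ (L1D (L1D (z_pow_L1 c 4) (z_prod4_L1 d d e e)) (L1_cst P 1))).
    by apply: measurable_funM => //; exact: measurable_funM.
  move=> w; rewrite !normrM.
  set x := `|z i c w|; set y := `|z i d w| * `|z i e w|.
  have -> : z i c w ^+ 4 = x ^+ 4 by rewrite /x -[in RHS]normrX ger0_norm // -[4%N]/(2 * 2)%N exprM sqr_ge0.
  have -> : z i d w * z i d w * (z i e w * z i e w) = y ^+ 2.
    by rewrite /y exprMn !real_normK ?num_real // !expr2.
  have := sqr_ge0 (x - y); have := sqr_ge0 (x ^+ 2 - 1); have := sqr_ge0 y; have := sqr_ge0 (x^+2).
  have : x ^+ 4 = (x ^+ 2) ^+ 2 by rewrite -exprM.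
  lra.
by apply: measurable_funM (measurable_funM _ _); exact: z_other.
Qed.

Lemma z_pair b d : b != d ->
  Ex P (fun w => z i b w * z i b w * (z i d w * z i d w)) = 1.
Proof.
move=> bd; rewrite (z_split (b := b)).
- by rewrite !z_cov !eqxx mulr1.
- by apply: measurable_funM; exact: z_own.
- by apply: measurable_funM; exact: z_other.
- exact: z_prod2_L1.
- exact: z_prod2_L1.
Qed.

(* Isserlis' formula. *)
Lemma z_moment4 b c d e : Ex P (fun w => z i b w * z i c w * (z i d w * z i e w))
  = (b == c)%:R * (d == e)%:R + (b == d)%:R * (c == e)%:R + (b == e)%:R * (c == d)%:R.
Proof.
have swap (f g : Om -> R) : f =1 g -> Ex P f = Ex P g by move=> /funext ->.
have [<-{c}|bc] := eqVneq b c.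
  have [<-{d}|bd] := eqVneq b d.
    have [<-{e}|be] := eqVneq b e.
      case: (sz b li) => _ _ _ h4 _.
      rewrite (swap _ (fun w => z i b w ^+ 4)) ?h4 => [|w]; first by rewrite /=; ring.
      by ring.
    rewrite (swap _ (fun w => z i e w * z i b w * (z i b w * z i b w))) => [|w]; last by ring.
    by rewrite z_lone // 1?eq_sym //= ; rewrite ?mulr0 ?mul0r=> /=; ring.
  have [de|de] := eqVneq d e; last first.
    rewrite (swap _ (fun w => z i d w * z i e w * (z i b w * z i b w))) => [|w]; last by ring.
    by rewrite z_lone // 1?eq_sym //= ?mulr0 ?mul0r ?addr0.
  by rewrite -de z_pair // (negPf bd); move=> /=; ring.
have [bd|bd] := eqVneq b d.
  subst d; have [ce|ce] := eqVneq c e.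
    subst e; rewrite (swap _ (fun w => z i b w * z i b w * (z i c w * z i c w))) => [|w]; last by ring.
    by rewrite z_pair // (negPf bc); move=> /=; ring.
  rewrite (swap _ (fun w => z i c w * z i e w * (z i b w * z i b w))) => [|w]; last by ring.
  have cb : c != b by rewrite eq_sym.
  by rewrite z_lone // (negPf cb); move=> /=; ring.
have [be|be] := eqVneq b e; last by rewrite z_lone //; move=> /=; ring.
subst e; have [cd|cd] := eqVneq c d.
  subst d; rewrite (swap _ (fun w => z i b w * z i b w * (z i c w * z i c w))) => [|w]; last by ring.
  by rewrite z_pair //; move=> /=; ring.
rewrite (swap _ (fun w => z i c w * z i d w * (z i b w * z i b w))) => [|w]; last by ring.
by rewrite z_lone // 1?eq_sym //; move=> /=; ring.
Qed.

Let dev b c w := z i b w * z i c w - (b == c)%:R.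

Lemma dev_L1 b c : L1 P (dev b c).
Proof. by apply: L1B; [exact: z_prod2_L1|exact: L1_cst]. Qed.

Lemma dev_cov b c d e : L1 P (fun w => dev b c w * dev d e w) /\
  Ex P (fun w => dev b c w * dev d e w)
  = (b == d)%:R * (c == e)%:R + (b == e)%:R * (c == d)%:R.
Proof.
have E : (fun w => dev b c w * dev d e w) = (fun w =>
    (z i b w * z i c w * (z i d w * z i e w) - (d == e)%:R * (z i b w * z i c w))
    - ((b == c)%:R * (z i d w * z i e w) - (b == c)%:R * (d == e)%:R)).
  by apply/funext => w; rewrite /dev; ring.
have l1 := z_prod4_L1 b c d e.
have l2 := L1Z (d == e)%:R (z_prod2_L1 b c).
have l3 := L1Z (b == c)%:R (z_prod2_L1 d e).
have l4 := L1_cst P ((b == c)%:R * (d == e)%:R).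
rewrite E; split; first by apply: L1B; exact: L1B.
rewrite (ExB (L1B l1 l2) (L1B l3 l4)) (ExB l1 l2) (ExB l3 l4) Ex_cst.
rewrite !(@ExZ _ _ _ P _ _ (z_prod2_L1 _ _)).
by rewrite z_moment4 !z_cov; ring.
Qed.

Variables (m : nat) (M : 'I_m -> 'M[R]_r).
Hypothesis symM : forall a, (M a)^T = M a.
Hypothesis orthM : forall a b, 2 * \tr (M a *m M b) = (a == b)%:R.

Definition qform (a : 'I_m) (w : Om) : R :=
  \sum_b \sum_c M a b c * (z i b w * z i c w - (b == c)%:R).

Lemma qform_L1 a : L1 P (qform a).
Proof. by apply: L1_sum => b _; apply: L1_sum => c _; apply: L1Z; exact: dev_L1. Qed.

Lemma qform_mean a : Ex P (qform a) = 0.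
Proof.
rewrite Ex_sum => [|b _]; last by apply: L1_sum => c _; apply: L1Z; exact: dev_L1.
rewrite big1 // => b _; rewrite Ex_sum => [|c _]; last by apply: L1Z; exact: dev_L1.
rewrite big1 // => c _; rewrite ExZ; last exact: dev_L1.
by rewrite ExB ?Ex_cst ?z_cov ?subrr ?mulr0 //; [exact: z_prod2_L1|exact: L1_cst].
Qed.

(** Centring removes one of the three pairings of Isserlis' formula. The other two are equal by
    symmetry of [M a'], whence the factor 2 in [orthM]. *)
Lemma qform_cov a a' : Ex P (fun w => qform a w * qform a' w) = (a == a')%:R.
Proof.
have E : (fun w => qform a w * qform a' w) = (fun w => \sum_b \sum_c \sum_d \sum_e
    (M a b c * M a' d e) * (dev b c w * dev d e w)).
  apply/funext => w; rewrite /qform mulr_suml; apply: eq_bigr => b _.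
  rewrite mulr_suml; apply: eq_bigr => c _; rewrite mulr_sumr; apply: eq_bigr => d _.
  by rewrite mulr_sumr; apply: eq_bigr => e _; rewrite /dev; ring.
have l b c d e := L1Z (M a b c * M a' d e) (dev_cov b c d e).1.
rewrite E -orthM Ex_sum => [|b _]; last by do 3 apply: L1_sum => ? _.
rewrite /mxtrace mulr_sumr; apply: eq_bigr => b _.
rewrite Ex_sum => [|c _]; last by do 2 apply: L1_sum => ? _.
rewrite mxE mulr_sumr; apply: eq_bigr => c _.
rewrite Ex_sum => [|d _]; last by apply: L1_sum => ? _.
transitivity (\sum_d \sum_e M a b c * M a' d e *
    ((b == d)%:R * (c == e)%:R + (b == e)%:R * (c == d)%:R)).
  apply: eq_bigr => d _; rewrite Ex_sum => [|e _]; last exact: l.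
  by apply: eq_bigr => e _; rewrite ExZ ?(dev_cov b c d e).2 //; exact: (dev_cov b c d e).1.
have pick (f : 'I_r -> 'I_r -> R) (x y : 'I_r) :
    \sum_d \sum_e f d e * ((x == d)%:R * (y == e)%:R) = f x y.
  rewrite (bigD1 x) //= [X in _ + X]big1 ?addr0 => [|d dx]; last first.
    by rewrite big1 // => e _; rewrite eq_sym (negPf dx) mul0r mulr0.
  rewrite (bigD1 y) //= big1 ?addr0 ?eqxx ?mulr1 // => e ey.
  by rewrite [y == e]eq_sym (negPf ey) !mulr0.
transitivity (M a b c * M a' b c + M a b c * M a' c b).
  rewrite -(pick (fun d e => M a b c * M a' d e) b c) -[X in _ = _ + X](pick (fun d e => M a b c * M a' d e) c b).
  rewrite -big_split /=; apply: eq_bigr => d _; rewrite -big_split /=; apply: eq_bigr => e _.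
  by rewrite mulrDr [(b == e)%:R * _]mulrC.
have -> : M a' b c = M a' c b by rewrite -[in LHS](symM a') mxE.
ring.
Qed.

Definition qbound : R := \sum_a \sum_b \sum_c `|M a b c| * 2.

Lemma qform_n1 w : n1 (qform ^~ w) <= qbound * (1 + \sum_b z i b w ^+ 2).
Proof.
rewrite /n1 /qbound mulr_suml; apply: ler_sum => a _.
apply: le_trans (ler_norm_sum _ _ _) _; rewrite mulr_suml; apply: ler_sum => b _.
apply: le_trans (ler_norm_sum _ _ _) _; rewrite mulr_suml; apply: ler_sum => c _.
rewrite normrM -mulrA ler_wpM2l //.
have hq d : z i d w ^+ 2 <= \sum_b z i b w ^+ 2.
  by rewrite (bigD1 d) //= lerDl sumr_ge0 // => ? _; rewrite sqr_ge0.
apply: le_trans (ler_normB _ _) _; rewrite normrM.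
have := sqr_ge0 (`|z i b w| - `|z i c w|); rewrite sqrrB !real_normK ?num_real //.
have : `|(b == c)%:R : R| <= 1 by case: (b == c); rewrite ?normr1 ?normr0.
have := hq b; have := hq c; have := sqr_ge0 (z i b w).
lra.
Qed.

Lemma sum_pow_le (x : 'I_r -> R) p : (forall b, 0 <= x b) ->
  (\sum_b x b) ^+ p.+1 <= r%:R ^+ p.+1 * \sum_b x b ^+ p.+1.
Proof.
move=> x0; case: (pickP (fun _ : 'I_r => true)) => [b0 _|no]; last first.
  rewrite !big_pred0 ?expr0n ?mulr0 // => b; by have := no b.
have [b _ hb] := @Order.TotalTheory.arg_maxP _ _ _ b0 xpredT x isT.
apply: le_trans (_ : (r%:R * x b) ^+ p.+1 <= _).
  rewrite lerXn2r ?nnegrE ?mulr_ge0 ?sumr_ge0 //.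
  apply: le_trans (_ : \sum_(c < r) x b <= _); first by apply: ler_sum => c _; exact: hb.
  by rewrite sumr_const card_ord mulr_natl.
rewrite exprMn ler_wpM2l ?exprn_ge0 // (bigD1 b) //= lerDl sumr_ge0 // => c _.
by rewrite exprn_ge0.
Qed.

(** Depends on the matrices only, neither on the row nor on [n]: the replacement argument needs one
    moment bound for all rows. *)
Definition qmom : R := (1 + qbound) ^+ 6 * (64 * (1 + r%:R ^+ 6 * (r%:R * mom12))).

Lemma qform_mom : L1 P (fun w => (1 + n1 (qform ^~ w)) ^+ 6) /\
  Ex P (fun w => (1 + n1 (qform ^~ w)) ^+ 6) <= qmom.
Proof.
(* From [(1 + S) ^+ 6 <= 64 * (1 + S ^+ 6)] for the sum [S] of squares, and a power-sum bound for
   [S ^+ 6]. *)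
pose D w := (1 + qbound) ^+ 6 * (64 * (1 + r%:R ^+ 6 * \sum_b z i b w ^+ 12)).
have qb0 : 0 <= qbound.
  by do 3 apply: sumr_ge0 => ? _; rewrite mulr_ge0.
have hD w : (1 + n1 (qform ^~ w)) ^+ 6 <= D w.
  set S := \sum_b z i b w ^+ 2.
  have S0 : 0 <= S by apply: sumr_ge0 => b _; rewrite sqr_ge0.
  have h : 1 + n1 (qform ^~ w) <= (1 + qbound) * (1 + S).
    have := qform_n1 w; rewrite -/S; have : 0 <= qbound * S by rewrite mulr_ge0.
    lra.
  apply: le_trans (_ : ((1 + qbound) * (1 + S)) ^+ 6 <= _).
    by rewrite lerXn2r ?nnegrE ?mulr_ge0 ?addr_ge0 ?n1_ge0.
  rewrite exprMn ler_wpM2l ?exprn_ge0 ?addr_ge0 //.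
  apply: le_trans (_ : 64 * (1 + S ^+ 6) <= _); last first.
    rewrite ler_wpM2l // lerD2l; have := @sum_pow_le (fun b => z i b w ^+ 2) 5 (fun b => sqr_ge0 _).
    by under [in X in _ <= X -> _]eq_bigr do rewrite -exprM.
  have [S1|S1] := leP S 1.
    apply: le_trans (_ : 2 ^+ 6 <= _); first by rewrite lerXn2r ?nnegrE; lra.
    have := exprn_ge0 6 S0; lra.
  apply: le_trans (_ : (2 * S) ^+ 6 <= _); first by rewrite lerXn2r ?nnegrE; lra.
  rewrite exprMn; lra.
have LD : L1 P D.
  do 2 apply: L1Z; apply: L1D; first exact: L1_cst.
  by apply: L1Z; apply: L1_sum => b _; exact: z_pow_L1.
have mq a : measurable_fun setT (qform a) by have /L1_measurable := qform_L1 a.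
have LN : L1 P (fun w => (1 + n1 (qform ^~ w)) ^+ 6).
  apply: (L1_le _ _ LD).
    apply: measurable_funX; apply: measurable_funD => //.
    by apply: measurable_sum => a; exact: measurableT_comp.
  by move=> w; rewrite ger0_norm ?exprn_ge0 ?addr_ge0 ?n1_ge0.
split=> //; apply: le_trans (Ex_le LN LD hD) _.
have LS : L1 P (fun w => \sum_b z i b w ^+ 12) by apply: L1_sum => b _; exact: z_pow_L1.
rewrite /D ExZ; last by apply: L1Z; apply: L1D; [exact: L1_cst|exact: L1Z].
rewrite ler_wpM2l ?exprn_ge0 ?addr_ge0 // ExZ; last by apply: L1D; [exact: L1_cst|exact: L1Z].
rewrite ler_wpM2l // ExD; [|exact: L1_cst|exact: L1Z].
rewrite Ex_cst lerD2l ExZ // ler_wpM2l ?exprn_ge0 // Ex_sum => [|b _]; last exact: z_pow_L1.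
apply: le_trans (_ : \sum_(b < r) mom12 <= _).
  by apply: ler_sum => b _; case: (sz b li).
by rewrite sumr_const card_ord mulr_natl.
Qed.

End Row.

Lemma qform_array m (M : 'I_m -> 'M[R]_r) :
  (forall a, (M a)^T = M a) ->
  (forall a b, 2 * \tr (M a *m M b) = (a == b)%:R) ->
  centered_array P (qmom M) n (fun i => qform i M)
    (fun i => boxes zz (fun k => (k.1 < i)%N)) (fun i => boxes zz (fun k => k.1 == i :> nat)).
Proof.
move=> sM oM.
have mG (S : pred ('I_n * 'I_r)) i a (li : (i < n)%N) : (forall b, S (Ordinal li, b)) ->
    measG (boxes zz S) (qform i M a).
  move=> hS; apply: measurable_sum => b; apply: measurable_sum => c.
  apply: measurable_funM => //; apply: measurable_funB => //.
  by apply: measurable_funM; apply: (@boxes_meas _ _ _ _ zz S (Ordinal li, _)); exact: hS.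
split.
- by move=> i a li; have /L1_measurable := @qform_L1 i li _ M a.
- by move=> i j a li ji; apply: (@mG _ j a (ltn_trans ji li)) => b /=.
- by move=> i a li; apply: (@mG _ i a li) => b /=; rewrite eqxx.
- move=> i f g li mf mg lf lg; apply: (boxes_Ex mzz iz _ mf mg lf lg) => k /= h.
  by rewrite neq_ltn h.
- move=> i li; have [h1 h2] := @qform_mom i li _ M; split => // [a|a b].
    exact: qform_mean.
  exact: qform_cov.
Qed.

End QuadraticForms.

(** * Weak convergence from Laplace transforms *)

Section HeineCantor.
Context {R : realType} {V : normedModType R}.

(** Compactness in its near-covering form, with the modulus [d] as a parameter tending to 0 from the
    right. *)
Lemma uniformly_continuous_within (A : set R) (f : R -> V) (e : R) : compact A ->
  {within A, continuous f} -> 0 < e ->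
  exists2 d : R, 0 < d & forall x y : R, A x -> A y -> `|x - y| <= d -> `|f x - f y| <= e.
Proof.
move=> cA cf e0.
have e2 : 0 < e / 2 by rewrite divr_gt0.
move/compact_near_coveringP : cA => /(_ _ (0^'+)
  (fun d x => forall y, A y -> A x -> `|x - y| <= d -> `|f x - f y| <= e) _).
case.
  move=> x Ax; have /subspace_continuousP/(_ x Ax)/cvgrPdist_le/(_ _ e2) := cf.
  rewrite /within /= => /nbhs_ballP[r /= r0 hr].
  exists (ball x (r / 2), [set d : R | 0 < d < r / 2]).
    split=> /=; first by apply: nbhsx_ballx; rewrite divr_gt0.
    exists (r / 2) => /=; first by rewrite divr_gt0.
    by move=> d /=; rewrite sub0r normrN => h1 h2; rewrite h2 (le_lt_trans (ler_norm _) h1).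
  move=> [y d] /= [bxy /andP[d0 dr]] z Az Ay yz.
  have h1 := hr y; have h2 := hr z.
  have -> : f y - f z = (f x - f z) - (f x - f y).
    by rewrite opprB [RHS]addrC addrA subrK.
  rewrite (le_trans (ler_normB _ _)) // (splitr e) lerD //.
    apply: h2 => //; rewrite /ball /= (_ : x - z = (x - y) + (y - z)); last by rewrite addrA subrK.
    rewrite (le_lt_trans (ler_normD _ _)) // (splitr r) ltr_leD //.
    by rewrite (le_trans yz) // ltW.
  by apply: h1 => //; rewrite /ball /= (lt_le_trans bxy) //; lra.
move=> r /= r0 hr; exists (r / 2); first by rewrite divr_gt0.
move=> x y Ax Ay; apply: hr => //=.
  by rewrite sub0r normrN gtr0_norm ?divr_gt0 // ltr_pdivrMr // ltr_pMr // ltr1n.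
by rewrite divr_gt0.
Qed.

End HeineCantor.

(** * Bernstein polynomials and uniform approximation *)

Section Bernstein.
Context {R : realType}.

(** The mean of [phi] at a binomial count with [N] trials, built by conditioning on one trial; this
    makes linearity, monotonicity and the variance short inductions. *)
Fixpoint bernstein (N : nat) (phi : nat -> R) : {poly R} :=
  if N is N'.+1 then
    'X * bernstein N' (fun j => phi j.+1) + (1 - 'X) * bernstein N' phi
  else (phi 0%N)%:P.

Lemma bernsteinS N phi u : (bernstein N.+1 phi).[u]
  = u * (bernstein N (fun j => phi j.+1)).[u] + (1 - u) * (bernstein N phi).[u].
Proof. by rewrite /= !hornerE. Qed.

Lemma bernstein_lin N (a b : R) phi psi u :
  (bernstein N (fun j => a * phi j + b * psi j)).[u]
  = a * (bernstein N phi).[u] + b * (bernstein N psi).[u].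
Proof.
elim: N phi psi => [|N IH] phi psi; first by rewrite /= !hornerE.
by rewrite !bernsteinS !IH; ring.
Qed.

Lemma bernstein_le N phi psi (u : R) : 0 <= u <= 1 ->
  (forall j, (j <= N)%N -> phi j <= psi j) -> (bernstein N phi).[u] <= (bernstein N psi).[u].
Proof.
move=> /andP[u0 u1]; elim: N phi psi => [|N IH] phi psi h; first by rewrite /= !hornerE h.
rewrite !bernsteinS lerD // ler_wpM2l ?subr_ge0 //; apply: IH => j jN; apply: h => //.
exact: leqW.
Qed.

Lemma bernstein_cst N (c : R) u : (bernstein N (fun=> c)).[u] = c.
Proof. by elim: N => [|N IH]; rewrite ?bernsteinS ?IH /= ?hornerE //; ring. Qed.

(** Squared mean plus variance of a shifted binomial count. The shift [a] is what the induction
    changes. *)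
Lemma bernstein_var N (a : R) u : (bernstein N (fun j => (a + j%:R) ^+ 2)).[u]
  = (a + N%:R * u) ^+ 2 + N%:R * u * (1 - u).
Proof.
elim: N a => [|N IH] a; first by rewrite /= hornerE; ring.
rewrite bernsteinS IH.
have -> : (fun j => (a + j.+1%:R) ^+ 2) = (fun j => ((a + 1) + j%:R) ^+ 2).
  by apply/funext => j; rewrite -natr1; ring.
by rewrite IH -natr1; ring.
Qed.

(** Chebyshev's argument: the deviation is dominated by [V], which is [e / 2] plus a multiple of the
    squared distance, and the binomial variance makes the latter at most [e / 2] in the mean. *)
Lemma weierstrass (g : R -> R) (M e : R) : {within `[0, 1], continuous g} ->
  (forall u : R, 0 <= u <= 1 -> `|g u| <= M) -> 0 < e ->
  exists p : {poly R}, forall u : R, 0 <= u <= 1 -> `|p.[u] - g u| <= e.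
Proof.
move=> cg gM e0; have e2 : 0 < e / 2 by rewrite divr_gt0.
have [d d0 hd] := uniformly_continuous_within (@segment_compact R 0 1) cg e2.
have M0 : 0 <= M by apply: le_trans (gM 0 _); rewrite ?lexx ?ler01.
have [N hN] : exists N : nat, 4 * M / (d ^+ 2 * e) < N.+1%:R.
  have h := archi_boundP (_ : 0 <= 4 * M / (d ^+ 2 * e)).
  exists (Num.bound (4 * M / (d ^+ 2 * e))); rewrite (lt_trans (h _)) ?ltr_nat //.
  by rewrite divr_ge0 ?mulr_ge0 ?sqr_ge0 // ltW.
set n := N.+1.
have n0 : 0 < n%:R :> R by rewrite ltr0n.
exists (bernstein n (fun j => g (j%:R / n%:R))) => u u01.
have -> : (bernstein n (fun j => g (j%:R / n%:R))).[u] - g u =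
    (bernstein n (fun j => 1 * g (j%:R / n%:R) + (-1) * g u)).[u].
  by rewrite bernstein_lin bernstein_cst; ring.
pose V j : R := e / 2 * 1 + (2 * M / d ^+ 2 / n%:R ^+ 2) * (- (n%:R * u) + j%:R) ^+ 2.
have VE : (bernstein n V).[u] <= e.
  rewrite /V bernstein_lin bernstein_cst bernstein_var.
  have -> : (- (n%:R * u) + n%:R * u) ^+ 2 = 0 by rewrite addNr expr0n.
  have -> : 2 * M / d ^+ 2 / n%:R ^+ 2 * (0 + n%:R * u * (1 - u)) = 2 * M / (d ^+ 2 * n%:R) * (u * (1 - u)).
    by field; rewrite !gt_eqF.
  have h1 : 2 * M / (d ^+ 2 * n%:R) <= e / 2.
    move: hN; rewrite -/n ltr_pdivrMr ?mulr_gt0 ?exprn_gt0 // => hN.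
    rewrite ler_pdivrMr ?mulr_gt0 ?exprn_gt0 //; nra.
  have h2 : u * (1 - u) <= 1 by nra.
  have h3 : 0 <= u * (1 - u) by move/andP: u01 => [? ?]; rewrite mulr_ge0 // subr_ge0.
  have h4 : 0 <= 2 * M / (d ^+ 2 * n%:R).
    by apply: divr_ge0; apply: mulr_ge0 => //; exact: sqr_ge0.
  nra.
have hV j : (j <= n)%N -> `|g (j%:R / n%:R) - g u| <= V j.
  move=> jn; set v := j%:R / n%:R.
  have v01 : 0 <= v <= 1 by rewrite divr_ge0 //= ler_pdivrMr // mul1r ler_nat.
  have -> : V j = e / 2 + 2 * M / d ^+ 2 * (v - u) ^+ 2.
    by rewrite /V /v; field; rewrite !gt_eqF.
  have c0 : 0 <= 2 * M / d ^+ 2 by rewrite divr_ge0 ?sqr_ge0 // mulr_ge0.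
  have [vu|vu] := leP `|v - u| d.
    apply: le_trans (hd v u _ _ vu) _; rewrite ?in_itv //=.
    by rewrite lerDl mulr_ge0 ?sqr_ge0.
  apply: le_trans (ler_normB _ _) _; have h1 := gM _ v01; have h2 := gM _ u01.
  have : 2 * M <= 2 * M / d ^+ 2 * (v - u) ^+ 2.
    rewrite -[leLHS]mulr1 -!mulrA ler_wpM2l // ler_wpM2l //.
    rewrite mulrC ler_pdivlMr ?exprn_gt0 // mul1r -(real_normK (num_real (v - u))).
    by rewrite lerXn2r ?nnegrE // ltW.
  lra.
rewrite ler_norml; apply/andP; split.
  apply: le_trans (_ : (bernstein n (fun j => 0 * 0 + (-1) * V j)).[u] <= _).
    by rewrite bernstein_lin; lra.
  apply: bernstein_le => // j jn; have := hV j jn; rewrite ler_norml => /andP[]; lra.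
apply: le_trans VE; apply: bernstein_le => // j jn; have := hV j jn.
rewrite ler_norml => /andP[]; lra.
Qed.

End Bernstein.

Lemma cvg_sumr {R : realType} {I T : Type} (F : set_system T) {FF : Filter F} (r : seq I)
    (f : I -> T -> R) (l : I -> R) :
  (forall i, f i @ F --> l i) -> (fun t => \sum_(i <- r) f i t) @ F --> \sum_(i <- r) l i.
Proof.
move=> h; elim: r => [|i r IH].
  by rewrite big_nil; under eq_fun do rewrite big_nil; exact: cvg_cst.
by rewrite big_cons; under eq_fun do rewrite big_cons; exact: cvgD.
Qed.

(** * From Laplace transforms to bounded continuous functions *)

Section LaplaceConvergence.
Context {R : realType} {disp : measure_display} {Om : measurableType disp}.
Variable P : probability Om R.
Variables (T : nat -> Om -> R) (mu : probability (measurableTypeR R) R).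
Hypothesis mT : forall n, measurable_fun setT (T n).
Hypothesis T0 : forall n w, 0 <= T n w.
Hypothesis mu0 : {ae mu, forall x : measurableTypeR R, 0 <= (x : R)}.
Hypothesis laplace : forall k : nat,
  Ex P (fun w => expR (- (k%:R * T n w))) @[n --> \oo] -->
  Ex mu (fun x : measurableTypeR R => expR (- (k%:R * (x : R)))).

(** The half-line carries [mu] only almost surely; composing with [pos] puts [expR (- x)] in the
    unit interval at every point. *)
Let pos (x : measurableTypeR R) : R := Num.max 0 (x : R).

Let mpos : measurable_fun setT pos.
Proof. by apply: measurable_maxr => //; exact: measurable_cst. Qed.

Let pos0 x : 0 <= pos x. Proof. by rewrite le_max lexx. Qed.

Let laplace' (k : nat) :
  Ex P (fun w => expR (- (k%:R * T n w))) @[n --> \oo] --> Ex mu (fun x => expR (- (k%:R * pos x))).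
Proof.
have -> : Ex mu (fun x => expR (- (k%:R * pos x))) =
    Ex mu (fun x : measurableTypeR R => expR (- (k%:R * (x : R)))); last exact: laplace.
apply: Ex_ae_eq.
- apply: measurableT_comp => //; apply: measurable_funN; exact: measurable_funM.
- apply: measurableT_comp => //; apply: measurable_funN; apply: measurable_funM => //.
by apply: filterS mu0 => x x0; rewrite /pos max_r.
Qed.

Lemma exp01 (x : R) : 0 <= x -> 0 <= expR (- x) <= 1.
Proof. by move=> x0; rewrite expR_ge0 -[leRHS]expR0 ler_expR oppr_le0. Qed.

Lemma poly_horner_exp (p : {poly R}) x :
  p.[expR (- x)] = \sum_(i < size p) p`_i * expR (- (i%:R * x)).
Proof.
rewrite horner_coef; apply: eq_bigr => i _; congr (_ * _).
by rewrite -expRM_natl mulrN.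
Qed.

Lemma laplace_poly (p : {poly R}) :
  Ex P (fun w => p.[expR (- T n w)]) @[n --> \oo] --> Ex mu (fun x => p.[expR (- pos x)]).
Proof.
have L (d : measure_display) (S : measurableType d) (Q : probability S R) (X : S -> R) (i : nat) :
    measurable_fun setT X -> (forall w, 0 <= X w) -> L1 Q (fun w => expR (- (i%:R * X w))).
  move=> mX X0; apply: (@L1_bounded _ _ _ _ _ 1).
    by apply: measurableT_comp => //; apply: measurable_funN; exact: measurable_funM.
  by move=> w; rewrite ger0_norm ?expR_ge0 //; case/andP: (exp01 (mulr_ge0 (ler0n R i) (X0 w))).
have E (d : measure_display) (S : measurableType d) (Q : probability S R) (X : S -> R) :
    measurable_fun setT X -> (forall w, 0 <= X w) -> Ex Q (fun w => p.[expR (- X w)]) =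
    \sum_(i < size p) p`_i * Ex Q (fun w => expR (- (i%:R * X w))).
  move=> mX X0; under eq_fun do rewrite poly_horner_exp.
  rewrite Ex_sum => [|i _]; last by apply: L1Z; exact: L.
  by apply: eq_bigr => i _; rewrite ExZ //; exact: L.
rewrite E //; under eq_fun do rewrite E //.
by apply: cvg_sumr => i; apply: cvgM; [exact: cvg_cst|exact: laplace'].
Qed.

Lemma laplace_continuous (g : R -> R) (M : R) : continuous g ->
  (forall u : R, 0 <= u <= 1 -> `|g u| <= M) ->
  Ex P (fun w => g (expR (- T n w))) @[n --> \oo] --> Ex mu (fun x => g (expR (- pos x))).
Proof.
move=> cg gM; apply/cvgrPdist_le => e e0.
have e3 : 0 < e / 3 by rewrite divr_gt0.
have [p hp] := weierstrass (continuous_subspaceT cg) gM e3.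
have /cvgrPdist_le/(_ _ e3) := @laplace_poly p; apply: filterS => n hn.
have mg : measurable_fun setT g by exact: continuous_measurable_fun.
have B (d : measure_display) (S : measurableType d) (Q : probability S R) (X : S -> R) :
    measurable_fun setT X -> (forall w, 0 <= X w) ->
    `|Ex Q (fun w => p.[expR (- X w)]) - Ex Q (fun w => g (expR (- X w)))| <= e / 3.
  move=> mX X0.
  have mE : measurable_fun setT (fun w => expR (- X w)).
    by apply: measurableT_comp => //; exact: measurable_funN.
  have Lg : L1 Q (fun w => g (expR (- X w))).
    by apply: (@L1_bounded _ _ _ _ _ M); [exact: (measurableT_comp mg mE)|move=> w; apply: gM; exact: exp01].
  have Lp : L1 Q (fun w => p.[expR (- X w)]).
    apply: (@L1_bounded _ _ _ _ _ (M + e / 3)).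
      apply: (measurableT_comp _ mE); exact: continuous_measurable_fun (@continuous_horner _ p).
    move=> w; have := hp _ (exp01 (X0 w)); have := gM _ (exp01 (X0 w)) => h1 h2.
    rewrite (_ : p.[_] = g (expR (- X w)) + (p.[expR (- X w)] - g (expR (- X w)))); last by rewrite addrC subrK.
    by rewrite (le_trans (ler_normD _ _)) // lerD.
  rewrite -ExB //; apply: le_trans (Ex_norm (L1B Lp Lg)) _.
  rewrite -[leRHS](Ex_cst Q); apply: Ex_le; [exact: L1_norm (L1B Lp Lg)|exact: L1_cst|].
  by move=> w; apply: hp; exact: exp01.
have b1 := B _ _ mu pos mpos pos0; have b2 := B _ _ P (T n) (mT n) (T0 n).
move: hn b1 b2; rewrite !ler_norml => /andP[? ?] /andP[? ?] /andP[? ?]; apply/andP; split; lra.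
Qed.

(** In the variable [u = expR (- x)] a bounded continuous [f] may fail to extend to [u = 0], that is
    to infinity. A cutoff removes this point at a cost measured by its own expectation, and the
    convergence of that expectation supplies tightness. *)
Theorem laplace_cvg_in_distribution : cvg_in_distribution P T mu.
Proof.
split=> // f cf [M hM].
have M0 : 0 <= M := le_trans (normr_ge0 _) (hM 0).
have mf : measurable_fun setT f by exact: continuous_measurable_fun.
(* For [L > 0] it is 0 when [u <= 0] and 1 when [u >= L^-1]. *)
pose cut (L u : R) := Num.min 1 (Num.max 0 (L * u)).
have cut01 L u : 0 <= cut L u <= 1.
  by rewrite /cut le_min ler01 le_max lexx /= ge_min lexx.
have ccut L : continuous (cut L).
  move=> u.
  have cL : {for u, continuous (fun v : R => L * v : R^o)}.
    by apply: cvgM; [exact: cvg_cst|exact: cvg_id].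
  have c (a : R) : {for u, continuous (fun _ : R => a : R^o)} by exact: cvg_cst.
  exact: (continuous_min (c 1) (continuous_max (c 0) cL)).
pose g (L u : R) := f (- ln u) * cut L u.
have gcut L u : `|g L u| <= M * cut L u.
  have [c0 _] := andP (cut01 L u).
  by rewrite normrM (ger0_norm c0) ler_wpM2r.
have gM L u : `|g L u| <= M.
  by apply: le_trans (gcut L u) _; rewrite ler_piMr //; case/andP: (cut01 L u).
have cg (L : R) : 0 < L -> continuous (g L).
  move=> L0 u; have [u0|u0] := ltP 0 u.
    apply: cvgM; last exact: ccut.
    apply: (@cvg_comp _ _ _ (fun v : R => - ln v) f _ (nbhs (- ln u))); last exact: cf.
    by apply: cvgN; exact: continuous_ln.
  (* At [u <= 0] the cutoff squeezes [g L] to 0, so [g L] is continuous on the whole line. *)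
  have cu0 : cut L u = 0.
    by rewrite /cut max_l ?min_r // mulr_ge0_le0 // ltW.
  rewrite /continuous_at {2}/g cu0 mulr0.
  apply/cvgr0Pnorm_le => e e0.
  have : M * cut L v @[v --> u] --> M * cut L u by apply: cvgM; [exact: cvg_cst|exact: ccut].
  rewrite cu0 mulr0 => /cvgr0Pnorm_le/(_ e e0); apply: filterS => v.
  by apply: le_trans; apply: le_trans (gcut L v) _; exact: ler_norm.
have fg (L x : R) : 0 <= x -> `|f x - g L (expR (- x))| <= M - M * cut L (expR (- x)).
  move=> x0; rewrite /g expRK opprK.
  have -> : f x - f x * cut L (expR (- x)) = f x * (1 - cut L (expR (- x))) by rewrite mulrBr mulr1.
  have -> : M - M * cut L (expR (- x)) = M * (1 - cut L (expR (- x))) by rewrite mulrBr mulr1.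
  rewrite normrM.
  have [c0 c1] := andP (cut01 L (expR (- x))).
  have d0 : 0 <= 1 - cut L (expR (- x)) by rewrite subr_ge0.
  by rewrite (ger0_norm d0) ler_wpM2r.
pose I L := Ex mu (fun x => cut L (expR (- pos x))).
have mcut (d : measure_display) (S : measurableType d) (X : S -> R) L :
    measurable_fun setT X -> measurable_fun setT (fun w => cut L (expR (- X w))).
  move=> mX; apply: (measurableT_comp (continuous_measurable_fun (@ccut L))).
  by apply: measurableT_comp => //; exact: measurable_funN.
have Lcut (d : measure_display) (S : measurableType d) (Q : probability S R) (X : S -> R) L :
    measurable_fun setT X -> L1 Q (fun w => cut L (expR (- X w))).
  move=> mX; apply: (@L1_bounded _ _ _ _ _ 1); first exact: mcut.
  by move=> w; have [? ?] := andP (cut01 L (expR (- X w))); rewrite ger0_norm.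
have Lf (d : measure_display) (S : measurableType d) (Q : probability S R) (X : S -> R) :
    measurable_fun setT X -> L1 Q (fun w => f (X w)).
  by move=> mX; apply: (@L1_bounded _ _ _ _ _ M) => //; exact: (measurableT_comp mf).
have mg (L : R) : 0 < L -> measurable_fun setT (g L).
  by move=> L0; exact: continuous_measurable_fun (cg L L0).
have Lg (d : measure_display) (S : measurableType d) (Q : probability S R) (X : S -> R) (L : R) :
    0 < L -> measurable_fun setT X -> L1 Q (fun w => g L (expR (- X w))).
  move=> L0 mX; apply: (@L1_bounded _ _ _ _ _ M) => //; apply: (measurableT_comp (mg L L0)).
  by apply: measurableT_comp => //; exact: measurable_funN.
have approx (d : measure_display) (S : measurableType d) (Q : probability S R) (X : S -> R) (L : R) :
    0 < L -> measurable_fun setT X -> (forall w, 0 <= X w) ->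
    `|Ex Q (fun w => f (X w)) - Ex Q (fun w => g L (expR (- X w)))|
      <= M - M * Ex Q (fun w => cut L (expR (- X w))).
  move=> L0 mX X0; have lf := Lf _ _ Q X mX; have lg := Lg _ _ Q X L L0 mX.
  have lc := Lcut _ _ Q X L mX.
  rewrite -(ExB lf lg); apply: le_trans (Ex_norm (L1B lf lg)) _.
  rewrite -(ExZ M lc) -{1}(Ex_cst Q M) -(ExB (L1_cst Q M) (L1Z M lc)).
  by apply: Ex_le; [exact: L1_norm (L1B lf lg)|exact: L1B (L1_cst _ _) (L1Z _ lc)|move=> w; exact: fg].
have Icvg : I n.+1%:R @[n --> \oo] --> (1 : R).
  rewrite -[X in _ --> X](Ex_cst mu 1); apply: (@dominated_cvg_Ex _ _ _ _ _ _ (fun=> 1)).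
  - by move=> n; exact: mcut.
  - exact: measurable_cst.
  - apply/aeW => x; apply: cvg_near_cst.
    exists (Num.bound (expR (pos x))) => // n /= hn.
    rewrite /cut; apply: min_l; rewrite le_max; apply/orP; right.
    rewrite expRN ler_pdivlMr ?expR_gt0 // mul1r; apply: ltW.
    by rewrite (lt_le_trans (archi_boundP (expR_ge0 _))) // ler_nat (leq_trans hn).
  - by move=> n w; have [? ?] := andP (cut01 n.+1%:R (expR (- pos w))); rewrite ger0_norm.
  - exact: L1_cst.
have -> : (\int[mu]_x (f x)%:E)%E = (Ex mu (fun x => f (pos x)))%:E.
  rewrite -ExE; last exact: Lf.
  apply: ae_eq_integral => //; try exact/measurable_EFinP.
    by apply/measurable_EFinP; exact: (measurableT_comp mf).
  by apply: filterS mu0 => x x0 _; rewrite /pos max_r.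
under eq_fun do rewrite ExE ?Lf //.
apply: cvg_EFin; first by exact: nearW.
apply/cvgrPdist_le => e e0.
have e4 : 0 < e / (4 * (M + 1)) by rewrite divr_gt0 // mulr_gt0 // ltr_wpDl.
(* The level is chosen from [mu] alone; for [T n] the mean of the same cutoff is close, by
   [laplace_continuous] applied to the cutoff. *)
have /cvgrPdist_le/(_ _ e4)[L _ hL] := Icvg.
have {hL}hL := hL L (leqnn L).
have L0 : (0 : R) < L.+1%:R by rewrite ltr0n.
have hI : M - M * I L.+1%:R <= e / 4.
  have h1 : 1 - I L.+1%:R <= e / (4 * (M + 1)) by apply: le_trans hL; exact: ler_norm.
  have := ler_wpM2l M0 h1.
  have -> : M * (e / (4 * (M + 1))) = e / 4 * (M / (M + 1)).
    by field; rewrite gt_eqF //; lra.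
  have : e / 4 * (M / (M + 1)) <= e / 4 * 1.
    by rewrite ler_wpM2l ?divr_ge0 ?(ltW e0) // ler_pdivrMr; lra.
  lra.
have e4' : 0 < e / 4 by rewrite divr_gt0.
have cutM u : `|M * cut L.+1%:R u| <= M.
  have [c0 c1] := andP (cut01 L.+1%:R u).
  by rewrite normrM !ger0_norm // ler_piMr.
have cMcut : continuous (fun u => M * cut L.+1%:R u).
  by move=> u; apply: cvgM; [exact: cvg_cst|exact: ccut].
have /cvgrPdist_le/(_ _ e4') h1 := laplace_continuous (cg _ L0) (fun u _ => gM L.+1%:R u).
have /cvgrPdist_le/(_ _ e4') h2 := laplace_continuous cMcut (fun u _ => cutM u).
apply: filterS2 h1 h2 => n.
rewrite !ExZ; do ?exact: Lcut.
rewrite -/(I L.+1%:R) => h1 h2.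
have a1 := approx _ _ mu pos _ L0 mpos pos0.
have a2 := approx _ _ P (T n) _ L0 (mT n) (T0 n).
rewrite -/(I L.+1%:R) in a1.
move: h1 h2 a1 a2; rewrite !ler_norml => /andP[? ?] /andP[? ?] /andP[? ?] /andP[? ?].
by rewrite /=; apply/andP; split; lra.
Qed.

End LaplaceConvergence.

(** * Laplace transform of the chi-squared law *)

Section ChiSquaredLaplace.
Context {R : realType}.
Local Notation N01 := (normal_prob 0 1 : probability (measurableTypeR R) R).

Lemma chi2_integral (r : nat) (h : measurableTypeR R -> \bar R) :
  measurable_fun setT h -> (forall x, 0 <= h x)%E ->
  (\int[chi2 r.+1]_x h x = \int[N01]_z \int[chi2 r]_y h (add_sqr (z, y)))%E.
Proof.
move=> mh h0; rewrite /= ge0_integral_distribution //.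
rewrite (fubini_tonelli1 (h \o add_sqr)) //.
  exact: measurableT_comp.
by move=> x; exact: h0.
Qed.

Lemma N01_gaussian : gaussian N01 1 (fun x : measurableTypeR R => x : R).
Proof. by split=> // A mA; rewrite -[RHS]/(N01 A). Qed.

(** The exponential times the standard density is [s] times the density with standard deviation [s],
    where [s ^+ 2 = (1 + 2 * k)^-1]. *)
Lemma gaussian_sqr_laplace (k : R) : 0 <= k ->
  (\int[N01]_z (expR (- (k * (z : R) ^+ 2)))%:E = (expR (- (2^-1 * ln (1 + 2 * k))))%:E)%E.
Proof.
move=> k0; have c0 : 0 < 1 + 2 * k by lra.
pose s := expR (- (2^-1 * ln (1 + 2 * k))).
have s0 : 0 < s := expR_gt0 _.
have s2 : s ^+ 2 = (1 + 2 * k)^-1.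
  by rewrite /s -expRM_natl mulrN mulrA divff // mul1r expRN lnK.
have mE : measurable_fun setT (fun x : R => expR (- (k * x ^+ 2))).
  apply: measurableT_comp => //; apply: measurable_funN; apply: measurable_funM => //.
rewrite (gaussian_integral N01_gaussian mE) => [|x]; last exact: expR_ge0.
transitivity (\int[lebesgue_measure]_x (s%:E * (normal_pdf 0 s x)%:E))%E.
  apply: eq_integral => x _; rewrite -EFinM; congr EFin.
  have pk : s * normal_peak s = normal_peak 1.
    rewrite /normal_peak -!mulrnAr sqrtrM ?sqr_ge0 // sqrtr_sqr (gtr0_norm s0).
    by rewrite expr1n mul1r invfM mulrA divff ?gt_eqF // mul1r.
  rewrite !normal_pdfE ?gt_eqF // [RHS]mulrA pk mulrCA; congr (_ * _).
  rewrite /normal_fun -expRD s2 !subr0; congr expR.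
  have aux (z : R) : - (k * z) + - z / 2 = - z * ((1 + 2 * k) * 2^-1) by field.
  by rewrite expr1n -[X in _ = _ / X]mulr_natr invfM invrK aux.
rewrite ge0_integralZl //.
- by rewrite integral_normal_pdf mule1.
- by apply: measurableT_comp => //; exact: measurable_normal_pdf.
- by move=> x _; rewrite lee_fin normal_pdf_ge0.
- by rewrite lee_fin ltW.
Qed.

Lemma chi2_laplace (r : nat) (k : R) : 0 <= k ->
  (\int[chi2 r]_x (expR (- (k * (x : R))))%:E = (expR (- (r%:R / 2 * ln (1 + 2 * k))))%:E)%E.
Proof.
move=> k0.
have mE : measurable_fun setT (fun x : measurableTypeR R => (expR (- (k * (x : R))))%:E).
  apply/measurable_EFinP; apply: measurableT_comp => //; apply: measurable_funN.
  exact: measurable_funM.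
elim: r => [|r IH].
  by rewrite /= integral_dirac // diracT mul1e mulr0 mul0r mul0r.
rewrite chi2_integral //.
transitivity (\int[N01]_z ((expR (- (k * (z : R) ^+ 2)))%:E * (expR (- (r%:R / 2 * ln (1 + 2 * k))))%:E))%E.
  apply: eq_integral => z _; rewrite -IH -ge0_integralZl //.
  - apply: eq_integral => y _; rewrite -EFinM -expRD; congr ((expR _)%:E).
    by rewrite /add_sqr /=; ring.
rewrite ge0_integralZr //.
- rewrite gaussian_sqr_laplace // -EFinM -expRD; congr ((expR _)%:E).
  by rewrite -natr1; field.
- apply/measurable_EFinP; apply: measurableT_comp => //; apply: measurable_funN.
  by apply: measurable_funM => //; exact: measurable_funX.
Qed.

Lemma chi2_ge0 (r : nat) : {ae chi2 r, forall x : measurableTypeR R, 0 <= (x : R)}.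
Proof.
have mA : measurable [set x : measurableTypeR R | (x : R) < 0].
  by rewrite -set_itvNyo; exact: measurable_itv.
suff h : chi2 r [set x : measurableTypeR R | (x : R) < 0] = 0%E.
  by exists [set x : measurableTypeR R | (x : R) < 0]; split => // x /= /negP; rewrite -ltNge.
elim: r => [|r IH]; first by rewrite /= diracE memNset //= ltxx.
set A := [set x : measurableTypeR R | (x : R) < 0] in mA IH *.
have mB : measurable (add_sqr @^-1` A) by rewrite -[X in measurable X]setTI; exact: measurable_funP.
rewrite /= /distribution /pushforward /product_measure1 /=.
rewrite -[RHS](integral0 N01 setT); apply: eq_integral => z _ /=.
apply: (subset_measure0 _ mA _ IH) => //; first exact: measurable_xsection.
move=> y; rewrite /xsection /= inE /A /add_sqr /= => h.
by apply: le_lt_trans h; rewrite lerDr sqr_ge0.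
Qed.

End ChiSquaredLaplace.

(** * Lipschitz diffusions and discretization error *)

Section Pathwise.
Context {R : realType}.

(** One Euler step is accurate to [e * (t - s)], uniformly on bounded time intervals. In this form
    the equation contains no integral, passes to stacked processes, and gives the convergence of
    both Riemann sums and Euler schemes. *)
Definition euler_consistent d r (B : 'cV[R]_d -> 'cV[R]_d) (S : 'M[R]_(d, r))
    (W : R -> 'cV[R]_r) (Y : R -> 'cV[R]_d) :=
  forall T e : R, 0 < e -> exists2 D : R, 0 < D & forall s t : R,
    0 <= s -> s <= t -> t <= T -> t - s <= D ->
    enorm (Y t - Y s - S *m (W t - W s) - (t - s) *: B (Y s)) <= e * (t - s).

Lemma lipschitz_pos d (B : 'cV[R]_d -> 'cV[R]_d) : glob_lipschitz B ->
  exists2 L : R, 0 < L & forall x y, enorm (B x - B y) <= L * enorm (x - y).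
Proof.
move=> [L hL]; exists (`|L| + 1); first by rewrite ltr_wpDl.
move=> x y; apply: le_trans (hL x y) _; rewrite ler_wpM2r ?enorm_ge0 //.
by have := ler_norm L; lra.
Qed.

Let abs_dev (I a c d : R) : I <= (a + c) * d -> (a - c) * d <= I -> `|I - d * a| <= c * d.
Proof. by move=> h1 h2; rewrite ler_norml; apply/andP; split; lra. Qed.

Lemma integral_deviation (f : R -> R) (s t e : R) : 0 <= s -> s <= t ->
  {within `[0, t], continuous f} -> (forall u, s <= u <= t -> `|f u - f s| <= e) ->
  `|\int[lebesgue_measure]_(u in `[0, t]) f u - \int[lebesgue_measure]_(u in `[0, s]) f u
    - (t - s) * f s| <= e * (t - s).
Proof.
move=> s0 st cf fe.
have If : (@lebesgue_measure R).-integrable `[0, t] (EFin \o f).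
  by apply: continuous_compact_integrable => //; exact: segment_compact.
have If' : (@lebesgue_measure R).-integrable `]s, t] (EFin \o f).
  apply: integrableS If => //; apply: subset_itvr; by rewrite bnd_simp.
rewrite Rintegral_itvB ?bnd_simp //.
have mu_st : fine (@lebesgue_measure R `]s, t]) = t - s.
  rewrite lebesgue_measure_itv /= lte_fin; case: ltP => [//|ts].
  have -> : t = s by apply/eqP; rewrite eq_le ts st.
  by rewrite subrr.
have Ic (c : R) : (@lebesgue_measure R).-integrable `]s, t] (EFin \o (fun=> c)).
  have : (@lebesgue_measure R).-integrable `[0, t] (EFin \o (fun=> c)).
    apply: continuous_compact_integrable; first exact: segment_compact.
    by apply: continuous_subspaceT => x; exact: cvg_cst.
  by apply: integrableS => //; apply: subset_itvr; rewrite bnd_simp.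
have up : \int[lebesgue_measure]_(u in `]s, t]) f u <= (f s + e) * (t - s).
  rewrite -mu_st -Rintegral_cst //; apply: le_Rintegral => // u.
  rewrite /= in_itv /= => /andP[su ut].
  by have := fe u; rewrite ut (ltW su) => /(_ isT); rewrite ler_norml => /andP[]; lra.
have lo : (f s - e) * (t - s) <= \int[lebesgue_measure]_(u in `]s, t]) f u.
  rewrite -mu_st -Rintegral_cst //; apply: le_Rintegral => // u.
  rewrite /= in_itv /= => /andP[su ut].
  by have := fe u; rewrite ut (ltW su) => /(_ isT); rewrite ler_norml => /andP[]; lra.
exact: abs_dev.
Qed.

Lemma integral_equation_consistent d r (B : 'cV[R]_d -> 'cV[R]_d) (S : 'M[R]_(d, r))
    (W : R -> 'cV[R]_r) (Y : R -> 'cV[R]_d) (c : 'cV[R]_d) :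
  glob_lipschitz B -> {within `[0, +oo[, continuous Y} ->
  (forall t, 0 <= t -> forall i, Y t i 0 = c i 0
     + \int[lebesgue_measure]_(s in `[0, t]) (B (Y s) i 0) + (S *m W t) i 0) ->
  euler_consistent B S W Y.
Proof.
move=> /lipschitz_pos[L L0 hL] cY eqY T e e0.
pose sd := Num.sqrt (d * 1)%:R : R.
have sd0 : 0 <= sd by exact: sqrtr_ge0.
(* The factors [sd + 1] pay for passing from sup norm to Euclidean norm, once for the result and
   once for the argument of [B]. *)
pose e1 := e / (sd + 1); have e10 : 0 < e1 by rewrite divr_gt0 // ltr_wpDl.
pose e2 := e1 / (L * (sd + 1)).
have e20 : 0 < e2 by rewrite divr_gt0 // mulr_gt0 // ltr_wpDl.
have sub t : `[0, t] `<=` `[(0 : R), +oo[ by apply: subset_itvl; rewrite bnd_simp.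
have cYt t : {within `[0, t], continuous Y} by apply: continuous_subspaceW cY.
have [D D0 hD] := uniformly_continuous_within (@segment_compact R 0 T) (@cYt T) e20.
have BY u v : 0 <= u <= T -> 0 <= v <= T -> `|u - v| <= D -> enorm (B (Y u) - B (Y v)) <= e1.
  move=> hu hv uv; apply: le_trans (hL _ _) _.
  have h : `|Y u - Y v| <= e2 by apply: hD; rewrite //= in_itv.
  apply: le_trans (_ : L * (sd * e2) <= _).
    rewrite ler_pM2l //; apply: le_trans (enorm_le_norm _) _.
    by rewrite ler_wpM2l.
  have -> : L * (sd * e2) = e1 * (sd / (sd + 1)).
    by rewrite /e2; field; rewrite !gt_eqF // ltr_wpDl.
  by rewrite ler_piMr ?(ltW e10) // ler_pdivrMr ?ltr_wpDl //; lra.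
exists D => // s t s0 st tT tsD.
have t0 : 0 <= t by exact: le_trans st.
have ent i : `|(Y t - Y s - S *m (W t - W s) - (t - s) *: B (Y s)) i 0| <= e1 * (t - s).
  pose f u := B (Y u) i 0.
  have cf : {within `[0, t], continuous f}.
    apply/subspace_continuousP => u hu; apply/cvgrPdist_le => z z0.
    have z1 : 0 < z / (L * (sd + 1)) by rewrite divr_gt0 // mulr_gt0 // ltr_wpDl.
    have /subspace_continuousP/(_ u hu)/cvgrPdist_le/(_ _ z1) := @cYt t.
    apply: filterS => v hv.
    have -> : f u - f v = (B (Y u) - B (Y v)) i 0 by rewrite !mxE.
    apply: le_trans (enorm_entry _ _ _) _; apply: le_trans (hL _ _) _.
    apply: le_trans (_ : L * (sd * (z / (L * (sd + 1)))) <= _).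
      rewrite ler_pM2l //; apply: le_trans (enorm_le_norm _) _.
      by rewrite ler_wpM2l.
    have -> : L * (sd * (z / (L * (sd + 1)))) = z * (sd / (sd + 1)).
      by field; rewrite !gt_eqF // ltr_wpDl.
    by rewrite ler_piMr ?(ltW z0) // ler_pdivrMr ?ltr_wpDl //; lra.
  have := @integral_deviation f s t e1 s0 st cf _.
  rewrite mulmxBr !mxE (eqY t t0 i) (eqY s s0 i) !mxE.
  set I1 := \int[lebesgue_measure]_(u in _) _.
  set I2 := \int[lebesgue_measure]_(u in _) _.
  set a1 := \sum_ _ _; set a2 := \sum_ _ _.
  have -> : c i 0 + I1 + a1 - (c i 0 + I2 + a2) - (a1 - a2) - (t - s) * B (Y s) i 0 = I1 - I2 - (t - s) * f s.
    by rewrite /f; ring.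
  apply=> u /andP[su ut].
  have -> : f u - f s = (B (Y u) - B (Y s)) i 0 by rewrite !mxE.
  apply: le_trans (enorm_entry _ _ _) _; apply: BY.
  - by rewrite (le_trans s0 su) (le_trans ut tT).
  - by rewrite s0 (le_trans st tT).
  - by rewrite ger0_norm ?subr_ge0 //; lra.
apply: le_trans (enorm_le_norm _) _; rewrite -/sd.
have nb : `|Y t - Y s - S *m (W t - W s) - (t - s) *: B (Y s)| <= e1 * (t - s).
  apply/mx_normrP => [|i j]; first by rewrite mulr_ge0 ?(ltW e10) ?subr_ge0.
  by rewrite (ord1 j).
apply: le_trans (ler_wpM2l sd0 nb) _.
rewrite mulrA ler_wpM2r ?subr_ge0 //.
have -> : sd * e1 = e * (sd / (sd + 1)) by rewrite /e1; field; rewrite gt_eqF // ltr_wpDl.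
by rewrite ler_piMr ?(ltW e0) // ler_pdivrMr ?ltr_wpDl //; lra.
Qed.

Lemma enorm_telescope d (Z : nat -> 'cV[R]_d) (c : R) m :
  (forall l, (l < m)%N -> enorm (Z l.+1 - Z l) <= c) -> enorm (Z m - Z 0%N) <= m%:R * c.
Proof.
elim: m => [|m IH] h; first by rewrite subrr enorm0 mul0r.
have -> : Z m.+1 - Z 0%N = (Z m.+1 - Z m) + (Z m - Z 0%N) by rewrite addrA subrK.
apply: le_trans (ler_enormD _ _) _; rewrite -natr1 mulrDl mul1r addrC lerD ?h //.
by apply: IH => l lm; apply: h; exact: ltnW.
Qed.

(** One-step errors telescope over a uniform grid; with tolerance [e / (t - s + 1)] per unit of time
    their sum is at most [e]. *)
Lemma riemann_cvg d r (B : 'cV[R]_d -> 'cV[R]_d) (S : 'M[R]_(d, r))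
    (W : R -> 'cV[R]_r) (Y : R -> 'cV[R]_d) (s t : R) :
  euler_consistent B S W Y -> 0 <= s -> s <= t ->
  enorm (Y t - Y s - S *m (W t - W s)
    - ((t - s) / m.+1%:R) *: \sum_(l < m.+1) B (Y (s + l%:R * ((t - s) / m.+1%:R))))
    @[m --> \oo] --> 0.
Proof.
move=> cons s0 st; apply/cvgrPdist_le => e e0.
have e1 : 0 < e / (t - s + 1) by rewrite divr_gt0 // ltr_wpDl ?subr_ge0.
have [D D0 hD] := cons t _ e1.
have [N hN] : exists N : nat, (t - s) / D < N.+1%:R.
  exists (Num.bound ((t - s) / D)); apply: lt_le_trans (archi_boundP _) _.
    by rewrite divr_ge0 ?subr_ge0 // ltW.
  by rewrite ler_nat.
exists N => // m /= Nm.
rewrite sub0r normrN ger0_norm ?enorm_ge0 //.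
set n := m.+1; set et := (t - s) / n%:R.
have n0 : 0 < n%:R :> R by rewrite ltr0n.
have et0 : 0 <= et by rewrite divr_ge0 ?subr_ge0.
have etn : n%:R * et = t - s by rewrite /et mulrC divfK ?gt_eqF.
have etD : et <= D.
  rewrite /et ler_pdivrMr // mulrC -ler_pdivrMr //; apply: ltW; apply: lt_le_trans hN _.
  by rewrite ler_nat ltnS.
pose Z (l : nat) := Y (s + l%:R * et) - S *m W (s + l%:R * et)
   - et *: \sum_(i < l) B (Y (s + i%:R * et)).
have -> : Y t - Y s - S *m (W t - W s) - et *: \sum_(l < n) B (Y (s + l%:R * et)) = Z n - Z 0%N.
  rewrite /Z etn big_ord0 scaler0 subr0 mul0r addr0 addrCA subrr addr0 mulmxBr !opprB.
  by apply/matrixP => i j; rewrite !mxE; ring.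
apply: le_trans (@enorm_telescope d Z (e / (t - s + 1) * et) n _) _; last first.
  rewrite mulrCA etn mulrAC -mulrA ler_piMr ?(ltW e0) // ler_pdivrMr ?ltr_wpDl ?subr_ge0 //; lra.
move=> l ln.
have et1 : s + l.+1%:R * et - (s + l%:R * et) = et by rewrite -natr1; ring.
have := hD (s + l%:R * et) (s + l.+1%:R * et) _ _ _; rewrite et1.
have -> : Y (s + l.+1%:R * et) - Y (s + l%:R * et) - S *m (W (s + l.+1%:R * et) - W (s + l%:R * et))
   - et *: B (Y (s + l%:R * et)) = Z l.+1 - Z l.
  rewrite /Z big_ord_recr /= scalerDr mulmxBr !opprB !opprD.
  set y1 := Y _; set y0 := Y _; set w1 := S *m _; set w0 := S *m _.
  set b := et *: B _; set sm := et *: _.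
  by apply/matrixP => i j; rewrite !mxE; ring.
apply=> //.
- by rewrite addr_ge0 // mulr_ge0.
- by rewrite lerD2l ler_wpM2r // ler_nat.
- by rewrite addrC -lerBrDr -etn ler_wpM2r // ler_nat.
Qed.

Fixpoint euler d r (B : 'cV[R]_d -> 'cV[R]_d) (S : 'M[R]_(d, r)) (c : 'cV[R]_d)
    (et : R) (dW : nat -> 'cV[R]_r) (l : nat) : 'cV[R]_d :=
  if l is l'.+1 then
    let y := euler B S c et dW l' in y + et *: B y + S *m dW l'
  else c.

(** Discrete Gronwall: a step multiplies the accumulated error by [1 + L * et] and adds [e * et];
    both fit under [e * x * expR (L * x)] at time [x]. *)
Lemma euler_error d r (B : 'cV[R]_d -> 'cV[R]_d) (S : 'M[R]_(d, r)) (c : 'cV[R]_d)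
    (W : R -> 'cV[R]_r) (Y : R -> 'cV[R]_d) (L et e : R) (n : nat) :
  0 < L -> (forall x y, enorm (B x - B y) <= L * enorm (x - y)) -> 0 <= et -> 0 <= e ->
  Y 0 = c ->
  (forall l, (l < n)%N -> enorm (Y (l.+1%:R * et) - Y (l%:R * et)
     - S *m (W (l.+1%:R * et) - W (l%:R * et)) - et *: B (Y (l%:R * et))) <= e * et) ->
  forall l, (l <= n)%N -> enorm (Y (l%:R * et)
     - euler B S c et (fun l => W (l.+1%:R * et) - W (l%:R * et)) l)
    <= e * (l%:R * et) * expR (L * (l%:R * et)).
Proof.
move=> L0 hL et0 e0 Y0 h; elim=> [|l IH] ln.
  by rewrite /= !mul0r Y0 subrr enorm0 mulr0 mul0r.
have {}IH := IH (ltnW ln); have {}h := h l ln.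
set dW := fun l => W (l.+1%:R * et) - W (l%:R * et) in IH *.
rewrite /= -/dW; set E := euler B S c et dW l in IH *.
have -> : Y (l.+1%:R * et) - (E + et *: B E + S *m dW l) =
  (Y (l.+1%:R * et) - Y (l%:R * et) - S *m dW l - et *: B (Y (l%:R * et)))
  + (Y (l%:R * et) - E) + et *: (B (Y (l%:R * et)) - B E).
  by apply/matrixP => i j; rewrite !mxE; ring.
apply: le_trans (ler_enormD _ _) _; rewrite enormZ (ger0_norm et0).
set x := l%:R * et in IH h *.
have x0 : 0 <= x by rewrite mulr_ge0.
have xe : l.+1%:R * et = x + et by rewrite /x -natr1; ring.
have dWE : dW l = W (x + et) - W x by rewrite /dW xe.
rewrite xe dWE; rewrite xe in h.
have h1 : enorm (B (Y x) - B E) <= L * enorm (Y x - E) := hL _ _.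
set a := enorm (Y x - E) in IH h1 *.
have a0 : 0 <= a := enorm_ge0 _.
have h2 : a * (1 + L * et) <= e * x * expR (L * (x + et)).
  rewrite [L * (x + et)]mulrDr expRD mulrA; apply: ler_pM => //; first by rewrite addr_ge0 // mulr_ge0 // ltW.
  exact: expR_ge1Dx.
have h3 : e * et * 1 <= e * et * expR (L * (x + et)).
  by rewrite ler_wpM2l ?mulr_ge0 // -[leLHS]expR0 ler_expR mulr_ge0 ?(ltW L0) // addr_ge0.
have h4 : et * enorm (B (Y x) - B E) <= et * (L * a) by rewrite ler_wpM2l.
apply: le_trans (lerD (ler_enormD _ _) h4) _.
rewrite (_ : e * (x + et) * expR (L * (x + et)) =
  e * et * expR (L * (x + et)) + e * x * expR (L * (x + et))); last by ring.
rewrite -/a; lra.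
Qed.

(** The mesh [h / m.+1] divides [h], so the time [i%:R * h] is the grid point of index
    [i * m.+1]. *)
Lemma euler_cvg d r (B : 'cV[R]_d -> 'cV[R]_d) (S : 'M[R]_(d, r)) (c : 'cV[R]_d)
    (W : R -> 'cV[R]_r) (Y : R -> 'cV[R]_d) (h : R) (i : nat) :
  glob_lipschitz B -> euler_consistent B S W Y -> Y 0 = c -> 0 < h ->
  enorm (Y (i%:R * h) - euler B S c (h / m.+1%:R)
     (fun l => W (l.+1%:R * (h / m.+1%:R)) - W (l%:R * (h / m.+1%:R))) (i * m.+1))
    @[m --> \oo] --> 0.
Proof.
move=> /lipschitz_pos[L L0 hL] cons Y0 h0; apply/cvgrPdist_le => e e0.
set T := i%:R * h; have T0 : 0 <= T by rewrite mulr_ge0 // ltW.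
pose C := T * expR (L * T) + 1.
have C0 : 0 < C by rewrite ltr_wpDl // mulr_ge0 ?expR_ge0.
have e1 : 0 < e / C by rewrite divr_gt0.
have [D D0 hD] := cons T _ e1.
have hD0 : 0 <= h / D by rewrite divr_ge0 // ltW.
exists (Num.bound (h / D)) => // m /= Nm.
rewrite sub0r normrN ger0_norm ?enorm_ge0 //.
set n := m.+1; set et := h / n%:R.
have n0 : 0 < n%:R :> R by rewrite ltr0n.
have et0 : 0 <= et by rewrite divr_ge0 // ltW.
have etn : n%:R * et = h by rewrite /et mulrC divfK ?gt_eqF.
have etD : et <= D.
  rewrite /et ler_pdivrMr // mulrC -ler_pdivrMr //; apply: ltW; apply: lt_le_trans (archi_boundP hD0) _.
  by rewrite ler_nat (leq_trans Nm).
have TE : T = (i * n)%:R * et by rewrite natrM -mulrA etn.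
have := @euler_error d r B S c W Y L et (e / C) (i * n) L0 hL et0 (ltW e1) Y0 _ (i * n) (leqnn _).
rewrite -TE; move=> H; apply: le_trans (H _) _; last first.
  rewrite -mulrA mulrAC -mulrA ler_piMr ?(ltW e0) // ler_pdivrMr // mul1r /C; lra.
move=> l li; have et1 : l.+1%:R * et - l%:R * et = et by rewrite -natr1; ring.
have := hD (l%:R * et) (l.+1%:R * et) _ _ _; rewrite et1; apply => //.
- by rewrite mulr_ge0.
- by rewrite ler_wpM2r // ler_nat.
- by rewrite TE ler_wpM2r // ler_nat.
Qed.

End Pathwise.

(** * Measurability of functions of random vectors *)

Section VectorMeasurability.
Context {R : realType}.

Lemma borel_coord d (T : measurableType d) m n (Z : T -> 'M[R]_(m, n)) i j :
  measurable_fun setT (Z : T -> borel R m n) -> measurable_fun setT (fun w => Z w i j).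
Proof.
move=> mZ.
suff h : measurable_fun setT (fun M : borel R m n => (M : 'M[R]_(m, n)) i j).
  exact: (measurableT_comp h mZ).
apply: (measurability _ (RGenOpens.measurableE R)) => _ [_ [a [b ->] <-]].
rewrite setTI; apply: sub_gen_smallest.
apply: open_comp; last exact: interval_open.
by move=> M _; exact: coord_continuous.
Qed.

Lemma measurable_enorm d (T : measurableType d) m n (Z : T -> 'M[R]_(m, n)) :
  (forall i j, measurable_fun setT (fun w => Z w i j)) ->
  measurable_fun setT (fun w => enorm (Z w)).
Proof.
move=> mZ; apply: (measurableT_comp (continuous_measurable_fun (@sqrt_continuous R))).
by apply: measurable_sum => i; apply: measurable_sum => j; exact: measurable_funX.
Qed.

Lemma rat_approx n (x : 'cV[R]_n) (e : R) : 0 < e ->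
  exists q : 'cV[rat]_n, enorm (x - map_mx (@ratr R) q) <= e.
Proof.
move=> e0.
have [e1 e10 he] : exists2 e1 : R, 0 < e1 & Num.sqrt (n * 1)%:R * e1 <= e.
  exists (e / (Num.sqrt (n * 1)%:R + 1)); first by rewrite divr_gt0 // ltr_wpDl // sqrtr_ge0.
  have s0 : 0 <= Num.sqrt (n * 1)%:R :> R by exact: sqrtr_ge0.
  by rewrite mulrCA ler_piMr ?(ltW e0) // ler_pdivrMr ?ltr_wpDl //; lra.
have hq i : exists q : rat, `|x i 0 - ratr q| <= e1.
  have lt1 : x i 0 - e1 < x i 0 by rewrite ltrBlDr ltrDl.
  have [q] := rat_in_itvoo lt1.
  rewrite in_itv /= => /andP[h1 h2]; exists q.
  by rewrite ger0_norm; lra.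
have [q hq'] := choice hq.
exists (\col_i q i); apply: le_trans (enorm_le_norm _) _; apply: le_trans he.
rewrite ler_wpM2l ?sqrtr_ge0 //; apply/mx_normrP; first exact: ltW.
by move=> i j; rewrite (ord1 j) !mxE.
Qed.

(** A Lipschitz [f] is the infimum of the cones [f q + L * enorm (x - q)] over rational points [q],
    so a sublevel set is a countable union. Any sigma-algebra making the coordinates measurable is
    allowed, such as one generated by past increments. *)
Lemma lipschitz_measurable d (T : measurableType d) n (Z : T -> 'cV[R]_n)
    (f : 'cV[R]_n -> R) (L : R) : 0 < L ->
  (forall x y, `|f x - f y| <= L * enorm (x - y)) ->
  (forall i, measurable_fun setT (fun w => Z w i 0)) ->
  measurable_fun setT (fun w => f (Z w)).
Proof.
move=> L0 hf mZ; apply: (measurability _ (RGenInftyO.measurableE R)) => _ [_ [a ->] <-].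
rewrite setTI.
pose Rq (q : 'cV[rat]_n) : 'cV[R]_n := map_mx (@ratr R) q.
have -> : (fun w => f (Z w)) @^-1` `]-oo, a[ =
    \bigcup_(q in [set: 'cV[rat]_n]) [set w | f (Rq q) + L * enorm (Z w - Rq q) < a].
  apply/seteqP; split=> w /=.
    rewrite in_itv /= => fa.
    have e0 : 0 < (a - f (Z w)) / (4 * L) by rewrite divr_gt0 ?subr_gt0 // mulr_gt0.
    have [q hq] := rat_approx (Z w) e0; exists q => //=.
    have h1 : L * enorm (Z w - Rq q) <= (a - f (Z w)) / 4.
      have -> : (a - f (Z w)) / 4 = L * ((a - f (Z w)) / (4 * L)) by field; rewrite gt_eqF.
      by rewrite ler_pM2l.
    have := hf (Z w) (Rq q); rewrite ler_norml => /andP[]; lra.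
  move=> [q _ /=] h; rewrite in_itv /=.
  have := hf (Z w) (Rq q); rewrite ler_norml => /andP[]; lra.
apply: countable_bigcupT_measurable; first exact: countableP.
move=> q; rewrite -[X in measurable X]setTI.
have mg : measurable_fun setT (fun w => f (Rq q) + L * enorm (Z w - Rq q)).
  apply: measurable_funD => //; apply: measurable_funM => //; apply: measurable_enorm => i j.
  have -> : (fun w => (Z w - Rq q) i j) = (fun w => Z w i 0 - ratr (q i 0)).
    by apply/funext => w; rewrite (ord1 j) !mxE.
  by apply: measurable_funD => //; exact: mZ.
have := mg measurableT `]-oo, a[%classic (measurable_itv _).
by congr (measurable (_ `&` _)); apply/seteqP; split=> w /=; rewrite in_itv.
Qed.

End VectorMeasurability.

Lemma sqn_colE {R : realType} n (x : 'cV[R]_n) : sqn x = \sum_i x i 0 ^+ 2.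
Proof. by apply: eq_bigr => i _; rewrite big_ord1. Qed.

Lemma measurable_sqn {R : realType} d (T : measurableType d) n (Z : T -> 'cV[R]_n) :
  (forall i, measurable_fun setT (fun w => Z w i 0)) -> measurable_fun setT (fun w => sqn (Z w)).
Proof.
move=> mZ; under eq_fun do rewrite sqn_colE.
by apply: measurable_sum => i; exact: measurable_funX.
Qed.

Section Fatou.
Context {R : realType} {disp : measure_display} {Om : measurableType disp}.
Variable P : probability Om R.

Lemma Ex_fatou (F : nat -> Om -> R) (f : Om -> R) (C : R) :
  (forall n, L1 P (F n)) -> (forall n w, 0 <= F n w) -> (forall n, Ex P (F n) <= C) ->
  measurable_fun setT f -> (forall w, 0 <= f w) ->
  {ae P, forall w, F n w @[n --> \oo] --> f w} ->
  L1 P f /\ Ex P f <= C.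
Proof.
move=> LF F0 FC mf f0 Ff.
have mF n : measurable_fun setT (EFin \o F n) by apply/measurable_EFinP; exact: L1_measurable.
have [N [mN N0 hN]] := Ff.
have aeN : {ae P, forall w, ~ N w}.
  by exists N; split=> // w /= /notP.
(* Off the null set nothing changes and on it everything is 0, so the lower limit can be computed at
   every point. *)
pose G n w := (F n w * \1_(~` N) w)%:E : \bar R.
have mI : measurable_fun setT (\1_(~` N) : Om -> R) by apply: measurable_indic; exact: measurableC.
have mG n : measurable_fun setT (G n).
  by apply/measurable_EFinP; apply: measurable_funM => //; exact: L1_measurable.
have GE w : ~ N w -> \1_(~` N) w = 1 :> R by move=> nw; rewrite indicE mem_set.
have GE0 w : N w -> \1_(~` N) w = 0 :> R by move=> nw; rewrite indicE memNset.
have key : (\int[P]_w (f w)%:E <= C%:E)%E.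
  have -> : (\int[P]_w (f w)%:E = \int[P]_w limn_einf (G^~ w))%E.
    have lE w : limn_einf (G^~ w) = (f w * \1_(~` N) w)%:E.
      apply: (cvg_limn_einf_sup _).1; apply: cvg_EFin; first exact: nearW.
      have [nw|nw] := pselect (N w).
        have -> : fine \o G^~ w = fun=> 0.
          by apply/funext => n; rewrite /G /= GE0 // mulr0.
        by rewrite GE0 // mulr0; exact: cvg_cst.
      have -> : fine \o G^~ w = F^~ w by apply/funext => n; rewrite /G /= GE // mulr1.
      rewrite GE // mulr1.
      by apply: contrapT => h; apply: nw; apply: hN.
    under [RHS]eq_integral do rewrite lE.
    apply: ae_eq_integral => //; try exact/measurable_EFinP.
      by apply/measurable_EFinP; exact: measurable_funM.
    by apply: filterS aeN => w nw _; rewrite GE // mulr1.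
  apply: le_trans (fatou _ measurableT mG _) _ => //.
    by move=> n w _; rewrite lee_fin mulr_ge0.
  have leC n : (\int[P]_w G n w <= C%:E)%E.
    apply: le_trans (_ : \int[P]_w (F n w)%:E <= _)%E; last by rewrite ExE // lee_fin.
    apply: ge0_le_integral => //.
    - by move=> w _; rewrite lee_fin mulr_ge0.
    - exact: mF.
    - by move=> w _; rewrite lee_fin ler_piMr // indicE lern1 leq_b1.
  rewrite limn_einf_lim; apply: lime_le; first exact: is_cvg_einfs.
  apply: nearW => n; apply: le_trans (leC n); apply: ereal_inf_lbound.
  by exists n => /=.
have Lf : L1 P f.
  apply/integrableP; split; first exact/measurable_EFinP.
  under eq_integral do rewrite gee0_abs ?lee_fin //.
  by rewrite (le_lt_trans key) // ltry.
by split=> //; rewrite -lee_fin -ExE.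
Qed.

End Fatou.

(** * Moments of Lipschitz systems *)

Section SystemMoments.
Context {R : realType} {disp : measure_display} {Om : measurableType disp}.
Variable P : probability Om R.
Variables (d r : nat) (B : 'cV[R]_d -> 'cV[R]_d) (S : 'M[R]_(d, r)) (c : 'cV[R]_d).
Variables (W : R -> Om -> 'cV[R]_r) (Y : R -> Om -> 'cV[R]_d).

(** The interface between the latent equations and the asymptotics. The fourth moment of [Y] is
    there because products of drift and noise are estimated in mean square. *)
Definition ito_system := [/\
  (forall (t : R) i, 0 <= t -> measurable_fun setT (fun w => W t w i 0)) /\
  (forall (t : R) i, 0 <= t -> measurable_fun setT (fun w => Y t w i 0)),
  {ae P, forall w, Y 0 w = c /\ euler_consistent B S (W^~ w) (Y^~ w)},
  forall s t (i : 'I_r), 0 <= s -> s < t ->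
    gaussian P (Num.sqrt (t - s)) (fun w => (W t w - W s w) i 0),
  forall (m : nat) (u : nat -> R), 0 <= u 0%N -> (forall k, u k < u k.+1) ->
    indep_rvs P (fun ki : 'I_m * 'I_r => fun w =>
      (W (u ki.1.+1) w - W (u ki.1) w) ki.2 0) &
  exists2 C : R, 0 <= C & forall t : R, 0 <= t ->
    L1 P (fun w => sqn (Y t w) ^+ 2) /\ Ex P (fun w => sqn (Y t w) ^+ 2) <= C].

Hypothesis lipB : glob_lipschitz B.
Hypothesis sys : ito_system.

Let mW (t : R) i : 0 <= t -> measurable_fun setT (fun w => W t w i 0).
Proof. by move=> t0; case: sys => -[h _] _ _ _ _; exact: h. Qed.

Let mY (t : R) i : 0 <= t -> measurable_fun setT (fun w => Y t w i 0).
Proof. by move=> t0; case: sys => -[_ h] _ _ _ _; exact: h. Qed.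

Lemma lipschitz_entry_measurable (Z : Om -> 'cV[R]_d) i :
  (forall i, measurable_fun setT (fun w => Z w i 0)) ->
  measurable_fun setT (fun w => B (Z w) i 0).
Proof.
move=> mZ; have [L L0 hL] := lipschitz_pos lipB.
apply: (@lipschitz_measurable _ _ _ _ Z (fun x => B x i 0) L L0) => // x y.
by apply: le_trans (hL x y); rewrite -[X in `|X|](_ : (B x - B y) i 0 = _) ?enorm_entry // !mxE.
Qed.

Let mB (t : R) i : 0 <= t -> measurable_fun setT (fun w => B (Y t w) i 0).
Proof. by move=> t0; apply: lipschitz_entry_measurable => j; exact: mY. Qed.

Lemma drift_moment : exists2 C : R, 0 <= C & forall t : R, 0 <= t ->
  [/\ L1 P (fun w => sqn (B (Y t w)) ^+ 2), Ex P (fun w => sqn (B (Y t w)) ^+ 2) <= C,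
      L1 P (fun w => sqn (B (Y t w))) & Ex P (fun w => sqn (B (Y t w))) <= C].
Proof.
have [L L0 hL] := lipschitz_pos lipB.
have [_ _ _ _ [C C0 hC]] := sys.
pose b0 := sqn (B 0); have b00 : 0 <= b0 := sqn_ge0 _.
have bnd y : sqn (B y) <= 2 * b0 + 2 * L ^+ 2 * sqn y.
  have -> : B y = B 0 + (B y - B 0) by rewrite addrC subrK.
  apply: le_trans (sqnD _ _) _; rewrite lerD2l -mulrA ler_pM2l //.
  have := hL y 0; rewrite subr0 => h.
  rewrite -!enorm_sqr -exprMn lerXn2r ?nnegrE ?enorm_ge0 // mulr_ge0 ?enorm_ge0 //; exact: ltW.
pose C2 := 8 * b0 ^+ 2 + 8 * L ^+ 4 * C.
have C20 : 0 <= C2.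
  have a1 : 0 <= 8 * b0 ^+ 2 by rewrite mulr_ge0 ?sqr_ge0.
  have a2 : 0 <= 8 * L ^+ 4 * C by rewrite !mulr_ge0 ?exprn_ge0 // ltW.
  by rewrite addr_ge0.
exists (1 + C2) => [|t t0]; first by rewrite addr_ge0.
have [l1 e1] := hC t t0.
have ms : measurable_fun setT (fun w => sqn (B (Y t w))).
  by apply: measurable_sqn => i; exact: mB.
have bnd2 w : sqn (B (Y t w)) ^+ 2 <= 8 * b0 ^+ 2 + 8 * L ^+ 4 * sqn (Y t w) ^+ 2.
  set a := sqn (B (Y t w)); set y := sqn (Y t w).
  have h := bnd (Y t w); rewrite -/a -/y in h.
  have a0 : 0 <= a := sqn_ge0 _; have y0 : 0 <= y := sqn_ge0 _.
  apply: le_trans (_ : (2 * b0 + 2 * L ^+ 2 * y) ^+ 2 <= _).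
    by rewrite lerXn2r ?nnegrE // (le_trans a0).
  have h2 := sqr_ge0 (2 * b0 - 2 * L ^+ 2 * y).
  rewrite (_ : 8 * b0 ^+ 2 + 8 * L ^+ 4 * y ^+ 2 =
    (2 * b0 + 2 * L ^+ 2 * y) ^+ 2 + (2 * b0 - 2 * L ^+ 2 * y) ^+ 2); last by ring.
  by rewrite lerDl.
have LD : L1 P (fun w => 8 * b0 ^+ 2 + 8 * L ^+ 4 * sqn (Y t w) ^+ 2).
  by apply: L1D; [exact: L1_cst|exact: L1Z].
have L2 : L1 P (fun w => sqn (B (Y t w)) ^+ 2).
  apply: (L1_le _ _ LD); first exact: measurable_funX.
  by move=> w; rewrite ger0_norm ?sqr_ge0.
have E2 : Ex P (fun w => sqn (B (Y t w)) ^+ 2) <= C2.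
  apply: le_trans (Ex_le L2 LD bnd2) _.
  rewrite (ExD (L1_cst _ _) (L1Z _ l1)) Ex_cst ExZ // lerD2l ler_wpM2l // mulr_ge0 ?exprn_ge0 // ltW //.
have LD1 : L1 P (fun w => 1 + sqn (B (Y t w)) ^+ 2) by apply: L1D => //; exact: L1_cst.
have b1 w : sqn (B (Y t w)) <= 1 + sqn (B (Y t w)) ^+ 2.
  by have := sqr_ge0 (sqn (B (Y t w)) - 1); have := sqn_ge0 (B (Y t w)); rewrite sqrrB; lra.
have L1s : L1 P (fun w => sqn (B (Y t w))).
  by apply: (L1_le _ _ LD1) => // w; rewrite ger0_norm ?sqn_ge0.
split=> //; first by apply: le_trans E2 _; rewrite lerDr.
apply: le_trans (Ex_le L1s LD1 b1) _; rewrite (ExD (L1_cst _ _) L2) Ex_cst lerD2l //.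
Qed.

(** A discrete form of Jensen's inequality, arranged so that [m%:R * et] is the length of the
    interval in a Riemann sum. *)
Lemma sqn_scaled_sum (et : R) m (v : nat -> 'cV[R]_d) : 0 <= et ->
  sqn (et *: \sum_(l < m) v l) <= (m%:R * et) * (et * \sum_(l < m) sqn (v l)).
Proof.
move=> et0.
have h : sqn (\sum_(l < m) v l) <= m%:R * \sum_(l < m) sqn (v l).
  rewrite sqn_colE (eq_bigr (fun l : 'I_m => \sum_i v l i 0 ^+ 2)) => [|l _]; last exact: sqn_colE.
  rewrite exchange_big mulr_sumr; apply: ler_sum => i _.
  rewrite summxE; have := sum_sqr_CS (fun _ : 'I_m => 1) (fun l => v l i 0).
  rewrite (eq_bigr (fun l : 'I_m => v l i 0)) => [|l _]; last by rewrite mul1r.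
  have -> : \sum_(l < m) 1 ^+ 2 = m%:R :> R.
    by under eq_bigr do rewrite expr1n; rewrite sumr_const card_ord.
  by [].
rewrite sqnZ (_ : m%:R * et * _ = et ^+ 2 * (m%:R * \sum_(l < m) sqn (v l))); last by ring.
by rewrite ler_wpM2l // sqr_ge0.
Qed.

(* Fatou's lemma along Riemann sums replaces a joint measurability argument. *)
Lemma riemann_second_moment (X : Om -> 'cV[R]_d) (v : R -> Om -> 'cV[R]_d) (s t K : R) :
  0 <= s -> s <= t -> (forall i, measurable_fun setT (fun w => X w i 0)) ->
  (forall u, s <= u <= t -> L1 P (fun w => sqn (v u w)) /\ Ex P (fun w => sqn (v u w)) <= K) ->
  (forall u i, s <= u <= t -> measurable_fun setT (fun w => v u w i 0)) ->
  {ae P, forall w, enorm (X w - ((t - s) / m.+1%:R) *: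
     \sum_(l < m.+1) v (s + l%:R * ((t - s) / m.+1%:R)) w) @[m --> \oo] --> 0} ->
  L1 P (fun w => sqn (X w)) /\ Ex P (fun w => sqn (X w)) <= (t - s) ^+ 2 * K.
Proof.
move=> s0 st mX hv mv hcv.
have ts0 : 0 <= t - s by rewrite subr_ge0.
pose et m := (t - s) / m.+1%:R.
have et0 m : 0 <= et m by rewrite divr_ge0.
have metE m : m.+1%:R * et m = t - s by rewrite /et mulrC divfK // pnatr_eq0.
pose Z m w := et m *: \sum_(l < m.+1) v (s + l%:R * et m) w.
have grid m (l : 'I_m.+1) : s <= s + l%:R * et m <= t.
  rewrite lerDl mulr_ge0 //= addrC -lerBrDr -(metE m) ler_wpM2r // ler_nat.
  by rewrite ltnW.
have mZ m i : measurable_fun setT (fun w => Z m w i 0).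
  have -> : (fun w => Z m w i 0) = fun w => et m * \sum_(l < m.+1) v (s + l%:R * et m) w i 0.
    by apply/funext => w; rewrite mxE summxE.
  by apply: measurable_funM => //; apply: measurable_sum => l; apply: mv.
have LS m : L1 P (fun w => (t - s) * (et m * \sum_(l < m.+1) sqn (v (s + l%:R * et m) w))).
  by do 2 apply: L1Z; apply: L1_sum => l _; case: (hv _ (grid m l)).
have ms (T' : Om -> 'cV[R]_d) : (forall i, measurable_fun setT (fun w => T' w i 0)) ->
    measurable_fun setT (fun w => sqn (T' w)).
  exact: measurable_sqn.
have ZS m w : sqn (Z m w) <= (t - s) * (et m * \sum_(l < m.+1) sqn (v (s + l%:R * et m) w)).
  by rewrite -[X in _ <= X * _](metE m); exact: (@sqn_scaled_sum (et m) m.+1 (fun l => v (s + l%:R * et m) w)).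
have LZ m : L1 P (fun w => sqn (Z m w)).
  apply: (L1_le _ _ (LS m)); first exact: ms.
  by move=> w; rewrite ger0_norm ?sqn_ge0.
apply: (@Ex_fatou _ _ _ _ (fun m w => sqn (Z m w))) => //.
- by move=> m w; exact: sqn_ge0.
- move=> m; apply: le_trans (Ex_le (LZ m) (LS m) (ZS m)) _.
  have LL : L1 P (fun w => \sum_(l < m.+1) sqn (v (s + l%:R * et m) w)).
    by apply: L1_sum => l _; case: (hv _ (grid m l)).
  rewrite (ExZ _ (L1Z _ LL)) (ExZ _ LL) expr2 -mulrA ler_wpM2l //.
  apply: le_trans (_ : et m * \sum_(l < m.+1) K <= _).
    rewrite ler_wpM2l // Ex_sum => [|l _]; last by case: (hv _ (grid m l)).
    by apply: ler_sum => l _; case: (hv _ (grid m l)).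
  by rewrite sumr_const card_ord -(metE m) -[K *+ _]mulr_natl mulrCA mulrA.
- exact: ms.
- by move=> w; exact: sqn_ge0.
apply: filterS hcv => w h.
have hen : enorm (Z m w) @[m --> \oo] --> enorm (X w).
  apply/cvgrPdist_le => e e0; have /cvgrPdist_le/(_ _ e0) := h.
  apply: filterS => m; rewrite sub0r normrN ger0_norm ?enorm_ge0 // => hm.
  apply: le_trans hm; rewrite ler_norml; apply/andP; split.
    rewrite lerNl opprB lerBlDr -{1}[Z m w](subrK (X w)).
    by apply: le_trans (ler_enormD _ _) _; rewrite lerD2r enormB.
  rewrite lerBlDr -{1}[X w](subrK (Z m w)).
  by apply: le_trans (ler_enormD _ _) _.
have -> : (fun m => sqn (Z m w)) = (fun m => enorm (Z m w) * enorm (Z m w)).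
  by apply/funext => m; rewrite -expr2 enorm_sqr.
by rewrite -enorm_sqr expr2; exact: cvgM.
Qed.

End SystemMoments.

Section SystemIncrements.
Context {R : realType} {disp : measure_display} {Om : measurableType disp}.
Variable P : probability Om R.
Variables (d r : nat) (B : 'cV[R]_d -> 'cV[R]_d) (S : 'M[R]_(d, r)) (c : 'cV[R]_d).
Variables (W : R -> Om -> 'cV[R]_r) (Y : R -> Om -> 'cV[R]_d).
Hypothesis lipB : glob_lipschitz B.
Hypothesis sys : ito_system P B S c W Y.

Let mW (t : R) i : 0 <= t -> measurable_fun setT (fun w => W t w i 0).
Proof. by move=> t0; case: sys => -[h _] _ _ _ _; exact: h. Qed.

Let mY (t : R) i : 0 <= t -> measurable_fun setT (fun w => Y t w i 0).
Proof. by move=> t0; case: sys => -[_ h] _ _ _ _; exact: h. Qed.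

Let mB (t : R) i : 0 <= t -> measurable_fun setT (fun w => B (Y t w) i 0).
Proof. by move=> t0; apply: (lipschitz_entry_measurable lipB) => j; exact: mY. Qed.

(** For a solution, the integral of [B (Y u)] over the interval from [s] to [t]. *)
Definition drift_part (s t : R) (w : Om) : 'cV[R]_d :=
  Y t w - Y s w - S *m (W t w - W s w).

(** For a solution, the integral of [B (Y u) - B (Y s)]. In mean square it is smaller than
    [drift_part] by half a power of [t - s], as the increments of [Y] are of that order. *)
Definition drift_rest (s t : R) (w : Om) : 'cV[R]_d :=
  drift_part s t w - (t - s) *: B (Y s w).

Lemma measurable_colB (U V : Om -> 'cV[R]_d) :
  (forall i, measurable_fun setT (fun w => U w i 0)) ->
  (forall i, measurable_fun setT (fun w => V w i 0)) ->
  forall i, measurable_fun setT (fun w => (U w - V w) i 0).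
Proof.
move=> mU mV i; under eq_fun do rewrite !mxE.
by apply: measurable_funB; [exact: mU|exact: mV].
Qed.

Lemma measurable_noise (s t : R) i : 0 <= s -> 0 <= t ->
  measurable_fun setT (fun w => (S *m (W t w - W s w)) i 0).
Proof.
move=> s0 t0; under eq_fun do rewrite mxE; apply: measurable_sum => j.
apply: measurable_funM => //; under eq_fun do rewrite !mxE.
by apply: measurable_funB; exact: mW.
Qed.

Lemma measurable_drift_part (s t : R) i : 0 <= s -> 0 <= t ->
  measurable_fun setT (fun w => drift_part s t w i 0).
Proof.
move=> s0 t0; apply: measurable_colB => j; last exact: measurable_noise.
by apply: measurable_colB => k; exact: mY.
Qed.

Lemma measurable_drift_rest (s t : R) i : 0 <= s -> 0 <= t ->
  measurable_fun setT (fun w => drift_rest s t w i 0).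
Proof.
move=> s0 t0; apply: measurable_colB => j; first exact: measurable_drift_part.
by under eq_fun do rewrite mxE; apply: measurable_funM => //; exact: mB.
Qed.

Lemma brownian_moments (s t : R) (i : 'I_r) : 0 <= s -> s < t ->
  [/\ L1 P (fun w => (W t w - W s w) i 0), Ex P (fun w => (W t w - W s w) i 0) = 0,
      L1 P (fun w => (W t w - W s w) i 0 ^+ 2) /\
      Ex P (fun w => (W t w - W s w) i 0 ^+ 2) = t - s,
      L1 P (fun w => (W t w - W s w) i 0 ^+ 4) &
      Ex P (fun w => (W t w - W s w) i 0 ^+ 4) = 3 * (t - s) ^+ 2].
Proof.
move=> s0 st; have [_ _ gW _ _] := sys.
have g := gW s t i s0 st.
have ts : 0 < Num.sqrt (t - s) by rewrite sqrtr_gt0 subr_gt0.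
have sq : Num.sqrt (t - s) ^+ 2 = t - s by rewrite sqr_sqrtr // subr_ge0 ltW.
split; first by have := gaussian_pow ts g 1.
- exact: gaussian_mean ts g.
- by split; [exact: gaussian_pow ts g 2|rewrite (gaussian_moment2 ts g)].
- exact: gaussian_pow ts g 4.
- by rewrite (gaussian_moment4 ts g) -[4%N]/(2 * 2)%N exprM sq.
Qed.

Lemma drift_part_moment : exists2 C : R, 0 <= C & forall s t : R, 0 <= s -> s <= t ->
  L1 P (fun w => sqn (drift_part s t w)) /\
  Ex P (fun w => sqn (drift_part s t w)) <= (t - s) ^+ 2 * C.
Proof.
have [C C0 hC] := drift_moment lipB sys; exists C => // s t s0 st.
have t0 : 0 <= t := le_trans s0 st.
apply: (@riemann_second_moment _ _ _ P _ (drift_part s t) (fun u w => B (Y u w))) => //.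
- by move=> i; exact: measurable_drift_part.
- by move=> u /andP[su _]; case: (hC u (le_trans s0 su)).
- by move=> u i /andP[su _]; apply: mB; exact: le_trans su.
have [_ ae _ _ _] := sys.
by apply: filterS ae => w [_ cons]; exact: (riemann_cvg cons s0 st).
Qed.

Lemma noise_moment (s t : R) : 0 <= s -> s < t ->
  L1 P (fun w => sqn (S *m (W t w - W s w))) /\
  Ex P (fun w => sqn (S *m (W t w - W s w))) <= sqn S * r%:R * (t - s).
Proof.
move=> s0 st; have t0 : 0 <= t := le_trans s0 (ltW st).
pose D w := sqn S * \sum_i (W t w - W s w) i 0 ^+ 2.
have Li (i : 'I_r) : L1 P (fun w => (W t w - W s w) i 0 ^+ 2).
  by have [_ _ []] := brownian_moments i s0 st.
have LS : L1 P (fun w => \sum_i (W t w - W s w) i 0 ^+ 2) by apply: L1_sum.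
have hD w : sqn (S *m (W t w - W s w)) <= D w.
  by apply: le_trans (sqnM _ _) _; rewrite (sqn_colE (W t w - W s w)).
have L : L1 P (fun w => sqn (S *m (W t w - W s w))).
  apply: (L1_le _ _ (L1Z (sqn S) LS)).
    by apply: measurable_sqn => i; exact: measurable_noise.
  by move=> w; rewrite ger0_norm ?sqn_ge0 //; exact: hD.
split=> //; apply: le_trans (Ex_le L (L1Z (sqn S) LS) hD) _.
rewrite ExZ // -mulrA ler_wpM2l ?sqn_ge0 // Ex_sum //.
rewrite (eq_bigr (fun=> t - s)) => [|i _]; last by have [_ _ []] := brownian_moments i s0 st.
by rewrite sumr_const card_ord mulr_natl.
Qed.

Lemma increment_moment : exists2 C : R, 0 <= C & forall s t : R, 0 <= s -> s <= t -> t - s <= 1 ->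
  L1 P (fun w => sqn (Y t w - Y s w)) /\
  Ex P (fun w => sqn (Y t w - Y s w)) <= C * (t - s).
Proof.
have [C C0 hC] := drift_part_moment.
exists (2 * C + 2 * (sqn S * r%:R)).
  by rewrite addr_ge0 ?mulr_ge0 ?sqn_ge0.
move=> s t s0; rewrite le_eqVlt => /predU1P[<- _|st ts1].
  have -> : (fun w => sqn (Y s w - Y s w)) = fun=> 0.
    by apply/funext => w; rewrite subrr sqn0.
  by split; [exact: L1_cst|rewrite Ex_cst subrr mulr0].
have t0 : 0 <= t := le_trans s0 (ltW st).
have [l1 e1] := hC s t s0 (ltW st); have [l2 e2] := noise_moment s0 st.
have LD := L1D (L1Z 2 l1) (L1Z 2 l2).
have h w : sqn (Y t w - Y s w) <= 2 * sqn (drift_part s t w) + 2 * sqn (S *m (W t w - W s w)).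
  by apply: le_trans (sqnD _ _); rewrite subrK.
have L : L1 P (fun w => sqn (Y t w - Y s w)).
  apply: (L1_le _ _ LD).
    by apply: measurable_sqn; apply: measurable_colB => k; exact: mY.
  by move=> w; rewrite ger0_norm ?sqn_ge0 //; exact: h.
split=> //; apply: le_trans (Ex_le L LD h) _.
rewrite (ExD (L1Z 2 l1) (L1Z 2 l2)) !ExZ //.
have ts0 : 0 <= t - s by rewrite subr_ge0 ltW.
have : (t - s) ^+ 2 * C <= (t - s) * C by rewrite ler_wpM2r // expr2 ler_piMr.
lra.
Qed.

Lemma drift_rest_moment : exists2 C : R, 0 <= C & forall s t : R, 0 <= s -> s <= t -> t - s <= 1 ->
  L1 P (fun w => sqn (drift_rest s t w)) /\
  Ex P (fun w => sqn (drift_rest s t w)) <= (t - s) ^+ 3 * C.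
Proof.
have [L L0 hL] := lipschitz_pos lipB.
have [C C0 hC] := increment_moment.
exists (L ^+ 2 * C) => [|s t s0 st ts1]; first by rewrite mulr_ge0 ?sqr_ge0.
have t0 : 0 <= t := le_trans s0 st.
have -> : (t - s) ^+ 3 * (L ^+ 2 * C) = (t - s) ^+ 2 * (L ^+ 2 * (C * (t - s))) by ring.
have hb u w : sqn (B (Y u w) - B (Y s w)) <= L ^+ 2 * sqn (Y u w - Y s w).
  rewrite -!enorm_sqr -exprMn lerXn2r ?nnegrE ?enorm_ge0 ?hL //.
  by rewrite mulr_ge0 ?enorm_ge0 // ltW.
apply: (@riemann_second_moment _ _ _ P _ (drift_rest s t) (fun u w => B (Y u w) - B (Y s w))) => //.
- by move=> i; exact: measurable_drift_rest.
- move=> u /andP[su ut].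
  have [l e] : L1 P (fun w => sqn (Y u w - Y s w)) /\ Ex P (fun w => sqn (Y u w - Y s w)) <= C * (u - s).
    by apply: hC => //; lra.
  have Lb : L1 P (fun w => sqn (B (Y u w) - B (Y s w))).
    apply: (L1_le _ _ (L1Z (L ^+ 2) l)).
      apply: measurable_sqn; apply: measurable_colB => k; apply: mB => //.
      exact: le_trans su.
    by move=> w; rewrite ger0_norm ?sqn_ge0 //; exact: hb.
  split=> //; apply: le_trans (Ex_le Lb (L1Z _ l) (hb u)) _.
  rewrite ExZ // ler_wpM2l ?sqr_ge0 //; apply: le_trans e _.
  by rewrite ler_wpM2l // lerD2r.
- move=> u i /andP[su ut]; apply: measurable_colB => k; apply: mB => //.
  exact: le_trans su.
have [_ ae _ _ _] := sys.
apply: filterS ae => w [_ cons]; have := riemann_cvg cons s0 st.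
have E m : drift_rest s t w - ((t - s) / m.+1%:R) *:
    \sum_(l < m.+1) (B (Y (s + l%:R * ((t - s) / m.+1%:R)) w) - B (Y s w)) =
  Y t w - Y s w - S *m (W t w - W s w) - ((t - s) / m.+1%:R) *:
    \sum_(l < m.+1) B (Y (s + l%:R * ((t - s) / m.+1%:R)) w).
  rewrite sumrB scalerBr /drift_rest sumr_const card_ord -[B (Y s w) *+ _]scaler_nat scalerA divfK ?pnatr_eq0 //.
  by rewrite opprB addrA subrK.
by under [in X in _ -> X]eq_fun do rewrite E.
Qed.

End SystemIncrements.

Section Clamp.
Context {R : realType}.

(** Truncation supplies a dominating function along the Euler schemes, whose moments are not
    estimated. *)
Definition clamp (K x : R) : R := Num.max (- K) (Num.min K x).

Lemma clamp_bound K x : 0 <= K -> `|clamp K x| <= K.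
Proof.
move=> K0; rewrite ler_norml /clamp le_max lexx /= ge_max; apply/andP; split.
  lra.
by rewrite ge_min lexx.
Qed.

Lemma clamp_id K x : `|x| <= K -> clamp K x = x.
Proof.
rewrite ler_norml => /andP[h1 h2]; rewrite /clamp min_r // max_r //.
Qed.

Lemma clamp_norm K x : 0 <= K -> `|clamp K x| <= `|x|.
Proof.
move=> K0; have [xK|xK] := leP `|x| K; first by rewrite clamp_id.
by apply: le_trans (clamp_bound x K0) _; exact: ltW.
Qed.

Lemma continuous_clamp K : continuous (clamp K).
Proof.
move=> x.
have c (a : R) : {for x, continuous (fun _ : R => a : R^o)} by exact: cvg_cst.
have ci : {for x, continuous (fun v : R => v : R^o)} by exact: cvg_id.
exact: (continuous_max (c (- K)) (continuous_min (c K) ci)).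
Qed.

Lemma measurable_clamp K : measurable_fun setT (clamp K).
Proof. exact: continuous_measurable_fun (@continuous_clamp K). Qed.

End Clamp.

Lemma measG_measurable {R : realType} {disp : measure_display} {Om : measurableType disp}
    (G : set (set Om)) (f : Om -> R) : G `<=` measurable -> measG G f -> measurable_fun setT f.
Proof.
move=> mG mf _ A mA; have := mf measurableT A mA.
by apply: smallest_sub => //; exact: sigma_algebra_measurable.
Qed.

(** * Adaptedness and the products of drift and noise *)

Section Adapted.
Context {R : realType} {disp : measure_display} {Om : measurableType disp}.
Variable P : probability Om R.
Variables (d r : nat) (B : 'cV[R]_d -> 'cV[R]_d) (S : 'M[R]_(d, r)) (c : 'cV[R]_d).
Variables (W : R -> Om -> 'cV[R]_r) (Y : R -> Om -> 'cV[R]_d).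
Hypothesis lipB : glob_lipschitz B.
Hypothesis sys : ito_system P B S c W Y.

Let mW (t : R) i : 0 <= t -> measurable_fun setT (fun w => W t w i 0).
Proof. by move=> t0; case: sys => -[h _] _ _ _ _; exact: h. Qed.

Let mY (t : R) i : 0 <= t -> measurable_fun setT (fun w => Y t w i 0).
Proof. by move=> t0; case: sys => -[_ h] _ _ _ _; exact: h. Qed.

Let mB (t : R) i : 0 <= t -> measurable_fun setT (fun w => B (Y t w) i 0).
Proof. by move=> t0; apply: (lipschitz_entry_measurable lipB) => j; exact: mY. Qed.

Section Grid.
Variables (et : R) (N : nat).
Hypothesis et0 : 0 < et.
Let u (l : nat) : R := l%:R * et.
Definition grid_noise (k : 'I_N * 'I_r) (w : Om) : R :=
  (W (u k.1.+1) w - W (u k.1) w) k.2 0.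

Let u0 l : 0 <= u l. Proof. by rewrite mulr_ge0 // ltW. Qed.

Lemma grid_noise_measurable k : measurable_fun setT (grid_noise k).
Proof.
by rewrite /grid_noise; under eq_fun do rewrite !mxE; apply: measurable_funB; exact: mW.
Qed.

Lemma grid_noise_indep : indep_rvs P grid_noise.
Proof.
have [_ _ _ ind _] := sys; apply: (ind N u) => // k.
by rewrite /u ltr_pM2r // ltr_nat.
Qed.

Lemma increment_measG (A : pred ('I_N * 'I_r)) l1 l2 b : (l1 <= l2)%N -> (l2 <= N)%N ->
  (forall k : 'I_N * 'I_r, (l1 <= k.1 < l2)%N -> A k) ->
  measG (boxes grid_noise A) (fun w => (W (u l2) w - W (u l1) w) b 0).
Proof.
elim: l2 => [|l2 IH] l12 lN hA.
  move: l12; rewrite leqn0 => /eqP ->.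
  by under eq_fun do rewrite subrr mxE; exact: measurable_cst.
move: l12; rewrite leq_eqVlt => /predU1P[->|l12].
  by under eq_fun do rewrite subrr mxE; exact: measurable_cst.
have -> : (fun w => (W (u l2.+1) w - W (u l1) w) b 0) = (fun w =>
    (W (u l2) w - W (u l1) w) b 0 + grid_noise (Ordinal lN, b) w).
  by apply/funext => w; rewrite /grid_noise !mxE /=; ring.
apply: measurable_funD.
  apply: IH => //; first exact: ltnW.
  by move=> k /andP[k1 k2]; apply: hA; rewrite k1 ltnW.
by apply: boxes_meas; apply: hA => /=; rewrite ltnS leqnn andbT.
Qed.

Lemma euler_measG (A : pred ('I_N * 'I_r)) l i : (l <= N)%N ->
  (forall k : 'I_N * 'I_r, (k.1 < l)%N -> A k) ->
  measG (boxes grid_noise A) (fun w => euler B S c et (fun l => W (u l.+1) w - W (u l) w) l i 0).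
Proof.
elim: l i => [|l IH] i lN hA; first exact: measurable_cst.
have mE j : measG (boxes grid_noise A)
    (fun w => euler B S c et (fun l => W (u l.+1) w - W (u l) w) l j 0).
  apply: IH; first exact: ltnW.
  by move=> k kl; apply: hA; rewrite ltnW.
rewrite /measG /=; under eq_fun do rewrite !mxE.
apply: measurable_funD.
  apply: measurable_funD; first exact: mE.
  apply: measurable_funM => //.
  exact: (@lipschitz_entry_measurable _ _ (g_sigma_algebraType (boxes grid_noise A)) _ _ lipB _ i mE).
apply: measurable_sum => j; apply: measurable_funM => //.
apply: (@increment_measG A l l.+1 j) => // k /andP[_ kl].
exact: hA.
Qed.

End Grid.

Variable CB : R.
Hypothesis CB0 : 0 <= CB.
Hypothesis hCB : forall t : R, 0 <= t ->
  L1 P (fun w => sqn (B (Y t w)) ^+ 2) /\ Ex P (fun w => sqn (B (Y t w)) ^+ 2) <= CB.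
Variable h : R.
Hypotheses (h0 : 0 < h) (h1 : h <= 1).
Let t (i : nat) : R := i%:R * h.
Let t0 i : 0 <= t i. Proof. by rewrite mulr_ge0 // ltW. Qed.
Let tS i : t i < t i.+1. Proof. by rewrite /t ltr_pM2r // ltr_nat. Qed.
Let tSB i : t i.+1 - t i = h. Proof. by rewrite /t -natr1; ring. Qed.

Definition noise (i : nat) (b : 'I_r) (w : Om) : R := (W (t i.+1) w - W (t i) w) b 0.
Definition drift_at (i : nat) (a : 'I_d) (w : Om) : R := B (Y (t i) w) a 0.

Lemma measurable_noise_at i b : measurable_fun setT (noise i b).
Proof. by rewrite /noise; under eq_fun do rewrite !mxE; apply: measurable_funB; exact: mW. Qed.

Lemma measurable_drift_at i a : measurable_fun setT (drift_at i a).
Proof. exact: mB. Qed.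

(** Cauchy-Schwarz for the squares: the fourth moment is at most [CB] for the drift and equals
    [3 * h ^+ 2] for the increment. *)
Lemma drift_noise_moment i a b :
  L1 P (fun w => (drift_at i a w * noise i b w) ^+ 2) /\
  Ex P (fun w => (drift_at i a w * noise i b w) ^+ 2) <= Num.sqrt (3 * CB) * h.
Proof.
have [l4 e4] := hCB (t0 i).
have mB4 : measurable_fun setT (fun w => drift_at i a w ^+ 2).
  by apply: measurable_funX; exact: measurable_drift_at.
have mN2 : measurable_fun setT (fun w => noise i b w ^+ 2).
  by apply: measurable_funX; exact: measurable_noise_at.
have b4 w : (drift_at i a w ^+ 2) ^+ 2 <= sqn (B (Y (t i) w)) ^+ 2.
  by rewrite lerXn2r ?nnegrE ?sqr_ge0 ?sqn_ge0 // sqn_entry.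
have Lb : L1 P (fun w => (drift_at i a w ^+ 2) ^+ 2).
  apply: (L1_le _ _ l4); first exact: measurable_funX.
  by move=> w; rewrite ger0_norm ?sqr_ge0.
have [_ _ _ l' e'] := brownian_moments sys b (t0 i) (tS i).
have En : Ex P (fun w => (noise i b w ^+ 2) ^+ 2) = 3 * h ^+ 2.
  by rewrite -(tSB i) -e'; congr Ex; apply/funext => w; rewrite -exprM.
have Ln : L1 P (fun w => (noise i b w ^+ 2) ^+ 2).
  by under eq_fun do rewrite -exprM.
have [L E] := Ex_CS mB4 mN2 Lb Ln.
have eq2 : (fun w => (drift_at i a w * noise i b w) ^+ 2) = (fun w => drift_at i a w ^+ 2 * noise i b w ^+ 2).
  by apply/funext => w; rewrite exprMn.
rewrite eq2; split=> //.
have x0 : 0 <= Ex P (fun w => drift_at i a w ^+ 2 * noise i b w ^+ 2).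
  by apply: Ex_ge0 => w; rewrite mulr_ge0 ?sqr_ge0.
have hs : 0 <= Num.sqrt (3 * CB) * h by rewrite mulr_ge0 ?sqrtr_ge0 // ltW.
rewrite -(@ler_pXn2r _ 2) ?nnegrE //; apply: le_trans E _.
rewrite exprMn sqr_sqrtr; last by rewrite mulr_ge0.
rewrite En (_ : 3 * CB * h ^+ 2 = CB * (3 * h ^+ 2)); last by ring.
have hC' : Ex P (fun w => (drift_at i a w ^+ 2) ^+ 2) <= CB := le_trans (Ex_le Lb l4 b4) e4.
by apply: ler_wpM2r hC'; rewrite mulr_ge0 ?sqr_ge0.
Qed.

Lemma measurable_drift_noise i a b :
  measurable_fun setT (fun w => drift_at i a w * noise i b w).
Proof. by apply: measurable_funM; [exact: measurable_drift_at|exact: measurable_noise_at]. Qed.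

Lemma drift_noise_prod_L1 i j a b :
  L1 P (fun w => (drift_at i a w * noise i b w) * (drift_at j a w * noise j b w)).
Proof.
have [l1 _] := drift_noise_moment i a b; have [l2 _] := drift_noise_moment j a b.
have mi := measurable_drift_noise i a b; have mj := measurable_drift_noise j a b.
by have [] := Ex_CS mi mj l1 l2.
Qed.

(* The Euler scheme is a function of finitely many past increments; letting its
   mesh tend to 0 makes [Y] at time [t j] uncorrelated with the next increment. *)
Lemma drift_noise_orthogonal i j a b : (i < j)%N ->
  Ex P (fun w => (drift_at i a w * noise i b w) * (drift_at j a w * noise j b w)) = 0.
Proof.
move=> ij; have [L L0 hL] := lipschitz_pos lipB.
pose V w := drift_at i a w * noise i b w * drift_at j a w.
have mV : measurable_fun setT V.
  by apply: measurable_funM; [exact: measurable_drift_noise|exact: measurable_drift_at].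
have [LG EG _ _ _] := brownian_moments sys b (t0 j) (tS j).
rewrite -/(noise j b) in LG EG.
have mG := measurable_noise_at j b.
(* With [Y] replaced by its Euler scheme, the truncated factor is a bounded function of increments
   before [t j], hence independent of [noise j b], which is centred. *)
have step1 (K : R) : 0 <= K -> Ex P (fun w => clamp K (V w) * noise j b w) = 0.
  move=> K0.
  pose et m : R := h / m.+1%:R.
  pose E m i w := euler B S c (et m) (fun l => W (l.+1%:R * et m) w - W (l%:R * et m) w) (i * m.+1).
  have et0 m : 0 < et m by rewrite divr_gt0.
  have etE m k : (k * m.+1)%:R * et m = t k.
    by rewrite natrM -mulrA /et [m.+1%:R * _]mulrC divfK ?pnatr_eq0.
  pose Vm m w := B (E m i w) a 0 * noise i b w * B (E m j w) a 0.
  (* The grid has [m.+1] cells per observation interval and ends at [t j.+1]; [A1] and [A2] separate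
     the cells before and after [t j]. *)
  pose N m := (j.+1 * m.+1)%N.
  pose A1 m (k : 'I_(N m) * 'I_r) := (k.1 < j * m.+1)%N.
  pose A2 m (k : 'I_(N m) * 'I_r) := (j * m.+1 <= k.1)%N.
  pose zz m := @grid_noise (et m) (N m).
  have gm m k : measurable_fun setT (@grid_noise (et m) (N m) k) by exact: grid_noise_measurable.
  have jN m : (j * m.+1 <= N m)%N by rewrite /N leq_mul2r leqnSn orbT.
  have iN m : (i.+1 * m.+1 <= j * m.+1)%N by rewrite leq_mul2r ij orbT.
  have iN' m : (i * m.+1 <= j * m.+1)%N by rewrite leq_mul2r (ltnW ij) orbT.
  have mBE m k : (k * m.+1 <= j * m.+1)%N ->
      measG (boxes (zz m) (@A1 m)) (fun w => B (E m k w) a 0).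
    move=> kj; apply: (@lipschitz_entry_measurable _ _ (g_sigma_algebraType (boxes (zz m) (@A1 m))) _ _ lipB (E m k)).
    move=> i'; apply: euler_measG => //.
      exact: leq_trans kj (jN m).
    by move=> q qk; exact: leq_trans kj.
  have mVm m : measG (boxes (zz m) (@A1 m)) (fun w => clamp K (Vm m w)).
    apply: (measurableT_comp (measurable_clamp K)).
    apply: measurable_funM; [apply: measurable_funM|]; [exact: mBE (iN' m)| |exact: mBE (leqnn _)].
    have -> : noise i b = fun w => (W ((i.+1 * m.+1)%:R * et m) w - W ((i * m.+1)%:R * et m) w) b 0.
      by apply/funext => w; rewrite !etE.
    apply: increment_measG => //.
    - by rewrite leq_mul2r leqnSn orbT.
    - exact: leq_trans (iN m) (jN m).
    - by move=> k /andP[_ k2]; exact: leq_trans (iN m).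
  have mGm m : measG (boxes (zz m) (@A2 m)) (noise j b).
    have -> : noise j b = fun w => (W ((j.+1 * m.+1)%:R * et m) w - W ((j * m.+1)%:R * et m) w) b 0.
      by apply/funext => w; rewrite !etE.
    apply: increment_measG => //.
    by move=> k /andP[k1 _].
  have mclV m : measurable_fun setT (fun w => clamp K (Vm m w)).
    apply: (measurableT_comp (measurable_clamp K)).
    have mE k : (k * m.+1 <= j * m.+1)%N -> measurable_fun setT (fun w => B (E m k w) a 0).
      by move=> kj; have := mBE m k kj; apply: measG_measurable; exact: boxes_measurable (gm m) _.
    apply: measurable_funM; [apply: measurable_funM|]; [exact: mE (iN' m)|exact: measurable_noise_at|exact: mE (leqnn _)].
  have zero m : Ex P (fun w => clamp K (Vm m w) * noise j b w) = 0.
    have [|_ ->] := boxes_Ex (gm m) (@grid_noise_indep (et m) (N m) (et0 m)) _ (mVm m) (mGm m)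
      (L1_bounded P (mclV m) (fun w => clamp_bound (Vm m w) K0)) LG; last by rewrite EG mulr0.
    by move=> k; rewrite /A1 /A2 ltnNge.
  have H : Ex P (fun w => clamp K (Vm m w) * noise j b w) @[m --> \oo]
      --> Ex P (fun w => clamp K (V w) * noise j b w).
    apply: (@dominated_cvg_Ex _ _ _ P _ _ (fun w => K * `|noise j b w|)).
    - by move=> m; exact: measurable_funM.
    - by apply: measurable_funM => //; exact: (measurableT_comp (measurable_clamp K)).
    - have [_ ae _ _ _] := sys; apply: filterS ae => w [Y0 cons].
      have cE k : B (E m k w) a 0 @[m --> \oo] --> drift_at k a w.
        apply/cvgrPdist_le => e e0.
        have eL : 0 < e / L by rewrite divr_gt0.
        have /cvgrPdist_le/(_ _ eL) := @euler_cvg _ _ _ B S c (W^~ w) (Y^~ w) h k lipB cons Y0 h0.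
        apply: filterS => m; rewrite sub0r normrN ger0_norm ?enorm_ge0 // => hm.
        have -> : drift_at k a w - B (E m k w) a 0 = (B (Y (t k) w) - B (E m k w)) a 0 by rewrite !mxE.
        apply: le_trans (enorm_entry _ _ _) _; apply: le_trans (hL _ _) _.
        by rewrite mulrC -ler_pdivlMr.
      apply: cvgM; last exact: cvg_cst.
      apply: (@cvg_comp _ _ _ (fun m => Vm m w) (clamp K) _ (nbhs (V w))); last exact: continuous_clamp.
      by apply: cvgM; [apply: cvgM; [exact: cE|exact: cvg_cst]|exact: cE].
    - by move=> m w; rewrite normrM ler_wpM2r // clamp_bound.
    - by apply: L1Z; exact: L1_norm.
  have e0 : (fun m => Ex P (fun w => clamp K (Vm m w) * noise j b w)) = fun=> 0 by exact/funext.
  by rewrite e0 in H; rewrite (cvg_unique _ H (cvg_cst 0)).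
have LVG : L1 P (fun w => V w * noise j b w).
  have := drift_noise_prod_L1 i j a b.
  by congr (L1 P _); apply/funext => w; rewrite /V; ring.
have -> : (fun w => (drift_at i a w * noise i b w) * (drift_at j a w * noise j b w)) =
    (fun w => V w * noise j b w) by apply/funext => w; rewrite /V; ring.
(* Removing the truncation is dominated by the product itself, which is integrable by
   Cauchy-Schwarz. *)
have H : Ex P (fun w => clamp m%:R (V w) * noise j b w) @[m --> \oo]
    --> Ex P (fun w => V w * noise j b w).
  apply: (@dominated_cvg_Ex _ _ _ P _ _ (fun w => `|V w * noise j b w|)).
  - by move=> m; apply: measurable_funM => //; exact: (measurableT_comp (measurable_clamp _)).
  - exact: L1_measurable LVG.
  - apply/aeW => w; apply: cvg_near_cst.
    exists (Num.bound `|V w|) => // m /= hm; rewrite clamp_id //.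
    apply: ltW; apply: lt_le_trans (archi_boundP (normr_ge0 _)) _; by rewrite ler_nat.
  - by move=> m w; rewrite normrM [leRHS]normrM ler_wpM2r // clamp_norm.
  - exact: L1_norm.
have e0 : (fun m : nat => Ex P (fun w => clamp m%:R (V w) * noise j b w)) = fun=> 0.
  by apply/funext => m; rewrite step1.
by rewrite e0 in H; rewrite (cvg_unique _ H (cvg_cst 0)).
Qed.

(** Orthogonality makes second moments add up, so the sum is of order [Num.sqrt (n%:R * h)], whereas
    the triangle inequality would give [n%:R * Num.sqrt h]. *)
Lemma martingale_moment n a b :
  L1 P (fun w => \sum_(i < n) drift_at i a w * noise i b w) /\
  Ex P (fun w => `|\sum_(i < n) drift_at i a w * noise i b w|) <= Num.sqrt (n%:R * (Num.sqrt (3 * CB) * h)).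
Proof.
pose C := Num.sqrt (3 * CB); have hC := drift_noise_moment.
pose M n w := \sum_(i < n) drift_at i a w * noise i b w.
have mM k : measurable_fun setT (M k).
  by apply: measurable_sum => i; exact: measurable_drift_noise.
have h2 k : L1 P (fun w => M k w ^+ 2) /\ Ex P (fun w => M k w ^+ 2) <= k%:R * (C * h).
  elim: k => [|k [l e]].
    have -> : (fun w => M 0%N w ^+ 2) = fun=> 0 by apply/funext => w; rewrite /M big_ord0 expr0n.
    by rewrite Ex_cst mul0r; split => //; exact: L1_cst.
  have [lk ek] := hC k a b.
  have lx (i : 'I_k) := drift_noise_prod_L1 i k a b.
  have eM : (fun w => M k.+1 w ^+ 2) = (fun w => (M k w ^+ 2
      + 2 * \sum_(i < k) (drift_at i a w * noise i b w) * (drift_at k a w * noise k b w))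
      + (drift_at k a w * noise k b w) ^+ 2).
    apply/funext => w; rewrite {1}/M big_ord_recr /= -/(M k w) -mulr_suml -/(M k w); ring.
  have LS : L1 P (fun w => \sum_(i < k) (drift_at i a w * noise i b w) * (drift_at k a w * noise k b w)).
    by apply: L1_sum => i _; exact: lx.
  rewrite eM; split; first by apply: L1D => //; apply: L1D => //; exact: L1Z.
  rewrite (ExD (L1D l (L1Z 2 LS)) lk) (ExD l (L1Z 2 LS)) ExZ // Ex_sum => [|i _]; last exact: lx.
  rewrite big1 => [|i _]; last exact: drift_noise_orthogonal.
  rewrite mulr0 addr0 -natr1 mulrDl mul1r; exact: lerD.
have [l e] := h2 n.
have [L E] := Ex_sqr_norm (mM n) l.
by split=> //; apply: le_trans E _; exact: ler_wsqrtr.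
Qed.

(** Cauchy-Schwarz: the root of [h ^+ 3 * C] from the remainder times the root of [h] from the
    increment. *)
Lemma remainder_noise_moment (C : R) i a b : 0 <= C ->
  L1 P (fun w => sqn (drift_rest B S W Y (t i) (t i.+1) w)) ->
  Ex P (fun w => sqn (drift_rest B S W Y (t i) (t i.+1) w)) <= h ^+ 3 * C ->
  L1 P (fun w => drift_rest B S W Y (t i) (t i.+1) w a 0 * noise i b w) /\
  Ex P (fun w => `|drift_rest B S W Y (t i) (t i.+1) w a 0 * noise i b w|) <= h ^+ 2 * Num.sqrt C.
Proof.
move=> C0 l e.
have mR : measurable_fun setT (fun w => `|drift_rest B S W Y (t i) (t i.+1) w a 0|).
  by apply: measurableT_comp => //; exact: (measurable_drift_rest lipB sys).
have mN : measurable_fun setT (fun w => `|noise i b w|).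
  by apply: measurableT_comp => //; exact: measurable_noise_at.
have LR : L1 P (fun w => `|drift_rest B S W Y (t i) (t i.+1) w a 0| ^+ 2).
  apply: (L1_le _ _ l); first exact: measurable_funX.
  by move=> w; rewrite ger0_norm ?sqr_ge0 // real_normK ?num_real // sqn_entry.
have [_ _ [Ln En] _ _] := brownian_moments sys b (t0 i) (tS i).
have LN : L1 P (fun w => `|noise i b w| ^+ 2).
  by under eq_fun do rewrite real_normK ?num_real //.
have [L E] := Ex_CS mR mN LR LN.
have eqn : (fun w => `|drift_rest B S W Y (t i) (t i.+1) w a 0 * noise i b w|) =
   (fun w => `|drift_rest B S W Y (t i) (t i.+1) w a 0| * `|noise i b w|).
  by apply/funext => w; rewrite normrM.
split.
  apply: (L1_le _ _ L).
    apply: measurable_funM; [exact: (measurable_drift_rest lipB sys)|exact: measurable_noise_at].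
  by move=> w; rewrite normrM.
rewrite eqn.
have x0 : 0 <= Ex P (fun w => `|drift_rest B S W Y (t i) (t i.+1) w a 0| * `|noise i b w|).
  by apply: Ex_ge0 => w; rewrite mulr_ge0.
have y0 : 0 <= h ^+ 2 * Num.sqrt C by rewrite mulr_ge0 ?sqr_ge0 ?sqrtr_ge0.
rewrite -(@ler_pXn2r _ 2) ?nnegrE //; apply: le_trans E _.
have -> : Ex P (fun w => `|noise i b w| ^+ 2) = h.
  by rewrite -[RHS](tSB i) -En; congr Ex; apply/funext => w; rewrite real_normK ?num_real.
rewrite exprMn sqr_sqrtr // (_ : (h ^+ 2) ^+ 2 * C = h ^+ 3 * C * h); last by ring.
rewrite ler_wpM2r ?(ltW h0) //; apply: le_trans e.
by apply: Ex_le => // w; rewrite real_normK ?num_real // sqn_entry.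
Qed.

(** Freezing the drift at the left end point gives [h] times an orthogonal sum; what is left over is
    small enough to be summed in absolute value. *)
Lemma cross_moment (C : R) n a b : 0 <= C ->
  (forall i, L1 P (fun w => sqn (drift_rest B S W Y (t i) (t i.+1) w)) /\
    Ex P (fun w => sqn (drift_rest B S W Y (t i) (t i.+1) w)) <= h ^+ 3 * C) ->
  L1 P (fun w => \sum_(i < n) drift_part S W Y (t i) (t i.+1) w a 0 * noise i b w) /\
  Ex P (fun w => `|\sum_(i < n) drift_part S W Y (t i) (t i.+1) w a 0 * noise i b w|)
    <= h * Num.sqrt (n%:R * (Num.sqrt (3 * CB) * h)) + n%:R * (h ^+ 2 * Num.sqrt C).
Proof.
move=> C0 hC; have [L E] := martingale_moment n a b.
have hR i := @remainder_noise_moment C i a b C0 (hC i).1 (hC i).2.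
have eqS : (fun w => \sum_(i < n) drift_part S W Y (t i) (t i.+1) w a 0 * noise i b w) =
  (fun w => h * (\sum_(i < n) drift_at i a w * noise i b w)
    + \sum_(i < n) drift_rest B S W Y (t i) (t i.+1) w a 0 * noise i b w).
  apply/funext => w; rewrite mulr_sumr -big_split /=; apply: eq_bigr => i _.
  have -> : drift_rest B S W Y (t i) (t i.+1) w a 0
      = drift_part S W Y (t i) (t i.+1) w a 0 - h * drift_at i a w.
    by rewrite /drift_rest tSB /drift_at; set X := drift_part _ _ _ _ _ _; rewrite !mxE.
  ring.
have LR : L1 P (fun w => \sum_(i < n) drift_rest B S W Y (t i) (t i.+1) w a 0 * noise i b w).
  by apply: L1_sum => i _; case: (hR i).
have LRn : L1 P (fun w => \sum_(i < n) `|drift_rest B S W Y (t i) (t i.+1) w a 0 * noise i b w|).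
  by apply: L1_sum => i _; apply: L1_norm; case: (hR i).
have LT : L1 P (fun w => \sum_(i < n) drift_part S W Y (t i) (t i.+1) w a 0 * noise i b w).
  by rewrite eqS; apply: L1D => //; exact: L1Z.
split=> //.
have LB := L1D (L1Z h (L1_norm L)) LRn.
apply: le_trans (Ex_le (L1_norm LT) LB _) _ => [w|].
  rewrite -[X in `|X|]/((fun w => \sum_(i < n) drift_part S W Y (t i) (t i.+1) w a 0 * noise i b w) w) eqS.
  by rewrite (le_trans (ler_normD _ _)) // normrM (gtr0_norm h0) lerD2l ler_norm_sum.
rewrite (ExD (L1Z h (L1_norm L)) LRn) (ExZ h (L1_norm L)); apply: lerD; first by rewrite ler_pM2l.
rewrite Ex_sum => [|i _]; last by apply: L1_norm; case: (hR i).
apply: le_trans (_ : \sum_(i < n) h ^+ 2 * Num.sqrt C <= _).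
  by apply: ler_sum => i _; case: (hR i).
by rewrite sumr_const card_ord mulr_natl.
Qed.

Lemma square_moment (C : R) n a b :
  (forall i, L1 P (fun w => sqn (drift_part S W Y (t i) (t i.+1) w)) /\
    Ex P (fun w => sqn (drift_part S W Y (t i) (t i.+1) w)) <= h ^+ 2 * C) ->
  L1 P (fun w => \sum_(i < n) drift_part S W Y (t i) (t i.+1) w a 0 * drift_part S W Y (t i) (t i.+1) w b 0) /\
  Ex P (fun w => `|\sum_(i < n) drift_part S W Y (t i) (t i.+1) w a 0 * drift_part S W Y (t i) (t i.+1) w b 0|)
    <= n%:R * (h ^+ 2 * C).
Proof.
move=> hC.
have LS : L1 P (fun w => \sum_(i < n) sqn (drift_part S W Y (t i) (t i.+1) w)).
  by apply: L1_sum => i _; case: (hC i).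
have hw w : `|\sum_(i < n) drift_part S W Y (t i) (t i.+1) w a 0 * drift_part S W Y (t i) (t i.+1) w b 0|
    <= \sum_(i < n) sqn (drift_part S W Y (t i) (t i.+1) w).
  apply: le_trans (ler_norm_sum _ _ _) _; apply: ler_sum => i _.
  set v := drift_part S W Y (t i) (t i.+1) w.
  have ha := sqn_entry v a 0; have hb := sqn_entry v b 0.
  rewrite normrM; have := sqr_ge0 (`|v a 0| - `|v b 0|); rewrite sqrrB !real_normK ?num_real //.
  lra.
have L : L1 P (fun w => \sum_(i < n) drift_part S W Y (t i) (t i.+1) w a 0 * drift_part S W Y (t i) (t i.+1) w b 0).
  apply: (L1_le _ hw LS); apply: measurable_sum => i.
  by apply: measurable_funM; exact: (measurable_drift_part sys).
split=> //; apply: le_trans (Ex_le (L1_norm L) LS hw) _.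
rewrite Ex_sum => [|i _]; last by case: (hC i).
apply: le_trans (_ : \sum_(i < n) h ^+ 2 * C <= _).
  by apply: ler_sum => i _; case: (hC i).
by rewrite sumr_const card_ord mulr_natl.
Qed.

End Adapted.

(** * Total effect of the drift on the realized covariance *)

Section Assembly.
Context {R : realType} {disp : measure_display} {Om : measurableType disp}.
Variable P : probability Om R.
Variables (d r : nat) (B : 'cV[R]_d -> 'cV[R]_d) (S : 'M[R]_(d, r)) (c : 'cV[R]_d).
Variables (W : R -> Om -> 'cV[R]_r) (Y : R -> Om -> 'cV[R]_d).
Hypothesis lipB : glob_lipschitz B.
Hypothesis sys : ito_system P B S c W Y.
Variables (p : nat) (Phi : 'M[R]_(p, d)).

Lemma enorm_le_sum m n (A : 'M[R]_(m, n)) : enorm A <= \sum_i \sum_j `|A i j|.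
Proof.
have s0 : 0 <= \sum_i \sum_j `|A i j| by do 2 apply: sumr_ge0 => ? _.
rewrite -(@ler_pXn2r _ 2) ?nnegrE ?enorm_ge0 // enorm_sqr expr2 mulr_suml.
apply: ler_sum => i _; rewrite mulr_suml; apply: ler_sum => j _.
rewrite -(real_normK (num_real (A i j))) expr2 ler_wpM2l //.
rewrite (bigD1 i) //= (bigD1 j) //= -addrA lerDl addr_ge0 //; do ?apply: sumr_ge0 => ? _ //.
Qed.

Lemma Ex_sum2_le m1 m2 (F : 'I_m1 -> 'I_m2 -> Om -> R) (K : R) :
  (forall a b, L1 P (F a b)) -> (forall a b, Ex P (F a b) <= K) ->
  Ex P (fun w => \sum_a \sum_b F a b w) <= m1%:R * (m2%:R * K).
Proof.
move=> LF FK; rewrite Ex_sum => [|a _]; last by apply: L1_sum.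
apply: le_trans (_ : \sum_(a < m1) m2%:R * K <= _); last by rewrite sumr_const card_ord -[_ *+ m1]mulr_natl.
apply: ler_sum => a _; rewrite Ex_sum //.
apply: le_trans (_ : \sum_(b < m2) K <= _); first by apply: ler_sum => b _.
by rewrite sumr_const card_ord -[_ *+ m2]mulr_natl.
Qed.

Lemma outer_product_split (x : 'cV[R]_d) (y : 'cV[R]_r) :
  (Phi *m (x + S *m y)) *m (Phi *m (x + S *m y))^T - (Phi *m S *m y) *m (Phi *m S *m y)^T
  = Phi *m (x *m y^T) *m (Phi *m S)^T + (Phi *m (x *m y^T) *m (Phi *m S)^T)^T
    + Phi *m (x *m x^T) *m Phi^T.
Proof.
rewrite (mulmxDr Phi) (mulmxA Phi S y); move: (Phi *m S) => A.
have e1 : Phi *m (x *m y^T) *m A^T = (Phi *m x) *m (A *m y)^T by rewrite (trmx_mul A) !mulmxA.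
have e2 : Phi *m (x *m x^T) *m Phi^T = (Phi *m x) *m (Phi *m x)^T.
  by rewrite (trmx_mul Phi) !mulmxA.
rewrite e1 e2; move: (Phi *m x) (A *m y) => u v.
rewrite trmx_mul trmxK [(u + v)^T]raddfD /= mulmxDl !mulmxDr !addrA addrK.
by rewrite -addrA addrC.
Qed.

(** The term [h * Num.sqrt (n%:R * h)] comes from the orthogonal sums, [n%:R * h ^+ 2] from the
    remainder and from the drift squared. The majorant [D] combines absolute values of entries, so
    its mean follows from the scalar estimates. *)
Theorem discretization_error : exists2 C : R, 0 <= C & forall n (h : R), 0 < h <= 1 ->
  exists D : Om -> R, [/\ L1 P D,
    Ex P D <= C * (h * Num.sqrt (n%:R * h) + n%:R * h ^+ 2) &
    forall w, enorm (\sum_(i < n)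
      ((Phi *m (Y (i.+1%:R * h) w - Y (i%:R * h) w)) *m (Phi *m (Y (i.+1%:R * h) w - Y (i%:R * h) w))^T
       - (Phi *m S *m (W (i.+1%:R * h) w - W (i%:R * h) w)) *m
         (Phi *m S *m (W (i.+1%:R * h) w - W (i%:R * h) w))^T)) <= D w].
Proof.
have [CB CB0 hCB'] := drift_moment lipB sys.
have hCB (t : R) : 0 <= t -> L1 P (fun w => sqn (B (Y t w)) ^+ 2) /\ Ex P (fun w => sqn (B (Y t w)) ^+ 2) <= CB.
  by move=> t0; case: (hCB' t t0).
have [C1 C10 hC1] := drift_part_moment lipB sys.
have [C3 C30 hC3] := drift_rest_moment lipB sys.
pose A := Phi *m S.
pose K1 := Num.sqrt (Num.sqrt (3 * CB)) + Num.sqrt C3.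
have K10 : 0 <= K1 by rewrite addr_ge0 ?sqrtr_ge0.
pose k1 := 2 * enorm Phi * enorm A; have k10 : 0 <= k1 by rewrite !mulr_ge0 ?enorm_ge0.
pose k2 := enorm Phi ^+ 2; have k20 : 0 <= k2 := sqr_ge0 _.
exists (k1 * (d%:R * (r%:R * K1)) + k2 * (d%:R * (d%:R * C1))).
  by apply: addr_ge0; do 2 (apply: mulr_ge0 => //); apply: mulr_ge0.
move=> n h /andP[h0 h1].
pose t i := i%:R * h.
have t0 i : 0 <= t i by rewrite mulr_ge0 // ltW.
have tS i : t i <= t i.+1 by rewrite ler_wpM2r ?ler_nat // ltW.
have tB i : t i.+1 - t i = h by rewrite /t -natr1; ring.
pose I i w := drift_part S W Y (t i) (t i.+1) w.
pose N1 w : 'M[R]_(d, r) := \sum_(i < n) I i w *m (W (t i.+1) w - W (t i) w)^T.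
pose N2 w : 'M[R]_(d, d) := \sum_(i < n) I i w *m (I i w)^T.
pose eps := h * Num.sqrt (n%:R * h) + n%:R * h ^+ 2.
have eps1 : 0 <= h * Num.sqrt (n%:R * h) by rewrite mulr_ge0 ?sqrtr_ge0 // ltW.
have eps2 : 0 <= n%:R * h ^+ 2 by rewrite mulr_ge0 ?sqr_ge0.
have m1 a b : L1 P (fun w => N1 w a b) /\ Ex P (fun w => `|N1 w a b|) <= K1 * eps.
  have E : (fun w => N1 w a b) = fun w => \sum_(i < n) I i w a 0 * noise W h i b w.
    apply/funext => w; rewrite summxE; apply: eq_bigr => i _.
    by rewrite mxE big_ord1 [X in _ * X]mxE.
  have En : (fun w => `|N1 w a b|) = fun w => `|\sum_(i < n) I i w a 0 * noise W h i b w|.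
    by apply/funext => w; rewrite -[N1 w a b]/((fun w => N1 w a b) w) E.
  have hR i : L1 P (fun w => sqn (drift_rest B S W Y (t i) (t i.+1) w)) /\
      Ex P (fun w => sqn (drift_rest B S W Y (t i) (t i.+1) w)) <= h ^+ 3 * C3.
    by have := hC3 (t i) (t i.+1) (t0 i) (tS i); rewrite tB; apply.
  have [l e] := cross_moment lipB sys CB0 hCB h0 n a b C30 hR.
    rewrite E En; split=> //; apply: le_trans e _.
    have -> : h * Num.sqrt (n%:R * (Num.sqrt (3 * CB) * h))
        = Num.sqrt (Num.sqrt (3 * CB)) * (h * Num.sqrt (n%:R * h)).
      by rewrite mulrCA sqrtrM ?sqrtr_ge0 // mulrCA.
    rewrite (_ : n%:R * (h ^+ 2 * Num.sqrt C3) = Num.sqrt C3 * (n%:R * h ^+ 2)); last by ring.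
    have a1 : 0 <= Num.sqrt (Num.sqrt (3 * CB)) * (n%:R * h ^+ 2) by rewrite mulr_ge0 ?sqrtr_ge0.
    have a2 : 0 <= Num.sqrt C3 * (h * Num.sqrt (n%:R * h)) by rewrite mulr_ge0 ?sqrtr_ge0.
    by rewrite /K1 /eps; lra.
have m2 a b : L1 P (fun w => N2 w a b) /\ Ex P (fun w => `|N2 w a b|) <= C1 * eps.
  have E : (fun w => N2 w a b) = fun w => \sum_(i < n) I i w a 0 * I i w b 0.
    apply/funext => w; rewrite summxE; apply: eq_bigr => i _.
    by rewrite mxE big_ord1 [X in _ * X]mxE.
  have En : (fun w => `|N2 w a b|) = fun w => `|\sum_(i < n) I i w a 0 * I i w b 0|.
    by apply/funext => w; rewrite -[N2 w a b]/((fun w => N2 w a b) w) E.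
  have hI i : L1 P (fun w => sqn (drift_part S W Y (t i) (t i.+1) w)) /\
      Ex P (fun w => sqn (drift_part S W Y (t i) (t i.+1) w)) <= h ^+ 2 * C1.
    by have := hC1 (t i) (t i.+1) (t0 i) (tS i); rewrite tB; apply.
  have [l e] := square_moment sys h0 n a b hI.
    rewrite E En; split=> //; apply: le_trans e _.
    have a1 : 0 <= C1 * (h * Num.sqrt (n%:R * h)) by rewrite mulr_ge0.
    by rewrite /eps; lra.
have L1n a b := L1_norm (m1 a b).1; have L2n a b := L1_norm (m2 a b).1.
have LS1 : L1 P (fun w => \sum_a \sum_b `|N1 w a b|) by do 2 apply: L1_sum => ? _.
have LS2 : L1 P (fun w => \sum_a \sum_b `|N2 w a b|) by do 2 apply: L1_sum => ? _.
exists (fun w => k1 * (\sum_a \sum_b `|N1 w a b|) + k2 * (\sum_a \sum_b `|N2 w a b|)); split.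
- by apply: L1D; exact: L1Z.
- rewrite (ExD (L1Z k1 LS1) (L1Z k2 LS2)) (ExZ k1 LS1) (ExZ k2 LS2) -/eps.
  have t1 := Ex_sum2_le L1n (fun a b => (m1 a b).2).
  have t2 := Ex_sum2_le L2n (fun a b => (m2 a b).2).
  have := ler_wpM2l k10 t1; have := ler_wpM2l k20 t2; lra.
move=> w; set D := \sum_(i < n) _.
have -> : D = Phi *m N1 w *m A^T + (Phi *m N1 w *m A^T)^T + Phi *m N2 w *m Phi^T.
  rewrite /D /N1 /N2 !mulmx_sumr !mulmx_suml !raddf_sum -!big_split /=; apply: eq_bigr => i _.
  rewrite -!/(t _).
  have -> : Y (t i.+1) w - Y (t i) w = I i w + S *m (W (t i.+1) w - W (t i) w).
    by rewrite /I /drift_part subrK.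
  exact: outer_product_split.
apply: le_trans (ler_enormD _ _) _; apply: lerD.
  apply: le_trans (ler_enormD _ _) _; rewrite enorm_trmx.
  have h2 : enorm (Phi *m N1 w *m A^T) <= enorm Phi * enorm A * (\sum_a \sum_b `|N1 w a b|).
    apply: le_trans (enormM _ _) _; rewrite enorm_trmx mulrAC ler_wpM2r ?enorm_ge0 //.
    apply: le_trans (enormM _ _) _; rewrite ler_wpM2l ?enorm_ge0 //; exact: enorm_le_sum.
  by rewrite /k1; lra.
apply: le_trans (enormM _ _) _; rewrite enorm_trmx /k2 expr2 mulrAC ler_wpM2r ?enorm_ge0 //.
apply: le_trans (enormM _ _) _; rewrite ler_wpM2l ?enorm_ge0 //; exact: enorm_le_sum.
Qed.

End Assembly.

(** * The stacked latent process *)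

Section BlockIndices.

Lemma big_block (T : Type) (idx : T) (op : Monoid.com_law idx) m r s (F : 'I_m * 'I_(r + s) -> T) :
  \big[op/idx]_ki F ki = op (\big[op/idx]_(ki : 'I_m * 'I_r) F (ki.1, lshift s ki.2))
                            (\big[op/idx]_(ki : 'I_m * 'I_s) F (ki.1, rshift r ki.2)).
Proof.
transitivity (\big[op/idx]_k \big[op/idx]_i F (k, i)).
  by rewrite pair_bigA; apply: eq_bigr => -[].
under eq_bigr do rewrite big_split_ord.
by rewrite big_split /= !pair_bigA.
Qed.

Lemma bigcap_block (T : Type) m r s (F : 'I_m * 'I_(r + s) -> set T) :
  \bigcap_ki F ki = (\bigcap_(ki : 'I_m * 'I_r) F (ki.1, lshift s ki.2)) `&`
                    (\bigcap_(ki : 'I_m * 'I_s) F (ki.1, rshift r ki.2)).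
Proof.
apply/seteqP; split=> [w Fw|w [F1 F2] [k i] _]; first by split=> ki _; exact: Fw.
case: (split_ordP i) => j ->; [exact: (F1 (k, j)) | exact: (F2 (k, j))].
Qed.

End BlockIndices.

Section StackedNoise.
Context {R : realType} {disp : measure_display} {Om : measurableType disp}.
Variable P : probability Om R.

Definition increments m r (W : R -> Om -> 'cV[R]_r) (u : nat -> R) (ki : 'I_m * 'I_r) w : R :=
  (W (u ki.1.+1) w - W (u ki.1) w) ki.2 0.

Definition noise_coordinates r (W : R -> Om -> 'cV[R]_r) :=
  (forall (t : R) i, 0 <= t -> measurable_fun setT (fun w => W t w i 0)) /\
  (forall s t (i : 'I_r), 0 <= s -> s < t ->
    gaussian P (Num.sqrt (t - s)) (fun w => (W t w - W s w) i 0)).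

Lemma wiener_noise_coordinates r (W : R -> Om -> 'cV[R]_r) : wiener P W -> noise_coordinates W.
Proof.
move=> [mW _ _ gW _]; have mc (t : R) i : 0 <= t -> measurable_fun setT (fun w => W t w i 0).
  by move=> t0; apply: borel_coord; exact: mW.
split=> // s t i s0 st; split; last by move=> A mA; exact: gW.
under eq_fun do rewrite !mxE.
by apply: measurable_funB; apply: mc; rewrite // (le_trans s0) // ltW.
Qed.

Lemma noise_coordinates_col r s (W1 : R -> Om -> 'cV[R]_r) (W2 : R -> Om -> 'cV[R]_s) :
  noise_coordinates W1 -> noise_coordinates W2 ->
  noise_coordinates (fun t w => col_mx (W1 t w) (W2 t w)).
Proof.
move=> [m1 g1] [m2 g2]; split=> [t i t0|u t i u0 ut].
  by case: (split_ordP i) => j ->; under eq_fun do rewrite ?col_mxEu ?col_mxEd; [exact: m1|exact: m2].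
case: (split_ordP i) => j ->; under eq_fun do rewrite opp_col_mx add_col_mx ?col_mxEu ?col_mxEd.
  exact: g1.
exact: g2.
Qed.

Lemma proc_sigma_increments m r (W : R -> Om -> 'cV[R]_r) (u : nat -> R)
    (B : 'I_m * 'I_r -> set R) :
  (forall k, 0 <= u k) -> (forall ki, measurable (B ki)) ->
  proc_sigma W (\bigcap_ki (increments W u ki @^-1` B ki)).
Proof.
move=> u0 mB.
pose G := [set A | exists t (B : set (borel R r 1)),
         [/\ 0 <= t, measurable B & A = W t @^-1` B]].
suff : measurable (\bigcap_ki (increments W u ki @^-1` B ki) : set (g_sigma_algebraType G)) by [].
have mc (t : R) i : 0 <= t -> measurable_fun setT (fun w : g_sigma_algebraType G => W t w i 0).
  move=> t0; apply: borel_coord => _ C mC; rewrite setTI.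
  by apply: sub_gen_smallest; exists t, C.
rewrite -[X in measurable X]setCK setC_bigcap; apply: measurableC.
apply: fin_bigcup_measurable => // -[k i] _.
apply: measurableC; rewrite -[X in measurable X]setTI.
have : measurable_fun setT (increments W u (k, i) : g_sigma_algebraType G -> R).
  rewrite /increments /=; under eq_fun do rewrite !mxE.
  by apply: measurable_funB; exact: mc.
by apply; [exact: measurableT | exact: mB].
Qed.

(** Independence of the four processes factors the event into four, and independence of increments
    factors each of these; the indices of the stacked vector split in the same way. *)
Lemma indep_increments4 m r1 r2 r3 r4 (W1 : R -> Om -> 'cV[R]_r1) (W2 : R -> Om -> 'cV[R]_r2)
    (W3 : R -> Om -> 'cV[R]_r3) (W4 : R -> Om -> 'cV[R]_r4) (u : nat -> R) :
  (forall k, 0 <= u k) ->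
  indep_sigma P (tnth [tuple proc_sigma W1; proc_sigma W2; proc_sigma W3; proc_sigma W4]) ->
  indep_rvs P (@increments m _ W1 u) -> indep_rvs P (@increments m _ W2 u) ->
  indep_rvs P (@increments m _ W3 u) -> indep_rvs P (@increments m _ W4 u) ->
  indep_rvs P (@increments m _
    (fun t w => col_mx (W1 t w) (col_mx (W2 t w) (col_mx (W3 t w) (W4 t w)))) u).
Proof.
move=> u0 hW i1 i2 i3 i4 B mB.
pose W t w := col_mx (W1 t w) (col_mx (W2 t w) (col_mx (W3 t w) (W4 t w))).
rewrite -/W.
have El r s (V1 : R -> Om -> 'cV[R]_r) (V2 : R -> Om -> 'cV[R]_s) k i :
    increments (m := m) (fun t w => col_mx (V1 t w) (V2 t w)) u (k, lshift s i) = increments V1 u (k, i).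
  by apply/funext => w; rewrite /increments /= opp_col_mx add_col_mx col_mxEu.
have Er r s (V1 : R -> Om -> 'cV[R]_r) (V2 : R -> Om -> 'cV[R]_s) k i :
    increments (m := m) (fun t w => col_mx (V1 t w) (V2 t w)) u (k, rshift r i) = increments V2 u (k, i).
  by apply/funext => w; rewrite /increments /= opp_col_mx add_col_mx col_mxEd.
pose A1 := \bigcap_ki (increments W1 u ki @^-1` B (ki.1, lshift _ ki.2)).
pose A2 := \bigcap_ki (increments W2 u ki @^-1` B (ki.1, rshift _ (lshift _ ki.2))).
pose A3 := \bigcap_ki (increments W3 u ki @^-1` B (ki.1, rshift _ (rshift _ (lshift _ ki.2)))).
pose A4 := \bigcap_ki (increments W4 u ki @^-1` B (ki.1, rshift _ (rshift _ (rshift _ ki.2)))).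
have -> : \bigcap_ki (increments W u ki @^-1` B ki) = \bigcap_i (tnth [tuple A1; A2; A3; A4] i).
  rewrite !bigcap_block /=.
  transitivity (A1 `&` (A2 `&` (A3 `&` A4))).
    by congr (_ `&` (_ `&` (_ `&` _))); apply: eq_bigcapr => -[k i] _; rewrite ?Er ?El.
  apply/seteqP; split=> [w [? [? [? ?]]] i _|w Aw].
    by case: i => -[|[|[|[|//]]]] lti; rewrite (tnth_nth set0).
  by split; [|split; [|split]]; [exact: (Aw (@Ordinal 4 0 isT)) | exact: (Aw (@Ordinal 4 1 isT)) | exact: (Aw (@Ordinal 4 2 isT)) | exact: (Aw (@Ordinal 4 3 isT))].
rewrite hW; last first.
  by case=> -[|[|[|[|//]]]] lti; rewrite !(tnth_nth set0) /=; apply: proc_sigma_increments.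
rewrite !big_ord_recl big_ord0 mule1 !(tnth_nth set0) /=.
rewrite i1 // i2 // i3 // i4 // !big_block /=.
by congr (_ * (_ * (_ * _)))%E; apply: eq_bigr => -[k i] _; rewrite ?Er ?El.
Qed.

End StackedNoise.

(** * Stacking diffusions driven by separate noises *)

Section StackedDiffusion.
Context {R : realType} {disp : measure_display} {Om : measurableType disp}.
Variable P : probability Om R.

Lemma sqn_col_mx m n (x : 'cV[R]_m) (y : 'cV[R]_n) : sqn (col_mx x y) = sqn x + sqn y.
Proof.
rewrite !sqn_colE big_split_ord /=.
by congr (_ + _); apply: eq_bigr => i _; rewrite ?col_mxEu ?col_mxEd.
Qed.

Lemma enorm_col_mx_le m n (x : 'cV[R]_m) (y : 'cV[R]_n) : enorm (col_mx x y) <= enorm x + enorm y.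
Proof.
rewrite -(@ler_pXn2r _ 2) ?nnegrE ?addr_ge0 ?enorm_ge0 // sqrrD !enorm_sqr sqn_col_mx.
have : 0 <= enorm x * enorm y by rewrite mulr_ge0 ?enorm_ge0.
by lra.
Qed.

Lemma enorm_usubmx m n (x : 'cV[R]_(m + n)) : enorm (usubmx x) <= enorm x.
Proof.
rewrite -(@ler_pXn2r _ 2) ?nnegrE ?enorm_ge0 // !enorm_sqr -{2}(vsubmxK x) sqn_col_mx.
by rewrite lerDl sqn_ge0.
Qed.

Lemma enorm_dsubmx m n (x : 'cV[R]_(m + n)) : enorm (dsubmx x) <= enorm x.
Proof.
rewrite -(@ler_pXn2r _ 2) ?nnegrE ?enorm_ge0 // !enorm_sqr -{2}(vsubmxK x) sqn_col_mx.
by rewrite lerDr sqn_ge0.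
Qed.

(** The part of [ito_system] that does not mention the law of the noise. It is closed under
    stacking; the joint law of the increments is treated apart. *)
Definition diffusion d r (B : 'cV[R]_d -> 'cV[R]_d) (S : 'M[R]_(d, r)) (c : 'cV[R]_d)
    (W : R -> Om -> 'cV[R]_r) (Y : R -> Om -> 'cV[R]_d) := [/\
  glob_lipschitz B,
  (forall (t : R) i, 0 <= t -> measurable_fun setT (fun w => Y t w i 0)),
  {ae P, forall w, Y 0 w = c /\ euler_consistent B S (W^~ w) (Y^~ w)} &
  exists2 C : R, 0 <= C & forall t : R, 0 <= t ->
    L1 P (fun w => sqn (Y t w) ^+ 2) /\ Ex P (fun w => sqn (Y t w) ^+ 2) <= C].

Definition col_drift d1 d2 (B1 : 'cV[R]_d1 -> 'cV[R]_d1) (B2 : 'cV[R]_d2 -> 'cV[R]_d2)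
    (y : 'cV[R]_(d1 + d2)) := col_mx (B1 (usubmx y)) (B2 (dsubmx y)).

Lemma diffusion_col d1 d2 r1 r2 (B1 : 'cV[R]_d1 -> 'cV[R]_d1) (B2 : 'cV[R]_d2 -> 'cV[R]_d2)
    (S1 : 'M[R]_(d1, r1)) (S2 : 'M[R]_(d2, r2)) c1 c2 W1 W2 Y1 Y2 :
  diffusion B1 S1 c1 W1 Y1 -> diffusion B2 S2 c2 W2 Y2 ->
  diffusion (col_drift B1 B2) (block_mx S1 0 0 S2) (col_mx c1 c2)
    (fun t w => col_mx (W1 t w) (W2 t w)) (fun t w => col_mx (Y1 t w) (Y2 t w)).
Proof.
move=> [lip1 m1 ae1 [C1 C10 h1]] [lip2 m2 ae2 [C2 C20 h2]]; split.
- have [l1 l10 hl1] := lipschitz_pos lip1; have [l2 l20 hl2] := lipschitz_pos lip2.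
  exists (l1 + l2) => x y; rewrite /col_drift opp_col_mx add_col_mx.
  apply: le_trans (enorm_col_mx_le _ _) _; rewrite mulrDl.
  apply: lerD; [apply: le_trans (hl1 _ _) _ | apply: le_trans (hl2 _ _) _]; rewrite ler_pM2l // -raddfB.
    exact: enorm_usubmx.
  exact: enorm_dsubmx.
- move=> t i t0.
  by case: (split_ordP i) => j ->; under eq_fun do rewrite ?col_mxEu ?col_mxEd; [exact: m1|exact: m2].
- apply: filterS2 ae1 ae2 => w [-> e1] [-> e2]; split=> // T e e0.
  have e20 : 0 < e / 2 by rewrite divr_gt0.
  have [D1 D10 f1] := e1 T _ e20; have [D2 D20 f2] := e2 T _ e20.
  exists (Num.min D1 D2); first by rewrite lt_min D10 D20.
  move=> s t s0 st tT; rewrite le_min => /andP[st1 st2].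
  rewrite /col_drift !col_mxKu !col_mxKd !opp_col_mx !add_col_mx mul_block_col !mul0mx addr0 add0r.
  rewrite scale_col_mx !opp_col_mx !add_col_mx.
  apply: le_trans (enorm_col_mx_le _ _) _.
  by have := f1 s t s0 st tT st1; have := f2 s t s0 st tT st2; lra.
exists (2 * C1 + 2 * C2); first by rewrite addr_ge0 ?mulr_ge0.
move=> t t0; have [l1 e1] := h1 t t0; have [l2 e2] := h2 t t0.
have lD : L1 P (fun w => 2 * sqn (Y1 t w) ^+ 2 + 2 * sqn (Y2 t w) ^+ 2) by apply: L1D; exact: L1Z.
have le w : sqn (col_mx (Y1 t w) (Y2 t w)) ^+ 2 <= 2 * sqn (Y1 t w) ^+ 2 + 2 * sqn (Y2 t w) ^+ 2.
  by rewrite sqn_col_mx; have := sqr_ge0 (sqn (Y1 t w) - sqn (Y2 t w)); rewrite sqrrB sqrrD; lra.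
have lS : L1 P (fun w => sqn (col_mx (Y1 t w) (Y2 t w)) ^+ 2).
  apply: L1_le lD => [|w]; last by rewrite ger0_norm ?sqr_ge0.
  apply: measurable_funX; under eq_fun do rewrite sqn_col_mx.
  by apply: measurable_funD; apply: measurable_sqn => i; [exact: m1 | exact: m2].
split=> //; apply: le_trans (Ex_le lS lD le) _.
by rewrite (ExD (L1Z 2 l1) (L1Z 2 l2)) (ExZ 2 l1) (ExZ 2 l2); lra.
Qed.

Lemma latent_diffusion d r (B : 'cV[R]_d -> 'cV[R]_d) (S : 'M[R]_(d, r)) c W Y :
  wiener P W -> latent_process P B S W c Y -> diffusion B S c W Y.
Proof.
move=> [_ _ W0 _ _] [[mY cY eqY] [lipB _] mom _].
have mc (t : R) i : 0 <= t -> measurable_fun setT (fun w => Y t w i 0).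
  by move=> t0; apply: borel_coord; exact: mY.
split=> //.
  apply: filterS3 W0 cY eqY => w W0 cY eqY; split.
    apply/colP => i; rewrite eqY // set_itv1 W0 mulmx0 mxE addr0 Rintegral_set1 addr0 //.
  exact: integral_equation_consistent eqY.
(* Exponent 4 because [sqn] is already a square. *)
have [C hC] := mom 4 (ler0n _ _).
exists `|C| => // t t0.
have mq : measurable_fun setT (fun w => sqn (Y t w) ^+ 2).
  by apply: measurable_funX; apply: measurable_sqn => i; exact: mc.
have E w : enorm (Y t w) `^ 4 = sqn (Y t w) ^+ 2.
  by rewrite powR_mulrn ?enorm_ge0 // -enorm_sqr -exprM.
have hI : (\int[P]_w (sqn (Y t w) ^+ 2)%:E <= `|C|%:E)%E.
  under eq_integral do rewrite -E.
  by apply: le_trans (hC t t0) _; rewrite lee_fin ler_norm.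
have l : L1 P (fun w => sqn (Y t w) ^+ 2).
  apply/integrableP; split; first exact/measurable_EFinP.
  under eq_integral do rewrite /= ger0_norm ?sqr_ge0 //.
  by apply: le_lt_trans hI _; exact: ltry.
by split=> //; rewrite -lee_fin -ExE.
Qed.

Lemma stacked_ito_system d1 d2 d3 d4 r1 r2 r3 r4
    (W1 : R -> Om -> 'cV[R]_r1) (W2 : R -> Om -> 'cV[R]_r2)
    (W3 : R -> Om -> 'cV[R]_r3) (W4 : R -> Om -> 'cV[R]_r4)
    (B1 : 'cV[R]_d1 -> 'cV[R]_d1) (B2 : 'cV[R]_d2 -> 'cV[R]_d2)
    (B3 : 'cV[R]_d3 -> 'cV[R]_d3) (B4 : 'cV[R]_d4 -> 'cV[R]_d4)
    (S1 : 'M[R]_(d1, r1)) (S2 : 'M[R]_(d2, r2)) (S3 : 'M[R]_(d3, r3)) (S4 : 'M[R]_(d4, r4))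
    (c1 : 'cV[R]_d1) (c2 : 'cV[R]_d2) (c3 : 'cV[R]_d3) (c4 : 'cV[R]_d4)
    (Y1 : R -> Om -> 'cV[R]_d1) (Y2 : R -> Om -> 'cV[R]_d2)
    (Y3 : R -> Om -> 'cV[R]_d3) (Y4 : R -> Om -> 'cV[R]_d4) :
  wiener P W1 -> wiener P W2 -> wiener P W3 -> wiener P W4 ->
  indep_sigma P (tnth [tuple proc_sigma W1; proc_sigma W2; proc_sigma W3; proc_sigma W4]) ->
  latent_process P B1 S1 W1 c1 Y1 -> latent_process P B2 S2 W2 c2 Y2 ->
  latent_process P B3 S3 W3 c3 Y3 -> latent_process P B4 S4 W4 c4 Y4 ->
  let B := col_drift B1 (col_drift B2 (col_drift B3 B4)) in
  glob_lipschitz B /\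
  ito_system P B
    (block_mx S1 0 0 (block_mx S2 0 0 (block_mx S3 0 0 S4)))
    (col_mx c1 (col_mx c2 (col_mx c3 c4)))
    (fun t w => col_mx (W1 t w) (col_mx (W2 t w) (col_mx (W3 t w) (W4 t w))))
    (fun t w => col_mx (Y1 t w) (col_mx (Y2 t w) (col_mx (Y3 t w) (Y4 t w)))).
Proof.
move=> h1 h2 h3 h4 hW l1 l2 l3 l4 B.
have [lip mY aeY mom] := diffusion_col (latent_diffusion h1 l1) (diffusion_col (latent_diffusion h2 l2)
  (diffusion_col (latent_diffusion h3 l3) (latent_diffusion h4 l4))).
have [mW gW] := noise_coordinates_col (wiener_noise_coordinates h1)
  (noise_coordinates_col (wiener_noise_coordinates h2)
  (noise_coordinates_col (wiener_noise_coordinates h3) (wiener_noise_coordinates h4))).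
split=> //; split=> // m u u0 ut.
have u0' k : 0 <= u k by elim: k => // k IH; rewrite (le_trans IH) // ltW.
have [_ _ _ _ i1] := h1; have [_ _ _ _ i2] := h2.
have [_ _ _ _ i3] := h3; have [_ _ _ _ i4] := h4.
by refine (indep_increments4 u0' hW _ _ _ _); [exact: i1|exact: i2|exact: i3|exact: i4].
Qed.

End StackedDiffusion.

Section Loading.
Context {R : realType} {p1 p2 k1 k2 : nat}.
Variables (L1 : 'M[R]_(p1, k1)) (L2 : 'M[R]_(p2, k2)) (G : 'M[R]_(k2, k1)) (Ps : 'M[R]_k2).

(* The observation is [loading] times the stacked latent process (xi, delta, eps, zeta). *)
Definition loading : 'M[R]_(p1 + p2, k1 + (p1 + (p2 + k2))) :=
  row_mx (col_mx L1 (L2 *m invmx Ps *m G))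
    (row_mx (col_mx 1%:M 0) (row_mx (col_mx 0 1%:M) (col_mx 0 (L2 *m invmx Ps)))).

Lemma loading_mul (x : 'cV[R]_k1) (d : 'cV[R]_p1) (e : 'cV[R]_p2) (z y : 'cV[R]_k2) :
  Ps \in unitmx -> Ps *m y = G *m x + z ->
  loading *m col_mx x (col_mx d (col_mx e z)) = col_mx (L1 *m x + d) (L2 *m y + e).
Proof.
move=> uP ey; have -> : y = invmx Ps *m (G *m x + z) by rewrite -ey mulKmx.
rewrite !mul_row_col !mul_col_mx !mul1mx !mul0mx !add_col_mx !addr0 ?add0r.
by rewrite mulmxDr mulmxDr !mulmxA addrA addrAC.
Qed.

(** Identifies the limit of the realized covariance with the structural covariance at the true
    matrices. *)
Lemma loading_covariance r1 r2 r3 r4 (S1 : 'M[R]_(k1, r1)) (S2 : 'M[R]_(p1, r2))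
    (S3 : 'M[R]_(p2, r3)) (S4 : 'M[R]_(k2, r4)) :
  let A := loading *m block_mx S1 0 0 (block_mx S2 0 0 (block_mx S3 0 0 S4)) in
  A *m A^T = Sigma (Sem L1 L2 G Ps (S1 *m S1^T) (S2 *m S2^T) (S3 *m S3^T) (S4 *m S4^T)).
Proof.
rewrite SigmaE /=; last by rewrite trmx_mul trmxK.
rewrite /loading !mul_row_block !mulmx0 !addr0 !add0r.
rewrite !tr_row_mx !mul_row_col.
have cg m n (A : 'M[R]_(m, n)) s (T : 'M[R]_(n, s)) : A *m T *m (A *m T)^T = A *m (T *m T^T) *m A^T.
  by rewrite trmx_mul !mulmxA.
rewrite !cg -[RHS]addrA; congr (_ + _); rewrite addrA addrC; congr (_ + _).
rewrite !tr_col_mx !trmx1 !trmx0 (mul_col_mx _ _ (S2 *m _)) (mul_col_mx _ _ (S3 *m _)) !mul1mx !mul0mx !mul_col_row !mulmx0 !mulmx1.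
by rewrite add_block_mx !addr0 !add0r.
Qed.

End Loading.

(** * Asymptotics of the test statistic *)

Section ContrastExpansion.
Context {R : realType}.

Lemma contrast_ge0 p (Q S : 'M[R]_p) : psd Q -> posdef S -> 0 <= contrast Q S.
Proof.
move=> psQ pS; rewrite /contrast; case: ifP => [uQ|_]; last exact: sqr_ge0.
by apply: F_disc_ge0 => //; exact: psd_unit_posdef.
Qed.

(** [inf] is a lower bound only for a set that is bounded below, here by 0. *)
Lemma attains_inf_le (T : Type) (A : set T) (f : T -> R) (x y : T) :
  (forall z, A z -> 0 <= f z) -> attains_inf A f x -> A y -> f x <= f y.
Proof.
move=> f0 [_ ->] Ay; apply: ge_inf; last by exists y.
by exists 0 => _ [z Az <-]; exact: f0.
Qed.

Variables (p q : nat) (Theta : set 'rV[R]_q) (S : 'rV[R]_q -> 'M[R]_p).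
Variables (theta0 : 'rV[R]_q) (gamma delta : R).
Hypotheses (cTheta : compact Theta) (iTheta : interior Theta theta0).
Hypotheses (pS : forall th, Theta th -> posdef (S th)).
Hypotheses (dS : forall th, Theta th -> diffmx S th).
Hypotheses (idS : forall th, Theta th -> S th = S theta0 -> th = theta0).
Hypothesis fJ : row_free ('J (fun th => vech (S th)) theta0).
Hypotheses (g0 : 0 < gamma) (d0 : 0 < delta).
Hypothesis deltaP : forall j, j \in active theta0 -> delta < `|theta0 0 j|.
Let S0 := S theta0.
Let m := (vech_dim p - #|active theta0|)%N.

(** Once [tt] has the zero pattern of [theta0], the restricted set is that of [restricted_minimum].
    The fluctuation is compared with [l2] by the condition [enorm (Q - S0) <= r * l2], through which
    the divergence of [sqrt n * lambda2] will enter. *)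
Theorem restricted_contrast_expansion : exists (K : 'M[R]_(vech_dim p, m)) (B : 'I_m -> 'M[R]_p),
  [/\ forall a, (B a)^T = B a,
      forall D, D^T = D -> forall a, (vech D *m K) 0 a = \tr (B a *m D),
      forall a b, 2 * \tr (B a *m S0 *m (B b *m S0)) = (a == b)%:R &
      forall e, 0 < e -> exists2 r, 0 < r & forall Q l1 l2 th tt tc,
        psd Q -> enorm (Q - S0) <= r -> 0 < l1 -> l1 <= r -> 0 < l2 ->
        enorm (Q - S0) <= r * l2 ->
        attains_inf Theta (fun th => contrast Q (S th)) th ->
        minimizes Theta (penalized l1 l2 gamma delta th) tt ->
        attains_inf (restricted Theta tt) (fun th => contrast Q (S th)) tc ->
        `|contrast Q (S tc) - sqn (vech (Q - S0) *m K)| <= e * enorm (Q - S0) ^+ 2].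
Proof.
have T0 : Theta theta0 by exact: interior_subset.
have [K [B [U [tB hB oB lowN [UA eqN]]]]] := quadratic_reduction (active theta0) (pS T0) fJ.
exists K, B; split=> // e e0.
have th0A j : j \notin active theta0 -> theta0 0 j = 0 by rewrite inE negbK => /eqP.
have [r1 r10 h1] := restricted_minimum cTheta iTheta pS dS idS fJ th0A lowN UA eqN e0.
have [C [r2 r20 [C0 h2]]] := contrast_rate cTheta iTheta pS dS idS fJ.
have [r3 r30 h3] := selection_consistency iTheta g0 d0 deltaP.
have [r4 r40 h4] := posdef_nbhs (pS T0).
(* [r3 / C] brings [th] into the range of selection consistency, and [(2 * C)^-1] turns the
   condition on [l2] into [enorm (th - theta0) <= l2 / 2]. *)
exists (Num.min (Num.min r1 r2) (Num.min (Num.min r3 r4) (Num.min (r3 / C) (2 * C)^-1))).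
  by rewrite !lt_min r10 r20 r30 r40 divr_gt0 // invr_gt0 mulr_gt0.
move=> Q l1 l2 th tt tc psQ; rewrite !le_min.
move=> /andP[/andP[q1 q2] /andP[/andP[q3 q4] /andP[q5 _]]] l10 /andP[_ /andP[/andP[l1r _] _]] l20 ql ath mtt atc.
have qC : enorm (Q - S0) <= (2 * C)^-1 * l2.
  by apply: le_trans ql _; rewrite ler_pM2r // !ge_min lexx !orbT.
(* Near [S0] the matrix [Q] is invertible, which selects the logarithmic branch of the contrast. *)
have pQ : posdef Q := h4 Q psQ.1 q4.
have cE T : contrast Q T = F_disc Q T by rewrite /contrast posdef_unit.
have c0 z : Theta z -> 0 <= contrast Q (S z) by move=> Tz; apply: contrast_ge0 (pS Tz).
have r : enorm (th - theta0) <= C * enorm (Q - S0).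
  apply: h2 => //; first by case: ath.
  by have := attains_inf_le c0 ath T0; rewrite !cE.
have sel : forall j, (tt 0 j = 0) <-> (j \notin active theta0).
  apply: (h3 l1 l2 th tt) => //.
    by apply: le_trans r _; rewrite mulrC -ler_pdivlMr.
  apply: le_trans r _; rewrite mulrC -ler_pdivlMr //; apply: le_trans qC _.
  have -> : (2 * C)^-1 * l2 = l2 / 2 / C by field; rewrite gt_eqF.
  by [].
rewrite cE; have [[Ttc ztc] _] := atc.
apply: h1 => // [j /sel|th' Tth' zth'].
  exact: ztc.
rewrite -!cE; apply: (attains_inf_le _ atc) => [z [Tz _]|]; first exact: c0.
by split=> // j /sel; exact: zth'.
Qed.

End ContrastExpansion.

(** * Transfer of Laplace transforms to the noise term *)

Section LaplaceTransfer.
Context {R : realType}.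

Lemma expRN_dist (x y : R) : 0 <= x -> 0 <= y -> `|expR (- x) - expR (- y)| <= `|x - y|.
Proof.
wlog xy : x y / x <= y => [hw x0 y0|x0 y0].
  by case: (leP x y) => [xy|/ltW yx]; [exact: hw|rewrite distrC [leRHS]distrC; exact: hw].
rewrite ger0_norm ?subr_ge0 ?ler_expR ?lerN2 // ler0_norm ?subr_le0 // opprB.
have -> : expR (- y) = expR (- x) * expR (- (y - x)) by rewrite -expRD; congr expR; ring.
have h := expR_ge1Dx (- (y - x)).
have e0 := expR_ge0 (- x : R).
have e1 : expR (- x) <= 1 :> R by rewrite -[leRHS]expR0 ler_expR oppr_le0.
have := ler_wpM2l e0 h; nra.
Qed.

Lemma vech_mul_le p m (K : 'M[R]_(vech_dim p, m)) (D : 'M[R]_p) :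
  enorm (vech D *m K) <= enorm K * enorm D.
Proof.
apply: le_trans (enormM _ _) _; rewrite mulrC ler_wpM2l ?enorm_ge0 //; exact: vech_le.
Qed.

Lemma sqn_dist m n (a b : 'M[R]_(m, n)) : `|sqn a - sqn b| <= enorm (a - b) * (enorm a + enorm b).
Proof.
have h1 := ler_enormD (a - b) b; rewrite subrK in h1.
have h2 := ler_enormD (b - a) a; rewrite subrK -enormB in h2.
rewrite -!enorm_sqr subr_sqr normrM.
have e : 0 <= enorm a + enorm b by rewrite addr_ge0 ?enorm_ge0.
by rewrite (ger0_norm e) ler_wpM2r // ler_norml; lra.
Qed.

(** A Markov inequality before integration: where [u] exceeds [kap] the difference is at most 1, and
    1 is at most [kap^-1 * (enorm v + D)]. The bound is linear in [enorm v] and [D], so only first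
    moments enter. *)
Lemma laplace_dist_pointwise p m (K : 'M[R]_(vech_dim p, m)) (k kap e T D : R) (u v : 'M[R]_p) :
  0 <= k -> 0 < kap -> 0 <= T -> enorm (u - v) <= D ->
  (enorm u <= kap -> `|T - sqn (vech u *m K)| <= e) -> 0 <= e ->
  `|expR (- (k * T)) - expR (- (k * sqn (vech v *m K)))| <=
    kap^-1 * enorm v + k * e + (kap^-1 + 1 + k * (enorm K ^+ 2 * (2 * kap + 1))) * D.
Proof.
move=> k0 kap0 T0 uvD hT e0.
have D0 : 0 <= D := le_trans (enorm_ge0 _) uvD.
set L := fun x : 'M[R]_p => vech x *m K.
have s0 : 0 <= sqn (L v) by exact: sqn_ge0.
have triv : `|expR (- (k * T)) - expR (- (k * sqn (L v)))| <= 1.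
  have a : 0 <= expR (- (k * T)) <= 1.
    by rewrite expR_ge0 -[X in _ <= X]expR0 ler_expR oppr_le0 mulr_ge0.
  have b : 0 <= expR (- (k * sqn (L v))) <= 1.
    by rewrite expR_ge0 -[X in _ <= X]expR0 ler_expR oppr_le0 mulr_ge0.
  by rewrite ler_norml; lra.
have c0 : 0 <= kap^-1 by rewrite invr_ge0 ltW.
have v0 : 0 <= kap^-1 * enorm v by rewrite mulr_ge0 ?enorm_ge0.
have ke : 0 <= k * e by rewrite mulr_ge0.
have x0 : 0 <= kap^-1 * D by rewrite mulr_ge0.
have y0 : 0 <= k * (enorm K ^+ 2 * (2 * kap + 1)) by rewrite mulr_ge0 // mulr_ge0 ?sqr_ge0 //; lra.
have z0 := mulr_ge0 y0 D0.
case: (leP (enorm u) kap) => [uk|uk]; last first.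
  apply: le_trans triv _.
  have h := ler_enormD (u - v) v; rewrite subrK in h.
  have : kap^-1 * kap <= kap^-1 * (D + enorm v).
    by rewrite ler_wpM2l // ltW // (lt_le_trans uk) //; lra.
  by rewrite mulVf ?gt_eqF //; lra.
(* For [D > 1] the trivial bound is enough; for [D <= 1] the norm of [v] is at most [kap + 1],
   whence the factor [2 * kap + 1]. *)
case: (leP D 1) => [D1|D1]; last by apply: le_trans triv _; lra.
apply: le_trans (expRN_dist _ _) _; do ?exact: mulr_ge0.
rewrite -mulrBr normrM (ger0_norm k0).
have h1 : `|T - sqn (L v)| <= e + enorm K ^+ 2 * (2 * kap + 1) * D.
  have -> : T - sqn (L v) = (T - sqn (L u)) + (sqn (L u) - sqn (L v)) by ring.
  apply: le_trans (ler_normD _ _) _; apply: lerD; first exact: hT.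
  apply: le_trans (sqn_dist _ _) _.
  have h := ler_enormD (v - u) u; rewrite subrK enormB in h.
  have a1 : enorm (L u - L v) <= enorm K * D.
    rewrite /L -mulmxBl -raddfB; apply: le_trans (vech_mul_le _ _) _.
    by rewrite ler_wpM2l ?enorm_ge0.
  have a2 : enorm (L u) + enorm (L v) <= enorm K * (2 * kap + 1).
    apply: le_trans (lerD (vech_mul_le K u) (vech_mul_le K v)) _.
    by rewrite -mulrDr ler_wpM2l ?enorm_ge0 //; lra.
  apply: le_trans (ler_pM (enorm_ge0 _) _ a1 a2) _; first by rewrite addr_ge0 ?enorm_ge0.
  by rewrite le_eqVlt; apply/orP; left; apply/eqP; ring.
have := ler_wpM2l k0 h1; lra.
Qed.

Context {disp : measure_display} {Om : measurableType disp}.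
Variable P : probability Om R.
Variables (p m : nat) (K : 'M[R]_(vech_dim p, m)).
Variables (T : nat -> Om -> R) (u v : nat -> Om -> 'M[R]_p).
Variables (dn : nat -> R) (CV : R).
Hypothesis mT : forall n, measurable_fun setT (T n).
Hypothesis T0 : forall n w, 0 <= T n w.
Hypothesis mv : forall n, measurable_fun setT (fun w => sqn (vech (v n w) *m K)).
Hypothesis uv : \forall n \near \oo, exists D : Om -> R, [/\ L1 P D, Ex P D <= dn n &
  forall w, enorm (u n w - v n w) <= D w].
Hypothesis dn0 : dn n @[n --> \oo] --> 0.
Hypothesis tv : \forall n \near \oo,
  L1 P (fun w => enorm (v n w)) /\ Ex P (fun w => enorm (v n w)) <= CV.
Hypothesis hT : forall kap e : R, 0 < kap -> 0 < e -> \forall n \near \oo, forall w,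
  enorm (u n w) <= kap -> `|T n w - sqn (vech (u n w) *m K)| <= e.

Lemma laplace_transfer (k : R) : 0 <= k ->
  Ex P (fun w => expR (- (k * T n w))) - Ex P (fun w => expR (- (k * sqn (vech (v n w) *m K))))
    @[n --> \oo] --> 0.
Proof.
move=> k0; apply/cvgrPdist_le => e e0.
(* A third of [e] each: [kap] controls the tail of [v], then [e1] the expansion, and finally [n] the
   discretization, whose constant [c] depends on [kap]. *)
have [kap kap0 hkap] : exists2 kap, 0 < kap & kap^-1 * CV <= e / 3.
  exists (3 * (`|CV| + 1) / e); first by rewrite divr_gt0 // mulr_gt0 // ltr_wpDl.
  have c0 : 0 < `|CV| + 1 by rewrite ltr_wpDl.
  have -> : (3 * (`|CV| + 1) / e)^-1 * CV = e / 3 * (CV / (`|CV| + 1)) by field; rewrite !gt_eqF.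
  have q : CV / (`|CV| + 1) <= 1 by rewrite ler_pdivrMr // mul1r; have := ler_norm CV; lra.
  have e3 : 0 <= e / 3 by lra.
  by have := ler_wpM2l e3 q; rewrite mulr1.
pose e1 := e / 3 / (k + 1); have e10 : 0 < e1 by rewrite !divr_gt0 // ltr_wpDl.
have ke1 : k * e1 <= e / 3.
  have q : k / (k + 1) <= 1 by rewrite ler_pdivrMr; lra.
  have e3 : 0 <= e / 3 by lra.
  have := ler_wpM2l e3 q; rewrite mulr1.
  by have -> : e / 3 * (k / (k + 1)) = k * e1 by rewrite /e1; ring.
pose c := kap^-1 + 1 + k * (enorm K ^+ 2 * (2 * kap + 1)).
have c0 : 0 < c.
  have a1 : 0 < kap^-1 by rewrite invr_gt0.
  have a2 : 0 <= k * (enorm K ^+ 2 * (2 * kap + 1)) by rewrite mulr_ge0 // mulr_ge0 ?sqr_ge0 //; lra.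
  by rewrite /c; lra.
have hd : \forall n \near \oo, dn n <= e / 3 / c.
  have d0 : 0 < e / 3 / c by rewrite !divr_gt0.
  move/cvgrPdist_le : dn0 => /(_ _ d0); apply: filterS => n.
  by rewrite sub0r normrN; apply: le_trans; exact: ler_norm.
near=> n.
have [D [lD eD dD]] : exists D : Om -> R, [/\ L1 P D, Ex P D <= dn n &
    forall w, enorm (u n w - v n w) <= D w].
  by near: n; exact: uv.
have [lv ev] : L1 P (fun w => enorm (v n w)) /\ Ex P (fun w => enorm (v n w)) <= CV.
  by near: n; exact: tv.
have hn : forall w, enorm (u n w) <= kap -> `|T n w - sqn (vech (u n w) *m K)| <= e1.
  by near: n; exact: hT.
have dne : dn n <= e / 3 / c by near: n; exact: hd.
have bnd (f : Om -> R) : measurable_fun setT f -> (forall w, 0 <= f w) ->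
    L1 P (fun w => expR (- (k * f w))).
  move=> mf f0; apply: (@L1_bounded _ _ _ P _ 1) => [|w].
    by apply: measurableT_comp => //; apply: measurable_funN; exact: measurable_funM.
  by rewrite ger0_norm ?expR_ge0 // -[leRHS]expR0 ler_expR oppr_le0 mulr_ge0.
have lT := bnd _ (mT n) (T0 n).
have ls := bnd _ (mv n) (fun w => sqn_ge0 _).
rewrite sub0r normrN -ExB //; apply: le_trans (Ex_norm (L1B lT ls)) _.
have pw w := laplace_dist_pointwise k0 kap0 (T0 n w) (dD w) (hn w) (ltW e10).
have lA := L1D (L1Z kap^-1 lv) (L1_cst P (k * e1)).
apply: le_trans (Ex_le (L1_norm (L1B lT ls)) (L1D lA (L1Z c lD)) pw) _.
rewrite (ExD lA (L1Z c lD)) (ExD (L1Z kap^-1 lv) (L1_cst P _)) Ex_cst (ExZ _ lv) (ExZ _ lD).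
have a1 : kap^-1 * Ex P (fun w => enorm (v n w)) <= kap^-1 * CV.
  by rewrite ler_wpM2l // invr_ge0 ltW.
have a2 : c * Ex P D <= e / 3.
  apply: le_trans (ler_wpM2l (ltW c0) (le_trans eD dne)) _.
  by rewrite mulrC divfK // gt_eqF.
lra.
Unshelve. all: by end_near.
Qed.

End LaplaceTransfer.

(** * Measurability of the test statistic *)

Section MatrixMeasurability.
Context {R : realType} {d : measure_display} {T : measurableType d}.

Definition measurable_mx m n (Z : T -> 'M[R]_(m, n)) :=
  forall i j, measurable_fun setT (fun w => Z w i j).

Lemma measurable_mx_cst m n (A : 'M[R]_(m, n)) : measurable_mx (fun=> A).
Proof. by move=> i j; exact: measurable_cst. Qed.

Lemma measurable_mxD m n (Z Z' : T -> 'M[R]_(m, n)) :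
  measurable_mx Z -> measurable_mx Z' -> measurable_mx (fun w => Z w + Z' w).
Proof. by move=> h h' i j; under eq_fun do rewrite mxE; exact: measurable_funD. Qed.

Lemma measurable_mxB m n (Z Z' : T -> 'M[R]_(m, n)) :
  measurable_mx Z -> measurable_mx Z' -> measurable_mx (fun w => Z w - Z' w).
Proof. by move=> h h' i j; under eq_fun do rewrite !mxE; exact: measurable_funB. Qed.

Lemma measurable_mxM m n s (Z : T -> 'M[R]_(m, n)) (Z' : T -> 'M[R]_(n, s)) :
  measurable_mx Z -> measurable_mx Z' -> measurable_mx (fun w => Z w *m Z' w).
Proof.
move=> h h' i j; under eq_fun do rewrite mxE.
by apply: measurable_sum => k; exact: measurable_funM.
Qed.

Lemma measurable_mxZ m n (a : T -> R) (Z : T -> 'M[R]_(m, n)) :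
  measurable_fun setT a -> measurable_mx Z -> measurable_mx (fun w => a w *: Z w).
Proof. by move=> ha h i j; under eq_fun do rewrite mxE; exact: measurable_funM. Qed.

Lemma measurable_mx_tr m n (Z : T -> 'M[R]_(m, n)) :
  measurable_mx Z -> measurable_mx (fun w => (Z w)^T).
Proof. by move=> h i j; under eq_fun do rewrite mxE; exact: h. Qed.

Lemma measurable_mx_sum m n (I : Type) (s : seq I) (Z : I -> T -> 'M[R]_(m, n)) :
  (forall i, measurable_mx (Z i)) -> measurable_mx (fun w => \sum_(i <- s) Z i w).
Proof. by move=> h i j; under eq_fun do rewrite summxE; apply: measurable_sum => k; exact: h. Qed.

Lemma measurable_mx_block m1 m2 n1 n2 (A : T -> 'M[R]_(m1, n1)) (B : T -> 'M[R]_(m1, n2))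
    (C : T -> 'M[R]_(m2, n1)) (D : T -> 'M[R]_(m2, n2)) :
  measurable_mx A -> measurable_mx B -> measurable_mx C -> measurable_mx D ->
  measurable_mx (fun w => block_mx (A w) (B w) (C w) (D w)).
Proof.
move=> hA hB hC hD i j.
case: (split_ordP i) => i' ->; case: (split_ordP j) => j' ->;
under eq_fun do rewrite ?block_mxEul ?block_mxEur ?block_mxEdl ?block_mxEdr;
by [exact: hA | exact: hB | exact: hC | exact: hD].
Qed.

Lemma measurable_tr n (Z : T -> 'M[R]_n) : measurable_mx Z ->
  measurable_fun setT (fun w => \tr (Z w)).
Proof. by move=> h; apply: measurable_sum => i; exact: h. Qed.

Lemma measurable_det n (Z : T -> 'M[R]_n) : measurable_mx Z ->
  measurable_fun setT (fun w => \det (Z w)).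
Proof.
move=> h; apply: measurable_sum => s; apply: measurable_funM => //.
by apply: measurable_prod => i _; exact: h.
Qed.

(** The inverse is written through [ln] and [expR] of the square; at 0 both expressions vanish. *)
Lemma measurable_invr (f : T -> R) : measurable_fun setT f -> measurable_fun setT (fun w => (f w)^-1).
Proof.
move=> mf; have -> : (fun w => (f w)^-1) = fun w => f w * expR (- ln (f w ^+ 2)).
  apply/funext => w; have [->|f0] := eqVneq (f w) 0; first by rewrite invr0 mul0r.
  have p : 0 < f w ^+ 2 by rewrite lt_def sqr_ge0 sqrf_eq0 f0.
  by rewrite expRN lnK ?posrE // expr2 invfM mulrA divff // mul1r.
apply: measurable_funM => //; apply: measurableT_comp => //; apply: measurable_funN.
by apply: measurableT_comp; [exact: measurable_ln | exact: measurable_funX].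
Qed.

Lemma measurable_invmx n (Z : T -> 'M[R]_n) : (forall w, Z w \in unitmx) ->
  measurable_mx Z -> measurable_mx (fun w => invmx (Z w)).
Proof.
move=> uZ mZ; have -> : (fun w => invmx (Z w)) = fun w => (\det (Z w))^-1 *: \adj (Z w).
  by apply/funext => w; rewrite /invmx uZ.
apply: measurable_mxZ; first by apply: measurable_invr; exact: measurable_det.
move=> i j; under eq_fun do rewrite mxE.
apply: measurable_funM => //; apply: measurable_det => k l.
by under eq_fun do rewrite !mxE; exact: mZ.
Qed.

Lemma measurable_vech n (Z : T -> 'M[R]_n) : measurable_mx Z -> measurable_mx (fun w => vech (Z w)).
Proof. by move=> h i j; rewrite ord1; under eq_fun do rewrite vechE; exact: h. Qed.

Lemma measurable_mx_sqn m n (Z : T -> 'M[R]_(m, n)) : measurable_mx Z ->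
  measurable_fun setT (fun w => sqn (Z w)).
Proof.
by move=> h; apply: measurable_sum => i; apply: measurable_sum => j; exact: measurable_funX.
Qed.

Lemma measurable_Sigma p1 p2 k1 k2 q (M : @param_sem R p1 p2 k1 k2 q) (th : T -> 'rV[R]_q) :
  (forall w, admissible (sem_at M (th w))) -> measurable_mx th ->
  measurable_mx (fun w => Sigma (sem_at M (th w))).
Proof.
move=> ad mth.
have ent m n (A : 'M[R + 'I_q]_(m, n)) : measurable_mx (fun w => map_mx (entry (th w)) A).
  move=> i j; under eq_fun do rewrite mxE.
  by case: (A i j) => [c|k] /=; [exact: measurable_cst|exact: mth].
have uP w : Psi (sem_at M (th w)) \in unitmx by case: (ad w).
have mP := measurable_invmx uP (ent _ _ (Psi M)).
have mS : measurable_mx (fun w => let N := sem_at M (th w) in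
    Lx1 N *m Sxi N *m (Gam N)^T *m (invmx (Psi N))^T *m (Lx2 N)^T).
  apply: measurable_mxM; last by apply: measurable_mx_tr; exact: ent.
  apply: measurable_mxM; last by apply: measurable_mx_tr; exact: mP.
  apply: measurable_mxM; last by apply: measurable_mx_tr; exact: ent.
  by apply: measurable_mxM; exact: ent.
apply: measurable_mx_block => //.
- apply: measurable_mxD; last exact: ent.
  apply: measurable_mxM; last by apply: measurable_mx_tr; exact: ent.
  by apply: measurable_mxM; exact: ent.
- exact: measurable_mx_tr.
apply: measurable_mxD; last exact: ent.
apply: measurable_mxM; last by apply: measurable_mx_tr; exact: ent.
apply: measurable_mxM; last by apply: measurable_mx_tr; exact: mP.
apply: measurable_mxM; first by apply: measurable_mxM; [exact: ent|exact: mP].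
apply: measurable_mxD; last exact: ent.
apply: measurable_mxM; last by apply: measurable_mx_tr; exact: ent.
by apply: measurable_mxM; exact: ent.
Qed.

Lemma measurable_contrast p (Q S : T -> 'M[R]_p) : (forall w, S w \in unitmx) ->
  measurable_mx Q -> measurable_mx S -> measurable_fun setT (fun w => contrast (Q w) (S w)).
Proof.
move=> uS mQ mS.
have -> : (fun w => contrast (Q w) (S w)) = fun w => if \det (Q w) == 0
    then enorm (vech (Q w) - vech (S w)) ^+ 2 else F_disc (Q w) (S w).
  by apply/funext => w; rewrite /contrast unitmxE unitfE; case: eqP.
apply: measurable_fun_ifT.
- by apply: measurable_fun_eqr => //; exact: measurable_det.
- under eq_fun do rewrite enorm_sqr.
  by apply: measurable_mx_sqn; apply: measurable_mxB; exact: measurable_vech.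
apply: measurable_funB => //; apply: measurable_funD; last first.
  by apply: measurable_tr; apply: measurable_mxM => //; exact: measurable_invmx.
by apply: measurable_funB; (apply: measurableT_comp; [exact: measurable_ln|exact: measurable_det]).
Qed.

End MatrixMeasurability.

Section PartialSumMoment.
Context {R : realType} {disp : measure_display} {Om : measurableType disp}.
Variable P : probability Om R.
Variables (r : nat) (Mom : R) (n : nat) (y : nat -> 'I_r -> Om -> R) (G1 G2 : nat -> set (set Om)).
Hypothesis hy : @centered_array _ _ _ P r Mom n y G1 G2.

Lemma partial_sum_moment (e : R) a j : (j <= n)%N ->
  [/\ measurable_fun setT (partial_sum e y j a), L1 P (fun w => partial_sum e y j a w ^+ 2) &
      Ex P (fun w => partial_sum e y j a w ^+ 2) = e ^+ 2 * j%:R].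
Proof.
have [my mG1 mG2 ind hm] := hy.
elim: j => [_|j IH lj].
  have -> : partial_sum e y 0 a = fun=> 0 by apply/funext => w; rewrite /partial_sum big_ord0 mulr0.
  rewrite mulr0; split; first exact: measurable_cst.
    exact: L1_cst.
  by rewrite Ex_cst expr0n.
have [mU LU EU] := IH (ltnW lj); have [_ _ m1 m2] := hm j lj; have [Ly Lyy] := array_L1 hy lj.
set U := partial_sum e y j a in mU LU EU *.
have UE : partial_sum e y j.+1 a = fun w => U w + e * y j a w.
  by apply/funext => w; rewrite /U /partial_sum big_ord_recr mulrDr.
have [LU1 _] := Ex_sqr_norm mU LU.
have mGU : measG (G1 j) U.
  by apply: measurable_funM => //; apply: measurable_sum => i; exact: mG1.
have [Lx Ex0] := ind j _ _ lj mGU (mG2 j a lj) LU1 (Ly a).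
have E2 : (fun w => partial_sum e y j.+1 a w ^+ 2) =
    fun w => U w ^+ 2 + (2 * e * (U w * y j a w) + e ^+ 2 * (y j a w * y j a w)).
  by apply/funext => w; rewrite UE; ring.
have l1 := L1Z (2 * e) Lx; have l2 := L1Z (e ^+ 2) (Lyy a a).
split.
- by rewrite UE; apply: measurable_funD => //; apply: measurable_funM => //; exact: my.
- by rewrite E2; apply: L1D => //; exact: L1D.
rewrite E2 (ExD LU (L1D l1 l2)) (ExD l1 l2) (ExZ _ Lx) (ExZ _ (Lyy a a)) Ex0 m1 m2 eqxx EU.
by rewrite -natr1 -[true%:R]/(1 : R); ring.
Qed.

End PartialSumMoment.

(** * The normalized covariance of the noise *)

Section NoiseLimit.
Context {R : realType} {disp : measure_display} {Om : measurableType disp}.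
Variable P : probability Om R.
Variables (d r : nat) (B : 'cV[R]_d -> 'cV[R]_d) (S : 'M[R]_(d, r)) (c : 'cV[R]_d).
Variables (W : R -> Om -> 'cV[R]_r) (Y : R -> Om -> 'cV[R]_d).
Hypothesis lipB : glob_lipschitz B.
Hypothesis sys : ito_system P B S c W Y.
Variables (p : nat) (A : 'M[R]_(p, r)).
Let S0 := A *m A^T.

(** The normalized error of the realized covariance of [A *m W], that is, of the observation without
    drift. *)
Definition noise_covariance (n : nat) (h : R) (w : Om) : 'M[R]_p :=
  (Num.sqrt n%:R)^-1 *: \sum_(i < n)
    (h^-1 *: ((A *m (W (i.+1%:R * h) w - W (i%:R * h) w)) *m
              (A *m (W (i.+1%:R * h) w - W (i%:R * h) w))^T) - S0).

Lemma outer_sym m n (x : 'M[R]_(m, n)) : (x *m x^T)^T = x *m x^T.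
Proof. by rewrite trmx_mul trmxK. Qed.

Lemma noise_covariance_sym n h w : (noise_covariance n h w)^T = noise_covariance n h w.
Proof.
rewrite /noise_covariance linearZ /= raddf_sum /=; congr (_ *: _); apply: eq_bigr => i _.
by rewrite linearB /= linearZ /= !outer_sym.
Qed.

Lemma measurable_noise_covariance n h : 0 < h -> measurable_mx (noise_covariance n h).
Proof.
move=> h0; have [[mW _] _ _ _ _] := sys.
have t0 i : 0 <= i%:R * h by rewrite mulr_ge0 // ltW.
have mI i : measurable_mx (fun w => A *m (W (i.+1%:R * h) w - W (i%:R * h) w)).
  apply: measurable_mxM; first exact: measurable_mx_cst.
  by apply: measurable_mxB => a b; rewrite ord1; exact: mW.
apply: measurable_mxZ; first exact: measurable_cst.
apply: measurable_mx_sum => i; apply: measurable_mxB; last exact: measurable_mx_cst.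
apply: measurable_mxZ; first exact: measurable_cst.
by apply: measurable_mxM => //; exact: measurable_mx_tr.
Qed.

Lemma trace_outer (C : 'M[R]_p) (x : 'cV[R]_r) :
  \tr (C *m ((A *m x) *m (A *m x)^T)) = \sum_b \sum_c (A^T *m C *m A) b c * (x b 0 * x c 0).
Proof.
rewrite trmx_mul !mulmxA mxtrace_mulC !mulmxA /mxtrace; apply: eq_bigr => b _.
rewrite mxE big_ord1 mxE mulr_suml; apply: eq_bigr => j _.
by rewrite [x^T _ _]mxE; ring.
Qed.

Lemma trace_qform (C : 'M[R]_p) :
  \tr (C *m S0) = \sum_b \sum_c (A^T *m C *m A) b c * (b == c)%:R.
Proof.
rewrite /S0 mulmxA mxtrace_mulC mulmxA /mxtrace; apply: eq_bigr => b _.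
rewrite (bigD1 b) //= eqxx mulr1 big1 ?addr0 // => j jb.
by rewrite eq_sym (negPf jb) mulr0.
Qed.

(** In standardized increments the trace against [C a] is the centred quadratic form with matrix
    [A^T *m C a *m A]; cyclicity of the trace carries the normalization over. *)
Theorem noise_array m (C : 'I_m -> 'M[R]_p) n h : 0 < h ->
  (forall a, (C a)^T = C a) ->
  (forall a b, 2 * \tr (C a *m S0 *m (C b *m S0)) = (a == b)%:R) ->
  exists y G1 G2, @centered_array _ _ _ P m (qmom (fun a => A^T *m C a *m A)) n y G1 G2 /\
    forall w a, \tr (C a *m noise_covariance n h w) = partial_sum (Num.sqrt n%:R)^-1 y n a w.
Proof.
move=> h0 tC oC; have [[mW _] _ gW iW _] := sys.
pose s := Num.sqrt h; have s0 : 0 < s by rewrite sqrtr_gt0.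
have ss : s * s = h by rewrite -expr2 sqr_sqrtr // ltW.
pose z i b w := s^-1 * noise W h i b w.
have t0 i : 0 <= i%:R * h by rewrite mulr_ge0 // ltW.
have sz i b : (i < n)%N -> std_moments P (z i b).
  move=> _; apply: gaussian_std_moments => //.
  have := gW (i%:R * h) (i.+1%:R * h) b (t0 i); rewrite -mulrBl -natrB ?leqnSn // subSnn mul1r.
  by apply; rewrite ltr_pM2r // ltr_nat.
have iz : indep_rvs P (fun k : 'I_n * 'I_r => z k.1 k.2).
  have iW' := iW n (fun k => k%:R * h) (t0 0%N) (fun k => _).
  move=> D mD; have mD' k : measurable [set x : R | D k (s^-1 * x)].
    have ms : measurable_fun setT (fun x : R => s^-1 * x) by exact: measurable_funM.
    by rewrite -[X in measurable X]setTI; apply: ms.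
  by apply: (iW' _ _ mD') => k; rewrite ltr_pM2r // ltr_nat.
have tM a : (A^T *m C a *m A)^T = A^T *m C a *m A by rewrite !trmx_mul trmxK tC mulmxA.
have oM a b : 2 * \tr ((A^T *m C a *m A) *m (A^T *m C b *m A)) = (a == b)%:R.
  rewrite -oC; congr (2 * _); rewrite /S0 !mulmxA -(mulmxA A^T) -(mulmxA A^T).
  by rewrite -!mulmxA mxtrace_mulC !mulmxA.
have ar := qform_array sz iz tM oM.
do 3 eexists; split; first exact: ar.
move=> w a; rewrite /noise_covariance -scalemxAr linearZ /= /partial_sum; congr (_ * _).
rewrite mulmx_sumr raddf_sum /=; apply: eq_bigr => i _.
rewrite mulmxBr -scalemxAr raddfB /= linearZ /= trace_outer trace_qform mulr_sumr -sumrB.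
apply: eq_bigr => b _; rewrite mulr_sumr -sumrB; apply: eq_bigr => e _.
by rewrite mulrBr /z /noise -ss; field; rewrite gt_eqF.
Qed.

Hypothesis pS0 : posdef S0.

Lemma noise_tight : exists CV : R, forall n h, (0 < n)%N -> 0 < h ->
  L1 P (fun w => enorm (noise_covariance n h w)) /\ Ex P (fun w => enorm (noise_covariance n h w)) <= CV.
Proof.
(* The reduction with no parameters: every direction is kept, so the sum of squares is the full form
   and controls [sqn] up to a constant. *)
have fJ : row_free (0 : 'M[R]_(0, vech_dim p)) by rewrite /row_free mxrank0.
have [K [C [U [tC hC oC _ [_ eqN]]]]] := quadratic_reduction (finset.set0 : {set 'I_0}) pS0 fJ.
set m := (_ - _)%N in K C tC hC oC eqN *.
pose k := \tr S0 ^+ 2 * 2; have k0 : 0 <= k by rewrite mulr_ge0 ?sqr_ge0.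
exists (Num.sqrt (k * m%:R)) => n h n0 h0.
have [y [G1 [G2 [ar hy]]]] := noise_array n h0 tC oC.
have hs w : sqn (noise_covariance n h w) <=
    k * \sum_a partial_sum (Num.sqrt n%:R)^-1 y n a w ^+ 2.
  apply: le_trans (sqn_le_wtr (noise_covariance_sym n h w) pS0) _.
  rewrite /k -mulrA ler_wpM2l ?sqr_ge0 //.
  have := eqN _ (noise_covariance_sym n h w); rewrite mulmx0 linear0 subr0.
  move=> e; rewrite -ler_pdivrMl // mulrC e /sqn big_ord1 le_eqVlt; apply/orP; left; apply/eqP.
  by apply: eq_bigr => a _; rewrite hC ?noise_covariance_sym // hy.
have mE : measurable_fun setT (fun w => enorm (noise_covariance n h w)).
  by apply: measurable_enorm; exact: measurable_noise_covariance.
have pm a := partial_sum_moment ar (Num.sqrt n%:R)^-1 a (leqnn n).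
have ls : L1 P (fun w => k * \sum_a partial_sum (Num.sqrt n%:R)^-1 y n a w ^+ 2).
  by apply: L1Z; apply: L1_sum => a _; case: (pm a).
have lE : L1 P (fun w => enorm (noise_covariance n h w) ^+ 2).
  apply: L1_le ls => [|w]; first exact: measurable_funX.
  by rewrite ger0_norm ?sqr_ge0 // enorm_sqr.
have [l e] := Ex_sqr_norm mE lE; split=> //.
under eq_fun do rewrite -(ger0_norm (enorm_ge0 _)).
apply: le_trans e _; rewrite ler_wsqrtr //.
apply: le_trans (Ex_le lE ls _) _ => [w|]; first by rewrite enorm_sqr.
rewrite ExZ; last by apply: L1_sum => a _; case: (pm a).
rewrite ler_wpM2l // Ex_sum => [|a _]; last by case: (pm a).
rewrite (eq_bigr (fun=> 1)) ?sumr_const ?card_ord // => a _.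
have [_ _ ->] := pm a; rewrite exprVn sqr_sqrtr // mulVf // pnatr_eq0 -lt0n //.
Qed.

End NoiseLimit.

Section Discretization.
Context {R : realType} {disp : measure_display} {Om : measurableType disp}.
Variable P : probability Om R.
Variables (d r : nat) (B : 'cV[R]_d -> 'cV[R]_d) (S : 'M[R]_(d, r)) (c : 'cV[R]_d).
Variables (W : R -> Om -> 'cV[R]_r) (Y : R -> Om -> 'cV[R]_d).
Hypothesis lipB : glob_lipschitz B.
Hypothesis sys : ito_system P B S c W Y.
Variables (p : nat) (Phi : 'M[R]_(p, d)).

Lemma realized_covE (X : R -> 'cV[R]_p) h n : realized_cov X h n = (n%:R * h)^-1 *:
  \sum_(i < n) (X (i.+1%:R * h) - X (i%:R * h)) *m (X (i.+1%:R * h) - X (i%:R * h))^T.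
Proof. by rewrite /realized_cov big_add1 /= big_mkord. Qed.

Lemma realized_cov_psd (X : R -> 'cV[R]_p) h n : 0 <= h -> psd (realized_cov X h n).
Proof.
move=> h0; rewrite realized_covE; split=> [|x].
  by rewrite linearZ /= raddf_sum /=; congr (_ *: _); apply: eq_bigr => i _; rewrite outer_sym.
rewrite -scalemxAr -scalemxAl mxE mulr_ge0 ?invr_ge0 ?mulr_ge0 //.
rewrite mulmx_sumr mulmx_suml summxE; apply: sumr_ge0 => i _.
set v := _ - _; have -> : x^T *m (v *m v^T) *m x = (v^T *m x)^T *m (v^T *m x).
  by rewrite trmx_mul trmxK !mulmxA.
by rewrite sqn_col sqn_ge0.
Qed.

Lemma realized_cov_distance : exists2 C : R, 0 <= C & forall n (h : R), (0 < n)%N -> 0 < h <= 1 ->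
  exists D : Om -> R, [/\ L1 P D, Ex P D <= C * (Num.sqrt h + Num.sqrt (n%:R * h ^+ 2)) &
    forall w, enorm (Num.sqrt n%:R *: (realized_cov (fun t => Phi *m Y t w) h n
        - (Phi *m S) *m (Phi *m S)^T)
      - noise_covariance W (Phi *m S) n h w) <= D w].
Proof.
have [C C0 hC] := discretization_error lipB sys Phi.
exists C => // n h n0 h01; have [D [lD eD hD]] := hC n h h01.
have h0 : 0 < h by case/andP: h01.
pose s := Num.sqrt n%:R : R; have s0 : 0 < s by rewrite sqrtr_gt0 ltr0n.
pose g := Num.sqrt h; have g0 : 0 < g by rewrite sqrtr_gt0.
have ss : n%:R = s * s by rewrite -expr2 sqr_sqrtr.
have gg : h = g * g by rewrite -expr2 sqr_sqrtr // ltW.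
have sh : 0 < (s * h)^-1 by rewrite invr_gt0 mulr_gt0.
(* Normalization turns [h * Num.sqrt (n%:R * h)] into [Num.sqrt h] and [n%:R * h ^+ 2] into its own
   root, the two quantities assumed to vanish. *)
exists (fun w => (s * h)^-1 * D w); split; first exact: L1Z.
  rewrite ExZ //; apply: le_trans (ler_wpM2l (ltW sh) eD) _.
  rewrite le_eqVlt; apply/orP; left; apply/eqP.
  rewrite -/g (sqrtrM _ (ler0n _ n)) (sqrtrM _ (ler0n _ n)) -/s -/g sqrtr_sqr (gtr0_norm h0) ss gg.
  by field; rewrite !gt_eqF.
move=> w; move: (Phi *m S) hD => A hD.
have -> : Num.sqrt n%:R *: (realized_cov (fun t => Phi *m Y t w) h n - A *m A^T)
    - noise_covariance W A n h w = (s * h)^-1 *: \sum_(i < n)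
      ((Phi *m (Y (i.+1%:R * h) w - Y (i%:R * h) w)) *m (Phi *m (Y (i.+1%:R * h) w - Y (i%:R * h) w))^T
       - (A *m (W (i.+1%:R * h) w - W (i%:R * h) w)) *m (A *m (W (i.+1%:R * h) w - W (i%:R * h) w))^T).
  rewrite realized_covE /noise_covariance -/s !sumrB sumr_const card_ord -scaler_sumr.
  under eq_bigr do rewrite -mulmxBr.
  move: (\sum_(i < n) _) (\sum_(i < n) _) (A *m A^T) => X Z S0.
  rewrite -[S0 *+ n]scaler_nat !scalerBr !scalerA ss.
  have -> : s * (s * s * h)^-1 = (s * h)^-1 by field; rewrite !gt_eqF.
  have -> : s^-1 * h^-1 = (s * h)^-1 by rewrite invfM.
  have -> : s^-1 * (s * s) = s by field; rewrite gt_eqF.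
  by rewrite opprB addrA subrK.
by rewrite enormZ (gtr0_norm sh) ler_pM2l.
Qed.

End Discretization.

Section NoiseLaplace.
Context {R : realType} {disp : measure_display} {Om : measurableType disp}.
Variable P : probability Om R.
Variables (d r : nat) (B : 'cV[R]_d -> 'cV[R]_d) (S : 'M[R]_(d, r)) (c : 'cV[R]_d).
Variables (W : R -> Om -> 'cV[R]_r) (Y : R -> Om -> 'cV[R]_d).
Hypothesis sys : ito_system P B S c W Y.
Variables (p : nat) (A : 'M[R]_(p, r)) (m : nat).
Variables (K : 'M[R]_(vech_dim p, m)) (C : 'I_m -> 'M[R]_p).
Hypothesis tC : forall a, (C a)^T = C a.
Hypothesis hC : forall D, D^T = D -> forall a, (vech D *m K) 0 a = \tr (C a *m D).
Hypothesis oC : forall a b, 2 * \tr (C a *m (A *m A^T) *m (C b *m (A *m A^T))) = (a == b)%:R.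
Variable h : nat -> R.
Hypothesis h0 : forall n, 0 < h n.

Lemma noise_laplace (k : R) : 0 <= k ->
  Ex P (fun w => expR (- (k * sqn (vech (noise_covariance W A n (h n) w) *m K)))) @[n --> \oo]
  --> expR (- (m%:R / 2 * ln (1 + 2 * k))).
Proof.
(* At [k = 0] both sides are 1; the replacement bound is for positive [k]. *)
rewrite le_eqVlt => /predU1P[<-|k0].
  rewrite mulr0 addr0 ln1 mulr0; under eq_fun do under eq_fun do rewrite mul0r.
  by rewrite oppr0 expR0; under eq_fun do rewrite Ex_cst; exact: cvg_cst.
pose Mom := qmom (fun a => A^T *m C a *m A).
have Mom0 : 0 <= Mom.
  have h12 : 0 <= mom12 :> R by rewrite !mulr_ge0 ?exprn_ge0 ?expR_ge0.
  apply: mulr_ge0; first exact: exprn_even_ge0.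
  by rewrite mulr_ge0 // addr_ge0 // mulr_ge0 ?exprn_ge0 ?mulr_ge0.
have [Cc Cc0 hclt] := @clt_laplace _ _ _ P m k Mom k0 Mom0.
apply/cvgrPdist_le => e e0.
near=> n.
have n0 : (0 < n)%N by near: n; exact: nbhs_infty_ge.
have [y [G1 [G2 [ar hy]]]] := noise_array sys n (h0 n) tC oC.
have := hclt n y G1 G2 n0 ar; rewrite distrC.
have -> : (fun w => expR (- (k * ssq (fun a => partial_sum (Num.sqrt n%:R)^-1 y n a w)))) =
    fun w => expR (- (k * sqn (vech (noise_covariance W A n (h n) w) *m K))).
  apply/funext => w; congr (expR (- (k * _))).
  rewrite /sqn big_ord1; apply: eq_bigr => a _.
  by rewrite hC ?noise_covariance_sym // hy.
move/le_trans; apply.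
have s0 : 0 < Num.sqrt n%:R :> R by rewrite sqrtr_gt0 ltr0n.
rewrite ler_pdivrMr // mulrC -ler_pdivrMr //.
have h1 : Num.sqrt ((Cc / e) ^+ 2) <= Num.sqrt n%:R.
  by apply: ler_wsqrtr; near: n; exact: nbhs_infty_ger.
by apply: le_trans h1; rewrite sqrtr_sqr ler_norm.
Unshelve. all: by end_near.
Qed.

End NoiseLaplace.

Theorem theorem11 (R : realType) (disp : measure_display)
  (Om : measurableType disp) (P : probability Om R)
  (p1 p2 k1 k2 r1 r2 r3 r4 q : nat)
  (hp1 : (1 <= p1)%N) (hp2 : (1 <= p2)%N) (hk1 : (1 <= k1)%N)
  (hk2 : (1 <= k2)%N) (hr1 : (1 <= r1)%N) (hr2 : (1 <= r2)%N)
  (hr3 : (1 <= r3)%N) (hr4 : (1 <= r4)%N)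
  (hkp1 : (k1 <= p1)%N) (hkp2 : (k2 <= p2)%N)
  (* driving noise *)
  (W1 : R -> Om -> 'cV[R]_r1) (W2 : R -> Om -> 'cV[R]_r2)
  (W3 : R -> Om -> 'cV[R]_r3) (W4 : R -> Om -> 'cV[R]_r4)
  (hW1 : wiener P W1) (hW2 : wiener P W2)
  (hW3 : wiener P W3) (hW4 : wiener P W4)
  (hW : indep_sigma P (tnth [tuple proc_sigma W1; proc_sigma W2;
                                   proc_sigma W3; proc_sigma W4]))
  (* latent processes *)
  (B1 : 'cV[R]_k1 -> 'cV[R]_k1) (B2 : 'cV[R]_p1 -> 'cV[R]_p1)
  (B3 : 'cV[R]_p2 -> 'cV[R]_p2) (B4 : 'cV[R]_k2 -> 'cV[R]_k2)
  (S1 : 'M[R]_(k1, r1)) (S2 : 'M[R]_(p1, r2))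
  (S3 : 'M[R]_(p2, r3)) (S4 : 'M[R]_(k2, r4))
  (c1 : 'cV[R]_k1) (c2 : 'cV[R]_p1) (c3 : 'cV[R]_p2) (c4 : 'cV[R]_k2)
  (xi : R -> Om -> 'cV[R]_k1) (delta0 : R -> Om -> 'cV[R]_p1)
  (eps : R -> Om -> 'cV[R]_p2) (zeta : R -> Om -> 'cV[R]_k2)
  (hxi : latent_process P B1 S1 W1 c1 xi)
  (hdelta0 : latent_process P B2 S2 W2 c2 delta0)
  (heps : latent_process P B3 S3 W3 c3 eps)
  (hzeta : latent_process P B4 S4 W4 c4 zeta)
  (hS2 : posdef (S2 *m S2^T)) (hS3 : posdef (S3 *m S3^T))
  (* true structural model and observations *)
  (L1 : 'M[R]_(p1, k1)) (L2 : 'M[R]_(p2, k2))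
  (G0 : 'M[R]_(k2, k1)) (B0 : 'M[R]_k2)
  (hL1 : \rank L1 = k1) (hB0 : forall i, B0 i i = 0)
  (hPsi0 : 1%:M - B0 \in unitmx)
  (eta : R -> Om -> 'cV[R]_k2) (X : R -> Om -> 'cV[R]_(p1 + p2))
  (heta : forall (t : R) w, 0 <= t ->
     eta t w = B0 *m eta t w + G0 *m xi t w + zeta t w)
  (hX : forall (t : R) w, 0 <= t ->
     X t w = col_mx (L1 *m xi t w + delta0 t w) (L2 *m eta t w + eps t w))
  (* parametric model *)
  (Theta : set 'rV[R]_q)
  (hconvex : @convex_set R 'rV[R]_q Theta) (hcompact : compact Theta)
  (M : @param_sem R p1 p2 k1 k2 q)
  (hMq : forall j, uses_coordinate M j)
  (hM : forall theta, Theta theta -> admissible (sem_at M theta))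
  (theta0 : 'rV[R]_q) (htheta0 : interior Theta theta0)
  (hH0 : Sigma (Sem L1 L2 G0 (1%:M - B0) (S1 *m S1^T) (S2 *m S2^T)
                    (S3 *m S3^T) (S4 *m S4^T))
         = Sigma (sem_at M theta0))
  (hident : forall theta1 theta2, Theta theta1 -> Theta theta2 ->
     Sigma (sem_at M theta1) = Sigma (sem_at M theta2) -> theta1 = theta2)
  (hrank : \rank ('J (fun theta => vech (Sigma (sem_at M theta))) theta0)^T
           = q)
  (* sampling scheme and tuning constants *)
  (h : nat -> R) (lambda1 lambda2 : nat -> R) (gamma delta : R)
  (hh : forall n, 0 < h n)
  (hlambda1 : forall n, 0 < lambda1 n) (hlambda2 : forall n, 0 < lambda2 n)
  (hgamma : 0 < gamma) (hdelta : 0 < delta)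
  (hdeltamin : forall j, j \in active theta0 -> delta < `|theta0 0 j|)
  (* estimators *)
  (that ttilde tcheck : nat -> Om -> 'rV[R]_q)
  (mthat : forall n, measurable_fun setT (that n : Om -> borel R 1 q))
  (mttilde : forall n, measurable_fun setT (ttilde n : Om -> borel R 1 q))
  (mtcheck : forall n, measurable_fun setT (tcheck n : Om -> borel R 1 q))
  (hthat : forall n w, attains_inf Theta
     (fun theta => contrast (realized_cov (X ^~ w) (h n) n)
                            (Sigma (sem_at M theta)))
     (that n w))
  (httilde : forall n w, minimizes Theta
     (penalized (lambda1 n) (lambda2 n) gamma delta (that n w))
     (ttilde n w))
  (htcheck : forall n w, attains_inf (restricted Theta (ttilde n w))
     (fun theta => contrast (realized_cov (X ^~ w) (h n) n)
                            (Sigma (sem_at M theta)))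
     (tcheck n w))
  (* asymptotic regime *)
  (hh0 : h n @[n --> \oo] --> 0)
  (hnh : n%:R * h n @[n --> \oo] --> +oo)
  (hnh2 : n%:R * h n ^+ 2 @[n --> \oo] --> 0)
  (hl1 : Num.sqrt n%:R * lambda1 n @[n --> \oo] --> 0)
  (hl2 : Num.sqrt n%:R * lambda2 n @[n --> \oo] --> +oo)
  (* positive degrees of freedom *)
  (hdf : (#|active theta0| < vech_dim (p1 + p2))%N) :
  cvg_in_distribution P
    (fun n w => n%:R * contrast (realized_cov (X ^~ w) (h n) n)
                                (Sigma (sem_at M (tcheck n w))))
    (chi2 (vech_dim (p1 + p2) - #|active theta0|)).

Proof.
pose S th := Sigma (sem_at M th).
pose S0 := S theta0.
have T0 : Theta theta0 by exact: interior_subset.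
have pS th : Theta th -> posdef (S th) by move=> Tth; apply: Sigma_posdef; exact: hM.
have dS th : Theta th -> diffmx S th by move=> Tth; apply: diffmx_Sigma; case: (hM _ Tth).
have idS th : Theta th -> S th = S theta0 -> th = theta0 by move=> Tth; exact: hident.
(* The Jacobian acts on row vectors, so its rows are indexed by the parameters and full rank means
   free rows. *)
have fJ : row_free ('J (fun th => vech (S th)) theta0) by rewrite /row_free -mxrank_tr; apply/eqP.
have [K [C [tC hC oC hexp]]] :=
  restricted_contrast_expansion hcompact htheta0 pS dS idS fJ hgamma hdelta hdeltamin.
have [lip sys] := stacked_ito_system hW1 hW2 hW3 hW4 hW hxi hdelta0 heps hzeta.
pose Y t w := col_mx (xi t w) (col_mx (delta0 t w) (col_mx (eps t w) (zeta t w))).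
pose Phi := loading L1 L2 G0 (1%:M - B0).
have XE t w : 0 <= t -> X t w = Phi *m Y t w.
  move=> t0; rewrite hX // (loading_mul _ _ _ _ hPsi0 (y := eta t w)) //.
  by rewrite mulmxBl mul1mx; apply/eqP; rewrite subr_eq addrC addrA; apply/eqP; exact: heta.
pose Q n w := realized_cov (X ^~ w) (h n) n.
have QE n w : Q n w = realized_cov (fun t => Phi *m Y t w) (h n) n.
  rewrite /Q !realized_covE; congr (_ *: _); apply: eq_bigr => i _.
  by rewrite !XE // mulr_ge0 // ltW.
have AE := loading_covariance L1 L2 G0 (1%:M - B0) S1 S2 S3 S4.
(* The null hypothesis enters here: the covariance of the noise is the model covariance at
   [theta0]. *)
rewrite /= hH0 -/Phi in AE.
set A := (Phi *m _) in AE.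
have psQ n w : psd (Q n w) by apply: realized_cov_psd; exact: ltW.
have Tc n w : Theta (tcheck n w) by case: (htcheck n w) => -[].
pose T n w := n%:R * contrast (Q n w) (S (tcheck n w)).
have Tge0 n w : 0 <= T n w by rewrite mulr_ge0 // contrast_ge0 //; exact: pS.
have mT n : measurable_fun setT (T n).
  apply: measurable_funM => //; apply: measurable_contrast.
  - by move=> w; apply: posdef_unit; exact: pS.
  - have [[_ mY] _ _ _ _] := sys.
    have mX (t : R) : 0 <= t -> measurable_mx (fun w => Phi *m Y t w).
      move=> t0; apply: measurable_mxM; first exact: measurable_mx_cst.
      by move=> i j; rewrite ord1; exact: mY.
    have mD i : measurable_mx (fun w => Phi *m Y (i.+1%:R * h n) w - Phi *m Y (i%:R * h n) w).
      by apply: measurable_mxB; apply: mX; rewrite mulr_ge0 // ltW.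
    have -> : Q n = fun w => (n%:R * h n)^-1 *: \sum_(i < n)
        (Phi *m Y (i.+1%:R * h n) w - Phi *m Y (i%:R * h n) w) *m
        (Phi *m Y (i.+1%:R * h n) w - Phi *m Y (i%:R * h n) w)^T.
      by apply/funext => w; rewrite QE realized_covE.
    apply: measurable_mxZ; first exact: measurable_cst.
    by apply: measurable_mx_sum => i; apply: measurable_mxM => //; exact: measurable_mx_tr.
  apply: measurable_Sigma => [w|i j]; first exact: hM.
  exact: borel_coord.
have [CD CD0 hCD] := realized_cov_distance lip sys Phi.
have pA : posdef (A *m A^T) by rewrite AE; exact: pS.
have [CV hCV] := noise_tight sys pA.
pose u n w := Num.sqrt n%:R *: (Q n w - S0).
pose W t w := col_mx (W1 t w) (col_mx (W2 t w) (col_mx (W3 t w) (W4 t w))).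
pose v n := noise_covariance W A n (h n).
have mu0 := chi2_ge0 (R := R) (vech_dim (p1 + p2) - #|active theta0|).
apply: (laplace_cvg_in_distribution mT Tge0 mu0) => k.
have k0 : 0 <= k%:R :> R by [].
rewrite {2}/Ex /Rintegral chi2_laplace //=.
have oC' a b : 2 * \tr (C a *m (A *m A^T) *m (C b *m (A *m A^T))) = (a == b)%:R by rewrite AE.
have lim := noise_laplace sys tC hC oC' hh k0.
have uv : \forall n \near \oo, exists D : Om -> R, [/\ P.-integrable setT (EFin \o D),
    Ex P D <= CD * (Num.sqrt (h n) + Num.sqrt (n%:R * h n ^+ 2)) &
    forall w, enorm (u n w - v n w) <= D w].
  near=> n.
  have n0 : (0 < n)%N by near: n; exact: nbhs_infty_ge.
  have h1 : h n <= 1.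
    by near: n; move/cvgrPdist_le : hh0 => /(_ 1 ltr01); apply: filterS => n;
      rewrite sub0r normrN; apply: le_trans; exact: ler_norm.
  have [|D [lD eD hD]] := hCD n (h n) n0; first by rewrite hh.
  by exists D; split=> // w; have := hD w; rewrite /u /v QE /S0 /S -AE.
have dn0 : CD * (Num.sqrt (h n) + Num.sqrt (n%:R * h n ^+ 2)) @[n --> \oo] --> 0.
  have sq (f : nat -> R) : f n @[n --> \oo] --> 0 -> Num.sqrt (f n) @[n --> \oo] --> 0.
    by move=> f0; rewrite -[X in _ --> X](@sqrtr0 R); apply: continuous_cvg => //; exact: sqrt_continuous.
  rewrite -[X in _ --> X](mulr0 CD); apply: cvgMr.
  by rewrite -[X in _ --> X](addr0 0); apply: cvgD; exact: sq.
have tv : \forall n \near \oo,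
    P.-integrable setT (EFin \o (fun w => enorm (v n w))) /\ Ex P (fun w => enorm (v n w)) <= CV.
  by near=> n; apply: hCV; [near: n; exact: nbhs_infty_ge | exact: hh].
have mv n : measurable_fun setT (fun w => sqn (vech (v n w) *m K)).
  apply: measurable_mx_sqn; apply: measurable_mxM; last exact: measurable_mx_cst.
  by apply: measurable_vech; exact: (measurable_noise_covariance sys).
have hT (kap e : R) : 0 < kap -> 0 < e -> \forall n \near \oo, forall w,
    enorm (u n w) <= kap -> `|T n w - sqn (vech (u n w) *m K)| <= e.
  (* The error is relative to [enorm (Q n w - S0) ^+ 2], which is at most [kap ^+ 2 / n%:R]; after
     multiplication by [n%:R] it is at most [e]. *)
  move=> kap0 e0; have e1 : 0 < e / kap ^+ 2 by rewrite divr_gt0 // exprn_gt0.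
  have [r r0 hr] := hexp _ e1.
  near=> n => w uk.
  have n0 : (0 < n)%N by near: n; exact: nbhs_infty_ge.
  have s0 : 0 < Num.sqrt n%:R :> R by rewrite sqrtr_gt0 ltr0n.
  have s1 : 1 <= Num.sqrt n%:R :> R by rewrite -[leLHS]sqrtr1; apply: ler_wsqrtr; rewrite ler1n.
  have eu : enorm (u n w) = Num.sqrt n%:R * enorm (Q n w - S0).
    by rewrite enormZ (gtr0_norm s0).
  have b1 : kap <= r * Num.sqrt n%:R.
    rewrite mulrC -ler_pdivrMr //.
    have h1 : Num.sqrt ((kap / r) ^+ 2) <= Num.sqrt n%:R.
      by apply: ler_wsqrtr; near: n; exact: nbhs_infty_ger.
    by apply: le_trans h1; rewrite sqrtr_sqr ler_norm.
  have b2 : Num.sqrt n%:R * lambda1 n <= r.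
    by near: n; move/cvgrPdist_le : hl1 => /(_ r r0); apply: filterS => n;
      rewrite sub0r normrN; apply: le_trans; exact: ler_norm.
  (* Here [lambda2 n] dominates the fluctuations, which are of size [kap / Num.sqrt n%:R]. *)
  have b3 : kap / r <= Num.sqrt n%:R * lambda2 n.
    by near: n; move/cvgryPge : hl2; apply.
  rewrite eu in uk.
  have q1 : enorm (Q n w - S0) <= r.
    by rewrite -(ler_pM2l s0) (le_trans uk) // mulrC.
  have q2 : lambda1 n <= r.
    by apply: le_trans b2; rewrite ler_peMl // ltW.
  have q3 : enorm (Q n w - S0) <= r * lambda2 n.
    by rewrite -(ler_pM2l s0) (le_trans uk) // mulrCA -ler_pdivrMl // mulrC.
  have := hr _ _ _ _ _ _ (psQ n w) q1 (hlambda1 n) q2 (hlambda2 n) q3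
    (hthat n w) (httilde n w) (htcheck n w).
  move=> hrn; have ss : n%:R = Num.sqrt n%:R * Num.sqrt n%:R :> R by rewrite -expr2 sqr_sqrtr.
  have -> : T n w - sqn (vech (u n w) *m K) = n%:R *
      (contrast (Q n w) (S (tcheck n w)) - sqn (vech (Q n w - S0) *m K)).
    by rewrite /u linearZ /= -scalemxAl sqnZ /T mulrBr expr2 -ss.
  rewrite normrM (ger0_norm (ler0n _ n)).
  apply: le_trans (ler_wpM2l (ler0n _ n) hrn) _.
  have sq : (Num.sqrt n%:R * enorm (Q n w - S0)) ^+ 2 <= kap ^+ 2.
    by rewrite lerXn2r ?nnegrE ?(ltW kap0) // -eu enorm_ge0.
  have h1 := ler_wpM2l (ltW e1) sq; rewrite divfK ?expf_neq0 ?gt_eqF // in h1.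
  apply: le_trans h1; rewrite le_eqVlt; apply/orP; left; apply/eqP.
  by rewrite exprMn (sqr_sqrtr (ler0n _ n)); ring.
have tail : Ex P (fun w => expR (- (k%:R * T n w))) -
    Ex P (fun w => expR (- (k%:R * sqn (vech (v n w) *m K)))) @[n --> \oo] --> 0.
  exact: (laplace_transfer mT Tge0 mv uv dn0 tv hT k0).
rewrite -[X in _ --> X]add0r.
have -> : (fun n => Ex P (fun w => expR (- (k%:R * T n w)))) = fun n =>
    (Ex P (fun w => expR (- (k%:R * T n w))) -
     Ex P (fun w => expR (- (k%:R * sqn (vech (v n w) *m K))))) +
    Ex P (fun w => expR (- (k%:R * sqn (vech (v n w) *m K)))).
  by apply/funext => n; rewrite subrK.
exact: cvgD tail lim.
Unshelve. all: by end_near.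
Qed.
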